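(* Let $\Omega\subset\mathbb{R}^n$ be a bounded, connected open set, let $p>1$, let $\ell,L,\alpha,\beta>0$ and $\mu\ge 0$ be constants, and let $F,G\colon\mathbb{R}^n\to\mathbb{R}$ be $C^1$ functions such that for every $\xi\in\mathbb{R}^n$ and every $\varphi\in C^1_0(\Omega)$: $$0\le F(\xi)\le L(\mu^2+|\xi|^2)^{\frac p2},$$ $$\int_\Omega F(\xi+\nabla\varphi)\,dx\ \ge\ \int_\Omega\Big(F(\xi)+\ell(\mu^2+|\xi|^2+|\nabla\varphi|^2)^{\frac{p-2}{2}}|\nabla\varphi|^2\Big)\,dx,$$ $$0\le G(\xi)\le \beta L(\mu^2+|\xi|^2)^{\frac p2},$$ $$\int_\Omega G(\xi+\nabla\varphi)\,dx\ \ge\ \int_\Omega\Big(G(\xi)+\alpha\ell(\mu^2+|\xi|^2+|\nabla\varphi|^2)^{\frac{p-2}{2}}|\nabla\varphi|^2\Big)\,dx.$$ Let $u_0\in W^{1,p}(\Omega)$ and $0<d<|\Omega|$. Consider the constrained problem $$(P)\qquad \min\Big\{\mathcal I(v,A):\ v=u_0\ \text{on}\ \partial\Omega,\ |A|=d\Big\},\qquad \mathcal I(v,A):=\int_\Omega\big(F(\nabla v)+\chi_A G(\nabla v)\big)\,dx+P(A,\Omega),$$ and, for $\lambda>0$, the functional $$\mathcal I_\lambda(v,A):=\int_\Omega\big(F(\nabla v)+\chi_A G(\nabla v)\big)\,dx+P(A,\Omega)+\lambda\big||A|-d\big|.$$ There exists $\lambda_0>0$ such that if $(u,E)$ is a minimizer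 of $\mathcal I_\lambda$, for some $\lambda\ge\lambda_0$, among all configurations $(v,A)$ such that $v=u_0$ on $\partial\Omega$, then $|E|=d$ and $(u,E)$ is a minimizer of problem $(P)$. Conversely, if $(u,E)$ is a minimizer of problem $(P)$, then it is a minimizer of $\mathcal I_\lambda$ among all configurations $(v,A)$ such that $v=u_0$ on $\partial\Omega$, for all $\lambda\ge\lambda_0$.
   Context: Configurations $(v,A)$ consist of a real-valued function $v\in W^{1,p}(\Omega)$ and a set $A\subset\Omega$ of finite perimeter in $\Omega$; $v=u_0$ on $\partial\Omega$ means $v-u_0\in W^{1,p}_0(\Omega)$. $\chi_A$ is the characteristic function of $A$, $|A|$ its Lebesgue measure, and $P(A,\Omega)=\sup\{\int_A\mathrm{div}\,\phi\,dx:\ \phi\in C^1_0(\Omega;\mathbb{R}^n),\ |\phi|\le 1\}$ is the perimeter of $A$ in $\Omega$. *)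

(* Defs.v *)
From HB Require Import structures.
From mathcomp Require Import all_boot all_order all_algebra.
From mathcomp Require Import all_classical all_reals all_analysis.

Set Implicit Arguments.
Unset Strict Implicit.
Unset Printing Implicit Defensive.

Import Order.TTheory GRing.Theory Num.Theory.
Import numFieldNormedType.Exports.

Local Open Scope classical_set_scope.
Local Open Scope ring_scope.

Section cons_measure.
Local Open Scope ereal_scope.
Context (R : realType) (n : nat).
Notation T := (measurableTypeR R).
Variable m : {sigma_finite_measure set (n.-tuple T) -> \bar R}.

Definition cons_pair (x : T * n.-tuple T) : n.+1.-tuple T :=
  [tuple of x.1 :: x.2].

Lemma measurable_cons_pair : measurable_fun setT cons_pair.
Proof. exact: measurable_cons. Qed.

Definition cons_measure : set (n.+1.-tuple T) -> \bar R :=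
  pushforward (@lebesgue_measure R \x m) cons_pair.

Let cons_measure0 : cons_measure set0 = 0.
Proof. by rewrite /cons_measure /pushforward preimage_set0 measure0. Qed.

Let cons_measure_ge0 A : 0 <= cons_measure A.
Proof. by rewrite /cons_measure /pushforward; exact: measure_ge0. Qed.

Let cons_measure_sigma_additive : semi_sigma_additive cons_measure.
Proof.
move=> F mF tF mUF; rewrite /cons_measure /pushforward preimage_bigcup.
apply: measure_semi_sigma_additive.
- by move=> k; rewrite -[X in measurable X]setTI; exact: measurable_cons_pair.
- apply/trivIsetP => /= i j _ _ ij; rewrite -preimage_setI.
  by move/trivIsetP : tF => /(_ _ _ _ _ ij) ->//; rewrite preimage_set0.
- by rewrite -preimage_bigcup -[X in measurable X]setTI;
    exact: measurable_cons_pair.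
Qed.

HB.instance Definition _ := isMeasure.Build _ _ _ cons_measure
  cons_measure0 cons_measure_ge0 cons_measure_sigma_additive.

Let cons_measure_sigma_finite : sigma_finite setT cons_measure.
Proof.
have /sigma_finiteP[F [FT Fnd Foo]] := sigma_finiteT (@lebesgue_measure R).
have /sigma_finiteP[G [GT Gnd Goo]] := sigma_finiteT m.
pose H k := [set t : n.+1.-tuple T |
  F k (tnth t ord0) /\ G k [tuple of behead t]].
have mH k : measurable (H k).
  have -> : H k = (fun t : n.+1.-tuple T => tnth t ord0) @^-1` F k
      `&` (fun t : n.+1.-tuple T => [tuple of behead t]) @^-1` G k.
    by [].
  apply: measurableI; rewrite -[X in measurable X]setTI.
    by apply: measurable_tnth => //; exact: (Foo k).1.
  by apply: measurable_behead => //; exact: (Goo k).1.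
exists H.
  apply/esym; rewrite -subTset => t _.
  have : (\bigcup_i F i) (tnth t ord0) by rewrite -FT.
  move=> [i _ Fi].
  have : (\bigcup_i G i) [tuple of behead t] by rewrite -GT.
  move=> [j _ Gj].
  exists (maxn i j) => //; split.
    by have /subsetPset := Fnd _ _ (leq_maxl i j); exact.
  by have /subsetPset := Gnd _ _ (leq_maxr i j); exact.
move=> k; split; first exact: mH.
rewrite /cons_measure /pushforward.
have -> : cons_pair @^-1` H k = F k `*` G k.
  have E (x : T) (t : n.-tuple T) :
      [tuple of behead [tuple of x :: t]] = t by apply/val_inj.
  by apply/seteqP; split => -[x t] /=; rewrite /H /= E tnth0.
have [mF Ffin] := Foo k; have [mG Gfin] := Goo k.
by rewrite /= product_measure1E// lte_mul_pinfty// ge0_fin_numE.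
Qed.

HB.instance Definition _ := @Measure_isSigmaFinite.Build _ _ _ cons_measure
  cons_measure_sigma_finite.

End cons_measure.

Fixpoint tuple_lebesgue (R : realType) (n : nat) :
    {sigma_finite_measure set (n.-tuple (measurableTypeR R)) -> \bar R} :=
  if n is k.+1 then cons_measure (tuple_lebesgue R k)
  else @dirac _ (0.-tuple (measurableTypeR R)) [tuple] R.

Section lebesgue.
Local Open Scope ereal_scope.
Context (R : realType) (n : nat).

Definition row_of_tuple (t : n.-tuple (measurableTypeR R)) : 'rV[R]_n :=
  \row_i tnth t i.

(* The outer measure of the Borel product measure; its Caratheodory
   sigma-algebra is that of all Lebesgue measurable sets of R^n, not only the
   Borel ones (same construction as [completed_lebesgue_measure] on R). *)
Definition lebesgue_outer (A : set 'rV[R]_n) : \bar R :=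
  (tuple_lebesgue R n)^*%mu (row_of_tuple @^-1` A).

Let lebesgue_outer0 : lebesgue_outer set0 = 0.
Proof. by rewrite /lebesgue_outer preimage_set0 outer_measure0. Qed.

Let lebesgue_outer_ge0 A : 0 <= lebesgue_outer A.
Proof. exact: outer_measure_ge0. Qed.

Let le_lebesgue_outer :
  {homo lebesgue_outer : A B / A `<=` B >-> A <= B}.
Proof.
by move=> A B AB; apply: le_outer_measure => t; exact: AB.
Qed.

Let lebesgue_outer_sigma_subadditive : sigma_subadditive lebesgue_outer.
Proof.
move=> F; rewrite /lebesgue_outer preimage_bigcup.
exact: outer_measure_sigma_subadditive.
Qed.

HB.instance Definition _ := isOuterMeasure.Build R 'rV[R]_n lebesgue_outer
  lebesgue_outer0 lebesgue_outer_ge0 le_lebesgue_outer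
  lebesgue_outer_sigma_subadditive.

Definition lebesgue_rV : Type := caratheodory_type lebesgue_outer.
HB.instance Definition _ := Measurable.on lebesgue_rV.

Definition leb : set lebesgue_rV -> \bar R := lebesgue_outer.
HB.instance Definition _ := isMeasure.Build _ _ _ leb
  (@caratheodory_measure0 _ _ lebesgue_outer)
  (@caratheodory_measure_ge0 _ _ lebesgue_outer)
  (@caratheodory_measure_sigma_additive _ _ lebesgue_outer).

End lebesgue.
Arguments leb {R n}.

Section calculus.
Context (R : realType) (n : nat).
Implicit Types (x xi : 'rV[R]_n) (Omega A : set 'rV[R]_n).

(* The norm `|x| of the library is the sup norm. *)
Definition enorm x : R := Num.sqrt (\sum_i x 0 i ^+ 2).

Definition partial (i : 'I_n) (f : 'rV[R]_n -> R) x : R :=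
  'D_(delta_mx 0 i) f x.

Definition grad (f : 'rV[R]_n -> R) x : 'rV[R]_n := \row_i partial i f x.

Definition div (phi : 'rV[R]_n -> 'rV[R]_n) x : R :=
  \sum_i partial i (fun y => phi y 0 i) x.

Definition C1 (f : 'rV[R]_n -> R) : Prop :=
  (forall x, differentiable f x) /\ (forall i, continuous (partial i f)).

Definition supp (f : 'rV[R]_n -> R) : set 'rV[R]_n :=
  closure [set x | f x != 0].

(* Elements of C^1_0(Omega), extended by 0 to the whole space. *)
Definition C1c Omega (phi : 'rV[R]_n -> R) : Prop :=
  [/\ C1 phi, compact (supp phi) & supp phi `<=` Omega].

Definition perimeter A Omega : \bar R :=
  ereal_sup [set (\int[leb]_(x in A) (div phi x)%:E)%E |
    phi in [set phi : 'rV[R]_n -> 'rV[R]_n |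
      (forall i, C1c Omega (fun x => phi x 0 i)) /\
      (forall x, enorm (phi x) <= 1)]].

Definition finite_perimeter Omega A : Prop :=
  [/\ A `<=` Omega, measurable (A : set (lebesgue_rV R n)) &
      (perimeter A Omega < +oo)%E].

Definition in_Lp Omega (p : R) (f : 'rV[R]_n -> R) : Prop :=
  measurable_fun (Omega : set (lebesgue_rV R n)) f /\
  (\int[leb]_(x in Omega) (`|f x| `^ p)%:E < +oo)%E.

Definition in_L1loc Omega (f : 'rV[R]_n -> R) : Prop :=
  forall K : set 'rV[R]_n, compact K -> K `<=` Omega ->
    leb.-integrable (K : set (lebesgue_rV R n)) (EFin \o f).

(* Test functions of class C^1_0(Omega), as in Gilbarg-Trudinger; equivalent to
   C^infty_0 test functions by mollification. *)
Definition is_wgrad Omega (u : 'rV[R]_n -> R) (g : 'rV[R]_n -> 'rV[R]_n) :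
    Prop :=
  [/\ in_L1loc Omega u, forall i, in_L1loc Omega (fun x => g x 0 i) &
   forall i phi, C1c Omega phi ->
     (\int[leb]_(x in Omega) (u x * partial i phi x) =
      - \int[leb]_(x in Omega) (g x 0 i * phi x))%R].

(* A chosen representative of the a.e. unique weak gradient (0 if none). *)
Definition wgrad Omega (u : 'rV[R]_n -> R) : 'rV[R]_n -> 'rV[R]_n :=
  xget (cst 0) [set g | is_wgrad Omega u g].

Definition W1p Omega (p : R) (u : 'rV[R]_n -> R) : Prop :=
  in_Lp Omega p u /\
  exists2 g, is_wgrad Omega u g & forall i, in_Lp Omega p (fun x => g x 0 i).

Definition W1p_norm Omega (p : R) (u : 'rV[R]_n -> R) : \bar R :=
  ((\int[leb]_(x in Omega) (`|u x| `^ p)%:E +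
    \int[leb]_(x in Omega) (enorm (wgrad Omega u x) `^ p)%:E) `^ p^-1)%E.

(* The closure of C^1_0(Omega) in W^{1,p}(Omega). *)
Definition W1p0 Omega (p : R) (u : 'rV[R]_n -> R) : Prop :=
  W1p Omega p u /\
  forall e : R, 0 < e ->
    exists2 phi, C1c Omega phi & (W1p_norm Omega p (u \- phi)%R < e%:E)%E.

End calculus.

Section problem.
Context (R : realType) (n : nat).
Implicit Types (Omega A : set 'rV[R]_n) (F G u : 'rV[R]_n -> R).

Definition config : Type := ('rV[R]_n -> R) * set 'rV[R]_n.

Definition configuration Omega (p : R) (u0 : 'rV[R]_n -> R) : set config :=
  [set c | [/\ W1p Omega p c.1, finite_perimeter Omega c.2 &
               W1p0 Omega p (c.1 \- u0)]].

Definition energy Omega F G (c : config) : \bar R :=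
  (\int[leb]_(x in Omega)
     (F (wgrad Omega c.1 x) + \1_(c.2) x * G (wgrad Omega c.1 x))%:E
   + perimeter c.2 Omega)%E.

Definition penalized_energy Omega F G (d lambda : R) (c : config) : \bar R :=
  (energy Omega F G c + lambda%:E * `|leb c.2 - d%:E|)%E.

Definition minimizer (S : set config) (J : config -> \bar R) (c : config) :
    Prop :=
  S c /\ forall c', S c' -> (J c <= J c')%E.

Definition growth (F : 'rV[R]_n -> R) (p mu L : R) : Prop :=
  forall xi, 0 <= F xi <= L * (mu ^+ 2 + enorm xi ^+ 2) `^ (p / 2).

(* Where the base of the power vanishes, so does |grad phi|, and the last term
   is 0 also for p < 2. *)
Definition quasiconvex Omega (F : 'rV[R]_n -> R) (p mu l : R) : Prop :=
  forall xi phi, C1c Omega phi ->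
  (\int[leb]_(x in Omega)
     (F xi + l * (mu ^+ 2 + enorm xi ^+ 2 + enorm (grad phi x) ^+ 2)
                   `^ ((p - 2) / 2) * enorm (grad phi x) ^+ 2)%:E
   <= \int[leb]_(x in Omega) (F (xi + grad phi x))%:E)%E.

End problem.

(* Main.v *)
(* It suffices to find C such that every configuration (v, A) can be replaced by one of
   volume d at the cost of at most C ||A| - d| in energy: then lambda0 = C + 1 works. If
   the energy of (v, A) exceeds the energy M of a fixed configuration (u0, E0) of volume
   d, or if |A| is not close to d, then (u0, E0) itself will do.

   Otherwise P(A) <= M, and as Omega is connected the density of A at a small scale r
   cannot be almost constant: for some c and r depending on M only, a bump b supported in
   a ball of radius r contained in Omega satisfies |int_A D_i b| >= c. The shear
   x |-> x + t b(x) e_i changes |A| by exactly t int_A D_i b, so the volume is restored by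
   some t of size at most ||A| - d| / c. The shear multiplies the perimeter by at most
   1 + O(t) and perturbs grad v by O(t) |grad v|.

   Testing quasiconvexity with laminates (v is scalar) shows that F and G are midpoint
   convex, whence F(xi + s zeta) <= F(xi) + O(s) (1 + |xi|^p) for |zeta| <= |xi|, and the
   strict term makes F coercive. Hence the energy grows by O(t) (|Omega| + M). *)
Require Import Defs.
From HB Require Import structures.
From mathcomp Require Import all_boot all_order all_algebra.
From mathcomp Require Import all_classical all_reals all_analysis.
From mathcomp Require Import measurable_realfun ring lra.

Set Implicit Arguments.
Unset Strict Implicit.
Unset Printing Implicit Defensive.

Import Order.TTheory GRing.Theory Num.Theory.
Import numFieldNormedType.Exports.

Local Open Scope classical_set_scope.
Local Open Scope ring_scope.

(** * C^1 functions and shears *)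

(** Shearing in a single coordinate direction keeps the argument elementary. The Jacobian 1 + t D_i
    b is affine in t, so the volume is corrected by solving a linear equation; the inverse map comes
    from the intermediate value theorem on lines, and the change of variables formula from a
    homotopy in t.

    The obstacle is that the constant C must not depend on (v, A). Instead of a compactness
    argument, the lower bound c is obtained quantitatively: a scale r and a cutoff are fixed from
    Omega, d and M before the set is given, and connectedness enters as a bound on the oscillation
    of a function by its gradient at scale r inside Omega. The resulting inequality holds for all
    configurations, so neither existence nor regularity of minimizers is involved.

    No derivative bound on F and G is used: repeated halving controls F(xi + s zeta) by F(xi) plus s
    times a growth bound. The 1 in C + 1 makes the penalty exceed the cost of repair strictly, which
    forces |E| = d. *)

Section calculus_lemmas.
Context {R : realType} {n : nat}.
Implicit Types (f g : 'rV[R]_n -> R) (x y h : 'rV[R]_n) (i j k : 'I_n).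

Lemma rV_sum_delta h : h = \sum_i h 0 i *: (delta_mx 0 i : 'rV[R]_n).
Proof. exact: row_sum_delta. Qed.

Lemma diff_sum_partial f x h : differentiable f x ->
  'd f x h = \sum_i h 0 i * partial i f x.
Proof.
move=> df; rewrite {1}(rV_sum_delta h) linear_sum; apply: eq_bigr => i _.
by rewrite linearZ /= /partial deriveE.
Qed.

Lemma is_derive_line f x h (s : R) : differentiable f (x + s *: h) ->
  is_derive s 1 (fun s => f (x + s *: h))
    (\sum_i h 0 i * partial i f (x + s *: h)).
Proof.
move=> df.
have dl : is_diff s (fun s => x + s *: h) (fun s => s *: h).
  by apply: is_diff_eq; rewrite add0r.
have dc : differentiable (f \o (fun s => x + s *: h)) s.
  exact: differentiable_comp.
apply: DeriveDef; first exact: diff_derivable.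
rewrite deriveE// diff_comp//=.
by rewrite (diff_val (is_diff_def := dl)) scale1r diff_sum_partial.
Qed.

Lemma C1_continuous f : C1 f -> continuous f.
Proof. by move=> [df _] x; exact: differentiable_continuous. Qed.

Lemma C1_cst (c : R) : C1 (cst c : 'rV[R]_n -> R).
Proof.
split=> [x|i]; first exact: differentiable_cst.
rewrite (_ : partial i _ = cst 0); first exact: cst_continuous.
by apply/funext => x; rewrite /partial derive_cst.
Qed.

Lemma partial_cst i (c : R) x : partial i (cst c) x = 0.
Proof. by rewrite /partial derive_cst. Qed.

Lemma partialD i f g x : differentiable f x -> differentiable g x ->
  partial i (f \+ g) x = partial i f x + partial i g x.
Proof. by move=> df dg; rewrite /partial deriveD//; exact: diff_derivable. Qed.

Lemma partialM i f g x : differentiable f x -> differentiable g x ->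
  partial i (f \* g) x = f x * partial i g x + g x * partial i f x.
Proof. by move=> df dg; rewrite /partial deriveM//; exact: diff_derivable. Qed.

Lemma partialN i f x : differentiable f x -> partial i (\- f) x = - partial i f x.
Proof. by move=> df; rewrite /partial deriveN//; exact: diff_derivable. Qed.

Lemma C1D f g : C1 f -> C1 g -> C1 (f \+ g).
Proof.
move=> [df cf] [dg cg]; split=> [x|i]; first exact: differentiableD.
rewrite (_ : partial i _ = partial i f \+ partial i g); last first.
  by apply/funext => x; rewrite partialD.
by move=> x; exact: (cvgD (cf i x) (cg i x)).
Qed.

Lemma C1M f g : C1 f -> C1 g -> C1 (f \* g).
Proof.
move=> f1 g1; have [df cf] := f1; have [dg cg] := g1.
split=> [x|i]; first exact: differentiableM.
rewrite (_ : partial i _ = (f \* partial i g) \+ (g \* partial i f)); last first.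
  by apply/funext => x; rewrite partialM.
move=> x; apply: (cvgD (cvgM _ (cg i x)) (cvgM _ (cf i x)));
  exact: C1_continuous.
Qed.

Lemma C1N f : C1 f -> C1 (\- f).
Proof.
move=> f1; have [df _] := f1.
rewrite (_ : \- f = cst (-1) \* f); last by apply/funext => x /=; rewrite mulN1r.
by apply: C1M => //; exact: C1_cst.
Qed.

Lemma C1B f g : C1 f -> C1 g -> C1 (f \- g).
Proof. by move=> cf cg; apply: C1D => //; exact: C1N. Qed.

Lemma C1_sum (I : Type) (r : seq I) (F : I -> 'rV[R]_n -> R) :
  (forall a, C1 (F a)) -> C1 (fun x => \sum_(i <- r) F i x).
Proof.
move=> F1; elim: r => [|i r ih].
  by under eq_fun do rewrite big_nil; exact: C1_cst.
by under eq_fun do rewrite big_cons; exact: C1D.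
Qed.

Lemma partial_sum (I : Type) (r : seq I) (F : I -> 'rV[R]_n -> R) k x :
  (forall a, C1 (F a)) ->
  partial k (fun x => \sum_(i <- r) F i x) x = \sum_(i <- r) partial k (F i) x.
Proof.
move=> F1; elim: r => [|i r ih].
  by under eq_fun do rewrite big_nil; rewrite big_nil (partial_cst k 0).
under eq_fun do rewrite big_cons; rewrite big_cons -ih.
by rewrite partialD//; [exact: (F1 i).1|exact: (C1_sum _ F1).1].
Qed.

Lemma partial_coord i j x : partial i (fun y => y 0 j) x = (i == j)%:R.
Proof.
rewrite /partial /derive; apply/cvg_lim => //.
apply: cvg_near_cst; near=> t.
rewrite /= /shift/= !mxE addrK eqxx /= eq_sym; case: eqP => _; last by rewrite mulr0 scaler0.
rewrite mulr1 [LHS]mulVf//.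
by near: t; exact: nbhs_dnbhs_neq.
Unshelve. all: end_near. Qed.

Lemma C1_coord j : C1 (fun y : 'rV[R]_n => y 0 j).
Proof.
split=> [x|i]; first exact: differentiable_coord.
rewrite (_ : partial i _ = cst (i == j)%:R); first exact: cst_continuous.
by apply/funext => x; rewrite partial_coord.
Qed.

Lemma partial_comp (q : R -> R) i f x :
  differentiable f x -> derivable q (f x) 1 ->
  partial i (q \o f) x = q^`()%classic (f x) * partial i f x.
Proof.
move=> df /derivable1_diffP dq.
rewrite /partial !deriveE//; last exact: differentiable_comp.
rewrite diff_comp//= deriv1E; last exact/derivable1_diffP.
by rewrite mulrC.
Qed.

Lemma C1_comp (q : R -> R) f : (forall s, derivable q s 1) ->
  continuous q^`()%classic -> C1 f -> C1 (q \o f).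
Proof.
move=> dq cq f1; have [df cf] := f1; split=> [x|i].
  by apply: differentiable_comp => //; exact/derivable1_diffP.
rewrite (_ : partial i _ = (q^`()%classic \o f) \* partial i f); last first.
  by apply/funext => x; rewrite partial_comp.
move=> x; apply: (cvgM _ (cf i x)).
by apply: continuous_comp; [exact: C1_continuous|exact: cq].
Qed.

Definition shear k (psi : 'rV[R]_n -> R) x : 'rV[R]_n :=
  x + psi x *: delta_mx 0 k.

Lemma continuous_shear k psi : continuous psi -> continuous (shear k psi).
Proof.
move=> cpsi x.
have h : {for x, continuous (fun y => psi y *: (delta_mx 0 k : 'rV[R]_n))}.
  have c : psi @ x --> psi x by exact: (cpsi x).
  by move=> A; apply: (cvgZr_tmp c).
by apply: (continuousD _ h) => A.
Qed.

Lemma differentiable_shear k psi x :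
  differentiable psi x -> differentiable (shear k psi) x.
Proof.
move=> dpsi; apply: differentiableD => //.
exact: differentiableZl.
Qed.

(** The differential of the shear sends e_i to e_i + D_i psi e_k, which adds to the chain rule a
    single term in the direction k. *)
Lemma partial_shear k psi f i x :
  differentiable psi x -> differentiable f (shear k psi x) ->
  partial i (f \o shear k psi) x =
  partial i f (shear k psi x) + partial i psi x * partial k f (shear k psi x).
Proof.
move=> dpsi df.
have ds := differentiable_shear k dpsi.
rewrite {1}/partial deriveE; last exact: differentiable_comp.
rewrite diff_comp//= diff_sum_partial//.
have -> : 'd (shear k psi) x (delta_mx 0 i) =
    delta_mx 0 i + partial i psi x *: delta_mx 0 k.
  have -> : shear k psi = id \+ (fun y => psi y *: delta_mx 0 k) by [].
  rewrite diffD//; last exact: differentiableZl.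
  rewrite [LHS](_ : _ = 'd id x (delta_mx 0 i) +
    'd (fun y => psi y *: (delta_mx 0 k : 'rV[R]_n)) x (delta_mx 0 i)) //.
  have e1 := congr1 (fun F : 'rV[R]_n -> 'rV[R]_n => F (delta_mx 0 i))
    (diffZl (delta_mx 0 k : 'rV[R]_n) dpsi).
  have e2 := congr1 (fun F : 'rV[R]_n -> 'rV[R]_n => F (delta_mx 0 i))
    (diff_val (is_diff_def := is_diff_id x)).
  rewrite /partial deriveE//; congr (_ + _); [exact: e2|exact: e1].
under eq_bigr do rewrite !mxE eqxx /= mulrDl -mulrA.
rewrite big_split/= -mulr_sumr; congr (_ + _ * _).
  rewrite (bigD1 i)//= eqxx mul1r big1 ?addr0// => j ji.
  by rewrite (negbTE ji) mul0r.
rewrite (bigD1 k)//= eqxx mul1r big1 ?addr0// => j ji.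
by rewrite (negbTE ji) mul0r.
Qed.

Lemma C1_shear k psi f : C1 psi -> C1 f -> C1 (f \o shear k psi).
Proof.
move=> psi1 f1; split=> [x|i].
  apply: differentiable_comp; last exact: f1.1.
  by apply: differentiable_shear; exact: psi1.1.
rewrite (_ : partial i _ = (partial i f \o shear k psi) \+
    (partial i psi \* (partial k f \o shear k psi))); last first.
  by apply/funext => x; rewrite partial_shear//; [exact: psi1.1|exact: f1.1].
have cs : continuous (shear k psi) by apply: continuous_shear; exact: C1_continuous.
have c j : continuous (partial j f \o shear k psi).
  by move=> x; apply: continuous_comp; [exact: cs|exact: f1.2].
by move=> x; apply: (cvgD (c i x) (cvgM (psi1.2 i x) (c k x))).
Qed.

End calculus_lemmas.

(** * Compactly supported C^1 functions and Lipschitz bounds *)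

Section compact_support.
Context {R : realType} {n : nat}.
Implicit Types (f g psi : 'rV[R]_n -> R) (x y h : 'rV[R]_n) (i j k : 'I_n).
Implicit Types (Omega U V K : set 'rV[R]_n).

Lemma continuous_mul f g : continuous f -> continuous g ->
  continuous (fun x => f x * g x).
Proof. by move=> cf cg x; exact: (cvgM (cf x) (cg x)). Qed.

Lemma continuous_add f g : continuous f -> continuous g ->
  continuous (fun x => f x + g x).
Proof. by move=> cf cg x; exact: (cvgD (cf x) (cg x)). Qed.

Lemma coord_le_norm x i : `|x 0 i| <= `|x|.
Proof.
rewrite [leRHS]mx_normrE; apply: (le_bigmax _ (fun ij => `|x ij.1 ij.2|) (0, i)).
Qed.

Lemma supp_out f x : ~ supp f x -> f x = 0.
Proof.
by move=> sx; apply/eqP; apply: contrapT => /negP fx; apply: sx; exact: subset_closure.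
Qed.

Lemma partial_out f i x : ~ supp f x -> partial i f x = 0.
Proof.
move=> sx.
have nx : \forall y \near x, f y = 0.
  have : open (~` supp f) by apply: closed_openC; exact: closed_closure.
  rewrite openE => /(_ _ sx); apply: filterS => y; exact: supp_out.
rewrite /partial (near_eq_derive (g := cst 0)) ?derive_cst//.
Qed.

Lemma compact_closed_rV K : compact K -> closed K.
Proof. by apply: compact_closed; exact: norm_hausdorff. Qed.

Lemma supp_sub f K : compact K -> (forall x, ~ K x -> f x = 0) -> supp f `<=` K.
Proof.
move=> cK fK; rewrite [X in _ `<=` X](closure_id K).1; last exact: compact_closed_rV.
by apply: closure_subset => x /=; apply: contra_neqP => /fK.
Qed.

Lemma C1cP Omega f K : C1 f -> compact K -> K `<=` Omega ->
  (forall x, ~ K x -> f x = 0) -> C1c Omega f.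
Proof.
move=> f1 cK KO fK; have sK := supp_sub cK fK; split => //.
- by apply: (subclosed_compact _ cK) => //; exact: closed_closure.
- exact: subset_trans KO.
Qed.

Lemma C1cW U V f : U `<=` V -> C1c U f -> C1c V f.
Proof. by move=> UV [? ? ?]; split=> //; exact: subset_trans UV. Qed.

Lemma C1c_out U f x : C1c U f -> ~ U x -> f x = 0.
Proof. by move=> [_ _ fU] Ux; apply: supp_out => /fU. Qed.

Lemma C1c0 U : C1c U (cst 0).
Proof.
apply: (C1cP (K := set0)) => //; [exact: C1_cst|exact: compact0].
Qed.

Lemma C1cD U f g : C1c U f -> C1c U g -> C1c U (f \+ g).
Proof.
move=> [f1 cf fU] [g1 cg gU].
apply: (C1cP (K := supp f `|` supp g)).
- exact: C1D.
- exact: compactU.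
- by move=> x [/fU|/gU].
- move=> x /not_orP[fx gx]; by rewrite /= !supp_out// addr0.
Qed.

Lemma C1cMl U f g : C1c U f -> C1 g -> C1c U (f \* g).
Proof.
move=> [f1 cf fU] g1; apply: (C1cP (K := supp f)) => //; first exact: C1M.
by move=> x fx; rewrite /= supp_out// mul0r.
Qed.

Lemma C1cMr U f g : C1 f -> C1c U g -> C1c U (f \* g).
Proof.
move=> f1 g1; rewrite (_ : f \* g = g \* f); first exact: C1cMl.
by apply/funext => x /=; rewrite mulrC.
Qed.

Lemma C1cZ U f (c : R) : C1c U f -> C1c U (fun x => c * f x).
Proof. by move=> cf; apply: (C1cMr (f := cst c)) => //; exact: C1_cst. Qed.

Lemma C1cN U f : C1c U f -> C1c U (\- f).
Proof.
move=> cf; rewrite (_ : \- f = (fun x => -1 * f x)); first exact: C1cZ.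
by apply/funext => x /=; rewrite mulN1r.
Qed.

Lemma C1cB U f g : C1c U f -> C1c U g -> C1c U (f \- g).
Proof. by move=> cf cg; apply: C1cD => //; exact: C1cN. Qed.

Lemma C1c_sum U (I : Type) (r : seq I) (F : I -> 'rV[R]_n -> R) :
  (forall a, C1c U (F a)) -> C1c U (fun x => \sum_(i <- r) F i x).
Proof.
move=> F1; elim: r => [|a r ih].
  by under eq_fun do rewrite big_nil; exact: C1c0.
by under eq_fun do rewrite big_cons; exact: C1cD.
Qed.

Lemma C1c_shear U k psi f : C1c U psi -> C1c U f -> C1c U (f \o shear k psi).
Proof.
move=> [p1 cp pU] [f1 cf fU].
apply: (C1cP (K := supp psi `|` supp f)).
- exact: C1_shear.
- exact: compactU.
- by move=> x [/pU|/fU].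
- move=> x /not_orP[px fx].
  by rewrite /= /shear (supp_out px) scale0r addr0 supp_out.
Qed.

Lemma continuous_compact_bounded f K : continuous f -> compact K ->
  (forall x, ~ K x -> f x = 0) -> exists2 M : R, 0 <= M & forall x, `|f x| <= M.
Proof.
move=> cf cK fK.
have : compact (f @` K).
  by apply: continuous_compact => //; exact: continuous_subspaceT.
move=> /compact_bounded[M0 [_ hM]].
have hM1 : M0 < `|M0| + 1 by rewrite (le_lt_trans (ler_norm _))// ltrDl.
have {}hM := hM _ hM1.
exists (`|M0| + 1); first by rewrite addr_ge0.
move=> x; have [Kx|nKx] := pselect (K x); first by apply: hM => /=; exists x.
by rewrite fK// normr0 addr_ge0.
Qed.

Lemma sum_le_const (F : 'I_n -> R) (c : R) : (forall i, F i <= c) ->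
  \sum_i F i <= n%:R * c.
Proof.
move=> Fc; rewrite -[n in n%:R]card_ord mulr_natl -sumr_const.
by apply: ler_sum => i _; exact: Fc.
Qed.

(** The mean value theorem along the segment from [y] to [x]. The bound is asked on the segment
    only, so that the estimate can be used inside a domain that is not convex. The factor [n] comes
    from the sup norm. *)
Lemma C1_lipschitz_segment f (M : R) x y : C1 f ->
  (forall i (s : R), 0 <= s <= 1 -> `|partial i f (y + s *: (x - y))| <= M) ->
  `|f x - f y| <= n%:R * M * `|x - y|.
Proof.
move=> f1 fM.
pose g (s : R) := f (y + s *: (x - y)).
have dg (s : R) : is_derive s 1 g (\sum_i (x - y) 0 i * partial i f (y + s *: (x - y))).
  by apply: is_derive_line; exact: f1.1.
have cg : {within `[0, 1], continuous g}.
  by apply: derivable_within_continuous => s _; exact: ex_derive.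
have [s] := MVT_segment ler01 (fun s _ => dg s) cg.
rewrite in_itv/= => s01; rewrite /g scale1r scale0r addr0 subrKC subr0 mulr1 => ->.
apply: (le_trans (ler_norm_sum _ _ _)).
rewrite -mulrA; apply: sum_le_const => i; rewrite normrM mulrC ler_pM//.
  exact: fM.
exact: coord_le_norm.
Qed.

Lemma C1_lipschitz f (M : R) : C1 f -> (forall i x, `|partial i f x| <= M) ->
  forall x y, `|f x - f y| <= n%:R * M * `|x - y|.
Proof. by move=> f1 fM x y; apply: C1_lipschitz_segment => // i s _; exact: fM. Qed.

(** The mean value theorem at first order, then the Lipschitz bound on each partial derivative. A
    remainder uniform in [x] is what survives integration against a merely integrable function. *)
Lemma C2_taylor f (M : R) : C1 f -> (forall i, C1 (partial i f)) ->
  (forall i j x, `|partial j (partial i f) x| <= M) ->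
  forall x h, `|f (x + h) - f x - \sum_i h 0 i * partial i f x| <=
    n%:R * (n%:R * M) * `|h| ^+ 2.
Proof.
move=> f1 f2 fM x h.
pose g (s : R) := f (x + s *: h).
have dg (s : R) : is_derive s 1 g (\sum_i h 0 i * partial i f (x + s *: h)).
  by apply: is_derive_line; exact: f1.1.
have cg : {within `[0, 1], continuous g}.
  by apply: derivable_within_continuous => s _; exact: ex_derive.
have [s] := MVT_segment ler01 (fun s _ => dg s) cg.
rewrite in_itv/= => /andP[s0 s1].
rewrite /g scale1r scale0r addr0 subr0 mulr1 => ->.
rewrite -sumrB; apply: (le_trans (ler_norm_sum _ _ _)).
rewrite -mulrA; apply: sum_le_const => i; rewrite -mulrBr normrM expr2 mulrC.
have := C1_lipschitz (f2 i) (fM i) (x + s *: h) x.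
rewrite addrAC subrr add0r normrZ ger0_norm// => H.
rewrite mulrA; apply: ler_pM => //; last exact: coord_le_norm.
apply: (le_trans H); rewrite ler_wpM2l//; last by rewrite ler_piMl.
rewrite mulr_ge0//; exact: le_trans (fM i i 0).
Qed.

Lemma C1c_bounded U f : C1c U f ->
  exists2 M : R, 0 <= M & forall x, `|f x| <= M /\ forall i, `|partial i f x| <= M.
Proof.
move=> [f1 cf fU].
have [M0 M00 fM0] := continuous_compact_bounded (C1_continuous f1) cf (@supp_out f).
have h i : {M : R | 0 <= M & forall x, `|partial i f x| <= M}.
  apply: cid2; apply: continuous_compact_bounded cf _; first exact: f1.2.
  by move=> x; exact: partial_out.
pose M i := s2val (h i).
have M0i i : 0 <= M i by rewrite /M; case: (h i).
exists (M0 + \sum_i M i); first by rewrite addr_ge0// sumr_ge0.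
move=> x; split; first by rewrite (le_trans (fM0 x))// lerDl sumr_ge0.
move=> i; rewrite (bigD1 i)//= addrCA (le_trans (y := M i))//.
  by rewrite /M; case: (h i).
by rewrite lerDl addr_ge0// sumr_ge0.
Qed.

End compact_support.

(** * Bumps and cutoffs *)

Section cbump.
Context {R : realType} {n : nat}.
Implicit Types (f g : 'rV[R]_n -> R) (x y c : 'rV[R]_n) (i j : 'I_n) (r : R).

(** From exponent 2 on, the power of a positive part is C^1: at 0 the difference quotient is at most
    |h|^(k+1). This is how compactly supported functions are made out of polynomials. *)
Lemma is_derive_pospow (k : nat) (s : R) :
  is_derive s 1 (fun s : R => Num.max 0 s ^+ k.+2)
    (k.+2%:R * Num.max 0 s ^+ k.+1).
Proof.
have [s0|s0|->] := ltgtP s 0.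
- rewrite expr0n mulr0.
  apply: (@near_eq_is_derive _ _ _ (cst 0)).
  near=> t; rewrite (_ : Num.max 0 t = 0) ?expr0n//; apply/max_idPl.
  by apply: ltW; near: t; exact: lt_nbhsl.
- apply: (@near_eq_is_derive _ _ _ (fun t : R => t ^+ k.+2)).
  + near=> t; rewrite (_ : Num.max 0 t = t)//; apply/max_idPr.
    by apply: ltW; near: t; exact: lt_nbhsr.
  + by apply: DeriveDef; [exact: exprn_derivable|rewrite exp_derive [_ *: 1]mulr1].
- have H : (fun h : R => h^-1 *: (Num.max 0 (h *: (1 : R) + 0) ^+ k.+2 -
     Num.max 0 0 ^+ k.+2)) @ 0^' --> (0 : R).
    have -> : Num.max 0 0 ^+ k.+2 = 0 :> R by rewrite maxxx expr0n.
    apply/cvgr0Pnorm_le => e e0; near=> h.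
    have h1 : `|h| <= 1 by near: h; apply: dnbhs0_le.
    rewrite subr0 addr0 [_ *: 1]mulr1 [_ *: _]/(_ * _) normrM normfV normrX.
    have hm : `|Num.max 0 h| <= `|h|.
      by rewrite maxEle; case: ifP => // _; rewrite normr0.
    have h0 : 0 < `|h| by rewrite normr_gt0; near: h; exact: nbhs_dnbhs_neq.
    rewrite ler_pdivrMl//.
    apply: (@le_trans _ _ (`|h| ^+ k.+2)); first by rewrite lerXn2r// nnegrE.
    rewrite exprS ler_wpM2l//.
    apply: (@le_trans _ _ `|h|); first by rewrite exprS ler_piMr// exprn_ile1.
    by near: h; exact: dnbhs0_le.
  rewrite expr0n mulr0; apply: DeriveDef; first by apply/cvg_ex; exists 0.
  exact/cvg_lim.
Unshelve. all: by end_near. Qed.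

Lemma continuous_pospow (k : nat) : continuous (fun s : R => Num.max 0 s ^+ k).
Proof.
move=> s; apply: (@continuous_comp _ _ _ (fun s : R => Num.max 0 s) (fun t => t ^+ k)).
  by apply: continuous_max; [exact: cst_continuous|exact: id].
exact: exprn_continuous.
Qed.

Lemma partial_pospow (k : nat) f i x : C1 f ->
  partial i (fun x => Num.max 0 (f x) ^+ k.+2) x =
  k.+2%:R * Num.max 0 (f x) ^+ k.+1 * partial i f x.
Proof.
move=> f1; have h := is_derive_pospow k (f x).
rewrite (partial_comp (q := fun s => Num.max 0 s ^+ k.+2))//; last exact: f1.1.
by rewrite derive1E derive_val.
Qed.

Lemma C1_pospow (k : nat) f : C1 f -> C1 (fun x => Num.max 0 (f x) ^+ k.+2).
Proof.
move=> f1; apply: (C1_comp (q := fun s => Num.max 0 s ^+ k.+2)) => //.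
  by move=> s; have h := is_derive_pospow k s.
rewrite (_ : derive1 _ = fun s => k.+2%:R * Num.max 0 s ^+ k.+1); last first.
  by apply/funext => s; have h := is_derive_pospow k s; rewrite derive1E derive_val.
move=> s; have h := @continuous_pospow k.+1 s.
exact: (cvgM (cvg_cst (k.+2%:R : R)) h).
Qed.

Definition paraboloid c r x : R := r ^+ 2 - \sum_i (x 0 i - c 0 i) ^+ 2.

(** The cube gives two continuous derivatives: a shear needs a C^1 Jacobian, and differentiating a
    convolution needs a kernel with C^1 gradient. The second derivatives stay explicit. *)
Definition cbump c r x : R := Num.max 0 (paraboloid c r x) ^+ 3.

Lemma C1_dcoord c j : C1 (fun x => x 0 j - c 0 j).
Proof. by apply: C1B; [exact: C1_coord|exact: C1_cst]. Qed.

Lemma partial_dcoord c i j x : partial i (fun x => x 0 j - c 0 j) x = (i == j)%:R.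
Proof.
rewrite (@partialD _ _ i (fun x => x 0 j) (cst (- c 0 j))).
- by rewrite partial_coord partial_cst addr0.
- exact: (C1_coord j).1.
- exact: (C1_cst _).1.
Qed.

Lemma C1_paraboloid c r : C1 (paraboloid c r).
Proof.
apply: C1B; first exact: C1_cst.
by apply: C1_sum => j; apply: C1M; exact: C1_dcoord.
Qed.

Lemma partial_paraboloid c r i x :
  partial i (paraboloid c r) x = - (2 * (x 0 i - c 0 i)).
Proof.
have h j : C1 (fun x => (x 0 j - c 0 j) ^+ 2).
  by apply: C1M; exact: C1_dcoord.
rewrite (@partialD _ _ i (cst (r ^+ 2)) (\- (fun x => \sum_j (x 0 j - c 0 j) ^+ 2))).
- rewrite partial_cst add0r partialN; last exact: (C1_sum _ h).1.
  rewrite partial_sum//; congr (- _).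
  rewrite (bigD1 i)//= big1 ?addr0 => [|j ji];
    rewrite (@partialM _ _ i (fun x => x 0 _ - c 0 _) (fun x => x 0 _ - c 0 _)); try exact: (C1_dcoord c _).1;
    rewrite partial_dcoord.
  + by rewrite eqxx mulr1 mulr_natl mulr2n.
  + by rewrite eq_sym (negbTE ji) mulr0 addr0.
- exact: (C1_cst _).1.
- exact: (C1N (C1_sum _ h)).1.
Qed.

Lemma C1_bump c r : C1 (cbump c r).
Proof. by apply: C1_pospow; exact: C1_paraboloid. Qed.

Lemma partial_bump c r i : partial i (cbump c r) =
  (fun x => (-6 * (x 0 i - c 0 i)) * Num.max 0 (paraboloid c r x) ^+ 2).
Proof.
apply/funext => x; rewrite partial_pospow; last exact: C1_paraboloid.
by rewrite partial_paraboloid; ring.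
Qed.

Lemma C1_partial_bump c r i : C1 (partial i (cbump c r)).
Proof.
rewrite partial_bump; apply: C1M.
  by apply: C1M; [exact: C1_cst|exact: C1_dcoord].
by apply: C1_pospow; exact: C1_paraboloid.
Qed.

(** The explicit formulas are symmetric in [i] and [j]. The Piola identity for shears along bumps
    rests on this, as the second derivatives have to cancel there. *)
Lemma partial_bumpC c r i j :
  partial j (partial i (cbump c r)) = partial i (partial j (cbump c r)).
Proof.
have d1 a : C1 (fun x => -6 * (x 0 a - c 0 a)).
  by apply: C1M; [exact: C1_cst|exact: C1_dcoord].
have d2 : C1 (fun x => Num.max 0 (paraboloid c r x) ^+ 2).
  by apply: C1_pospow; exact: C1_paraboloid.
apply/funext => x; rewrite !partial_bump.
rewrite !(@partialM _ _ _ (fun x => -6 * (x 0 _ - c 0 _))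
  (fun x => Num.max 0 (paraboloid c r x) ^+ 2));
  try exact: (d1 _).1; try exact: d2.1.
rewrite !partial_pospow; try exact: C1_paraboloid.
rewrite !partial_paraboloid.
rewrite !(@partialM _ _ _ (cst (-6)) (fun x => x 0 _ - c 0 _));
  try exact: (C1_cst _).1; try exact: (C1_dcoord c _).1.
rewrite !partial_cst !partial_dcoord (eq_sym i j) /=; ring.
Qed.

Lemma bump_ge0 c r x : 0 <= cbump c r x.
Proof. by rewrite exprn_ge0// le_max lexx. Qed.

Lemma bump_gt0 c r x : \sum_i (x 0 i - c 0 i) ^+ 2 < r ^+ 2 -> 0 < cbump c r x.
Proof. by move=> h; rewrite exprn_gt0// lt_max subr_gt0 h orbT. Qed.

(** A point at sup distance at least [r] has one coordinate that differs from that of [c] by at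
    least [r], and this single square already makes the paraboloid nonpositive. *)
Lemma bump_out c r x : 0 < r -> r <= `|x - c| -> cbump c r x = 0.
Proof.
move=> r0 rx; rewrite /cbump (_ : Num.max _ _ = 0) ?expr0n//.
apply/max_idPl; rewrite subr_le0.
have /mx_norm_neq0[[a i] /= xi] : mx_norm (x - c) != 0.
  by rewrite gt_eqF// (lt_le_trans r0).
have -> : \sum_i (x 0 i - c 0 i) ^+ 2 = (x 0 i - c 0 i) ^+ 2 +
    \sum_(j | j != i) (x 0 j - c 0 j) ^+ 2 by rewrite (bigD1 i).
apply: (@le_trans _ _ ((x 0 i - c 0 i) ^+ 2)).
  rewrite -[leRHS]real_normK ?num_real// lerXn2r ?nnegrE ?normr_ge0//; first exact: ltW.
  apply: (le_trans rx); rewrite [leLHS]xi.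
  by rewrite (ord1 a) !mxE.
by rewrite lerDl sumr_ge0// => j _; rewrite sqr_ge0.
Qed.

Lemma bumpC c r x : cbump c r x = cbump x r c.
Proof.
rewrite /cbump /paraboloid; congr (Num.max 0 (_ - _) ^+ 3).
by apply: eq_bigr => i _; rewrite -sqrrN opprB.
Qed.

Lemma bump_shift c r x y : cbump (c + y) r (x + y) = cbump c r x.
Proof.
rewrite /cbump /paraboloid; congr (Num.max 0 (_ - _) ^+ 3).
by apply: eq_bigr => i _; rewrite !mxE; congr (_ ^+ 2); ring.
Qed.

Lemma compact_closed_ball_rV c r : compact (closed_ball_ Num.norm c r).
Proof.
apply: bounded_closed_compact; last exact: closed_closed_ball_.
exists (`|c| + `|r|); split; first exact: num_real.
move=> M hM x /= xr; rewrite -(subrK c x) addrC (le_trans (ler_normD _ _))//.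
by rewrite (le_trans _ (ltW hM))// lerD2l distrC (le_trans xr)// ler_norm.
Qed.

End cbump.

(** * Cutoff functions of open sets *)

Section cutoff.
Context {R : realType} {n : nat}.
Implicit Types (x y c : 'rV[R]_n) (i j : 'I_n) (r : R) (U : set 'rV[R]_n).

Lemma norm_le_coord x r : 0 <= r -> (forall i, `|x 0 i| <= r) -> `|x| <= r.
Proof.
move=> r0 xr; have [x0|/mx_norm_neq0[[a i] /= xi]] := eqVneq (mx_norm x) 0.
  by rewrite [leLHS]x0.
by rewrite [leLHS]xi (ord1 a).
Qed.

(** The factor [n.+1] is a crude bound for the ratio of the Euclidean norm to the sup norm. *)
Lemma bump_near_gt0 c r x : `|x - c| * n.+1%:R < r -> 0 < cbump c r x.
Proof.
move=> h; apply: bump_gt0.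
apply: (@le_lt_trans _ _ ((`|x - c| * n.+1%:R) ^+ 2)); last first.
  by rewrite ltrXn2r ?nnegrE ?mulr_ge0// (le_trans _ (ltW h))// mulr_ge0.
apply: (@le_trans _ _ (n%:R * `|x - c| ^+ 2)).
  apply: sum_le_const => i.
  rewrite -real_normK ?num_real// lerXn2r ?nnegrE//.
  by have := coord_le_norm (x - c) i; rewrite !mxE.
rewrite exprMn mulrC ler_wpM2l ?sqr_ge0// -natrX ler_nat.
by rewrite (@leq_trans n.+1)// -{1}[n.+1]muln1 leq_mul.
Qed.

Lemma C1c_bump U c r : 0 < r -> closed_ball_ Num.norm c r `<=` U ->
  C1c U (cbump c r).
Proof.
move=> r0 cU; apply: (C1cP (K := closed_ball_ Num.norm c r)) => //.
- exact: C1_bump.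
- exact: compact_closed_ball_rV.
- move=> x /= /negP; rewrite -ltNge => xr.
  by apply: bump_out => //; rewrite distrC ltW.
Qed.

(* The bumps supported in [U] with rational centre and radius [1 / m.+1], enumerated
   by the index [a]. *)
Definition node_bump U (a : nat) x : R :=
  if unpickle a is Some cm then
    let c := map_mx ratr (cm : 'rV[rat]_n * nat).1 : 'rV[R]_n in
    let r := (cm.2.+1%:R^-1 : R) in
    if `[< closed_ball_ Num.norm c r `<=` U >] then cbump c r x else 0
  else 0.

Lemma node_bump_ge0 U a x : 0 <= node_bump U a x.
Proof.
rewrite /node_bump; case: unpickle => // cm; case: ifP => // _; exact: bump_ge0.
Qed.

Lemma C1c_node_bump U a : C1c U (node_bump U a).
Proof.
rewrite /node_bump; case: unpickle => [cm|]; last exact: C1c0.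
by case: asboolP => h; [exact: C1c_bump|exact: C1c0].
Qed.

Lemma rat_approx x r : 0 < r ->
  exists c : 'rV[rat]_n, `|x - map_mx ratr c| <= r.
Proof.
move=> r0.
have h i : {q : rat | `|x 0 i - ratr q| <= r}.
  apply: cid.
  have /rat_in_itvoo[q] : x 0 i - r < x 0 i + r by rewrite ltrD2l gt0_cp.
  rewrite in_itv/= => /andP[q1 q2]; exists q.
  by rewrite ler_distlC (ltW q1) (ltW q2).
exists (\row_i sval (h i)); apply: norm_le_coord; first exact: ltW.
by move=> i; rewrite !mxE; case: (h i).
Qed.

(** The second clause puts [x] so close to the rational centre that the bump on that ball is
    positive at [x]. *)
Lemma open_node U x : open U -> U x ->
  exists2 cm : 'rV[rat]_n * nat,
    closed_ball_ Num.norm (map_mx ratr cm.1 : 'rV[R]_n) cm.2.+1%:R^-1 `<=` U &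
    `|x - map_mx ratr cm.1| * n.+1%:R < cm.2.+1%:R^-1.
Proof.
move=> oU Ux.
have /nbhs_ballP[e /= e0 xeU] := open_nbhs_nbhs (conj oU Ux).
have [m me] : exists m : nat, m.+1%:R^-1 < e / 2.
  exists (Num.truncn (e / 2)^-1); rewrite invf_plt ?posrE ?divr_gt0//.
  exact: truncnS_gt.
set r : R := m.+1%:R^-1.
have r0 : 0 < r by rewrite invr_gt0.
(* Dividing by [n.+2] rather than [n.+1] makes the inequality strict after multiplication by
   [n.+1]. *)
have d0 : 0 < r / n.+2%:R by rewrite divr_gt0.
have [c xc] := rat_approx x d0.
exists (c, m) => /=; rewrite -/r; last first.
  apply: (@le_lt_trans _ _ (r / n.+2%:R * n.+1%:R)); first by rewrite ler_wpM2r.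
  by rewrite -mulrA gtr_pMr// mulrC ltr_pdivrMr// mul1r ltr_nat.
move=> y /= cy; apply: xeU; rewrite mx_norm_ball /ball_ /=.
rewrite (@le_lt_trans _ _ (r + r))//; last by rewrite [ltRHS]splitr ltrD.
rewrite -(subrK (map_mx ratr c) x) -addrA (le_trans (ler_normD _ _))// lerD//.
by rewrite (le_trans xc)// ler_pdivrMr// ler_peMr ?ler1n// ltW.
Qed.

Lemma node_bump_cover U x : open U -> U x -> exists a, 0 < node_bump U a x.
Proof.
move=> oU Ux; have [cm cmU xcm] := open_node oU Ux.
exists (pickle cm); rewrite /node_bump pickleK; case: asboolP => // _.
exact: bump_near_gt0.
Qed.

(** With [G k] equal to [k] times the sum of the first [k] node bumps, take 1 - max(0, 1 - G k)^2.
    It vanishes where [G k] does, and equals 1 once [G k] is at least 1; at each point of [U] this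
    happens eventually, since some node bump is positive there. *)
Lemma open_cutoff U : open U -> exists theta : nat -> 'rV[R]_n -> R,
  [/\ forall k, C1c U (theta k), forall k x, 0 <= theta k x <= 1 &
   forall x, U x -> exists N, forall k, (N <= k)%N -> theta k x = 1].
Proof.
move=> oU.
pose G k x := k%:R * \sum_(a < k) node_bump U a x.
have cG k : C1c U (G k) by apply: C1cZ; apply: C1c_sum => a; exact: C1c_node_bump.
have G0 k x : 0 <= G k x.
  by rewrite mulr_ge0// sumr_ge0// => a _; exact: node_bump_ge0.
exists (fun k x => 1 - Num.max 0 (1 - G k x) ^+ 2); split.
- move=> k; have [G1 cs sU] := cG k; apply: (C1cP _ cs sU).
    apply: C1B; first exact: C1_cst.
    by apply: C1_pospow; apply: C1B => //; exact: C1_cst.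
  by move=> x /supp_out ->; rewrite subr0 (max_idPr _)// expr1n subrr.
- move=> k x.
  have h1 : 0 <= Num.max 0 (1 - G k x) by rewrite le_max lexx.
  have h2 : Num.max 0 (1 - G k x) <= 1 by rewrite ge_max ler01/= gerBl.
  by rewrite subr_ge0 exprn_ile1// gerBl exprn_ge0.
- move=> x Ux; have [a ax] := node_bump_cover oU Ux.
  have [N Na] : exists N : nat, (node_bump U a x)^-1 < N%:R.
    by exists (Num.truncn (node_bump U a x)^-1).+1; exact: truncnS_gt.
  exists (maxn a.+1 N) => k; rewrite geq_max => /andP[ak Nk].
  rewrite (max_idPl _) ?expr0n ?subr0// subr_le0.
  apply: (@le_trans _ _ (k%:R * node_bump U a x)); last first.
    rewrite ler_wpM2l// (bigD1 (Ordinal ak))//= lerDl sumr_ge0// => b _.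
    exact: node_bump_ge0.
  rewrite -ler_pdivrMr// div1r (le_trans (ltW Na))// ler_nat//.
Qed.

End cutoff.

(** * Lebesgue measure on R^n *)

Section borel.
Context {R : realType} {n : nat}.
Implicit Types (x c : 'rV[R]_n) (i j : 'I_n) (r : R) (U : set 'rV[R]_n).

Lemma open_preimages_measurable d (Y : measurableType d) (D : set Y) (f : Y -> R) :
  (forall V, open V -> measurable (D `&` f @^-1` V)) ->
  measurable D -> measurable_fun D f.
Proof.
move=> fV mD; apply: (measurability _ (RGenOpens.measurableE R)) => _ [_ [a [b ->] <-]].
by apply: fV; exact: interval_open.
Qed.

(** Closed sup-norm balls are intersections of coordinate slabs, and an open set is the countable
    union of the balls of rational centre and radius 1/(m+1) that it contains. *)
Lemma measurable_coords_open d (Y : measurableType d) (D : set Y)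
    (G : Y -> 'rV[R]_n) U : measurable D ->
  (forall i, measurable_fun D (fun y => G y 0 i)) -> open U ->
  measurable (D `&` G @^-1` U).
Proof.
move=> mD mG oU.
pose Q : set ('rV[rat]_n * nat) := [set cm |
  closed_ball_ Num.norm (map_mx ratr cm.1 : 'rV[R]_n) cm.2.+1%:R^-1 `<=` U].
have -> : D `&` G @^-1` U = \bigcup_(cm in Q) (D `&`
    G @^-1` closed_ball_ Num.norm (map_mx ratr cm.1 : 'rV[R]_n) cm.2.+1%:R^-1).
  apply/seteqP; split=> [y [Dy UGy]|y [cm Qcm] [Dy /Qcm]//].
  have [cm cmU h] := open_node oU UGy; exists cm => //; split => //=.
  by rewrite /closed_ball_ /= distrC (le_trans _ (ltW h))// ler_peMr// ler1n.
rewrite bigcup_mkcond; apply: countable_bigcupT_measurable.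
  exact: countableP.
move=> cm; case: ifPn => // _.
set c := map_mx _ _; set r := _^-1.
have -> : D `&` G @^-1` closed_ball_ Num.norm (c : 'rV[R]_n) r =
    D `&` \big[setI/setT]_i (D `&` [set y | `|c 0 i - G y 0 i| <= r]).
  apply/seteqP; split => y [Dy] /=.
    move=> h; split => //; elim/big_ind : _ => //= i _; split => //.
    by apply: le_trans h; have := coord_le_norm (c - G y) i; rewrite !mxE.
  move=> h; split => //; rewrite /closed_ball_ /=; apply: norm_le_coord.
    by rewrite invr_ge0.
  move=> i; move: h; rewrite (bigD1 i)//= => -[[_ +] _].
  by rewrite !mxE.
apply: measurableI => //; apply: bigsetI_measurable => i _.
have -> : D `&` [set y | `|c 0 i - G y 0 i| <= r] =
    D `&` (fun y => G y 0 i) @^-1` `[c 0 i - r, c 0 i + r].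
  by apply/seteqP; split=> y [Dy]/=; rewrite in_itv/= distrC ler_distl.
by apply: mG.
Qed.

Lemma measurable_continuous_comp d (Y : measurableType d) (D : set Y)
    (G : Y -> 'rV[R]_n) (F : 'rV[R]_n -> R) : measurable D ->
  (forall i, measurable_fun D (fun y => G y 0 i)) -> continuous F ->
  measurable_fun D (F \o G).
Proof.
move=> mD mG cF; apply: open_preimages_measurable => // V oV.
rewrite comp_preimage; apply: measurable_coords_open => //.
by apply: open_comp => // x _; exact: cF.
Qed.

Definition tuple_of_row (x : 'rV[R]_n) : n.-tuple (measurableTypeR R) :=
  [tuple x 0 i | i < n].

Lemma tuple_of_rowK : cancel tuple_of_row (@row_of_tuple R n).
Proof. by move=> x; apply/rowP => i; rewrite mxE tnth_mktuple. Qed.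

Lemma row_of_tupleK : cancel (@row_of_tuple R n) tuple_of_row.
Proof. by move=> t; apply: eq_from_tnth => i; rewrite tnth_mktuple mxE. Qed.

Local Notation T := (lebesgue_rV R n).

Lemma leb_measurable_tuple (A : set T) :
  measurable (@row_of_tuple R n @^-1` A) -> measurable A.
Proof.
move=> mA.
have sA : <<s measurable >> (@row_of_tuple R n @^-1` A).
  by apply: sub_gen_smallest.
have h := sub_caratheodory (tuple_lebesgue R n) sA.
by move=> X; exact: (h (@row_of_tuple R n @^-1` X)).
Qed.

Lemma leb_tuple (A : set T) : measurable (@row_of_tuple R n @^-1` A) ->
  leb A = tuple_lebesgue R n (@row_of_tuple R n @^-1` A).
Proof. by move=> mA; rewrite /leb /lebesgue_outer measurable_mu_extE. Qed.

Lemma measurable_row_coord i :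
  measurable_fun [set: n.-tuple (measurableTypeR R)] (fun t => row_of_tuple t 0 i).
Proof.
rewrite (_ : (fun t => _) = @tnth _ _ ^~ i); first exact: measurable_tnth.
by apply/funext => t; rewrite mxE.
Qed.

Lemma open_tuple_measurable U : open U -> measurable (@row_of_tuple R n @^-1` U).
Proof.
move=> oU; rewrite -[X in measurable X]setTI.
by apply: measurable_coords_open => // i; exact: measurable_row_coord.
Qed.

Lemma leb_open_measurable U : open U -> measurable (U : set T).
Proof. by move=> oU; apply: leb_measurable_tuple; exact: open_tuple_measurable. Qed.

Lemma leb_closed_measurable (K : set 'rV[R]_n) : closed K -> measurable (K : set T).
Proof.
move=> cK; rewrite -[K]setCK; apply: measurableC.
by apply: leb_open_measurable; exact: closed_openC.
Qed.

Lemma leb_measurable_continuous (f : 'rV[R]_n -> R) (D : set T) :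
  measurable D -> continuous f -> measurable_fun D f.
Proof.
move=> mD cf; apply: open_preimages_measurable => // V oV.
apply: measurableI => //; apply: leb_open_measurable.
by apply: open_comp => // x _; exact: cf.
Qed.

Lemma leb_measurable_coord (D : set T) i :
  measurable D -> measurable_fun D (fun x : T => (x : 'rV[R]_n) 0 i).
Proof. by move=> mD; apply: leb_measurable_continuous => //; exact: coord_continuous. Qed.

Definition borel_rV : set (set 'rV[R]_n) := <<s [set U | open U] >>.

Lemma tuple_measurable_borel (B : set (n.-tuple (measurableTypeR R))) :
  measurable B -> borel_rV (tuple_of_row @^-1` B).
Proof.
pose BT := g_sigma_algebraType ([set U | open U] : set (set 'rV[R]_n)).
have mf : measurable_fun [set: BT] (tuple_of_row : BT -> _).
  apply/measurable_fun_tnthP => i.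
  apply: open_preimages_measurable => // V oV; rewrite setTI.
  apply: sub_sigma_algebra => /=.
  rewrite (_ : _ @^-1` _ = (fun x : 'rV[R]_n => x 0 i) @^-1` V); last first.
    by apply/funext => x; rewrite /preimage /= tnth_mktuple.
  by apply: open_comp => // x _; exact: coord_continuous.
by move=> mB; have := mf measurableT _ mB; rewrite setTI.
Qed.

Lemma borel_tuple_measurable (B : set 'rV[R]_n) : borel_rV B ->
  measurable (@row_of_tuple R n @^-1` B).
Proof.
move=> bB.
pose H := [set B : set 'rV[R]_n | measurable (@row_of_tuple R n @^-1` B)].
suff : borel_rV `<=` H by exact.
apply: smallest_sub => [|U]; last exact: open_tuple_measurable.
split => /=; rewrite /H /=.
- by rewrite preimage_set0; exact: measurable0.
- by move=> A mA; rewrite setTD preimage_setC; exact: measurableC.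
- by move=> A mA; rewrite preimage_bigcup; exact: bigcupT_measurable.
Qed.

Lemma leb_borel_measurable (B : set 'rV[R]_n) : borel_rV B -> measurable (B : set T).
Proof. by move=> /borel_tuple_measurable /leb_measurable_tuple. Qed.

(** When the measure is finite, intersect Borel covers whose measure exceeds that of [A] by at most
    1/(k+1). *)
Lemma leb_borel_cover (A : set 'rV[R]_n) :
  exists2 B, borel_rV B & A `<=` B /\ leb (B : set T) = leb (A : set T).
Proof.
have [lA|lA] := eqVneq (leb (A : set T)) +oo%E.
  exists setT; first by apply: sub_sigma_algebra => /=; exact: openT.
  split => //; apply/eqP; rewrite lA -leye_eq -lA; exact: le_outer_measure.
have fA : leb (A : set T) \is a fin_num.
  by rewrite ge0_fin_numE ?outer_measure_ge0// ltey.
have h (k : nat) : {B | borel_rV B & A `<=` B /\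
    (leb (B : set T) <= leb (A : set T) + k.+1%:R^-1%:E)%E}.
  apply: cid2.
  have k0 : 0 < k.+1%:R^-1 :> R by rewrite invr_gt0.
  have [_ [F [mF AF] <-] lF] := lb_ereal_inf_adherent k0 fA.
  exists (tuple_of_row @^-1` \bigcup_i F i).
    by apply: tuple_measurable_borel; apply: bigcupT_measurable => i; exact: mF.
  split; first by move=> x Ax; apply: AF; rewrite /preimage /= tuple_of_rowK.
  apply: (le_trans _ (ltW lF)); rewrite /leb /lebesgue_outer -comp_preimage.
  rewrite (_ : _ \o _ = id) ?preimage_id; last by apply/funext => t /=; rewrite row_of_tupleK.
  apply: (le_trans (outer_measure_sigma_subadditive _ _)).
  by apply: lee_nneseries => // i _; rewrite /= measurable_mu_extE.
pose B k := s2val (h k).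
have bB k : borel_rV (B k) by rewrite /B; case: (h k).
have AB k : A `<=` B k by rewrite /B; case: (h k) => ? ? [].
have lB k : (leb (B k : set T) <= leb (A : set T) + k.+1%:R^-1%:E)%E.
  by rewrite /B; case: (h k) => ? ? [].
exists (\bigcap_k B k).
  exact: (@bigcap_measurableType _ (g_sigma_algebraType
    ([set U | open U] : set (set 'rV[R]_n))) B setT (fun k _ => bB k)).
split; first by move=> x Ax k _; exact: AB.
apply/eqP; rewrite eq_le; apply/andP; split; last first.
  by apply: le_outer_measure => x Ax k _; exact: AB.
apply/lee_addgt0Pr => e e0.
have ke : (Num.truncn e^-1).+1%:R^-1 <= e.
  by rewrite invf_ple ?posrE// ltW// truncnS_gt.
apply: (@le_trans _ _ (leb (B (Num.truncn e^-1) : set T))).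
  by apply: le_outer_measure => x; exact.
by apply: (le_trans (lB _)); rewrite leeD2l// lee_fin.
Qed.

End borel.

(** * Balls, sigma-finiteness and approximation by Borel sets *)

Section finiteness.
Context {R : realType} {n : nat}.
Implicit Types (x c : 'rV[R]_n) (i j : 'I_n) (r : R) (U : set 'rV[R]_n).
Local Notation T := (lebesgue_rV R n).

Definition nball r : set 'rV[R]_n := [set x | `|x| <= r].

Lemma closed_nball r : closed (nball r).
Proof.
rewrite (_ : nball r = Num.norm @^-1` [set s | s <= r])//.
by apply: closed_comp => [x _|]; [exact: norm_continuous|exact: closed_le].
Qed.

Lemma tuple_box (k : nat) (r : R) : 0 < r ->
  tuple_lebesgue R k [set t : k.-tuple (measurableTypeR R) |
    forall i : 'I_k, (`|tnth t i| <= r)%R] = ((2 * r) ^+ k)%:E.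
Proof.
move=> r0; elim: k => [|k ih].
  by rewrite /= /dirac indicE mem_set// => -[].
rewrite /= /cons_measure /pushforward.
set B := (X in tuple_lebesgue R k X) in ih.
have mB : measurable B.
  rewrite (_ : B = \bigcap_(i in [set: 'I_k]) ((@tnth _ _ ^~ i) @^-1` `[- r, r])).
    apply: fin_bigcap_measurable => // i _.
    by rewrite -[X in measurable X]setTI; apply: measurable_tnth.
  apply/seteqP; split => t /= h i; first by move=> _ /=; rewrite in_itv/= -ler_norml.
  by have := h i Logic.I; rewrite /= in_itv/= -ler_norml.
rewrite (_ : _ @^-1` _ = `[- r, r] `*` B).
  pose I : set (measurableTypeR R) := `[- r, r]%classic.
  have mI : measurable I by exact: measurable_itv.
  change ((@lebesgue_measure R \x tuple_lebesgue R k) (I `*` B) = ((2 * r) ^+ k.+1)%:E)%E.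
  have h : @lebesgue_measure R I = (2 * r)%:E.
    rewrite lebesgue_measure_itv/= lte_fin gtrN// -EFinB opprK.
    by rewrite mulr_natl mulr2n.
  by rewrite product_measure1E// ih [X in (X * _)%E](_ : _ = (2 * r)%:E)// exprS EFinM.
apply/seteqP; split => -[a t] /=.
  move=> h; split=> /=.
    by have := h ord0; rewrite tnth0 in_itv/= ler_norml.
  by move=> i; have := h (lift ord0 i); rewrite tnthS.
move=> [] /=; rewrite in_itv/= -ler_norml => ar h i.
by case: (unliftP ord0 i) => [j ->|->]; rewrite ?tnth0// tnthS.
Qed.

Lemma leb_ball r : 0 < r -> leb (nball r : set T) = ((2 * r) ^+ n)%:E.
Proof.
move=> r0; rewrite leb_tuple.
  rewrite (_ : _ @^-1` _ = [set t | forall i, `|tnth t i| <= r]).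
    exact: tuple_box.
  apply/seteqP; split => t /= h; last first.
    by apply: norm_le_coord => [|i]; rewrite ?mxE//; exact: ltW.
  by move=> i; have := coord_le_norm (row_of_tuple t) i; rewrite mxE => /le_trans; exact.
apply: borel_tuple_measurable; rewrite -[nball r]setCK -setTD.
have [_ + _] := @smallest_sigma_algebra _ setT [set U : set 'rV[R]_n | open U].
by apply; apply: sub_sigma_algebra => /=; apply: closed_openC; exact: closed_nball.
Qed.

Lemma leb_ball_fin r : (leb (nball r : set T) < +oo)%E.
Proof.
have h : 0 < `|r| + 1 by rewrite ltr_wpDl.
apply: (@le_lt_trans _ _ (leb (nball (`|r| + 1) : set T))); last by rewrite leb_ball// ltey.
apply: le_outer_measure => x /= xr; rewrite /nball /= (le_trans xr)//.
by rewrite (le_trans (ler_norm _))// lerDl.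
Qed.

Lemma leb_bounded_fin (A : set 'rV[R]_n) : bounded_set A ->
  (leb (A : set T) < +oo)%E.
Proof.
move=> [M [_ hM]]; apply: (le_lt_trans _ (leb_ball_fin (M + 1))).
by apply: le_outer_measure => x Ax; apply: (hM (M + 1)); rewrite ?ltrDl.
Qed.

Lemma leb_compact_fin (A : set 'rV[R]_n) : compact A -> (leb (A : set T) < +oo)%E.
Proof. by move=> /compact_bounded/leb_bounded_fin. Qed.

Lemma bigcup_closed_balls : \bigcup_k nball k%:R = setT.
Proof.
rewrite -subTset => x _; exists (Num.truncn `|x|).+1 => //=.
exact/ltW/truncnS_gt.
Qed.

Lemma leb_sigma_finite : sigma_finite setT (@leb R n).
Proof.
exists (fun k => nball k%:R); first by rewrite bigcup_closed_balls.
move=> k; split; last exact: leb_ball_fin.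
by apply: leb_closed_measurable; exact: closed_nball.
Qed.

HB.instance Definition _ := @Measure_isSigmaFinite.Build _ _ _ (@leb R n)
  leb_sigma_finite.

Lemma le_leb (A B : set 'rV[R]_n) : A `<=` B ->
  (leb (A : set T) <= leb (B : set T))%E.
Proof. exact: le_outer_measure. Qed.

Lemma leb_subset_null (A B : set 'rV[R]_n) : A `<=` B ->
  leb (B : set T) = 0%E -> leb (A : set T) = 0%E.
Proof.
move=> AB B0; apply/eqP; rewrite eq_le -{1}B0 le_leb//=; exact: outer_measure_ge0.
Qed.

Lemma leb_setU_null (A N : set 'rV[R]_n) : leb (N : set T) = 0%E ->
  leb (A `|` N : set T) = leb (A : set T).
Proof.
move=> N0; apply/eqP; rewrite eq_le; apply/andP; split.
  apply: (le_trans (outer_measureU2 _ _ _)).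
  by rewrite [X in (_ + X)%E]N0 adde0.
by apply: le_leb => x; left.
Qed.

Lemma leb_null_measurable (N A : set T) : measurable N -> leb N = 0 ->
  A `<=` N -> measurable A.
Proof.
by move=> mN N0 AN; apply: measure_is_complete_caratheodory; exists N; split.
Qed.

(** A continuous preimage of a Lebesgue measurable set need not be measurable, so later statements
    are proved for Borel sets and carried over by this sandwich. Truncation to balls makes the
    measure finite, and then the excess of the Borel cover is null. *)
Lemma leb_borel_approx (A : set T) : measurable A -> exists B N : set 'rV[R]_n,
  [/\ borel_rV B, borel_rV N, leb (N : set T) = 0,
   B `\` N `<=` A & A `<=` B `|` N].
Proof.
move=> mA.
have h (k : nat) : {BN : set 'rV[R]_n * set 'rV[R]_n |
    [/\ borel_rV BN.1, borel_rV BN.2, leb (BN.2 : set T) = 0,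
     BN.1 `\` BN.2 `<=` A & A `&` nball k%:R `<=` BN.1]}.
  apply: cid; pose Ak : set 'rV[R]_n := A `&` nball k%:R.
  have mAk : measurable (Ak : set T).
    by apply: measurableI => //; apply: leb_closed_measurable; exact: closed_nball.
  have fAk : (leb (Ak : set T) < +oo)%E.
    by apply: (le_lt_trans _ (leb_ball_fin k%:R)); apply: le_outer_measure => x [].
  have [B bB [AB lB]] := leb_borel_cover Ak.
  have mB := leb_borel_measurable bB.
  have lBA : leb ((B `\` Ak) : set T) = 0.
    rewrite measureD//; last by rewrite [ltLHS]lB.
    rewrite (setIidr AB) [X in (X - _)%E](_ : _ = leb (Ak : set T))//.
    by rewrite subee// ge0_fin_numE// measure_ge0.
  have [N bN [BN lN]] := leb_borel_cover (B `\` Ak).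
  exists (B, N); split => //=; first by rewrite lN.
  move=> x [Bx Nx]; apply: contrapT => Ax; apply: Nx; apply: BN; split => //.
  by move=> [].
pose B k := (sval (h k)).1; pose N k := (sval (h k)).2.
have hP k : [/\ borel_rV (B k), borel_rV (N k), leb (N k : set T) = 0,
    B k `\` N k `<=` A & A `&` nball k%:R `<=` B k] := svalP (h k).
exists (\bigcup_k B k), (\bigcup_k N k).
have [sU0 sUC sUU] := @smallest_sigma_algebra _ setT [set U : set 'rV[R]_n | open U].
split.
- by apply: sUU => k; have [] := hP k.
- by apply: sUU => k; have [] := hP k.
- apply/eqP; rewrite eq_le measure_ge0 andbT.
  apply: (le_trans (outer_measure_sigma_subadditive _ _)).
  by rewrite eseries0// => k _ _; have [] := hP k.
- move=> x [[k _ Bkx] Nx]; have [_ _ _ + _] := hP k; apply; split => //.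
  by move=> Nkx; apply: Nx; exists k.
- move=> x Ax; left.
  have [k _ xk] : (\bigcup_k nball k%:R) x by rewrite bigcup_closed_balls.
  by exists k => //; have [_ _ _ _] := hP k; apply; split.
Qed.

End finiteness.

(* unfolding the outer measure makes the terminator of rewrite and apply diverge *)
Opaque lebesgue_outer.

(** * Change of variables, from open sets to functions *)

Section integral_push.
Local Open Scope ereal_scope.
Context d (T : measurableType d) (R : realType).
Variables (mu : {measure set T -> \bar R}) (Phi : T -> T) (J : T -> R).
Hypothesis mPhi : measurable_fun setT Phi.
Hypothesis mJ : measurable_fun setT J.
Hypothesis J0 : forall x, (0 <= J x)%R.
Hypothesis vol : forall A, measurable A ->
  \int[mu]_(x in Phi @^-1` A) (J x)%:E = mu A.

Import HBNNSimple.

(** The formula for sets gives simple functions by linearity, and monotone convergence gives the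
    rest. *)
Lemma ge0_integral_jacobian (f : T -> \bar R) :
  measurable_fun setT f -> (forall x, 0 <= f x) ->
  \int[mu]_x (f (Phi x) * (J x)%:E) = \int[mu]_x f x.
Proof.
move=> mf f0; pose f_ := nnsfun_approx measurableT mf.
have cf x : (f_ n x)%:E @[n --> \oo] --> f x by apply: cvg_nnsfun_approx.
transitivity (limn (fun n => \int[mu]_x ((f_ n (Phi x))%:E * (J x)%:E))).
  rewrite -monotone_convergence//.
  - apply: eq_integral => x _; apply/esym/cvg_lim => //.
    by apply: cvgeMr => //; exact: cf.
  - move=> n; apply: emeasurable_funM; apply/measurable_EFinP => //.
    exact: measurableT_comp.
  - by move=> n x _; rewrite -EFinM lee_fin mulr_ge0.
  - move=> x _ a b ab; rewrite -!EFinM lee_fin ler_wpM2r//.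
    exact/lefP/nd_nnsfun_approx.
transitivity (limn (fun n => \int[mu]_x (f_ n x)%:E)); last first.
  rewrite -monotone_convergence//.
  - by apply: eq_integral => x _; apply/cvg_lim => //; exact: cf.
  - by move=> n; exact/measurable_EFinP.
  - by move=> n x _; rewrite lee_fin.
  - by move=> x _ a b ab; rewrite lee_fin; exact/lefP/nd_nnsfun_approx.
congr (limn _); apply/funext => n.
have mP (A : set T) : measurable A -> measurable (Phi @^-1` A).
  by move=> mA; rewrite -[X in measurable X]setTI; exact: mPhi.
have mfr (r : R) : measurable (f_ n @^-1` [set r]) by exact: measurable_sfunP.
transitivity (\sum_(r \in range (f_ n))
    \int[mu]_x (r%:E * (\1_(Phi @^-1` (f_ n @^-1` [set r])) x * J x)%:E)).
  rewrite -ge0_integral_fsum//.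
  - apply: eq_integral => x _; rewrite fimfunE -fsumEFin// ge0_mule_fsuml.
      by apply: eq_fsbigr => r _; rewrite -!EFinM mulrA.
    by move=> r; rewrite lee_fin; exact: nnfun_muleindic_ge0.
  - move=> r; apply: emeasurable_funM; first exact: measurable_cst.
    by apply/measurable_EFinP/measurable_funM => //; exact/measurable_indic/mP/mfr.
  - move=> r x _; have := @nnfun_muleindic_ge0 _ _ _ (f_ n) r (Phi x).
    by rewrite -!EFinM mulrA !lee_fin => h; rewrite mulr_ge0.
transitivity (\sum_(r \in range (f_ n))
    \int[mu]_x (r%:E * (\1_(f_ n @^-1` [set r]) x)%:E)); last first.
  rewrite -ge0_integral_fsum//.
  - by apply: eq_integral => x _; rewrite fimfunE -fsumEFin.
  - by move=> r; apply/measurable_EFinP/measurable_funM.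
  - by move=> r x _; exact: nnfun_muleindic_ge0.
apply: eq_fsbigr => r /[!inE] -[x0 _ <-].
rewrite !ge0_integralZl//.
- rewrite integral_indic// setIT -vol//.
  congr (_ * _); rewrite [RHS]integral_mkcond; apply: eq_integral => x _.
  by rewrite patchE indicE; case: ifP => _; rewrite ?mul1r ?mul0r.
- exact/measurable_EFinP/measurable_indic.
- by rewrite lee_fin.
- by apply/measurable_EFinP/measurable_funM => //; exact/measurable_indic/mP/mfr.
- by move=> x _; rewrite lee_fin mulr_ge0.
- by rewrite lee_fin.
Qed.

End integral_push.

Section jacobian.
Context {R : realType} {n : nat}.
Implicit Types (x c : 'rV[R]_n) (i j : 'I_n) (r : R) (U : set 'rV[R]_n).
Local Notation T := (lebesgue_rV R n).

Lemma borel_preimage (Phi : 'rV[R]_n -> 'rV[R]_n) (B : set 'rV[R]_n) :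
  continuous Phi -> borel_rV B -> borel_rV (Phi @^-1` B).
Proof.
move=> cPhi bB; pose H := [set B : set 'rV[R]_n | borel_rV (Phi @^-1` B)].
have [s0 sC sU] := @smallest_sigma_algebra _ setT [set U : set 'rV[R]_n | open U].
suff : borel_rV `<=` H by exact.
apply: smallest_sub => [|U oU]; last first.
  apply: sub_sigma_algebra => /=.
  by apply: open_comp => // x _; exact: cPhi.
split; rewrite /H /=.
- by rewrite preimage_set0.
- by move=> A mA; rewrite setTD preimage_setC -setTD; exact: sC.
- by move=> A mA; rewrite preimage_bigcup; exact: sU.
Qed.

Lemma bounded_setS (A B : set 'rV[R]_n) : A `<=` B -> bounded_set B -> bounded_set A.
Proof. by move=> AB [M [Mr h]]; exists M; split=> // x Mx y Ay; exact/(h x Mx)/AB. Qed.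

Lemma nball_bounded r : bounded_set (nball r : set 'rV[R]_n).
Proof.
exists r; split; first exact: num_real.
by move=> M rM x /= xr; rewrite (le_trans xr)// ltW.
Qed.

Lemma open_nball r : open ([set x : 'rV[R]_n | `|x| < r]).
Proof.
rewrite (_ : [set x | _] = Num.norm @^-1` [set s | s < r])//.
by apply: open_comp => [x _|]; [exact: norm_continuous|exact: open_lt].
Qed.

(** Boundedness makes the measures compared below finite on the generating sets, as the uniqueness
    theorem for measures requires of its exhausting sequence. *)
Definition open_bounded : set (set 'rV[R]_n) := [set U | open U /\ bounded_set U].

Lemma borel_open_bounded : borel_rV `<=` <<s open_bounded >>.
Proof.
apply: smallest_sub; first exact: smallest_sigma_algebra.
move=> U oU.
have -> : U = \bigcup_(k in [set: nat]) (U `&` [set x | `|x| < k%:R]).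
  apply/seteqP; split => [x Ux|x [k _ []//]].
  by exists (Num.truncn `|x|).+1 => //; split => //=; exact/truncnS_gt.
have [_ _] := @smallest_sigma_algebra _ setT open_bounded; apply => k.
apply: sub_sigma_algebra; split; first by apply: openI => //; exact: open_nball.
by apply: (@bounded_setS _ (nball k%:R)); [move=> x [_ /= /ltW]|exact: nball_bounded].
Qed.

Variables (Phi : 'rV[R]_n -> 'rV[R]_n) (J : 'rV[R]_n -> R).
Hypothesis cPhi : continuous Phi.
Hypothesis cJ : continuous J.
Hypothesis J0 : forall x, 0 < J x.
Hypothesis vol : forall U, open U -> bounded_set U ->
  (\int[leb]_(x in (Phi @^-1` U : set T)) (J x)%:E = leb (U : set T))%E.

(** Both sides are measures on the Borel sets that agree on the bounded open sets; these are stable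
    under intersection, generate the Borel sets, and include balls of finite measure that exhaust
    the space. *)
Lemma jacobian_borel (B : set 'rV[R]_n) : borel_rV B ->
  (\int[leb]_(x in (Phi @^-1` B : set T)) (J x)%:E = leb (B : set T))%E.
Proof.
pose BT := g_sigma_algebraType ([set U | open U] : set (set 'rV[R]_n)).
have mJ (D : set T) : measurable D -> measurable_fun D (EFin \o J).
  by move=> mD; apply/measurable_EFinP; exact: leb_measurable_continuous.
have mP (A : set BT) : measurable A -> measurable (Phi @^-1` A : set T).
  by move=> mA; apply: leb_borel_measurable; exact: borel_preimage.
pose nu (A : set BT) : \bar R := (\int[leb]_(x in (Phi @^-1` A : set T)) (J x)%:E)%E.
pose mu (A : set BT) : \bar R := leb (A : set T).
have nu0 : nu set0 = 0%E by rewrite /nu preimage_set0 integral_set0.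
have nu_ge0 A : (0 <= nu A)%E by apply: integral_ge0 => x _; rewrite lee_fin ltW.
have nu_add : semi_sigma_additive nu.
  move=> F mF tF mUF; rewrite /nu preimage_bigcup ge0_integral_bigcup.
  - by apply: is_cvg_ereal_nneg_natsum => k _; exact: nu_ge0.
  - by move=> k; exact: mP.
  - by apply: mJ; apply: bigcupT_measurable => k; exact: mP.
  - by move=> x _; rewrite lee_fin ltW.
  - apply/trivIsetP => /= i j _ _ ij; rewrite -preimage_setI.
    by move/trivIsetP : tF => /(_ _ _ _ _ ij) ->//; rewrite preimage_set0.
have mu0 : mu set0 = 0%E by exact: measure0.
have mu_ge0 A : (0 <= mu A)%E by exact: measure_ge0.
have mu_add : semi_sigma_additive mu.
  move=> F mF tF mUF; apply: (@measure_semi_sigma_additive _ _ _ (@leb R n)) => //.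
    by move=> i; exact: (leb_borel_measurable (mF i)).
  exact: (leb_borel_measurable mUF).
pose nuM : {measure set BT -> \bar R} :=
  HB.pack nu (isMeasure.Build _ _ _ nu nu0 nu_ge0 nu_add).
pose muM : {measure set BT -> \bar R} :=
  HB.pack mu (isMeasure.Build _ _ _ mu mu0 mu_ge0 mu_add).
move=> bB; have bB' := borel_open_bounded bB.
have ob k : open_bounded [set x : 'rV[R]_n | `|x| < k%:R].
  split; first exact: open_nball.
  by apply: (@bounded_setS _ (nball k%:R)); [move=> x /= /ltW|exact: nball_bounded].
apply/esym.
apply: (@g_sigma_algebra_measure_unique _ R BT open_bounded _
  (fun k => [set x | `|x| < k%:R]) _ _ muM nuM _ _ _ _ bB').
- by move=> U [oU _]; exact: sub_sigma_algebra.
- exact: ob.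
- rewrite -subTset => x _; exists (Num.truncn `|x|).+1 => //=; exact/truncnS_gt.
- move=> U V [oU bU] [oV bV]; split; first exact: openI.
  by apply: bounded_setS bU => x [].
- by move=> U [oU bU]; rewrite /muM/nuM/= /mu /nu vol.
- by move=> k; apply: leb_bounded_fin; have [] := ob k.
Qed.

(** As [J] is positive, a set on which its integral vanishes is null; a Borel null cover of [N]
    reduces the claim to the formula for Borel sets. *)
Lemma jacobian_null (N : set T) : measurable N -> leb N = 0%E ->
  leb (Phi @^-1` N : set T) = 0%E.
Proof.
move=> mN N0; have [B bB [NB lB]] := leb_borel_cover N.
have mPB : measurable (Phi @^-1` B : set T).
  by apply: leb_borel_measurable; exact: borel_preimage.
have B0 : leb (Phi @^-1` B : set T) = 0%E.
  have mJ : measurable_fun (Phi @^-1` B : set T) (EFin \o J).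
    by apply/measurable_EFinP; exact: leb_measurable_continuous.
  have : (\int[leb]_(x in (Phi @^-1` B : set T)) `|(EFin \o J) x| = 0)%E.
    under eq_integral => x _ do rewrite gee0_abs ?lee_fin ?(ltW (J0 _))//.
    by rewrite jacobian_borel// lB.
  move=> /(ae_eq_integral_abs _ mPB mJ)[N' [mN' N'0 h]].
  apply: (leb_subset_null _ N'0) => x Bx; apply: h => /= /(_ Bx) [] Jx0.
  by have := J0 x; rewrite Jx0 ltxx.
by apply: (leb_subset_null _ B0) => x; exact: NB.
Qed.

Lemma jacobian_measurable (A : set T) : measurable A ->
  measurable (Phi @^-1` A : set T).
Proof.
move=> mA; have [B [N [bB bN N0 BNA ABN]]] := leb_borel_approx mA.
have mB := leb_borel_measurable (borel_preimage cPhi bB).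
have mN := leb_borel_measurable (borel_preimage cPhi bN).
have -> : Phi @^-1` A = (Phi @^-1` B `\` Phi @^-1` N) `|`
    (Phi @^-1` A `&` Phi @^-1` N).
  apply/seteqP; split => [x Ax|x [h|[]//]]; last exact: BNA.
  have [Nx|Nx] := pselect (N (Phi x)); [by right|left; split => //].
  by have [] := ABN _ Ax.
apply: measurableU; first exact: measurableD.
apply: (leb_null_measurable mN); last by move=> x [].
by apply: jacobian_null => //; exact: leb_borel_measurable.
Qed.

Lemma jacobian_measurable_fun : measurable_fun [set: T] (Phi : T -> T).
Proof. by move=> _ A mA; rewrite setTI; exact: jacobian_measurable. Qed.

Lemma jacobian_volume (A : set T) : measurable A ->
  (\int[leb]_(x in (Phi @^-1` A : set T)) (J x)%:E = leb A)%E.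
Proof.
move=> mA; have [B [N [bB bN N0 BNA ABN]]] := leb_borel_approx mA.
have mPA := jacobian_measurable mA.
have mPB := leb_borel_measurable (borel_preimage cPhi bB).
have mPN := leb_borel_measurable (borel_preimage cPhi bN).
have mB := leb_borel_measurable bB; have mN := leb_borel_measurable bN.
have N0' : leb (Phi @^-1` N : set T) = 0%E by exact: jacobian_null.
have -> : leb A = leb (B : set T).
  apply/eqP; rewrite eq_le; apply/andP; split.
    by apply: (le_trans (le_leb ABN)); rewrite leb_setU_null.
  apply: (@le_trans _ _ (leb ((A `|` N) : set T))); last by rewrite leb_setU_null.
  apply: le_leb => x Bx; have [Nx|Nx] := pselect (N x); [by right|left].
  exact: BNA.
rewrite -jacobian_borel// integral_mkcond [RHS]integral_mkcond.
have mJ : measurable_fun [set: T] (EFin \o J).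
  by apply/measurable_EFinP; exact: leb_measurable_continuous.
apply: ae_eq_integral.
- exact: measurableT.
- exact/(measurable_restrictT _ mPA).1/measurable_funTS.
- exact/(measurable_restrictT _ mPB).1/measurable_funTS.
- exists (Phi @^-1` N); split => // x /= h; apply: contrapT => Nx; apply: h => _.
  rewrite !patchE; congr (if _ then _ else _).
  apply/idP/idP; rewrite !inE => H.
    by have [] := ABN _ H.
  exact: BNA.
Qed.

Lemma ge0_jacobian (f : T -> \bar R) :
  measurable_fun setT f -> (forall x, 0 <= f x)%E ->
  (\int[leb]_x (f (Phi x : T) * (J x)%:E) = \int[leb]_x f x)%E.
Proof.
move=> mf f0; apply: (@ge0_integral_jacobian _ T R leb Phi J).
- exact: jacobian_measurable_fun.
- exact: leb_measurable_continuous.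
- by move=> x; exact: ltW.
- exact: jacobian_volume.
- exact: mf.
- exact: f0.
Qed.

End jacobian.

Section pushforward_measurable.
Local Open Scope ereal_scope.
Context d d' (T1 : measurableType d) (T2 : measurableType d') (R : realType).
Variables (m : {measure set T1 -> \bar R}) (f : T1 -> T2).
Hypothesis mf : measurable_fun [set: T1] f.

(** The unnamed argument, a proof of measurability, makes the function itself carry what its measure
    structure needs. *)
Definition push_measure of measurable_fun [set: T1] f : set T2 -> \bar R :=
  fun A => m (f @^-1` A).

Let push0 : push_measure mf set0 = 0.
Proof. by rewrite /push_measure preimage_set0 measure0. Qed.

Let push_ge0 A : 0 <= push_measure mf A.
Proof. exact: measure_ge0. Qed.

Let push_sigma_additive : semi_sigma_additive (push_measure mf).
Proof.
move=> F mF tF mUF; rewrite /push_measure preimage_bigcup.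
apply: measure_semi_sigma_additive.
- by move=> k; rewrite -[X in measurable X]setTI; exact: mf.
- apply/trivIsetP => /= i j _ _ ij; rewrite -preimage_setI.
  by move/trivIsetP : tF => /(_ _ _ _ _ ij) ->//; rewrite preimage_set0.
- by rewrite -preimage_bigcup -[X in measurable X]setTI; exact: mf.
Qed.

HB.instance Definition _ := isMeasure.Build _ _ _ (push_measure mf)
  push0 push_ge0 push_sigma_additive.

End pushforward_measurable.

(** * Translation invariance of Lebesgue measure *)

Section translation.
Context {R : realType}.

Lemma lebesgue_measure_shift (a : R) (A : set (measurableTypeR R)) :
  measurable A -> (lebesgue_measure ((fun x => x + a)%R @^-1` A) = lebesgue_measure A)%E.
Proof.
move=> mA.
have mf : measurable_fun [set: measurableTypeR R]
    (fun x : measurableTypeR R => x + a : measurableTypeR R).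
  by apply: measurable_funD => //; exact: measurable_cst.
symmetry; apply: (@lebesgue_measure_unique _ (push_measure (@lebesgue_measure R) mf)) => //.
move=> _ [[x y] _ <-]; rewrite /push_measure/=.
rewrite (_ : _ @^-1` _ = `]x - a, y - a]%classic); last first.
  by apply/seteqP; split => z /=; rewrite !in_itv/= ltrBlDr lerBrDr.
rewrite !lebesgue_measure_itv/= !lte_fin ltrD2r; case: ifPn => // xy.
by rewrite -!EFinB opprB addrA subrK.
Qed.

Definition shift_tuple (k : nat) (a t : k.-tuple (measurableTypeR R)) :
  k.-tuple (measurableTypeR R) := [tuple (tnth t i + tnth a i : R) | i < k].

Lemma measurable_shift_tuple (k : nat) (a : k.-tuple (measurableTypeR R)) :
  measurable_fun setT (shift_tuple a).
Proof.
apply/measurable_fun_tnthP => i.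
rewrite (_ : _ \o _ = fun t => (tnth t i + tnth a i : R)); last first.
  by apply/funext => t /=; rewrite tnth_mktuple.
by apply: measurable_funD; [exact: measurable_tnth|exact: measurable_cst].
Qed.

(** Induction on the dimension: the shifted measure agrees with the product measure on rectangles,
    which determine it. *)
Lemma tuple_lebesgue_shift (k : nat) (a : k.-tuple (measurableTypeR R))
    (A : set (k.-tuple (measurableTypeR R))) : measurable A ->
  tuple_lebesgue R k (shift_tuple a @^-1` A) = tuple_lebesgue R k A.
Proof.
elim: k a A => [|k ih] a A mA.
  have -> // : shift_tuple a = id.
  by apply/funext => t; rewrite [LHS]tuple0 [RHS]tuple0.
pose a' : k.-tuple (measurableTypeR R) := [tuple of behead a].
pose S (z : measurableTypeR R * k.-tuple (measurableTypeR R)) :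
  measurableTypeR R * k.-tuple (measurableTypeR R) := (z.1 + thead a : R, shift_tuple a' z.2).
have mS : measurable_fun setT S.
  apply/measurable_fun_pairP; split.
    by apply: measurable_funD; [exact: measurable_fst|exact: measurable_cst].
  exact: (measurableT_comp (measurable_shift_tuple a') measurable_snd).
rewrite /= /cons_measure /pushforward.
have mcA : measurable (@cons_pair R k @^-1` A).
  by rewrite -[X in measurable X]setTI; exact: measurable_cons_pair.
rewrite [RHS](@product_measure_unique _ _ _ _ _ _ _ (push_measure (@lebesgue_measure R \x tuple_lebesgue R k)%E mS))//.
  rewrite /= /push_measure; congr (_ _); apply/seteqP; split => -[x t];
    rewrite /preimage /=; congr (A _); apply: eq_from_tnth => i;
    rewrite tnth_mktuple; case: (unliftP ord0 i) => [j ->|->];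
    rewrite ?tnth0 ?tnthS ?tnth_mktuple ?tnth_behead /thead //; congr (_ + tnth a _ : R);
    by apply/val_inj; rewrite /= inordK// ltnS.
move=> X Y mX mY; rewrite /= /push_measure.
rewrite (_ : S @^-1` _ = ((fun x => x + thead a) @^-1` X) `*` (shift_tuple a' @^-1` Y))//.
rewrite product_measure1E.
- by rewrite ih//; congr (_ * _)%E; exact: lebesgue_measure_shift.
- rewrite -[X in measurable X]setTI.
  have mf : measurable_fun [set: measurableTypeR R]
    (fun x : measurableTypeR R => x + thead a : measurableTypeR R).
    by apply: measurable_funD => //; exact: measurable_cst.
  exact: mf.
- by rewrite -[X in measurable X]setTI; exact: measurable_shift_tuple.
Qed.

Context {n : nat}.
Local Notation T := (lebesgue_rV R n).

Definition translate (a x : 'rV[R]_n) : 'rV[R]_n := x + a.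

Lemma continuous_translate (a : 'rV[R]_n) : continuous (translate a).
Proof. by move=> x; apply: (cvgD (@cvg_id _ (nbhs x)) (cvg_cst a)). Qed.

Lemma leb_open_translate (a : 'rV[R]_n) (U : set 'rV[R]_n) : open U ->
  leb (translate a @^-1` U : set T) = leb (U : set T).
Proof.
move=> oU.
have oU' : open (translate a @^-1` U).
  by apply: open_comp => // x _; exact: continuous_translate.
rewrite (leb_tuple (open_tuple_measurable oU)).
rewrite (leb_tuple (open_tuple_measurable oU')).
rewrite -[RHS](tuple_lebesgue_shift (tuple_of_row a)); last exact: open_tuple_measurable.
congr (_ _); apply/seteqP; split => t; rewrite /preimage /=; congr (U _);
  by apply/rowP => i; rewrite !mxE !tnth_mktuple.
Qed.

Lemma translate_volume (a : 'rV[R]_n) (U : set 'rV[R]_n) : open U ->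
  (\int[leb]_(x in (translate a @^-1` U : set T)) (1%R)%:E = leb (U : set T))%E.
Proof.
move=> oU; rewrite integral_cst ?mul1e.
  exact: leb_open_translate.
apply: leb_open_measurable; apply: open_comp => // x _; exact: continuous_translate.
Qed.

End translation.

(** * Integrals and change of variables *)

Section rint.
Context {R : realType} {n : nat}.
Local Notation T := (lebesgue_rV R n).
Implicit Types (f g h : 'rV[R]_n -> R) (D : set 'rV[R]_n).

(** A real number for every function, meaningful only together with [rintegrable]. Integrals over a
    set are written with its indicator, so that changes of variables act on the whole space. *)
Definition rint f : R := Rintegral (@leb R n) setT f.

Definition rintegrable f : Prop :=
  (@leb R n).-integrable [set: T] (EFin \o f).

Lemma rintegrable_measurable f : rintegrable f -> measurable_fun [set: T] f.
Proof. by move=> /measurable_int /measurable_EFinP. Qed.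

Lemma rint_fin f : rintegrable f -> (\int[leb]_(x in [set: T]) (f x)%:E)%E = (rint f)%:E.
Proof.
move=> fi; rewrite /rint /Rintegral fineK//.
exact: (integrable_fin_num measurableT fi).
Qed.

Lemma rintegrableD f g : rintegrable f -> rintegrable g -> rintegrable (f \+ g).
Proof.
move=> fi gi; rewrite /rintegrable.
rewrite (_ : EFin \o (f \+ g) = ((EFin \o f) \+ (EFin \o g))%E); last exact/funext.
exact: (integrableD measurableT fi gi).
Qed.

Lemma rintegrableZ (c : R) f : rintegrable f -> rintegrable (fun x => c * f x).
Proof.
move=> fi; rewrite /rintegrable.
rewrite (_ : EFin \o _ = (fun x => c%:E * (EFin \o f) x)%E); last exact/funext.
exact: (integrableZl measurableT _ fi).
Qed.

Lemma rintegrableN f : rintegrable f -> rintegrable (\- f).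
Proof.
move=> fi; rewrite (_ : \- f = (fun x => -1 * f x)); first exact: rintegrableZ.
by apply/funext => x /=; rewrite mulN1r.
Qed.

Lemma rintegrableB f g : rintegrable f -> rintegrable g -> rintegrable (f \- g).
Proof. by move=> fi gi; apply: rintegrableD => //; exact: rintegrableN. Qed.

Lemma rintegrable0 : rintegrable (cst 0).
Proof.
rewrite /rintegrable (_ : EFin \o _ = cst 0%E); last exact/funext.
exact: integrable0.
Qed.

Lemma rintegrable_abs f : rintegrable f -> rintegrable (fun x => `|f x|).
Proof.
move=> fi; rewrite /rintegrable.
rewrite (_ : EFin \o _ = abse \o (EFin \o f)); last exact/funext.
exact: integrable_abse.
Qed.

Lemma le_rintegrable f g : measurable_fun [set: T] f ->
  (forall x, `|f x| <= g x) -> rintegrable g -> rintegrable f.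
Proof.
move=> mf fg gi; apply: (le_integrable measurableT _ _ gi).
  exact/measurable_EFinP.
by move=> x _; rewrite /= lee_fin (le_trans (fg x))// ler_norm.
Qed.

Lemma rintegrableM f h (M : R) : rintegrable f -> measurable_fun [set: T] h ->
  (forall x, `|h x| <= M) -> rintegrable (f \* h).
Proof.
move=> fi mh hM.
apply: (@le_rintegrable _ (fun x => M * `|f x|)).
- apply: measurable_funM mh; exact: rintegrable_measurable.
- by move=> x; rewrite normrM mulrC ler_wpM2r.
- exact/rintegrableZ/rintegrable_abs.
Qed.

Lemma rint0 : rint (cst 0) = 0.
Proof. by rewrite /rint Rintegral_cst//= mul0r. Qed.

Lemma rintD f g : rintegrable f -> rintegrable g ->
  rint (fun x => f x + g x) = rint f + rint g.
Proof. by move=> fi gi; rewrite /rint RintegralD. Qed.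

Lemma rintZ (c : R) f : rintegrable f -> rint (fun x => c * f x) = c * rint f.
Proof. by move=> fi; rewrite /rint RintegralZl. Qed.

Lemma rintN f : rintegrable f -> rint (fun x => - f x) = - rint f.
Proof.
move=> fi; rewrite -[RHS]mulN1r -rintZ//.
by congr rint; apply/funext => x; rewrite mulN1r.
Qed.

Lemma rintB f g : rintegrable f -> rintegrable g ->
  rint (fun x => f x - g x) = rint f - rint g.
Proof. by move=> fi gi; rewrite rintD//; [rewrite rintN|exact: rintegrableN]. Qed.

Lemma le_rint f g : rintegrable f -> rintegrable g ->
  (forall x, f x <= g x) -> rint f <= rint g.
Proof. by move=> fi gi fg; apply: le_Rintegral. Qed.

Lemma rint_ge0 f : (forall x, 0 <= f x) -> 0 <= rint f.
Proof. by move=> f0; apply: Rintegral_ge0. Qed.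

Lemma rint_norm_le f : rintegrable f -> `|rint f| <= rint (fun x => `|f x|).
Proof. by move=> fi; apply: le_normr_Rintegral. Qed.

Lemma rintegrable_sum (I : Type) (r : seq I) (F : I -> 'rV[R]_n -> R) :
  (forall a, rintegrable (F a)) -> rintegrable (fun x => \sum_(a <- r) F a x).
Proof.
move=> Fi; elim: r => [|a r ih].
  by under eq_fun do rewrite big_nil; exact: rintegrable0.
by under eq_fun do rewrite big_cons; exact: rintegrableD.
Qed.

Lemma rint_sum (I : Type) (r : seq I) (F : I -> 'rV[R]_n -> R) :
  (forall a, rintegrable (F a)) ->
  rint (fun x => \sum_(a <- r) F a x) = \sum_(a <- r) rint (F a).
Proof.
move=> Fi; elim: r => [|a r ih].
  by under eq_fun do rewrite big_nil; rewrite big_nil rint0.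
under eq_fun do rewrite big_cons; rewrite big_cons -ih rintD//.
exact: rintegrable_sum.
Qed.

Lemma patch_indic (D : set 'rV[R]_n) f : f \_ D = (fun x => \1_D x * f x).
Proof.
apply/funext => x; rewrite patchE indicE.
by case: ifP => _; rewrite ?mul1r ?mul0r.
Qed.

Lemma rint_setE (D : set T) f :
  (\int[leb]_(x in D) f x)%R = rint (fun x => \1_D x * f x).
Proof. by rewrite Rintegral_mkcond patch_indic. Qed.

Lemma integrable_setE (D : set T) f : measurable D ->
  leb.-integrable D (EFin \o f) <-> rintegrable (fun x => \1_D x * f x).
Proof.
move=> mD; rewrite integrable_mkcond// /rintegrable.
rewrite (_ : (EFin \o f) \_ D = EFin \o (fun x => \1_D x * f x))//.
by rewrite -patch_indic; apply/funext => x; rewrite /= !patchE; case: ifP.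
Qed.

Lemma rintegrable_indic (D : set T) : measurable D -> (leb D < +oo)%E ->
  rintegrable (\1_D).
Proof.
move=> mD Dfin; apply/integrableP; split.
  exact/measurable_EFinP/measurable_indic.
under eq_integral => x _ do rewrite gee0_abs ?lee_fin//.
by rewrite integral_indic// setIT.
Qed.

Lemma rint_indic (D : set T) : measurable D -> rint (\1_D) = fine (leb D).
Proof. by move=> mD; rewrite /rint /Rintegral integral_indic// setIT. Qed.

Lemma rintegrable_bounded f (K : set T) (M : R) : measurable_fun [set: T] f ->
  measurable K -> (leb K < +oo)%E -> (forall x, `|f x| <= M) ->
  (forall x, ~ K x -> f x = 0) -> rintegrable f.
Proof.
move=> mf mK Kfin fM fK.
apply: (@le_rintegrable _ (fun x => M * \1_K x)) => //.
  move=> x; rewrite indicE; have [Kx|nKx] := pselect (K x).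
    by rewrite mem_set// mulr1.
  by rewrite memNset// mulr0 fK// normr0.
exact/rintegrableZ/rintegrable_indic.
Qed.

Lemma rintegrable_continuous f (K : set 'rV[R]_n) : continuous f -> compact K ->
  (forall x, ~ K x -> f x = 0) -> rintegrable f.
Proof.
move=> cf cK fK; have [M _ fM] := continuous_compact_bounded cf cK fK.
apply: (@rintegrable_bounded _ K M _ _ _ fM fK).
- exact: (leb_measurable_continuous measurableT cf).
- exact: (leb_closed_measurable (compact_closed_rV cK)).
- exact: leb_compact_fin.
Qed.

Lemma C1c_rintegrable U f : C1c U f -> rintegrable f.
Proof.
move=> [f1 cf _]; apply: (rintegrable_continuous _ cf); first exact: C1_continuous.
by move=> x; exact: supp_out.
Qed.

Lemma partial_rintegrable U i f : C1c U f -> rintegrable (partial i f).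
Proof.
move=> [f1 cf _]; apply: (rintegrable_continuous _ cf); first exact: f1.2.
by move=> x; exact: partial_out.
Qed.

Lemma rint_dominated (f_ : nat -> 'rV[R]_n -> R) f g :
  (forall k, measurable_fun [set: T] (f_ k)) ->
  (forall x, f_ k x @[k --> \oo] --> f x) ->
  (forall k x, `|f_ k x| <= g x) -> rintegrable g ->
  rintegrable f /\ rint (f_ k) @[k --> \oo] --> rint f.
Proof.
move=> mf ff fg gi.
have mlim : measurable_fun [set: T] f by apply: (measurable_fun_cvg mf) => x _; exact: ff.
have mf' k : measurable_fun [set: T] (EFin \o f_ k) by exact/measurable_EFinP.
have ml' : measurable_fun [set: T] (EFin \o f) by exact/measurable_EFinP.
have ff' : {ae @leb R n, forall x, setT x -> (EFin \o f_ k) x @[k --> \oo] --> (EFin \o f) x}.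
  by apply: aeW => x _; apply: cvg_EFin; [exact: nearW|exact: ff].
have fg' : {ae @leb R n, forall x (k : nat), setT x -> (`|(EFin \o f_ k) x| <= (EFin \o g) x)%E}.
  by apply: aeW => x k _; rewrite /= lee_fin.
have [fi _ h] := dominated_convergence measurableT mf' ml' ff' gi fg'.
split => //.
have -> : rint f = fine (\int[leb]_(x in [set: T]) (EFin \o f) x)%E by [].
apply: fine_cvg; rewrite fineK; last exact: (integrable_fin_num measurableT fi).
exact: h.
Qed.

(** Domination is required only for [t] within 1 of [a]: translates and shears with unbounded
    parameter have no common integrable bound. *)
Lemma rint_derive (f df : R -> 'rV[R]_n -> R) (g : 'rV[R]_n -> R) (a : R) :
  (forall t, rintegrable (f t)) ->
  (forall (t : R) x, is_derive t 1 (f ^~ x) (df t x)) ->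
  rintegrable g ->
  (forall t x, `|t - a| < 1 -> `|df t x| <= g x) ->
  is_derive a 1 (fun t => rint (f t)) (rint (df a)).
Proof.
move=> fi fd gi dfg.
have dfE t x : partial1of2 f t x = df t x.
  by rewrite partial1of2E; have h := fd t x; rewrite derive_val.
have Ia : `]a - 1, a + 1[%classic a by rewrite /= in_itv/= ltrBlDr ltrDl ltr01.
have h := @cvg_differentiation_under_integral R _ T leb f setT measurableT a
  (a - 1) (a + 1) Ia (fun t _ => fi t) (fun t x _ _ => @ex_derive _ _ _ _ _ _ _ (fd t x))
  (fun x => `|g x|) (fun x => normr_ge0 _) (rintegrable_abs gi).
have {}h : h^-1 *: (rint (f (h + a)) - rint (f a)) @[h --> 0^'] --> rint (df a).
  have -> : rint (df a) = \int[leb]_(y in [set: T]) partial1of2 f a y.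
    by congr Rintegral; apply/funext => x; rewrite dfE.
  apply: h => t x; rewrite /= in_itv/= => /andP[t1 t2] _.
  rewrite dfE (le_trans (dfg t x _)) ?ler_norm// ltr_norml.
  by rewrite ltrBlDl t2 ltrBrDl t1.
have h' : h^-1 *: (rint (f (h *: 1 + a)) - rint (f a)) @[h --> 0^'] --> rint (df a).
  by under eq_fun do rewrite [_ *: 1]mulr1.
apply: DeriveDef; first by apply/cvg_ex; exists (rint (df a)).
exact/cvg_lim.
Qed.

End rint.

(** * Integration by parts and the Jacobian of a shear *)

Section change_of_variables.
Context {R : realType} {n : nat}.
Local Notation T := (lebesgue_rV R n).
Implicit Types (f g psi : 'rV[R]_n -> R) (D U : set 'rV[R]_n) (i j k : 'I_n).

Lemma rint_jacobian (Phi : 'rV[R]_n -> 'rV[R]_n) (J : 'rV[R]_n -> R) f :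
  continuous Phi -> continuous J -> (forall x, 0 < J x) ->
  (forall U, open U -> bounded_set U ->
    (\int[leb]_(x in (Phi @^-1` U : set T)) (J x)%:E = leb (U : set T))%E) ->
  rintegrable f ->
  rintegrable (fun x => f (Phi x) * J x) /\ rint (fun x => f (Phi x) * J x) = rint f.
Proof.
move=> cPhi cJ J0 vol fi; have mf := rintegrable_measurable fi.
have mPhi := jacobian_measurable_fun cPhi cJ J0 vol.
have mg : measurable_fun [set: T] (fun x => f (Phi x) * J x).
  apply: measurable_funM.
    exact: (measurableT_comp mf mPhi).
  exact: (leb_measurable_continuous measurableT cJ).
have E h : measurable_fun [set: T] h -> (forall x, 0 <= h x)%E ->
    (\int[leb]_x (h (Phi x : T) * (J x)%:E) = \int[leb]_x h x)%E.
  exact: (ge0_jacobian cPhi cJ J0 vol).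
have gi : rintegrable (fun x => f (Phi x) * J x).
  apply/integrableP; split; first exact/measurable_EFinP.
  have /integrableP[_] := fi; apply: le_lt_trans.
  rewrite -(E (abse \o (EFin \o f))).
  - rewrite [leLHS](_ : _ = \int[leb]_(x in [set: T])
        ((abse \o (EFin \o f)) (Phi x) * (J x)%:E))%E; first exact: lexx.
    by apply: eq_integral => x _; rewrite /= normrM (gtr0_norm (J0 x)).
  - exact/measurable_EFinP/(rintegrable_measurable (rintegrable_abs fi)).
  - by move=> x; exact: abse_ge0.
split => //; rewrite /rint /Rintegral; congr fine.
rewrite integralE [RHS]integralE; congr (_ - _)%E.
  rewrite -(E ((EFin \o f)^\+)%E).
  - apply: eq_integral => x _; rewrite !funeposE /= -!EFin_max -EFinM.
    by rewrite maxr_pMl ?mul0r// ltW.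
  - exact/measurable_funepos/measurable_EFinP.
  - exact: funepos_ge0.
rewrite -(E ((EFin \o f)^\-)%E).
- apply: eq_integral => x _; rewrite !funenegE /= -?EFinN -!EFin_max -EFinM.
  by rewrite maxr_pMl ?mul0r ?mulNr// ltW.
- exact/measurable_funeneg/measurable_EFinP.
- exact: funeneg_ge0.
Qed.

Lemma rint_translate (a : 'rV[R]_n) f : rintegrable f ->
  rintegrable (fun x => f (x + a)) /\ rint (fun x => f (x + a)) = rint f.
Proof.
move=> fi.
have := @rint_jacobian (translate a) (cst 1) f (@continuous_translate _ _ a)
  (@cst_continuous _ _ (1 : R)) (fun _ => ltr01) (fun U oU _ => @translate_volume _ _ a U oU) fi.
rewrite (_ : (fun x => _ * _) = (fun x => f (x + a))) //.
by apply/funext => x /=; rewrite mulr1.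
Qed.

Lemma C1c_C1 U f : C1c U f -> C1 f.
Proof. by case. Qed.

(** By translation invariance the integral of f(x + t e_i) is constant in t, and its derivative at 0
    is the integral of the partial derivative. *)
Lemma rint_partial0 i f : C1c setT f -> rint (partial i f) = 0.
Proof.
move=> fc; have [f1 cf _] := fc; have fi := C1c_rintegrable fc.
have [M M0 fM] := C1c_bounded fc.
pose e : 'rV[R]_n := delta_mx 0 i.
pose K : set 'rV[R]_n := [set x | exists2 s, `|s| <= 1 & supp f (x + s *: e)].
have [N [_ hN]] := compact_bounded cf.
(* For |t| <= 1 the translates of the support stay in this ball, whose indicator provides the
   dominating function. *)
pose B : set 'rV[R]_n := nball (`|N| + 1 + `|e|).
have KB : K `<=` B.
  move=> x [s s1 fx]; rewrite /B/nball/= -(addrK (s *: e) x).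
  rewrite (le_trans (ler_normB _ _))// lerD//.
    by apply: hN => //; rewrite (le_lt_trans (ler_norm _))// ltrDl.
  by rewrite normrZ ler_piMl.
have gi : rintegrable (fun x => M * \1_B x).
  apply/rintegrableZ/rintegrable_indic; last exact: leb_ball_fin.
  exact/leb_closed_measurable/closed_nball.
have h : is_derive (0 : R) 1 (fun t : R => rint (fun x => f (x + t *: e)))
    (rint (fun x => partial i f (x + 0 *: e))).
  apply: (rint_derive (f := fun t x => f (x + t *: e))
    (df := fun t x => partial i f (x + t *: e)) _ _ gi).
  - by move=> t; exact: (rint_translate (t *: e) fi).1.
  - move=> t x; have := is_derive_line (f1.1 (x + t *: e)).
    rewrite (bigD1 i)//= big1 ?addr0 ?mxE ?eqxx ?mul1r// => j ji.
    by rewrite mxE eqxx (negbTE ji) mul0r.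
  - move=> t x; rewrite subr0 => /ltW t1; rewrite indicE.
    have [Bx|nBx] := pselect (B x); first by rewrite mem_set// mulr1; exact: (fM _).2.
    rewrite memNset// mulr0 partial_out ?normr0// => sx; apply: nBx; apply: KB.
    by exists t.
have h0 : (fun t => rint (fun x => f (x + t *: e))) = cst (rint f).
  by apply/funext => t; rewrite (rint_translate (t *: e) fi).2.
rewrite h0 in h.
have : rint (fun x => partial i f (x + 0 *: e)) = 0.
  by rewrite -(@derive_val _ _ _ _ _ _ _ h) derive_cst.
by under eq_fun do rewrite scale0r addr0.
Qed.

Definition jacobian_shear k psi x : R := 1 + partial k psi x.

Lemma continuous_jacobian_shear k psi : C1 psi -> continuous (jacobian_shear k psi).
Proof. by move=> p1 x; apply: (cvgD (cvg_cst _) (p1.2 k x)). Qed.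
Arguments continuous_jacobian_shear k {psi}.

(** A homotopy from the identity: with [t * psi] in place of [psi], the t-derivative of the
    integrand is the partial derivative in direction k of the product of [psi] with the composed
    function, which has integral zero. So the integral is the same at t = 0 and at t = 1. *)
Lemma rint_shear_C1c k psi f : C1c setT psi -> C1 (partial k psi) -> C1c setT f ->
  rint (fun x => f (shear k psi x) * jacobian_shear k psi x) = rint f.
Proof.
move=> pc p2 fc; have [p1 cp _] := pc; have [f1 cf _] := fc.
have [Mp Mp0 pM] := C1c_bounded pc; have [Mf Mf0 fM] := C1c_bounded fc.
pose psit (t : R) := fun x => t * psi x.
have ptc t : C1c setT (psit t) by exact: C1cZ.
have dpt t i x : partial i (psit t) x = t * partial i psi x.
  rewrite (@partialM _ _ i (cst t) psi); [|exact: (C1_cst t).1|exact: p1.1].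
  by rewrite partial_cst mulr0 addr0.
pose F (t : R) x := f (shear k (psit t) x) * jacobian_shear k (psit t) x.
pose dF (t : R) x := psi x * partial k f (shear k (psit t) x) * jacobian_shear k (psit t) x
  + f (shear k (psit t) x) * partial k psi x.
have Fi t : rintegrable (F t).
  have fs := C1c_shear k (ptc t) fc.
  apply: (rintegrable_continuous (K := supp (f \o shear k (psit t)))).
  - have [fs1 _ _] := fs; have [pt1 _ _] := ptc t.
    exact: (continuous_mul (C1_continuous fs1) (continuous_jacobian_shear k pt1)).
  - by case: fs.
  - by move=> x /supp_out fx; rewrite /F [X in X * _]fx mul0r.
have dFE t : dF t = partial k ((f \o shear k (psit t)) \* psi).
  apply/funext => x; rewrite partialM; last exact: p1.1; last first.
    exact: (C1_shear k (C1c_C1 (ptc t)) f1).1.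
  rewrite partial_shear; [|exact: (C1c_C1 (ptc t)).1|exact: f1.1].
  by rewrite /dF /jacobian_shear /=; ring.
have dF0 t : rint (dF t) = 0.
  rewrite dFE; apply: rint_partial0.
  exact: (C1cMr (C1_shear k (C1c_C1 (ptc t)) f1) pc).
have dFd (t : R) x : is_derive t 1 (F ^~ x) (dF t x).
  have h1 : is_derive t 1 (fun t => f (x + t *: (psi x *: delta_mx 0 k)))
     (psi x * partial k f (shear k (psit t) x)).
    have h0 := @is_derive_line _ _ f x (psi x *: delta_mx 0 k) t (f1.1 _).
    apply: (is_derive_eq h0); rewrite (bigD1 k)//= big1 ?addr0.
      by rewrite !mxE !eqxx mulr1 scalerA.
    by move=> j jk; rewrite !mxE eqxx (negbTE jk) mulr0 mul0r.
  have h2 : is_derive t 1 (fun t => 1 + t * partial k psi x) (partial k psi x).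
    apply: is_derive_eq; rewrite add0r /GRing.scale/= mulr0 add0r mulr1.
    by rewrite ?mul1r.
  have -> : F ^~ x = (fun t => f (x + t *: (psi x *: delta_mx 0 k))) \*
      (fun t => 1 + t * partial k psi x).
    by apply/funext => s; rewrite /F /shear /jacobian_shear dpt /psit /= scalerA.
  have h3 := @is_deriveM _ _ _ _ _ _ _ _ h1 h2.
  have e : shear k (psit t) x = x + t *: (psi x *: delta_mx 0 k).
    by rewrite /shear /psit scalerA.
  apply: (is_derive_eq h3); rewrite /dF /jacobian_shear dpt e.
  rewrite addrC; congr (_ + _); exact: mulrC.
have Fder (a : R) : is_derive a 1 (fun t => rint (F t)) 0.
  rewrite -(dF0 a).
  (* Bounds [dF t] for |t - a| < 1 on the support of [psi], outside of which [dF t] vanishes. *)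
  pose C := Mp * Mf * (1 + (`|a| + 1) * Mp) + Mf * Mp.
  apply: (rint_derive (g := fun x => C * \1_(supp psi) x) Fi dFd).
    apply/rintegrableZ/rintegrable_indic; last exact: leb_compact_fin.
    exact: (leb_closed_measurable (compact_closed_rV cp)).
  move=> t x ta; rewrite indicE; have [px|px] := pselect (supp psi x); last first.
    rewrite memNset// mulr0 /dF (supp_out px) (partial_out _ px).
    by rewrite !mul0r mulr0 addr0 normr0.
  rewrite mem_set// mulr1 /dF (le_trans (ler_normD _ _))// !normrM lerD//.
    apply: ler_pM => //.
      apply: ler_pM => //; [exact: (pM x).1|exact: (fM _).2].
    rewrite /jacobian_shear dpt (le_trans (ler_normD _ _))// normr1 lerD2l normrM.
    apply: ler_pM => //; last exact: (pM x).2.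
    rewrite -[t](subrK a) addrC (le_trans (ler_normD _ _))// lerD2l; exact: ltW.
  by apply: ler_pM => //; [exact: (fM _).1|exact: (pM _).2].
have := is_derive_0_is_cst 1 0 Fder.
have -> : rint (F 0) = rint f.
  congr rint; apply/funext => x; rewrite /F /jacobian_shear dpt /shear /psit.
  by rewrite !mul0r scale0r !addr0 mulr1.
move=> <-; congr rint; apply/funext => x; rewrite /F.
by have -> : psit 1 = psi by apply/funext => y; rewrite /psit mul1r.
Qed.

(** The cutoffs of [U] converge pointwise to its indicator; dominated convergence on both sides
    carries the formula for compactly supported C^1 functions over to [U]. *)
Lemma shear_volume k psi U : C1c setT psi -> C1 (partial k psi) ->
  (forall x, 0 < jacobian_shear k psi x) -> open U -> bounded_set U ->
  (\int[leb]_(x in (shear k psi @^-1` U : set T)) (jacobian_shear k psi x)%:E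
   = leb (U : set T))%E.
Proof.
move=> pc p2 J0 oU bU; have [p1 cp _] := pc.
have cs : continuous (shear k psi) by apply: continuous_shear; exact: C1_continuous.
have cJ := continuous_jacobian_shear k p1.
have oPU : open (shear k psi @^-1` U) by apply: open_comp => // x _; exact: cs.
have mU := leb_open_measurable oU; have mPU := leb_open_measurable oPU.
have [theta [tc t01 t1]] := open_cutoff oU.
have tcvg x : theta a x @[a --> \oo] --> (\1_U x : R).
  rewrite indicE; have [Ux|Ux] := pselect (U x).
    rewrite mem_set//; have [N hN] := t1 _ Ux.
    by apply: cvg_near_cst; exists N => // m /= /hN.
  rewrite memNset//; apply: cvg_near_cst; apply: nearW => m.
  exact: C1c_out (tc m) Ux.
have le1 a x : `|theta a x| <= \1_U x.
  rewrite indicE; have [Ux|Ux] := pselect (U x).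
    by rewrite mem_set//; have /andP[? ?] := t01 a x; rewrite ger0_norm.
  by rewrite memNset// (C1c_out (tc a) Ux) normr0.
have Ui : rintegrable (\1_U) by apply: rintegrable_indic => //; exact: leb_bounded_fin.
have mt a : measurable_fun [set: T] (theta a).
  exact: (leb_measurable_continuous measurableT (C1_continuous (C1c_C1 (tc a)))).
have [_ h1] := rint_dominated mt tcvg le1 Ui.
pose V := shear k psi @^-1` U.
have bV : bounded_set (U `|` supp psi).
  have := compact_bounded cp; move: bU => [M1 [? h1']] [M2 [? h2']].
  exists (Num.max M1 M2); split; first exact: num_real.
  move=> M; rewrite gt_max => /andP[? ?] x [Ux|px]; [exact: (h1' M)|exact: (h2' M)].
have VB : V `<=` U `|` supp psi.
  move=> x Vx; have [px|px] := pselect (supp psi x); first by right.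
  by left; move: Vx; rewrite /V /preimage /= /shear supp_out// scale0r addr0.
have [Mp Mp0 pM] := C1c_bounded pc.
have JM x : `|jacobian_shear k psi x| <= 1 + Mp.
  by rewrite (le_trans (ler_normD _ _))// normr1 lerD2l (pM x).2.
have Vi : rintegrable (fun x => \1_V x * jacobian_shear k psi x).
  apply: (rintegrableM (M := 1 + Mp) _ _ JM).
    apply: (rintegrable_indic mPU).
    by apply: leb_bounded_fin; exact: bounded_setS bV.
  exact: (leb_measurable_continuous measurableT cJ).
have mtJ a : measurable_fun [set: T]
    (fun x => theta a (shear k psi x) * jacobian_shear k psi x).
  apply: (leb_measurable_continuous measurableT) => x; apply: (cvgM _ (cJ x)).
  apply: continuous_comp; [exact: cs|exact: (C1_continuous (C1c_C1 (tc a)))].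
have tcvgJ x : theta a (shear k psi x) * jacobian_shear k psi x @[a --> \oo] -->
    \1_V x * jacobian_shear k psi x.
  exact: (cvgM (tcvg (shear k psi x)) (cvg_cst _)).
have leJ a x : `|theta a (shear k psi x) * jacobian_shear k psi x| <=
    \1_V x * jacobian_shear k psi x.
  by rewrite normrM (gtr0_norm (J0 x)) ler_wpM2r ?(ltW (J0 x))//; exact: le1.
have [_ h2] := rint_dominated mtJ tcvgJ leJ Vi.
have E : rint (fun x => \1_V x * jacobian_shear k psi x) = rint (\1_U).
  have e : (fun a => rint (fun x => theta a (shear k psi x) * jacobian_shear k psi x)) =
      (fun a => rint (theta a)).
    by apply/funext => a; rewrite rint_shear_C1c//; exact: C1cW (tc a).
  rewrite e in h2; exact: (cvg_unique (@Rhausdorff R) h2 h1).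
have Jfin : leb.-integrable (V : set T) (EFin \o jacobian_shear k psi).
  exact/integrable_setE.
rewrite -[LHS]fineK; last exact: (integrable_fin_num mPU Jfin).
rewrite -[LHS]/((Rintegral leb (V : set T) (jacobian_shear k psi))%:E).
rewrite rint_setE E rint_indic// fineK// ge0_fin_numE ?measure_ge0//.
exact: leb_bounded_fin.
Qed.

End change_of_variables.

(** * Mollification *)

Section compact_neighbourhood.
Context {R : realType} {n : nat}.
Implicit Types (K U : set 'rV[R]_n).

Lemma compact_thickening K U : compact K -> open U -> K `<=` U ->
  exists2 e : R, 0 < e & forall x y, K y -> `|x - y| <= e -> U x.
Proof.
move=> cK oU KU.
have /compact_near_coveringP := cK.
move=> /(_ R (0 : R)^'+ (fun e y => forall x, `|x - y| <= e -> U x) _).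
have H : forall y, K y -> \forall y' \near y & e \near (0 : R)^'+,
    forall x, `|x - y'| <= e -> U x.
  move=> y Ky; have /nbhs_ballP[d /= d0 ydU] := open_nbhs_nbhs (conj oU (KU _ Ky)).
  have d2 : 0 < d / 2 by rewrite divr_gt0.
  exists (ball y (d / 2), [set e | e < d / 2]) => /=.
    by split; [exact: nbhsx_ballx|exact: nbhs_right_lt].
  move=> [y' e] [/= By' ed] x xy'; apply: ydU.
  move: By'; rewrite mx_norm_ball /ball_ /= => By'.
  rewrite -(subrK y' y) -addrA (le_lt_trans (ler_normD _ _))//.
  by rewrite [ltRHS]splitr ltrD// distrC (le_lt_trans xy').
move=> /(_ H) h.
have {}h : \forall e \near (0 : R)^'+, forall y x, K y -> `|x - y| <= e -> U x.
  by apply: filterS h => e he y x Ky; exact: he.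
near (0 : R)^'+ => e; exists e; first by near: e; exact: nbhs_right_gt.
by move=> x y; move: y x; near: e.
Unshelve. all: by end_near. Qed.

Lemma thickening_compact K (e : R) : compact K ->
  compact [set x | exists2 y, K y & `|x - y| <= e].
Proof.
move=> cK.
rewrite (_ : [set x | _] = (fun z : 'rV[R]_n * 'rV[R]_n => z.1 + z.2) @`
    (K `*` closed_ball_ Num.norm 0 e)).
  apply: continuous_compact; last first.
    by apply: compact_setX => //; exact: compact_closed_ball_rV.
  apply: continuous_subspaceT => z.
  by apply: (cvgD cvg_fst cvg_snd).
apply/seteqP; split => [x [y Ky xy]|_ [[y z] [/= Ky yz] <-]].
  by exists (y, x - y) => /=; [split => //; rewrite /closed_ball_/= sub0r normrN|rewrite subrKC].
by exists y => //; move: yz; rewrite /closed_ball_/= sub0r normrN addrAC subrr add0r.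
Qed.

End compact_neighbourhood.

Lemma lipschitz_continuous (R : realType) (V W : normedModType R) (f : V -> W) (C : R) :
  (forall x y, `|f x - f y| <= C * `|x - y|) -> continuous f.
Proof.
move=> fC x; apply/cvgrPdist_le => e e0; near=> y.
rewrite (le_trans (fC x y))//.
apply: (@le_trans _ _ ((`|C| + 1) * `|x - y|)).
  by rewrite ler_wpM2r// (le_trans (ler_norm _))// lerDl.
rewrite mulrC -ler_pdivlMr ?ltr_wpDl//; near: y.
by apply: cvgr_dist_le => //; rewrite divr_gt0// ltr_wpDl.
Unshelve. all: by end_near. Qed.

Lemma differentiable_remainder (R : realType) (V W : normedModType R) (f : V -> W)
    (L : {linear V -> W}) (x : V) (C : R) : continuous L ->
  (forall h, `|f (x + h) - f x - L h| <= C * `|h| ^+ 2) ->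
  differentiable f x /\ 'd f x = L :> (V -> W).
Proof.
move=> cL fL.
have FL : f \o shift x = cst (f x) + L +o_ 0 id.
  apply/eqaddoP => e e0; near=> h => /=.
  rewrite !fctE /= opprD addrA (addrC h) (le_trans (fL h))// expr2 mulrA ler_wpM2r//.
  apply: (@le_trans _ _ ((`|C| + 1) * `|h|)).
    by rewrite ler_wpM2r// (le_trans (ler_norm _))// lerDl.
  rewrite mulrC -ler_pdivlMr ?ltr_wpDl//.
  by near: h; apply: nbhs0_le; rewrite divr_gt0// ltr_wpDl.
have dE : 'd f x = L :> (V -> W) by apply: diff_unique.
by split => //; apply/diff_locallyP; rewrite dE; split.
Unshelve. all: by end_near. Qed.

(** * Convolution with a compactly supported kernel *)

Section convolution.
Context {R : realType} {n : nat}.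
Local Notation T := (lebesgue_rV R n).
Implicit Types (f g k : 'rV[R]_n -> R) (i j : 'I_n) (x y h : 'rV[R]_n).

Definition convol f k x : R := rint (fun y => f y * k (x - y)).

Lemma continuous_reflect x : continuous (fun y : 'rV[R]_n => x - y).
Proof. by move=> y; apply: (cvgB (cvg_cst x) (@cvg_id _ (nbhs y))). Qed.

Lemma measurable_reflect k x : continuous k ->
  measurable_fun [set: T] (fun y : 'rV[R]_n => k (x - y)).
Proof.
move=> ck; apply: (leb_measurable_continuous measurableT) => y.
by apply: continuous_comp; [exact: continuous_reflect|exact: ck].
Qed.

Lemma convol_rintegrable f k x (M : R) : rintegrable f -> continuous k ->
  (forall z, `|k z| <= M) -> rintegrable (fun y => f y * k (x - y)).
Proof.
move=> fi ck kM.
exact: (rintegrableM fi (measurable_reflect x ck) (fun y => kM (x - y))).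
Qed.

Lemma rint_weight_le f g (M : R) : rintegrable f -> measurable_fun [set: T] g ->
  (forall x, `|g x| <= M) ->
  `|rint (fun x => f x * g x)| <= M * rint (fun x => `|f x|).
Proof.
move=> fi mg gM; have fgi := rintegrableM fi mg gM.
rewrite (le_trans (rint_norm_le fgi))// -rintZ; last exact: rintegrable_abs.
apply: le_rint; [exact: rintegrable_abs|exact/rintegrableZ/rintegrable_abs|].
by move=> x; rewrite normrM mulrC ler_wpM2r.
Qed.

Lemma differentiable_quadratic (F : 'rV[R]_n -> R^o) (G : 'I_n -> R) (C : R) x :
  (forall h, `|F (x + h) - F x - \sum_i h 0 i * G i| <= C * `|h| ^+ 2) ->
  differentiable F x /\ forall i, partial i F x = G i.
Proof.
move=> FG.
pose L h : R^o := \sum_i h 0 i * G i.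
have linL : linear L.
  move=> a u v; rewrite /L scaler_sumr -big_split/=; apply: eq_bigr => i _.
  by rewrite !mxE mulrDl -mulrA.
pose L' : {linear 'rV[R]_n -> R^o} := HB.pack L (GRing.isLinear.Build _ _ _ _ L linL).
have cL : continuous (L' : 'rV[R]_n -> R^o).
  move=> z; rewrite /= /L.
  have h : differentiable (fun h : 'rV[R]_n => \sum_i h 0 i * G i) z.
    by apply: (C1_sum _ (fun i => C1M (C1_coord i) (C1_cst (G i)))).1.
  exact: differentiable_continuous h.
have [dfF dF] : differentiable F x /\ 'd F x = L' :> ('rV[R]_n -> R^o).
  by apply: (differentiable_remainder cL) => h; exact: FG.
split => // i; rewrite /partial deriveE// dF /= /L (bigD1 i)//= big1 ?addr0.
  by rewrite mxE !eqxx mul1r.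
by move=> j ji; rewrite mxE eqxx (negbTE ji) mul0r.
Qed.

Lemma C1_quadratic (F : 'rV[R]_n -> R) (G : 'I_n -> 'rV[R]_n -> R) (C : R) :
  (forall x h, `|F (x + h) - F x - \sum_i h 0 i * G i x| <= C * `|h| ^+ 2) ->
  (forall i, continuous (G i)) -> C1 F /\ forall i, partial i F = G i.
Proof.
move=> FG cG; have h x := differentiable_quadratic (FG x).
have e i : partial i F = G i by apply/funext => x; exact: (h x).2.
by split => //; split => [x|i]; [exact: (h x).1|rewrite e].
Qed.

Lemma convol_lipschitz f k (M : R) : rintegrable f -> C1c setT k ->
  (forall i x, `|partial i k x| <= M) -> forall x y,
  `|convol f k x - convol f k y| <= n%:R * M * `|x - y| * rint (fun z => `|f z|).
Proof.
move=> fi kc kM x y; have [Mk _ hk] := C1c_bounded kc.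
have ck := C1_continuous (C1c_C1 kc).
have ci z := convol_rintegrable z fi ck (fun z => (hk z).1).
rewrite /convol -rintB//.
under eq_fun do rewrite -mulrBr.
apply: (rint_weight_le fi).
  by apply: measurable_funB; exact: measurable_reflect.
move=> z; rewrite (le_trans (C1_lipschitz (C1c_C1 kc) kM _ _))//.
by rewrite opprB addrA subrK.
Qed.

Lemma convol_continuous f k : rintegrable f -> C1c setT k -> continuous (convol f k).
Proof.
move=> fi kc; have [M M0 hM] := C1c_bounded kc.
have h := convol_lipschitz fi kc (fun i x => (hM x).2 i).
apply: (@lipschitz_continuous _ _ _ _ (n%:R * M * rint (fun z => `|f z|))) => x y.
by rewrite mulrAC; exact: h.
Qed.

(** All the regularity comes from the kernel, whose Taylor remainder is uniformly quadratic;
    integrated against [f], it is at most a multiple of the L^1 norm of [f] times |h|^2. *)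
Lemma C1_convol f k : rintegrable f -> C1c setT k -> (forall i, C1 (partial i k)) ->
  C1 (convol f k) /\ forall i, partial i (convol f k) = convol f (partial i k).
Proof.
move=> fi kc k2; have [Mk _ hk] := C1c_bounded kc.
have [k1 csk _] := kc; have ck := C1_continuous k1.
have pc i : C1c setT (partial i k).
  by apply: (C1cP (k2 i) csk) => // x; exact: partial_out.
have ci z := convol_rintegrable z fi ck (fun z => (hk z).1).
have cpi i z := convol_rintegrable z fi (k1.2 i) (fun z => (hk z).2 i).
have [M M2] : exists M : R, forall i j x, `|partial j (partial i k) x| <= M.
  have h i : {M : R | forall j x, `|partial j (partial i k) x| <= M}.
    by apply: cid; have [M _ hM] := C1c_bounded (pc i); exists M => j x; exact: (hM x).2.
  exists (\sum_i `|sval (h i)|) => i j x; rewrite (le_trans (svalP (h i) j x))//.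
  by rewrite (le_trans (ler_norm _))// (bigD1 i)//= lerDl sumr_ge0.
apply: (C1_quadratic (C := n%:R * (n%:R * M) * rint (fun z => `|f z|))) => [x h|i].
  have -> : convol f k (x + h) - convol f k x - \sum_i h 0 i * convol f (partial i k) x =
      rint (fun y => f y * (k (x + h - y) - k (x - y) -
        \sum_i h 0 i * partial i k (x - y))).
    rewrite /convol.
    under [in RHS]eq_fun do rewrite mulrBr mulrBr mulr_sumr.
    rewrite rintB; [|exact: rintegrableB|]; last first.
      apply: rintegrable_sum => i; under eq_fun do rewrite mulrCA.
      exact: rintegrableZ.
    rewrite rintB// rint_sum; last first.
      by move=> i; under eq_fun do rewrite mulrCA; exact: rintegrableZ.
    congr (_ - _); apply: eq_bigr => i _; rewrite -rintZ//.
    by congr rint; apply/funext => y; rewrite mulrCA.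
  rewrite mulrAC; apply: (rint_weight_le fi).
    apply: measurable_funB.
      by apply: measurable_funB; exact: measurable_reflect.
    apply: measurable_sum => i; apply: measurable_funM; first exact: measurable_cst.
    apply: measurable_reflect; exact: k1.2.
  by move=> y; rewrite [x + h - y]addrAC; exact: C2_taylor.
exact: convol_continuous.
Qed.

End convolution.

Section fubini.
Context {R : realType} {n : nat}.
Local Notation T := (lebesgue_rV R n).

Lemma rint_fubini (H : 'rV[R]_n -> 'rV[R]_n -> R) :
  measurable_fun [set: T * T] (fun z : T * T => H z.1 z.2) ->
  (forall x, rintegrable (H x)) -> (forall y, rintegrable (H ^~ y)) ->
  rintegrable (fun y => rint (fun x => `|H x y|)) ->
  rintegrable (fun x => rint (H x)) /\
  rint (fun x => rint (H x)) = rint (fun y => rint (H ^~ y)).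
Proof.
move=> mH iH iH' iA.
have mH' : measurable_fun [set: T * T] (fun z : T * T => (H z.1 z.2)%:E).
  exact/measurable_EFinP.
have I : (@leb R n \x @leb R n)%E.-integrable [set: T * T]
    (fun z : T * T => (H z.1 z.2)%:E).
  apply/(integrable21ltyP _ _ mH') => /=.
  under eq_integral => y _ do rewrite (rint_fin (rintegrable_abs (iH' y))).
  by rewrite (rint_fin iA) ltry.
have h1 := integrable_fubini_F I; have h2 := Fubini I.
have e1 : fubini_F leb (fun z : T * T => (H z.1 z.2)%:E) =
    (fun x : T => (rint (H x))%:E).
  by apply/funext => x; rewrite /fubini_F/= (rint_fin (iH x)).
rewrite e1 in h1; split; first exact: h1.
have {}h2 : (\int[leb]_(x in [set: T]) (rint (H x))%:E =
             \int[leb]_(y in [set: T]) (rint (H ^~ y))%:E)%E.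
  under eq_integral => x _ do rewrite -(rint_fin (iH x)).
  under [RHS]eq_integral => y _ do rewrite -(rint_fin (iH' y)).
  exact: h2.
by rewrite /rint /Rintegral h2.
Qed.

End fubini.

Section mollifier.
Context {R : realType} {n : nat}.
Local Notation T := (lebesgue_rV R n).
Implicit Types (f g a k : 'rV[R]_n -> R) (i j : 'I_n) (x y : 'rV[R]_n) (r : R).

Lemma measurable_fst_sub k : continuous k ->
  measurable_fun [set: T * T] (fun z : T * T => k ((z.1 : 'rV[R]_n) - (z.2 : 'rV[R]_n))).
Proof.
move=> ck.
apply: (measurable_continuous_comp (G := fun z : T * T => (z.1 : 'rV[R]_n) - z.2)) => //.
move=> i; rewrite (_ : (fun _ => _) = (fun z : T * T => (z.1 : 'rV[R]_n) 0 i - (z.2 : 'rV[R]_n) 0 i)).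
  have mi : measurable_fun [set: T] (fun x : T => (x : 'rV[R]_n) 0 i).
    exact: leb_measurable_coord.
  by apply: measurable_funB; apply: measurableT_comp mi _;
    [exact: measurable_fst|exact: measurable_snd].
by apply/funext => z; rewrite !mxE.
Qed.

(** The kernel is general because kernels in x - y and in x + y are both needed. The bound [C] on
    its integrals in [x] makes the double integral absolutely convergent. *)
Lemma kernel_fubini (k : 'rV[R]_n -> 'rV[R]_n -> R) a g (M B C : R) :
  rintegrable g -> measurable_fun [set: T] a -> (forall x, `|a x| <= M) ->
  measurable_fun [set: T * T] (fun z : T * T => k z.1 z.2) ->
  (forall x, measurable_fun [set: T] (k x)) -> (forall x y, `|k x y| <= B) ->
  (forall y, rintegrable (k ^~ y)) -> (forall y, rint (fun x => `|k x y|) <= C) ->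
  rintegrable (fun x => a x * rint (fun y => g y * k x y)) /\
  rint (fun x => a x * rint (fun y => g y * k x y)) =
  rint (fun y => g y * rint (fun x => a x * k x y)).
Proof.
move=> ig ma aM mk mkx kB ik kC.
have M0 : 0 <= M by apply: le_trans (aM 0).
have iak y : rintegrable (fun x => a x * k x y).
  by under eq_fun do rewrite mulrC; exact: rintegrableM (ik y) ma aM.
have igk x : rintegrable (fun y => g y * k x y).
  exact: rintegrableM ig (mkx x) (kB x).
have mak : measurable_fun [set: T] (fun y => rint (fun x => `|a x * k x y|)).
  have mF : measurable_fun [set: T * T]
      (fun z : T * T => (`|a z.2 * k z.2 z.1|)%:E).
    apply/measurable_EFinP; apply: measurableT_comp => //.
    apply: measurable_funM.
      by apply: measurableT_comp ma _; exact: measurable_snd.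
    have := measurableT_comp mk (@measurable_swap _ _ T T).
    exact.
  have := @measurable_fun_fubini_tonelli_F _ _ _ _ _ (@leb R n) _ mF
    (fun z => normr_ge0 (a z.2 * k z.2 z.1)).
  rewrite (_ : fubini_F _ _ = (fun y : T => (rint (fun x => `|a x * k x y|))%:E)).
    by move/measurable_EFinP.
  by apply/funext => y; rewrite /fubini_F/= (rint_fin (rintegrable_abs (iak y))).
have [||||r1 r2] := @rint_fubini R n (fun x y => a x * (g y * k x y)).
- apply: measurable_funM; first by apply: measurableT_comp ma _; exact: measurable_fst.
  apply: measurable_funM; last exact: mk.
  by apply: measurableT_comp (rintegrable_measurable ig) _; exact: measurable_snd.
- by move=> x; exact: rintegrableZ.
- by move=> y; under eq_fun do rewrite mulrCA; exact: rintegrableZ.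
- have -> : (fun y => rint (fun x => `|a x * (g y * k x y)|)) =
      (fun y => `|g y| * rint (fun x => `|a x * k x y|)).
    apply/funext => y; rewrite -rintZ; last exact: rintegrable_abs.
    by congr rint; apply/funext => x; rewrite mulrCA normrM.
  apply: (rintegrableM (M := M * C) (rintegrable_abs ig) mak).
  move=> y; rewrite (ger0_norm (rint_ge0 _))//.
  apply: (@le_trans _ _ (M * rint (fun x => `|k x y|))); last by rewrite ler_wpM2l.
  rewrite -(rintZ _ (rintegrable_abs (ik y))); apply: le_rint.
  + exact: rintegrable_abs.
  + exact: rintegrableZ (rintegrable_abs (ik y)).
  by move=> x; rewrite normrM ler_wpM2r.
- have h x : rint (fun y => a x * (g y * k x y)) = a x * rint (fun y => g y * k x y).
    exact: rintZ.
  have {h} e : (fun x => a x * rint (fun y => g y * k x y)) =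
      (fun x => rint (fun y => a x * (g y * k x y))) by apply/funext => x.
  rewrite e; split; first exact: r1.
  rewrite r2; congr rint; apply/funext => y.
  by rewrite -(rintZ (g y) (iak y)); congr rint; apply/funext => x; rewrite mulrCA.
Qed.

Lemma convol_fubini a g k (M : R) : rintegrable g -> C1c setT k ->
  measurable_fun [set: T] a -> (forall x, `|a x| <= M) ->
  rintegrable (fun x => a x * convol g k x) /\
  rint (fun x => a x * convol g k x) =
  rint (fun y => g y * rint (fun x => a x * k (x - y))).
Proof.
move=> ig kc ma aM; have ck := C1_continuous (C1c_C1 kc).
have [B B0 hB] := C1c_bounded kc; have ik := C1c_rintegrable kc.
have bk x y : `|k (x - y)| <= B by exact: (hB _).1.
have sk y : rintegrable (fun x => k (x - y)) by exact: (rint_translate (- y) ik).1.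
have nk y : rint (fun x => `|k (x - y)|) <= rint (fun x => `|k x|).
  by have [_ ->] := rint_translate (- y) (rintegrable_abs ik).
exact: (@kernel_fubini (fun x y => k (x - y)) a g M B _ ig ma aM
  (measurable_fst_sub ck) (fun x => measurable_reflect x ck) bk sk nk).
Qed.

Lemma C1c_bumpT (c : 'rV[R]_n) r : 0 < r -> C1c setT (cbump c r).
Proof. by move=> r0; exact: C1c_bump. Qed.

Lemma bump_mass_gt0 r : 0 < r -> 0 < rint (cbump (0 : 'rV[R]_n) r).
Proof.
(* On the sup ball of radius [s] the paraboloid is at least r^2 / 2, so the bump is at least [m]
   there. *)
move=> r0; pose s := r / (2 * n.+1%:R); pose m := (r ^+ 2 / 2) ^+ 3.
have N0 : 0 < n.+1%:R :> R by rewrite ltr0n.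
have s0 : 0 < s by rewrite divr_gt0// mulr_gt0.
have ms : measurable (nball s : set T) by exact/leb_closed_measurable/closed_nball.
have is_ : rintegrable (\1_(nball s : set T)).
  by apply: rintegrable_indic => //; exact: leb_ball_fin.
have : 0 < m * rint (\1_(nball s : set T)).
  rewrite mulr_gt0//; first by rewrite exprn_gt0// divr_gt0// exprn_gt0.
  by rewrite rint_indic// leb_ball//= exprn_gt0// mulr_gt0.
move=> /lt_le_trans; apply; rewrite -rintZ//; apply: le_rint.
- exact: rintegrableZ.
- exact: (C1c_rintegrable (C1c_bumpT 0 r0)).
move=> x; rewrite indicE; case: (boolP (x \in _)) => [|_]; rewrite ?mulr1 ?mulr0 ?bump_ge0//.
rewrite inE /nball/= => xs; rewrite /cbump /m.
have h : r ^+ 2 / 2 <= paraboloid 0 r x.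
  rewrite /paraboloid.
  have : \sum_i (x 0 i - (0 : 'rV[R]_n) 0 i) ^+ 2 <= n%:R * s ^+ 2.
    apply: sum_le_const => i; rewrite mxE subr0 -real_normK ?num_real//.
    by rewrite lerXn2r ?nnegrE ?(ltW s0)// (le_trans (coord_le_norm _ _)).
  have : n%:R * s ^+ 2 <= r ^+ 2 / 2.
    rewrite (_ : s ^+ 2 = r ^+ 2 / 2 * (2 * n.+1%:R ^+ 2)^-1); last first.
      by rewrite /s; field; rewrite gt_eqF.
    rewrite mulrCA ler_piMr ?divr_ge0 ?sqr_ge0// ler_pdivrMr ?mul1r; last first.
      by rewrite mulr_gt0// exprn_gt0.
    rewrite (le_trans (_ : n%:R <= n.+1%:R))// ?ler_nat//.
    rewrite expr2 mulrA ler_peMl// ?ltW//.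
    have : 1 <= n.+1%:R :> R by rewrite ler1n.
    by lra.
  by lra.
rewrite lerXn2r ?nnegrE//; first by rewrite divr_ge0// sqr_ge0.
- by rewrite le_max lexx.
- by rewrite le_max h orbT.
Qed.

Definition mollifier r x : R :=
  (rint (cbump (0 : 'rV[R]_n) r))^-1 * cbump 0 r x.

Lemma mollifier_ge0 r x : 0 < r -> 0 <= mollifier r x.
Proof. by move=> r0; rewrite mulr_ge0 ?bump_ge0// invr_ge0 ltW// bump_mass_gt0. Qed.

Lemma C1c_mollifier r : 0 < r -> C1c setT (mollifier r).
Proof. by move=> r0; apply: C1cZ; exact: C1c_bumpT. Qed.

Lemma partial_mollifier r i : partial i (mollifier r) =
  (fun x => (rint (cbump (0 : 'rV[R]_n) r))^-1 * partial i (cbump 0 r) x).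
Proof.
apply/funext => x.
rewrite (@partialM _ _ i (cst _) (cbump 0 r))//; last exact: (C1_bump _ _).1.
by rewrite partial_cst mulr0 addr0.
Qed.

Lemma C1_partial_mollifier r i : C1 (partial i (mollifier r)).
Proof.
rewrite partial_mollifier.
exact: (C1M (C1_cst _) (C1_partial_bump 0 r i)).
Qed.

Lemma mollifier_out r x : 0 < r -> r <= `|x| -> mollifier r x = 0.
Proof. by move=> r0 rx; rewrite /mollifier bump_out ?mulr0// subr0. Qed.

Lemma mollifierN r x : mollifier r (- x) = mollifier r x.
Proof.
congr (_ * _); rewrite [RHS]bumpC -[RHS](bump_shift _ _ _ (- x)).
by rewrite subrr add0r.
Qed.

Lemma rint_mollifier r : 0 < r -> rint (mollifier r) = 1.
Proof.
move=> r0; rewrite /mollifier rintZ ?mulVf//.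
  by rewrite gt_eqF// bump_mass_gt0.
exact: (C1c_rintegrable (C1c_bumpT 0 r0)).
Qed.

Lemma mollifier_shift r x : 0 < r ->
  [/\ rintegrable (fun y => mollifier r (x - y)),
      rint (fun y => mollifier r (x - y)) = 1,
      rintegrable (fun y => mollifier r (y - x)) &
      rint (fun y => mollifier r (y - x)) = 1].
Proof.
move=> r0; have [h1 h2] := rint_translate (- x) (C1c_rintegrable (C1c_mollifier r0)).
have e : (fun y => mollifier r (x - y)) = (fun y => mollifier r (y - x)).
  by apply/funext => y; rewrite -mollifierN opprB.
by rewrite e h2 (rint_mollifier r0).
Qed.

End mollifier.

(** * Density of compactly supported C^1 functions in L^1 *)

Section density.
Context {R : realType} {n : nat}.
Local Notation T := (lebesgue_rV R n).
Implicit Types (f g : 'rV[R]_n -> R) (A B : set 'rV[R]_n).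

Lemma rint_dist_triangle g f h : rintegrable f -> rintegrable g -> rintegrable h ->
  rint (fun x => `|f x - h x|) <=
  rint (fun x => `|f x - g x|) + rint (fun x => `|g x - h x|).
Proof.
move=> fi gi hi.
have fg := rintegrable_abs (rintegrableB fi gi).
have gh := rintegrable_abs (rintegrableB gi hi).
rewrite -(rintD fg gh); apply: le_rint.
- exact: rintegrable_abs (rintegrableB fi hi).
- exact: rintegrableD fg gh.
- by move=> x; rewrite ler_distD.
Qed.

Definition C1c_approximable f : Prop := rintegrable f /\
  forall e : R, 0 < e -> exists2 phi, C1c setT phi & rint (fun x => `|f x - phi x|) < e.

Lemma C1c_approximable_closed f : rintegrable f ->
  (forall e : R, 0 < e ->
    exists2 g, C1c_approximable g & rint (fun x => `|f x - g x|) < e) ->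
  C1c_approximable f.
Proof.
move=> fi h; split => // e e0; have e2 : 0 < e / 2 by rewrite divr_gt0.
have [g [gi hg] fg] := h _ e2; have [phi cphi gphi] := hg _ e2.
exists phi => //.
apply: le_lt_trans (rint_dist_triangle fi gi (C1c_rintegrable cphi)) _.
by rewrite (splitr e) ltrD.
Qed.

Lemma C1c_approximable_dominated (f_ : nat -> 'rV[R]_n -> R) f g :
  (forall k, C1c_approximable (f_ k)) ->
  (forall x, f_ k x @[k --> \oo] --> f x) ->
  (forall k x, `|f_ k x| <= g x) -> rintegrable g -> C1c_approximable f.
Proof.
move=> hf ff fg ig.
have mf k := rintegrable_measurable (hf k).1.
have [fi _] := rint_dominated mf ff fg ig.
apply: C1c_approximable_closed => // e e0.
have fxg x : `|f x| <= g x.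
  apply: (@cvgr_to_le _ _ _ _ _ _ _ (cvg_norm (ff x))).
  by apply: nearW => k; exact: fg.
have [||||_] := @rint_dominated _ _ (fun k x => `|f x - f_ k x|) (cst 0) (fun x => 2 * g x).
- move=> k; apply: rintegrable_measurable.
  exact: rintegrable_abs (rintegrableB fi (hf k).1).
- move=> x; rewrite -[X in _ --> X](normr0 R) -(subrr (f x)).
  by apply: cvg_norm; apply: cvgB; [exact: cvg_cst|exact: ff].
- move=> k x; rewrite normr_id (le_trans (ler_normB _ _))//.
  by rewrite mulr2n mulrDl mul1r lerD.
- exact: rintegrableZ.
rewrite rint0 => /cvgrPdist_lt/(_ _ e0)[N _ /(_ N (leqnn N))] h.
exists (f_ N) => //.
by move: h; rewrite /= sub0r normrN ger0_norm// rint_ge0.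
Qed.

Lemma C1c_approximable_C1c phi : C1c setT phi -> C1c_approximable phi.
Proof.
move=> cphi; split; first exact: C1c_rintegrable cphi.
move=> e e0; exists phi => //.
have -> : (fun x => `|phi x - phi x|) = cst 0.
  by apply/funext => x; rewrite subrr normr0.
by rewrite rint0.
Qed.

Lemma C1c_approximable0 : C1c_approximable (cst 0).
Proof. exact: C1c_approximable_C1c (C1c0 _). Qed.

Lemma C1c_approximableD f g : C1c_approximable f -> C1c_approximable g ->
  C1c_approximable (fun x => f x + g x).
Proof.
move=> [fi hf] [gi hg]; have fgi := rintegrableD fi gi.
split; first exact: fgi.
move=> e e0; have e2 : 0 < e / 2 by rewrite divr_gt0.
have [a ca fa] := hf _ e2; have [b cb gb] := hg _ e2.
exists (a \+ b); first exact: C1cD.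
have ai := C1c_rintegrable ca; have bi := C1c_rintegrable cb.
have i1 := rintegrable_abs (rintegrableB fi ai).
have i2 := rintegrable_abs (rintegrableB gi bi).
rewrite (splitr e); apply: le_lt_trans (ltrD fa gb).
rewrite -(rintD i1 i2); apply: le_rint.
- exact: rintegrable_abs (rintegrableB fgi (rintegrableD ai bi)).
- exact: rintegrableD i1 i2.
- by move=> x /=; rewrite opprD addrACA ler_normD.
Qed.

Lemma C1c_approximableZ (c : R) f : C1c_approximable f ->
  C1c_approximable (fun x => c * f x).
Proof.
move=> [fi hf]; split; first exact: rintegrableZ.
move=> e e0; have c0 : 0 < `|c| + 1 by rewrite ltr_wpDl.
have [a ca fa] := hf (e / (`|c| + 1)) (divr_gt0 e0 c0).
exists (fun x => c * a x); first exact: C1cZ.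
have -> : (fun x => `|c * f x - c * a x|) = (fun x => `|c| * `|f x - a x|).
  by apply/funext => x; rewrite -mulrBr normrM.
rewrite (rintZ _ (rintegrable_abs (rintegrableB fi (C1c_rintegrable ca)))).
rewrite ltr_pdivlMr// mulrC in fa; apply: le_lt_trans fa.
by apply: ler_wpM2r; [exact: rint_ge0|rewrite lerDl].
Qed.

Lemma C1c_approximable_sum (I : Type) (r : seq I) (F : I -> 'rV[R]_n -> R) :
  (forall a, C1c_approximable (F a)) ->
  C1c_approximable (fun x => \sum_(a <- r) F a x).
Proof.
move=> h; elim: r => [|a r ih].
  by under eq_fun do rewrite big_nil; exact: C1c_approximable0.
by under eq_fun do rewrite big_cons; exact: C1c_approximableD.
Qed.

Lemma C1c_approximable_open U : open U -> bounded_set U ->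
  C1c_approximable (\1_(U : set T)).
Proof.
move=> oU bU; have [th [cth th01 thU]] := open_cutoff oU.
apply: (C1c_approximable_dominated (f_ := th) (g := \1_(U : set T))).
- by move=> k; apply: C1c_approximable_C1c; exact: C1cW (cth k).
- move=> x; rewrite indicE; have [xU|xU] := boolP (x \in _).
    have [N hN] := thU x (set_mem xU).
    by apply: cvg_near_cst; exists N => //= k; exact: hN.
  have h k : th k x = 0.
    by apply: (C1c_out (cth k)) => Ux; move: xU; rewrite (mem_set Ux).
  by under eq_fun do rewrite h; exact: cvg_cst.
- move=> k x; rewrite indicE; have [xU|xU] := boolP (x \in _).
    by have /andP[t0 t1] := th01 k x; rewrite ger0_norm.
  rewrite (C1c_out (cth k)) ?normr0// => Ux.
  by move: xU; rewrite (mem_set Ux).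
- apply: rintegrable_indic; first exact: leb_open_measurable.
  exact: leb_bounded_fin.
Qed.

(** Dynkin's argument, with all sets cut by one ball so that measures are finite. For disjoint sets,
    the partial sums of indicators jump at most once, from 0 to 1, at each point, and dominated
    convergence applies. *)
Lemma C1c_approximable_borel A (N : R) : borel_rV A ->
  C1c_approximable (\1_(A `&` [set x | `|x| < N] : set T)).
Proof.
move=> bA; set B := [set x : 'rV[R]_n | `|x| < N].
pose BT := g_sigma_algebraType ([set U | open U] : set (set 'rV[R]_n)).
have mB : measurable (B : set T) by exact/leb_open_measurable/open_nball.
have fB : (leb (B : set T) < +oo)%E.
  apply: leb_bounded_fin; apply: bounded_setS (nball_bounded N) => x /=.
  exact: ltW.
have iB := rintegrable_indic mB fB.
have hU (U : set 'rV[R]_n) : open U -> C1c_approximable (\1_(U `&` B : set T)).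
  move=> oU; apply: C1c_approximable_open; first by apply: openI => //; exact: open_nball.
  by apply: bounded_setS (nball_bounded N) => x /= -[_]; exact: ltW.
pose P (A : set BT) := C1c_approximable (\1_((A : set 'rV[R]_n) `&` B : set T)).
apply: (@dynkin_induction _ BT [set U | open U] P) => //.
- by move=> U V; exact: openI.
- rewrite /P setTI; apply: C1c_approximable_open; first exact: open_nball.
  by apply: bounded_setS (nball_bounded N) => x /=; exact: ltW.
- move=> S mS PS; rewrite /P.
  have -> : \1_((~` S : set 'rV[R]_n) `&` B : set T) =
      (fun x => \1_(setT `&` B : set T) x + (-1) * \1_((S : set 'rV[R]_n) `&` B : set T) x) :> ('rV[R]_n -> R).
    apply/funext => x; rewrite setTI !indicE !in_setI in_setC.
    by case: (x \in S); case: (x \in B); rewrite /=; ring.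
  apply: C1c_approximableD; last exact: C1c_approximableZ.
  rewrite setTI; apply: C1c_approximable_open; first exact: open_nball.
  by apply: bounded_setS (nball_bounded N) => x /=; exact: ltW.
- move=> F mF tF PF; rewrite /P.
  have sumE x k (i : nat) : F i x -> B x ->
      \sum_(j < k) \1_((F j : set 'rV[R]_n) `&` B : set T) x = (i < k)%N%:R :> R.
    move=> Fi Bx; elim: k => [|k ih]; first by rewrite big_ord0.
    rewrite big_ord_recr/= ih indicE in_setI (mem_set Bx) andbT ltnS.
    have [ik|ki|ik] := ltngtP i k; last by rewrite -ik (mem_set Fi) add0r.
      rewrite (_ : _ \in _ = false) ?addr0//; apply/negP => /set_mem Fk.
      have := tF k i Logic.I Logic.I (ex_intro _ x (conj Fk Fi)).
      by move=> kik; rewrite kik ltnn in ik.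
    rewrite (_ : _ \in _ = false) ?addr0//; apply/negP => /set_mem Fk.
    have := tF k i Logic.I Logic.I (ex_intro _ x (conj Fk Fi)).
    by move=> kik; rewrite kik ltnn in ki.
  have sum0 x k : ~ (\bigcup_j F j `&` B) x ->
      \sum_(j < k) \1_((F j : set 'rV[R]_n) `&` B : set T) x = 0 :> R.
    move=> nx; rewrite big1// => j _; rewrite indicE memNset// => -[Fj Bx].
    by apply: nx; split => //; exists j.
  apply: (C1c_approximable_dominated (g := \1_(B : set T))
    (f_ := fun k x => \sum_(j < k) \1_((F j : set 'rV[R]_n) `&` B : set T) x)) => //.
  + by move=> k; apply: C1c_approximable_sum => j; exact: PF.
  + move=> x; have [[[i _ Fi] Bx]|nx] := pselect ((\bigcup_j F j `&` B) x).
      rewrite indicE mem_set; last by split => //; exists i.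
      apply: cvg_near_cst; exists i.+1 => //= k ik.
      by rewrite (sumE x k i Fi Bx) ik.
    rewrite indicE memNset//; under eq_fun do rewrite sum0//.
    exact: cvg_cst.
  + move=> k x; have [[[i _ Fi] Bx]|nx] := pselect ((\bigcup_j F j `&` B) x).
      by rewrite (sumE x k i Fi Bx) indicE mem_set//; case: (_ < _)%N; rewrite ?normr1 ?normr0.
    by rewrite sum0// normr0 indicE.
Qed.

Lemma C1c_approximable_measurable A (N : R) : measurable (A : set T) ->
  C1c_approximable (\1_(A `&` [set x | `|x| < N] : set T)).
Proof.
move=> mA; have [B [Z [bB bZ Z0 BZ AZ]]] := leb_borel_approx mA.
have mZ := leb_borel_measurable bZ.
have iZ : rintegrable (\1_(Z : set T)).
  by apply: rintegrable_indic => //; rewrite Z0 ltry.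
have mN : measurable ([set x | `|x| < N] : set T).
  exact/leb_open_measurable/open_nball.
have iA : rintegrable (\1_(A `&` [set x | `|x| < N] : set T)).
  apply: rintegrable_indic; first exact: measurableI.
  apply: leb_bounded_fin; apply: bounded_setS (nball_bounded N) => x /= [_].
  exact: ltW.
have aB := C1c_approximable_borel N bB.
apply: C1c_approximable_closed => // e e0.
exists (\1_(B `&` [set x | `|x| < N] : set T)) => //.
have : rint (\1_(Z : set T)) < e by rewrite rint_indic// Z0.
apply: le_lt_trans; apply: le_rint.
- exact: rintegrable_abs (rintegrableB iA aB.1).
- exact: iZ.
move=> x; rewrite !indicE !in_setI.
case: (x \in [set x0 : 'rV[R]_n | `|x0| < N]); rewrite ?andbT ?andbF ?subrr ?normr0 ?ler0n//.
have [xZ|xZ] := boolP (x \in Z).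
  by case: (x \in A); case: (x \in B); rewrite /= ?subrr ?subr0 ?sub0r ?normrN ?normr1 ?normr0.
have [xA|xA] := boolP (x \in A); have [xB|xB] := boolP (x \in B); rewrite /= ?subrr ?normr0//.
  by have [/mem_set|/mem_set] := AZ _ (set_mem xA); rewrite ?(negPf xB) ?(negPf xZ).
suff : A x by move/mem_set; rewrite (negPf xA).
by apply: BZ; split; [exact: set_mem|move/mem_set; rewrite (negPf xZ)].
Qed.

Import HBSimple.

(** Restricted to a ball, [f] is an L^1 limit of simple functions, that is, of combinations of
    indicators of measurable sets in that ball; these are already approximable. *)
Lemma rintegrable_approximable f : rintegrable f -> C1c_approximable f.
Proof.
move=> fi; have mT : measurable [set: T] by exact: measurableT.
pose D (N : nat) : set T := [set x : 'rV[R]_n | `|x| < N%:R].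
have mD N : measurable (D N) by exact/leb_open_measurable/open_nball.
have iD f' N : rintegrable f' -> rintegrable (fun x => \1_(D N) x * f' x).
  move=> i'; under eq_fun do rewrite mulrC.
  apply: (rintegrableM (h := \1_(D N)) (M := 1)) => //.
  by move=> x; rewrite indicE; case: (_ \in _); rewrite ?normr1 ?normr0.
suff h (N : nat) : C1c_approximable (fun x => \1_(D N) x * f x).
  apply: (C1c_approximable_dominated h (g := fun x => `|f x|)).
  - move=> x; apply: cvg_near_cst.
    near=> k; rewrite indicE mem_set ?mul1r// /D/=.
    by near: k; exact: nbhs_infty_gtr.
  - move=> k x; rewrite indicE; case: (_ \in _); rewrite ?mul1r// mul0r normr0//.
  - exact: rintegrable_abs.
apply: C1c_approximable_closed => [|e e0]; first exact: iD.
have [g_ [ig_ _ gf]] := approximation_sfun_integrable mT fi.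
have /fine_cvgP[_ /cvgrPdist_lt/(_ _ e0)[k _ /(_ k (leqnn k))]] := gf.
rewrite /= sub0r normrN => hk.
exists (fun x => \1_(D N) x * g_ k x).
  have -> : (fun x => \1_(D N) x * g_ k x) = (fun x : 'rV[R]_n =>
      \sum_(y <- finmap.enum_fset (fset_set (range (g_ k)))) y * \1_((g_ k @^-1` [set y]) `&` D N) x).
    apply/funext => x; rewrite [g_ k x]fimfunE (fsbig_finite _ _ (fimfunP (g_ k))).
    rewrite mulr_sumr; apply: eq_bigr => y _.
    rewrite !indicE in_setI mulrCA; congr (_ * _).
    by case: (_ \in D N); case: (_ \in g_ k @^-1` _); rewrite /= ?mulr1 ?mulr0.
  apply: C1c_approximable_sum => y; apply: C1c_approximableZ.
  by apply: C1c_approximable_measurable.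
have ig : rintegrable (g_ k) := ig_ k.
have ia := rintegrable_abs (rintegrableB fi ig).
have : rint (fun x => `|f x - g_ k x|) < e.
  apply: le_lt_trans hk; rewrite ger0_norm ?fine_ge0 ?integral_ge0//.
apply: le_lt_trans; apply: le_rint => //.
  exact: rintegrable_abs (rintegrableB (iD _ _ fi) (iD _ _ ig)).
move=> x; rewrite -mulrBr normrM ler_piMl// indicE.
by case: (_ \in _); rewrite ?normr1 ?normr0.
Unshelve. all: by end_near.
Qed.

End density.

Section mollification.
Context {R : realType} {n : nat}.
Local Notation T := (lebesgue_rV R n).
Implicit Types (f g : 'rV[R]_n -> R) (x : 'rV[R]_n) (r p : R).

Lemma convol_rintegrable_mollifier f r x : 0 < r -> rintegrable f ->
  rintegrable (fun y => f y * mollifier r (x - y)).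
Proof.
move=> r0 fi; have cm := @C1c_mollifier R n r r0; have [B _ hB] := C1c_bounded cm.
apply: (convol_rintegrable x fi _ (fun z => (hB z).1)).
exact: C1_continuous (C1c_C1 cm).
Qed.

Lemma convol_mollifierB f g r x : 0 < r -> rintegrable f -> rintegrable g ->
  convol (fun y => f y - g y) (mollifier r) x =
  convol f (mollifier r) x - convol g (mollifier r) x.
Proof.
move=> r0 fi gi; rewrite /convol.
rewrite -(rintB (convol_rintegrable_mollifier x r0 fi) (convol_rintegrable_mollifier x r0 gi)).
by congr rint; apply/funext => y; rewrite mulrBl.
Qed.

Lemma rint_convol_mollifier f r : 0 < r -> rintegrable f ->
  rintegrable (convol f (mollifier r)) /\ rint (convol f (mollifier r)) = rint f.
Proof.
move=> r0 fi; have [|||i e] := @convol_fubini _ _ (cst 1) f (mollifier r) 1 fi.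
- exact: C1c_mollifier.
- exact: measurable_cst.
- by move=> x; rewrite normr1.
have e1 : (fun x => cst 1 x * convol f (mollifier r) x) = convol f (mollifier r).
  by apply/funext => x; rewrite mul1r.
rewrite e1 in i e; split; first exact: i.
rewrite e; congr rint; apply/funext => y.
have [_ _ _ h] := mollifier_shift y r0.
rewrite (_ : (fun x => _) = (fun x => mollifier r (x - y))) ?h ?mulr1//.
by apply/funext => x; rewrite mul1r.
Qed.

(** The graph of the power lies above its tangent at [a]. This is Young's inequality for a^(p-1) and
    s with the exponents p/(p-1) and p, multiplied by p. *)
Lemma powR_tangent p (a s : R) : 1 <= p -> 0 <= a -> 0 <= s ->
  p * a `^ (p - 1) * s - (p - 1) * a `^ p <= s `^ p.
Proof.
move=> p1 a0 s0; have p0 : 0 < p by rewrite (lt_le_trans ltr01).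
have [pp|p1'] := eqVneq p 1.
  by rewrite pp subrr powRr0 mul0r subr0 !mul1r powRr1.
have q0 : 0 < p - 1 by rewrite subr_gt0 lt_neqAle eq_sym p1'.
have := conjugate_powR (powR_ge0 a (p - 1)) s0 (divr_gt0 p0 q0) p0.
rewrite -powRrM (_ : (p - 1) * (p / (p - 1)) = p); last by field; rewrite gt_eqF.
have -> : (p / (p - 1))^-1 + p^-1 = 1 by field; rewrite !gt_eqF.
move=> /(_ erefl) h.
have -> : s `^ p = p * (s `^ p / p) by field; rewrite gt_eqF.
have -> : (p - 1) * a `^ p = p * (a `^ p / (p / (p - 1))).
  by field; rewrite !gt_eqF.
by rewrite -mulrA -mulrBr ler_pM2l// lerBlDl.
Qed.

Lemma ler_powR_ge0 p (a b : R) : 0 <= p -> 0 <= a -> a <= b -> a `^ p <= b `^ p.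
Proof. by move=> p0 a0 ab; apply: ge0_ler_powR; rewrite // nnegrE// (le_trans a0). Qed.

(** Jensen's inequality for the probability density y |-> mollifier (x - y), obtained by integrating
    the tangent inequality at the mean [a] of |f|. *)
Lemma convol_jensen f r p x : 1 <= p -> 0 < r -> rintegrable f ->
  rintegrable (fun y => `|f y| `^ p) ->
  `|convol f (mollifier r) x| `^ p <= convol (fun y => `|f y| `^ p) (mollifier r) x.
Proof.
move=> p1 r0 fi fpi; have p0 : 0 <= p by rewrite (le_trans ler01).
have i1 := convol_rintegrable_mollifier x r0 (rintegrable_abs fi).
have i2 := convol_rintegrable_mollifier x r0 fpi.
have [i3 e3 _ _] := mollifier_shift x r0.
set a := convol (fun y => `|f y|) (mollifier r) x.
have a0 : 0 <= a by apply: rint_ge0 => y; rewrite mulr_ge0// mollifier_ge0.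
apply: le_trans (_ : a `^ p <= _).
  apply: ler_powR_ge0 => //.
  rewrite (le_trans (rint_norm_le (convol_rintegrable_mollifier x r0 fi)))//.
  rewrite /a /convol le_eqVlt; apply/orP; left; apply/eqP; congr rint.
  by apply/funext => y; rewrite normrM (ger0_norm (mollifier_ge0 _ r0)).
set c1 := p * a `^ (p - 1); set c2 := (p - 1) * a `^ p.
have -> : a `^ p = rint (fun y => c1 * (`|f y| * mollifier r (x - y)) -
                                c2 * mollifier r (x - y)).
  rewrite (rintB (rintegrableZ c1 i1) (rintegrableZ c2 i3)).
  rewrite (rintZ _ i1) (rintZ _ i3) e3 mulr1 -[rint _]/a /c1 /c2.
  rewrite -mulrA [_ `^ _ * a]mulrC mulr_powRB1//; first by ring.
  by rewrite (lt_le_trans ltr01).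
apply: le_rint => //.
  exact: (rintegrableB (rintegrableZ c1 i1) (rintegrableZ c2 i3)).
move=> y; rewrite mulrA -mulrBl ler_wpM2r ?mollifier_ge0//.
exact: powR_tangent.
Qed.

Lemma measurable_abs_powR f p : measurable_fun [set: T] f ->
  measurable_fun [set: T] (fun x => `|f x| `^ p).
Proof.
move=> mf; apply: (measurableT_comp (measurable_powR p)).
by apply: measurableT_comp.
Qed.

Lemma convol_contraction f r p : 1 <= p -> 0 < r -> rintegrable f ->
  rintegrable (fun y => `|f y| `^ p) ->
  rintegrable (fun x => `|convol f (mollifier r) x| `^ p) /\
  rint (fun x => `|convol f (mollifier r) x| `^ p) <= rint (fun y => `|f y| `^ p).
Proof.
move=> p1 r0 fi fpi; have [i1 e1] := rint_convol_mollifier r0 fi.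
have [i2 e2] := rint_convol_mollifier r0 fpi.
have h : rintegrable (fun x => `|convol f (mollifier r) x| `^ p).
  apply: (le_rintegrable _ _ i2).
    exact: measurable_abs_powR (rintegrable_measurable i1).
  move=> x; rewrite ger0_norm ?powR_ge0//; exact: convol_jensen.
split; first exact: h.
by rewrite -e2; apply: (le_rint h i2) => x; exact: convol_jensen.
Qed.

(** Averaging over a ball of radius [r] moves a Lipschitz function by at most n M r, and for r < 1
    only points within 1 of the support are affected. *)
Lemma mollify_C1c phi (e : R) : C1c setT phi -> 0 < e ->
  exists2 d : R, 0 < d & forall r, 0 < r -> r < d ->
    rint (fun x => `|convol phi (mollifier r) x - phi x|) < e.
Proof.
move=> cphi e0; have [M M0 hM] := C1c_bounded cphi.
have [c1 csupp _] := cphi; have iphi := C1c_rintegrable cphi.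
pose K : set 'rV[R]_n := [set x | exists2 y, supp phi y & `|x - y| <= 1].
have cK : compact K by exact: thickening_compact.
have mK : measurable (K : set T).
  by apply: leb_closed_measurable; exact: compact_closed_rV.
have iK : rintegrable (\1_(K : set T)).
  by apply: rintegrable_indic => //; exact: leb_compact_fin.
set V := rint (\1_(K : set T)); have V0 : 0 <= V.
  by apply: rint_ge0 => x; rewrite indicE.
pose L := n%:R * M * V + 1; have L0 : 0 < L.
  by rewrite /L ltr_wpDl// !mulr_ge0.
exists (Num.min 1 (e / L)) => [|r r0]; first by rewrite lt_min ltr01 divr_gt0.
rewrite lt_min => /andP[r1 re].
have [ic _] := rint_convol_mollifier r0 iphi.
have : n%:R * M * r * V < e.
  rewrite ltr_pdivlMr// in re; apply: le_lt_trans re.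
  by rewrite mulrAC mulrC ler_wpM2l ?(ltW r0)// /L lerDl.
apply: le_lt_trans; rewrite -rintZ//; apply: le_rint.
- exact: rintegrable_abs (rintegrableB ic iphi).
- exact: rintegrableZ.
move=> x; have [i3 e3 _ _] := mollifier_shift x r0.
have i4 := convol_rintegrable_mollifier x r0 iphi.
have -> : convol phi (mollifier r) x - phi x =
    rint (fun y => (phi y - phi x) * mollifier r (x - y)).
  rewrite -[X in _ - X]mulr1 -e3 -(rintZ _ i3) -(rintB i4 (rintegrableZ _ i3)).
  by congr rint; apply/funext => y; rewrite mulrBl.
have i5 : rintegrable (fun y => (phi y - phi x) * mollifier r (x - y)).
  under eq_fun do rewrite mulrBl; exact: (rintegrableB i4 (rintegrableZ _ i3)).
rewrite indicE; have [xK|xK] := boolP (x \in (K : set T)).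
  have -> : n%:R * M * r * true%:R = rint (fun y => n%:R * M * r * mollifier r (x - y)).
    by rewrite (rintZ _ i3) e3.
  rewrite (le_trans (rint_norm_le i5))//; apply: le_rint.
  - exact: rintegrable_abs.
  - exact: rintegrableZ.
  move=> y; rewrite normrM (ger0_norm (mollifier_ge0 _ r0)).
  have [xyr|xyr] := ltP `|x - y| r; last by rewrite (mollifier_out r0 xyr) !mulr0.
  rewrite ler_wpM2r ?mollifier_ge0//.
  rewrite (le_trans (C1_lipschitz c1 (fun i x => (hM x).2 i) y x))//.
  by rewrite ler_wpM2l ?mulr_ge0// distrC ltW.
have h y : `|x - y| < r -> phi y = 0.
  move=> xyr; apply: supp_out => sy; move: xK; rewrite mem_set//; exists y => //.
  by rewrite (le_trans (ltW xyr))// ltW.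
rewrite (_ : (fun y => _) = cst 0) ?rint0 ?normr0 ?mulr0//.
apply/funext => y /=; have [xyr|xyr] := ltP `|x - y| r.
  by rewrite (h y xyr) (h x) ?subrr ?normr0 ?mul0r.
by rewrite (mollifier_out r0 xyr) mulr0.
Qed.

Lemma mollify_L1 f (e : R) : rintegrable f -> 0 < e ->
  exists2 d : R, 0 < d & forall r, 0 < r -> r < d ->
    rint (fun x => `|convol f (mollifier r) x - f x|) < e.
Proof.
move=> fi e0; have e3 : 0 < e / 3 by rewrite divr_gt0.
have [_ /(_ _ e3)[phi cphi fphi]] := rintegrable_approximable fi.
have [d d0 hd] := mollify_C1c cphi e3; exists d => // r r0 rd.
have pi := C1c_rintegrable cphi.
have [cf _] := rint_convol_mollifier r0 fi.
have [cp _] := rint_convol_mollifier r0 pi.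
have [ca ea] := rint_convol_mollifier r0 (rintegrable_abs (rintegrableB fi pi)).
apply: le_lt_trans (rint_dist_triangle cf cp fi) _.
have -> : e = e / 3 + (e / 3 + e / 3) by field.
apply: ler_ltD.
  apply: le_trans (ltW fphi); rewrite -ea; apply: le_rint => //.
    exact: rintegrable_abs (rintegrableB cf cp).
  move=> x; rewrite -convol_mollifierB//.
  have i := convol_rintegrable_mollifier x r0 (rintegrableB fi pi).
  rewrite (le_trans (rint_norm_le i))// le_eqVlt; apply/orP; left; apply/eqP.
  congr rint; apply/funext => y.
  by rewrite normrM (ger0_norm (mollifier_ge0 _ r0)).
apply: le_lt_trans (rint_dist_triangle cp pi fi) _; apply: ltrD; first exact: hd.
apply: le_lt_trans fphi; rewrite le_eqVlt; apply/orP; left; apply/eqP.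
by congr rint; apply/funext => x; rewrite distrC.
Qed.

End mollification.

Opaque rint.

(** * Mollification in L^p *)

Section mollification_Lp.
Context {R : realType} {n : nat}.
Local Notation T := (lebesgue_rV R n).
Implicit Types (f g : 'rV[R]_n -> R) (x : 'rV[R]_n) (r p : R).

Lemma powR_addle p (a b : R) : 0 <= p -> 0 <= a -> 0 <= b ->
  (a + b) `^ p <= 2 `^ p * (a `^ p + b `^ p).
Proof.
move=> p0 a0 b0; wlog ab : a b a0 b0 / a <= b.
  by move=> h; have [/h|/ltW/h] := leP a b; [exact|rewrite addrC [_ `^ p + _]addrC; exact].
apply: le_trans (_ : (2 * b) `^ p <= _).
  by apply: ler_powR_ge0; rewrite ?addr_ge0// mulr_natl mulr2n lerD2r.
by rewrite powRM// ler_wpM2l ?powR_ge0// lerDr powR_ge0.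
Qed.

Lemma Lp_addle f g p : 0 <= p ->
  measurable_fun [set: T] f -> measurable_fun [set: T] g ->
  rintegrable (fun x => `|f x| `^ p) -> rintegrable (fun x => `|g x| `^ p) ->
  rintegrable (fun x => `|f x + g x| `^ p) /\
  rint (fun x => `|f x + g x| `^ p) <=
    2 `^ p * (rint (fun x => `|f x| `^ p) + rint (fun x => `|g x| `^ p)).
Proof.
move=> p0 mf mg fi gi; have h x : `|f x + g x| `^ p <=
    2 `^ p * (`|f x| `^ p + `|g x| `^ p).
  apply: le_trans (powR_addle p0 (normr_ge0 _) (normr_ge0 _)).
  by apply: ler_powR_ge0 => //; exact: ler_normD.
have i := rintegrableZ (2 `^ p) (rintegrableD fi gi).
have i' : rintegrable (fun x => `|f x + g x| `^ p).
  apply: (le_rintegrable _ _ i).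
    by apply: measurable_abs_powR; exact: measurable_funD.
  by move=> x; rewrite ger0_norm ?powR_ge0//; exact: h.
split; first exact: i'.
rewrite -(rintD fi gi) -(rintZ _ (rintegrableD fi gi)).
exact: (le_rint i' i).
Qed.

Lemma LpN f g p : (fun x => `|f x - g x| `^ p) = (fun x => `|g x - f x| `^ p).
Proof. by apply/funext => x; rewrite distrC. Qed.

Lemma truncation_Lp f p (e : R) : 1 <= p -> measurable_fun [set: T] f ->
  rintegrable (fun x => `|f x| `^ p) -> 0 < e ->
  exists2 N : R, 0 < N & exists2 g : 'rV[R]_n -> R, measurable_fun [set: T] g &
    [/\ forall x, `|g x| <= `|f x|, forall x, `|g x| <= N,
        rintegrable (fun x => `|f x - g x| `^ p) &
        rint (fun x => `|f x - g x| `^ p) < e].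
Proof.
move=> p1 mf fi e0; have p0 : 0 < p by rewrite (lt_le_trans ltr01).
pose g (N : nat) x : R := Num.max (- N%:R) (Num.min N%:R (f x)).
have mg N : measurable_fun [set: T] (g N).
  have mc (c : R) : measurable_fun [set: T] (cst c : T -> R) by exact: measurable_cst.
  exact: (measurable_maxr (mc _) (measurable_minr (mc _) mf)).
have g1 N x : `|g N x| <= `|f x|.
  rewrite /g; have N0 : 0 <= N%:R :> R by [].
  rewrite /Num.max /Num.min; case: ifPn; case: ifPn => // h1 h2;
    rewrite ler_norml; move: (normr_ge0 (f x)) (ler_norm (f x)) (ler_norm (- f x));
    rewrite normrN; move: h1 h2; rewrite -?leNgt; lra.
have g2 N x : `|g N x| <= N%:R.
  have N0 : 0 <= N%:R :> R by [].
  by rewrite /g ler_norml le_max lexx ge_max ge_min lexx andbT/=; lra.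
have g3 N x : `|f x - g N x| <= `|f x|.
  rewrite /g; have N0 : 0 <= N%:R :> R by [].
  rewrite /Num.max /Num.min; case: ifPn; case: ifPn => // h1 h2;
    rewrite ler_norml; move: (normr_ge0 (f x)) (ler_norm (f x)) (ler_norm (- f x));
    rewrite normrN; move: h1 h2; rewrite -?leNgt; lra.
have m N : measurable_fun [set: T] (fun x => `|f x - g N x| `^ p).
  by apply: measurable_abs_powR; exact: measurable_funB.
have b N x : `| `|f x - g N x| `^ p| <= `|f x| `^ p.
  by rewrite ger0_norm ?powR_ge0//; apply: ler_powR_ge0; rewrite // ltW.
have lim x : `|f x - g N x| `^ p @[N --> \oo] --> cst 0 x.
  apply: cvg_near_cst; near=> N.
  have h : `|f x| < N%:R by near: N; exact: nbhs_infty_gtr.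
  have [h1 h2] : - N%:R <= f x /\ f x <= N%:R.
    by split; move: h; rewrite ltr_norml => /andP[]/ltW ? /ltW.
  have -> : g N x = f x by rewrite /g (min_idPr h2) (max_idPr h1).
  by rewrite subrr normr0 powR0// gt_eqF.
have [_] := rint_dominated m lim b fi.
rewrite rint0 => /cvgrPdist_lt/(_ _ e0)[N _ /(_ N.+1 (leqnSn N))].
rewrite /= sub0r normrN ger0_norm; last by apply: rint_ge0 => x; exact: powR_ge0.
move=> h; exists N.+1%:R; first by rewrite ltr0n.
exists (g N.+1); first exact: mg.
split => //; apply: (le_rintegrable (m _) _ fi) => x; exact: b.
Unshelve. all: by end_near.
Qed.

(** A truncation [g] at height [N] is close to [f] in L^p, and mollification contracts L^p, so only
    [g] has to be treated. For it, |t|^p <= (2 N)^(p-1) |t| on the values that occur, which reduces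
    L^p convergence to L^1 convergence. *)
Lemma mollify_Lp f p (e : R) : 1 <= p -> rintegrable f ->
  rintegrable (fun x => `|f x| `^ p) -> 0 < e ->
  exists2 d : R, 0 < d & forall r, 0 < r -> r < d ->
    rintegrable (fun x => `|convol f (mollifier r) x - f x| `^ p) /\
    rint (fun x => `|convol f (mollifier r) x - f x| `^ p) < e.
Proof.
move=> p1 fi fpi e0; have p0 : 0 < p by rewrite (lt_le_trans ltr01).
pose C : R := 2 `^ p; have C0 : 0 < C by rewrite powR_gt0.
have mf := rintegrable_measurable fi.
(* Two nested uses of (a + b)^p <= C (a^p + b^p) cost C (e' + 2 C e') below; this choice keeps that
   under [e]. *)
pose e' := e / (4 * C * C + 4 * C).
have CC : 0 < 4 * C * C + 4 * C by rewrite addr_gt0 ?mulr_gt0.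
have e'0 : 0 < e' by rewrite divr_gt0.
have key : C * (e' + C * (e' + e')) < e.
  have -> : C * (e' + C * (e' + e')) = e' * (2 * C * C + C) by ring.
  rewrite /e' mulrAC ltr_pdivrMr// ltr_pM2l//.
  by have := mulr_gt0 C0 C0; lra.
have [N N0 [g mg [g1 g2 fgi fge]]] := truncation_Lp p1 mf fpi e'0.
have gi : rintegrable g := le_rintegrable mg g1 (rintegrable_abs fi).
pose D := (2 * N) `^ (p - 1); have D0 : 0 < D by apply: powR_gt0; rewrite mulr_gt0.
have [d d0 hd] := mollify_L1 gi (divr_gt0 e'0 D0).
exists d => // r r0 rd; have {}hd := hd r r0 rd.
have [cf _] := rint_convol_mollifier r0 fi.
have [cg _] := rint_convol_mollifier r0 gi.
have cgi := rintegrableB cg gi.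
have i1 := rintegrable_abs cgi.
have cN x : `|convol g (mollifier r) x| <= N.
  have [i3 e3 _ _] := mollifier_shift x r0.
  have i := convol_rintegrable_mollifier x r0 gi.
  have -> : N = rint (fun y => N * mollifier r (x - y)) by rewrite (rintZ _ i3) e3 mulr1.
  apply: le_trans (rint_norm_le i) _.
  apply: le_rint (rintegrable_abs i) (rintegrableZ _ i3) _ => y.
  by rewrite normrM (ger0_norm (mollifier_ge0 _ r0)) ler_wpM2r ?mollifier_ge0.
have bd x : `|convol g (mollifier r) x - g x| `^ p <=
    D * `|convol g (mollifier r) x - g x|.
  rewrite -mulr_powRB1// mulrC ler_wpM2r//; apply: ler_powR_ge0 => //.
    by rewrite subr_ge0.
  by rewrite (le_trans (ler_normB _ _))// mulr_natl mulr2n lerD.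
have i2 : rintegrable (fun x => `|convol g (mollifier r) x - g x| `^ p).
  apply: (le_rintegrable _ _ (rintegrableZ D i1)).
    by apply: measurable_abs_powR; exact: rintegrable_measurable cgi.
  by move=> x; rewrite ger0_norm ?powR_ge0//; exact: bd.
have l2 : rint (fun x => `|convol g (mollifier r) x - g x| `^ p) <= e'.
  apply: le_trans (le_rint i2 (rintegrableZ D i1) bd) _.
  by rewrite (rintZ _ i1) mulrC -ler_pdivlMr// ltW.
have [i3] := convol_contraction p1 r0 (rintegrableB fi gi) fgi.
have e3 : (fun x => `|convol (f \- g) (mollifier r) x| `^ p) =
    (fun x => `|convol f (mollifier r) x - convol g (mollifier r) x| `^ p).
  by apply/funext => x; rewrite -convol_mollifierB.
rewrite e3 => l3; rewrite e3 in i3.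
have mB (a b : 'rV[R]_n -> R) : rintegrable a -> rintegrable b ->
    measurable_fun [set: T] (fun x => a x - b x).
  by move=> ia ib; exact: rintegrable_measurable (rintegrableB ia ib).
have fgi' : rintegrable (fun x => `|g x - f x| `^ p) by rewrite LpN.
have [i4 l4] := Lp_addle (ltW p0) (mB _ _ cg gi) (mB _ _ gi fi) i2 fgi'.
have [i5 l5] := Lp_addle (ltW p0) (mB _ _ cf cg)
  (measurable_funD (mB _ _ cg gi) (mB _ _ gi fi)) i3 i4.
have ee : (fun x => `|convol f (mollifier r) x - f x| `^ p) =
  (fun x => `|(convol f (mollifier r) x - convol g (mollifier r) x) +
    ((convol g (mollifier r) x - g x) + (g x - f x))| `^ p).
  by apply/funext => x; congr (`| _ | `^ p); ring.
rewrite ee; split; first exact: i5.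
apply: le_lt_trans l5 _; rewrite -/C in l4 *.
have l6 : rint (fun x => `|g x - f x| `^ p) <= e' by rewrite LpN ltW.
apply: (@le_lt_trans _ _ (C * (e' + C * (e' + e')))).
  apply: ler_wpM2l; first exact: ltW.
  apply: lerD; first exact: (le_trans l3 (ltW fge)).
  apply: (le_trans l4); apply: ler_wpM2l; first exact: ltW.
  exact: (lerD l2 l6).
exact: key.
Qed.

End mollification_Lp.

(** * Weak gradients and Sobolev functions *)

Opaque leb.

Section zero_extension.
Context {R : realType} {n : nat}.
Local Notation T := (lebesgue_rV R n).
Implicit Types (f g : 'rV[R]_n -> R) (x : 'rV[R]_n) (p : R) (N Omega : set 'rV[R]_n).

Definition zext Omega f x : R := \1_Omega x * f x.

Lemma zextE Omega f x : Omega x -> zext Omega f x = f x.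
Proof. by move=> Ox; rewrite /zext indicE mem_set// mul1r. Qed.

Lemma zext_out Omega f x : ~ Omega x -> zext Omega f x = 0.
Proof. by move=> Ox; rewrite /zext indicE memNset// mul0r. Qed.

Lemma zext_comp Omega f (q : R -> R) : q 0 = 0 ->
  (fun x => q (zext Omega f x)) = zext Omega (q \o f).
Proof.
move=> q0; apply/funext => x; have [Ox|Ox] := pselect (Omega x).
  by rewrite !zextE.
by rewrite !zext_out.
Qed.

Lemma zext_powR Omega f p : p != 0 ->
  (fun x => `|zext Omega f x| `^ p) = zext Omega (fun x => `|f x| `^ p).
Proof.
by move=> p0; rewrite (zext_comp _ _ (q := fun t => `|t| `^ p))// normr0 powR0.
Qed.

Lemma measurable_zext Omega f : measurable (Omega : set T) ->
  measurable_fun (Omega : set T) f <-> measurable_fun [set: T] (zext Omega f).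
Proof.
move=> mO; rewrite (_ : zext Omega f = f \_ (Omega : set T)).
  have := measurable_restrictT (f : T -> R) mO; exact.
by rewrite patch_indic.
Qed.

Lemma in_LpP Omega p f : measurable (Omega : set T) -> p != 0 ->
  in_Lp Omega p f <-> measurable_fun [set: T] (zext Omega f) /\
                      rintegrable (fun x => `|zext Omega f x| `^ p).
Proof.
move=> mO p0; rewrite /in_Lp (zext_powR _ _ p0).
have mm : measurable_fun (Omega : set T) f ->
    measurable_fun (Omega : set T) (fun x => `|f x| `^ p).
  move=> mf; apply: (measurableT_comp (measurable_powR p)).
  exact: (measurableT_comp _ mf).
split=> -[mf h].
  split; first exact: (measurable_zext f mO).1 mf.
  apply/(integrable_setE _ mO); apply/integrableP; split.
    by apply/measurable_EFinP; exact: mm.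
  by under eq_integral do rewrite /= ger0_norm ?powR_ge0//.
have {}mf := (measurable_zext f mO).2 mf; split; first exact: mf.
have /integrableP[_] := (integrable_setE _ mO).2 h.
by under eq_integral do rewrite /= ger0_norm ?powR_ge0//.
Qed.

Lemma integral_zext Omega f : measurable (Omega : set T) ->
  rintegrable (zext Omega f) ->
  (\int[leb]_(x in (Omega : set T)) (f x)%:E = (rint (zext Omega f))%:E)%E.
Proof.
move=> mO h; rewrite -(rint_fin h) integral_mkcond; apply: eq_integral => x _.
rewrite /patch /zext indicE; case: ifPn => _; first by rewrite mul1r.
by rewrite mul0r.
Qed.

(** |f| <= 1 + |f|^p, and 1 is integrable over a set of finite measure. *)
Lemma in_Lp_rintegrable Omega p f : measurable (Omega : set T) ->
  (leb (Omega : set T) < +oo)%E -> 1 <= p -> in_Lp Omega p f ->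
  rintegrable (zext Omega f).
Proof.
move=> mO fO p1; have p0 : p != 0 by rewrite gt_eqF// (lt_le_trans ltr01).
move=> /(in_LpP _ mO p0)[mf fi].
apply: (le_rintegrable mf _ (rintegrableD (rintegrable_indic mO fO) fi)) => x.
have [Ox|Ox] := pselect (Omega x); last first.
  by rewrite zext_out// normr0/= addr_ge0 ?powR_ge0// indicE.
rewrite /= indicE mem_set//; have [|] := leP `|zext Omega f x| 1.
  by move=> /le_trans; apply; rewrite lerDl powR_ge0.
move=> h; rewrite -[leLHS]powRr1// (le_trans (ler_powR _ p1)) ?lerDr//.
exact: ltW.
Qed.

(** Caratheodory's criterion holds for null sets by monotonicity of the outer measure. *)
Lemma leb0_measurable N : leb (N : set T) = 0%E -> measurable (N : set T).
Proof.
move=> N0; apply: le_caratheodory_measurable => X.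
rewrite -[leRHS]add0e; apply: leeD; last by apply: le_outer_measure; exact: subIsetl.
rewrite le_eqVlt; apply/orP; left; apply/eqP.
exact: leb_subset_null (@subIsetr _ X N) N0.
Qed.

Lemma leb0_bigcup (N_ : nat -> set 'rV[R]_n) : (forall k, leb (N_ k : set T) = 0%E) ->
  leb (\bigcup_k N_ k : set T) = 0%E.
Proof.
move=> h; apply/eqP; rewrite eq_le measure_ge0 andbT.
apply: le_trans (outer_measure_sigma_subadditive (@lebesgue_outer R n) N_) _.
rewrite eseries0 => [|k _ _]; first exact: lexx.
exact: h.
Qed.

Lemma rint_eq0_null f : rintegrable f -> rint (fun x => `|f x|) = 0 ->
  leb ([set x | f x != 0] : set T) = 0%E.
Proof.
move=> fi f0.
have mf : measurable_fun [set: T] (EFin \o f).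
  exact/measurable_EFinP/rintegrable_measurable.
have : (\int[leb]_(x in [set: T]) `|(EFin \o f) x| = 0)%E.
  by rewrite (rint_fin (rintegrable_abs fi)) f0.
move=> /(ae_eq_integral_abs _ measurableT mf)[N [mN N0 hN]].
apply: (leb_subset_null _ N0) => x /= fx; apply: hN => /= h.
by move: fx; have := h Logic.I => /= -[->]; rewrite eqxx.
Qed.

Lemma measurable_null f g : measurable_fun [set: T] f ->
  leb ([set x | f x != g x] : set T) = 0%E -> measurable_fun [set: T] g.
Proof.
move=> mf h; have mN := leb0_measurable h.
have cpl : measure_is_complete (@leb R n).
  by move=> X [A [mA A0 XA]]; exact: leb_null_measurable mA A0 XA.
have aeE : ae_eq (@leb R n) [set: T] (EFin \o f) (EFin \o g).
  exists [set x | f x != g x]; split => // x /= /not_implyP[_ fgx].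
  by apply/eqP => e; apply: fgx; rewrite /= e.
have mf' : measurable_fun [set: T] (EFin \o f) by exact/measurable_EFinP.
by have := ae_measurable_fun cpl aeE mf' => /measurable_EFinP.
Qed.

Lemma rint_null f g : rintegrable f -> leb ([set x | f x != g x] : set T) = 0%E ->
  rintegrable g /\ rint f = rint g.
Proof.
move=> fi h.
have mN := leb0_measurable h.
have aeE (q : R -> \bar R) : ae_eq (@leb R n) [set: T] (q \o f) (q \o g).
  exists [set x | f x != g x]; split => // x /= /not_implyP[_ fgx].
  by apply/eqP => e; apply: fgx; rewrite /= e.
have mf : measurable_fun [set: T] (EFin \o f).
  by apply/measurable_EFinP; exact: rintegrable_measurable.
have mg : measurable_fun [set: T] (EFin \o g).
  by apply/measurable_EFinP; exact: measurable_null (rintegrable_measurable fi) h.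
have ma (k : 'rV[R]_n -> R) : measurable_fun [set: T] (EFin \o k) ->
    measurable_fun [set: T] (fun x => `|(k x)%:E|%E).
  move=> /measurable_EFinP mk.
  have : measurable_fun [set: T] (fun x => `|k x|) by exact: measurableT_comp.
  by move=> /measurable_EFinP.
have gi : rintegrable g.
  apply/integrableP; split; first exact: mg.
  have /integrableP[_ h1] := fi.
  have h2 := ae_eq_integral _ _ measurableT (ma _ mf) (ma _ mg)
    (aeE (fun t => `|t%:E|%E)).
  by move: h1; rewrite h2.
split; first exact: gi.
apply: EFin_inj; rewrite -(rint_fin fi) -(rint_fin gi).
exact: (ae_eq_integral _ _ measurableT mf mg (aeE EFin)).
Qed.

End zero_extension.

(** * Weak gradients: localization and uniqueness *)

Section weak_gradient.
Context {R : realType} {n : nat}.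
Local Notation T := (lebesgue_rV R n).
Implicit Types (f u v phi : 'rV[R]_n -> R) (g h : 'rV[R]_n -> 'rV[R]_n).
Implicit Types (x : 'rV[R]_n) (p : R) (K Omega : set 'rV[R]_n) (i : 'I_n).

Lemma mollifier_reflectE r x : (fun y => mollifier r (x - y)) =
  (fun y => (rint (cbump (0 : 'rV[R]_n) r))^-1 * cbump x r y).
Proof.
apply/funext => y; rewrite /mollifier -(bump_shift 0 r (x - y) y) add0r subrK.
by rewrite bumpC.
Qed.

Lemma C1_mollifier_reflect r x : C1 (fun y => mollifier r (x - y)).
Proof. by rewrite mollifier_reflectE; exact: (C1M (C1_cst _) (C1_bump x r)). Qed.

Lemma partial_mollifier_reflect r x i y :
  partial i (fun y => mollifier r (x - y)) y = - partial i (mollifier r) (x - y).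
Proof.
rewrite mollifier_reflectE partial_mollifier.
rewrite (@partialM _ _ i (cst _) (cbump x r))//; last exact: (C1_bump _ _).1.
rewrite partial_cst mulr0 addr0 !partial_bump -mulrN; congr (_ * _).
have -> : paraboloid 0 r (x - y) = paraboloid x r y.
  rewrite /paraboloid; congr (_ - _); apply: eq_bigr => j _.
  by rewrite !mxE subr0 -sqrrN opprB.
rewrite !mxE /=; ring.
Qed.

Lemma leb_compact_measurable K : compact K -> measurable (K : set T).
Proof. by move=> cK; apply: leb_closed_measurable; exact: compact_closed_rV. Qed.

Lemma in_L1locP Omega f : in_L1loc Omega f <->
  forall K, compact K -> K `<=` Omega -> rintegrable (zext K f).
Proof.
split=> h K cK KO; have mK := leb_compact_measurable cK.
  exact: (integrable_setE _ mK).1 (h K cK KO).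
exact: (integrable_setE _ mK).2 (h K cK KO).
Qed.

Lemma L1loc_mul Omega f phi K : in_L1loc Omega f -> compact K -> K `<=` Omega ->
  continuous phi -> (forall x, ~ K x -> phi x = 0) ->
  rintegrable (fun x => f x * phi x).
Proof.
move=> /in_L1locP hf cK KO cphi phi0.
have [M _ hM] := continuous_compact_bounded cphi cK phi0.
have mphi : measurable_fun [set: T] phi by exact: leb_measurable_continuous.
have -> : (fun x => f x * phi x) = zext K f \* phi.
  apply/funext => x /=; have [Kx|Kx] := pselect (K x); first by rewrite zextE.
  by rewrite phi0// !mulr0.
exact: rintegrableM (hf K cK KO) mphi hM.
Qed.

Lemma L1loc_C1c Omega f phi : in_L1loc Omega f -> C1c Omega phi ->
  rintegrable (fun x => f x * phi x).
Proof.
move=> hf [c1 cs sO]; apply: (L1loc_mul hf cs sO); first exact: C1_continuous.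
by move=> x; exact: supp_out.
Qed.

Lemma L1loc_partial Omega f phi i : in_L1loc Omega f -> C1c Omega phi ->
  rintegrable (fun x => f x * partial i phi x).
Proof.
move=> hf [c1 cs sO]; apply: (L1loc_mul hf cs sO); first exact: c1.2.
by move=> x; exact: partial_out.
Qed.

Lemma Rintegral_supp Omega f : (forall x, ~ Omega x -> f x = 0) ->
  (\int[leb]_(x in (Omega : set T)) f x)%R = rint f.
Proof.
move=> f0; rewrite rint_setE; congr rint; apply/funext => x.
have [Ox|Ox] := pselect (Omega x); first by rewrite indicE mem_set// mul1r.
by rewrite f0// mulr0.
Qed.

Lemma is_wgradP Omega u g : is_wgrad Omega u g <->
  [/\ in_L1loc Omega u, forall i, in_L1loc Omega (fun x => g x 0 i) &
   forall i phi, C1c Omega phi ->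
     rint (fun x => u x * partial i phi x) = - rint (fun x => g x 0 i * phi x)].
Proof.
have h i phi : C1c Omega phi ->
    ((\int[leb]_(x in (Omega : set T)) (u x * partial i phi x))%R =
     rint (fun x => u x * partial i phi x)) /\
    ((\int[leb]_(x in (Omega : set T)) (g x 0 i * phi x))%R =
     rint (fun x => g x 0 i * phi x)).
  move=> cphi; split; apply: Rintegral_supp => x Ox.
    by rewrite partial_out ?mulr0//; have [_ _ sO] := cphi => /sO.
  by rewrite (C1c_out cphi) ?mulr0.
split=> -[h1 h2 h3]; split => // i phi cphi.
  by have := h3 i phi cphi; have [-> ->] := h i phi cphi.
by have [-> ->] := h i phi cphi; exact: h3.
Qed.

(** For a cutoff [th k], the mollification of f * th k at [x] is the integral of [f] against the
    admissible function th k * mollifier (x - .), hence zero. So f * th k is an L^1 limit of zeros,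
    and every point of Omega is eventually seen by the cutoffs. *)
Lemma fundamental_lemma Omega f : open Omega -> in_L1loc Omega f ->
  (forall phi, C1c Omega phi -> rint (fun x => f x * phi x) = 0) ->
  leb ([set x | Omega x /\ f x != 0] : set T) = 0%E.
Proof.
move=> oO hf h0; have [th [cth th01 thO]] := open_cutoff oO.
have i k := L1loc_C1c hf (cth k).
have z k : leb ([set x | f x * th k x != 0] : set T) = 0%E.
  apply: rint_eq0_null; first exact: i.
  apply/eqP; rewrite eq_le rint_ge0// andbT; apply/ler_addgt0Pr => e e0.
  rewrite add0r; have [d d0 hd] := mollify_L1 (i k) e0.
  have d2 : 0 < d / 2 by rewrite divr_gt0.
  have := hd (d / 2) d2; rewrite ltr_pdivrMr// ltr_pMr// ltr1n => /(_ isT)/ltW.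
  apply: le_trans; rewrite le_eqVlt; apply/orP; left; apply/eqP; congr rint.
  apply/funext => x; rewrite distrC (_ : convol _ _ x = 0) ?subr0//.
  rewrite -[RHS](h0 (fun y => th k y * mollifier (d / 2) (x - y))).
    by congr rint; apply/funext => y; rewrite mulrA.
  exact: C1cMl (cth k) (C1_mollifier_reflect _ _).
apply: leb_subset_null (leb0_bigcup z) => x [Ox fx].
by have [N hN] := thO x Ox; exists N => //=; rewrite hN// mulr1.
Qed.

End weak_gradient.

Section weak_gradient_calculus.
Context {R : realType} {n : nat}.
Local Notation T := (lebesgue_rV R n).
Implicit Types (f u v phi : 'rV[R]_n -> R) (g h : 'rV[R]_n -> 'rV[R]_n).
Implicit Types (x : 'rV[R]_n) (p : R) (K Omega : set 'rV[R]_n) (i : 'I_n).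

Lemma L1locD Omega f f' : in_L1loc Omega f -> in_L1loc Omega f' ->
  in_L1loc Omega (fun x => f x + f' x).
Proof.
move=> /in_L1locP hf /in_L1locP hf'; apply/in_L1locP => K cK KO.
have -> : zext K (fun x => f x + f' x) = zext K f \+ zext K f'.
  by apply/funext => x; rewrite /zext /= mulrDr.
by apply: rintegrableD; [exact: hf|exact: hf'].
Qed.

Lemma L1locN Omega f : in_L1loc Omega f -> in_L1loc Omega (fun x => - f x).
Proof.
move=> /in_L1locP hf; apply/in_L1locP => K cK KO.
have -> : zext K (fun x => - f x) = \- zext K f.
  by apply/funext => x; rewrite /zext /= mulrN.
by apply: rintegrableN; exact: hf.
Qed.

Lemma L1loc_continuous Omega f : continuous f -> in_L1loc Omega f.
Proof.
move=> cf; apply/in_L1locP => K cK _.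
have mK := leb_compact_measurable cK.
have [M [_ hM]] := compact_bounded (continuous_compact (continuous_subspaceT cf) cK).
have mf : measurable_fun (K : set T) f by exact: leb_measurable_continuous.
apply: (@rintegrable_bounded _ _ _ K `|M + 1|).
- exact: (measurable_zext f mK).1.
- exact: mK.
- exact: leb_compact_fin.
- move=> x; rewrite -/(zext K f x); have [Kx|Kx] := pselect (K x).
    rewrite zextE//; apply: le_trans (ler_norm (M + 1)).
    by apply: (hM (M + 1)); [rewrite ltrDl|exists x].
  by rewrite zext_out// normr0.
- by move=> x Kx; exact: zext_out.
Qed.

Lemma is_wgradD Omega u v g h : is_wgrad Omega u g -> is_wgrad Omega v h ->
  is_wgrad Omega (fun x => u x + v x) (fun x => g x + h x).
Proof.
move=> /is_wgradP[u1 g1 ug] /is_wgradP[v1 h1 vh]; apply/is_wgradP; split.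
- exact: L1locD.
- move=> i; under eq_fun do rewrite mxE; exact: L1locD.
- move=> i phi cphi; under eq_fun do rewrite mulrDl.
  under [in RHS]eq_fun do rewrite mxE mulrDl.
  rewrite (rintD (L1loc_partial i u1 cphi) (L1loc_partial i v1 cphi)).
  rewrite (rintD (L1loc_C1c (g1 i) cphi) (L1loc_C1c (h1 i) cphi)).
  by rewrite ug// vh// opprD.
Qed.

Lemma is_wgradN Omega u g : is_wgrad Omega u g ->
  is_wgrad Omega (fun x => - u x) (fun x => - g x).
Proof.
move=> /is_wgradP[u1 g1 ug]; apply/is_wgradP; split.
- exact: L1locN.
- by move=> i; under eq_fun do rewrite mxE; exact: L1locN.
- move=> i phi cphi; under eq_fun do rewrite mulNr.
  under [in RHS]eq_fun do rewrite mxE mulNr.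
  by rewrite (rintN (L1loc_partial i u1 cphi)) (rintN (L1loc_C1c (g1 i) cphi)) ug.
Qed.

Lemma is_wgrad_unique Omega u g h : open Omega ->
  is_wgrad Omega u g -> is_wgrad Omega u h ->
  leb ([set x | Omega x /\ g x != h x] : set T) = 0%E.
Proof.
move=> oO /is_wgradP[u1 g1 ug] /is_wgradP[_ h1 uh].
pose N i := [set x | Omega x /\ g x 0 i - h x 0 i != 0].
have N0 i : leb (N i : set T) = 0%E.
  apply: fundamental_lemma => //; first by apply: L1locD => //; exact: L1locN.
  move=> phi cphi; under eq_fun do rewrite mulrBl.
  rewrite (rintB (L1loc_C1c (g1 i) cphi) (L1loc_C1c (h1 i) cphi)).
  by apply/eqP; rewrite subr_eq0 -eqr_opp -ug// -uh.
pose N' k : set 'rV[R]_n := if insub k is Some i then N i else set0.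
have N'0 k : leb (N' k : set T) = 0%E.
  by rewrite /N'; case: insub => [i|]; [exact: N0|exact: measure0].
apply: leb_subset_null (leb0_bigcup N'0) => x [Ox /eqP gh].
apply: contrapT => hN; apply: gh; apply/rowP => i.
apply/eqP; rewrite -subr_eq0; apply/negP => /negP nz; apply: hN.
by exists i => //; rewrite /N' valK.
Qed.

(** Lets any explicit weak gradient replace the chosen representative under an integral. *)
Lemma wgradE Omega u g : open Omega -> is_wgrad Omega u g ->
  leb ([set x | Omega x /\ wgrad Omega u x != g x] : set T) = 0%E.
Proof.
move=> oO ug; apply: is_wgrad_unique (ug) => //.
exact: (@xgetPex _ (cst 0) [set g | is_wgrad Omega u g] (ex_intro _ g ug)).
Qed.

Lemma is_wgrad_C1c Omega phi : C1c setT phi -> is_wgrad Omega phi (grad phi).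
Proof.
move=> cphi; have [c1 _ _] := cphi; apply/is_wgradP; split.
- by apply: L1loc_continuous; exact: C1_continuous.
- move=> i; under eq_fun do rewrite mxE; apply: L1loc_continuous.
  exact: c1.2.
- move=> i psi cpsi; have cpsi' : C1c setT psi := C1cW (@subsetT _ _) cpsi.
  have i1 := L1loc_partial i (L1loc_continuous (Omega := setT) (C1_continuous c1)) cpsi'.
  have i2 := L1loc_C1c (L1loc_continuous (Omega := setT) (c1.2 i)) cpsi'.
  under [in RHS]eq_fun do rewrite mxE.
  apply/eqP; rewrite -subr_eq0 opprK -(rintD i1 i2); apply/eqP.
  rewrite -(rint_partial0 i (C1cMl cphi (C1c_C1 cpsi))); congr rint.
  apply/funext => x; rewrite (@partialM _ _ i phi psi)//.
  - by rewrite [psi x * _]mulrC.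
  - exact: c1.1.
  - exact: (C1c_C1 cpsi).1.
Qed.

End weak_gradient_calculus.

(** * The Euclidean norm *)

Section euclidean_norm.
Context {R : realType} {n : nat}.
Implicit Types (x y : 'rV[R]_n) (p : R).

Lemma enorm_ge0 x : 0 <= enorm x.
Proof. exact: sqrtr_ge0. Qed.

Lemma enorm_sqr x : enorm x ^+ 2 = \sum_i x 0 i ^+ 2.
Proof. by rewrite sqr_sqrtr// sumr_ge0// => i _; rewrite sqr_ge0. Qed.

Lemma coord_le_enorm x i : `|x 0 i| <= enorm x.
Proof.
rewrite -(@ler_pXn2r _ 2)// ?nnegrE ?enorm_ge0// real_normK ?num_real// enorm_sqr.
by rewrite (bigD1 i)//= lerDl sumr_ge0// => j _; rewrite sqr_ge0.
Qed.

Lemma enorm_le_norm x : enorm x <= n%:R * `|x|.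
Proof.
rewrite -(@ler_pXn2r _ 2)// ?nnegrE ?enorm_ge0 ?mulr_ge0// enorm_sqr.
apply: le_trans (sum_le_const (c := `|x| ^+ 2) _) _.
  move=> i; rewrite -real_normK ?num_real// lerXn2r ?nnegrE//.
  exact: coord_le_norm.
rewrite exprMn ler_wpM2r ?sqr_ge0// -natrX ler_nat.
by case: n => // m; rewrite expnS expn1 leq_pmulr.
Qed.

Lemma norm_le_enorm x : `|x| <= enorm x.
Proof. by apply: norm_le_coord => [|i]; [exact: enorm_ge0|exact: coord_le_enorm]. Qed.

Lemma enorm_le_sum x : enorm x <= \sum_i `|x 0 i|.
Proof.
have h0 : 0 <= \sum_i `|x 0 i| by rewrite sumr_ge0.
rewrite -(@ler_pXn2r _ 2)// ?nnegrE ?enorm_ge0// enorm_sqr.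
rewrite expr2 mulr_suml; apply: ler_sum => i _.
rewrite -real_normK ?num_real// expr2 ler_wpM2l//.
by rewrite (bigD1 i)//= lerDl sumr_ge0.
Qed.

(** The sum is at most [n] times its largest term, whose power occurs on the right. *)
Lemma powR_sum_le (a : 'I_n -> R) p : 0 < p -> (forall i, 0 <= a i) ->
  (\sum_i a i) `^ p <= n%:R `^ p * \sum_i a i `^ p.
Proof.
move=> p0 a0; case: (pickP (fun _ : 'I_n => true)) => [i0 _|n0]; last first.
  rewrite big_pred0// powR0 ?gt_eqF// mulr_ge0 ?powR_ge0//.
  by apply: sumr_ge0 => i _; exact: powR_ge0.
have [i hi] : exists i, forall j, a j <= a i.
  have := @arg_maxP _ _ _ i0 xpredT a isT; case => i _ hi; exists i => j.
  exact: hi.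
apply: le_trans (_ : (n%:R * a i) `^ p <= _).
  by apply: ler_powR_ge0; [exact: ltW|exact: sumr_ge0|exact: sum_le_const].
rewrite powRM// ler_wpM2l ?powR_ge0// (bigD1 i)//= lerDl sumr_ge0// => j _.
exact: powR_ge0.
Qed.

Lemma enorm_powR_le x p : 0 < p ->
  enorm x `^ p <= n%:R `^ p * \sum_i `|x 0 i| `^ p.
Proof.
move=> p0; apply: le_trans (powR_sum_le p0 _) => //.
apply: ler_powR_ge0; [exact: ltW|exact: enorm_ge0|exact: enorm_le_sum].
Qed.

Lemma enormN x : enorm (- x) = enorm x.
Proof. by congr Num.sqrt; apply: eq_bigr => i _; rewrite mxE sqrrN. Qed.

Lemma enorm0 : enorm (0 : 'rV[R]_n) = 0.
Proof. by rewrite /enorm big1 ?sqrtr0// => i _; rewrite mxE expr0n. Qed.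

Lemma enorm_eq0 x : enorm x = 0 -> x = 0.
Proof.
by move=> x0; apply/eqP; rewrite -normr_le0; have := norm_le_enorm x; rewrite x0.
Qed.

Lemma cauchy_schwarz x y : \sum_i x 0 i * y 0 i <= enorm x * enorm y.
Proof.
have [x0|x0] := eqVneq (enorm x) 0.
  rewrite x0 mul0r (enorm_eq0 x0) big1// => i _; by rewrite mxE mul0r.
have [y0|y0] := eqVneq (enorm y) 0.
  rewrite y0 mulr0 (enorm_eq0 y0) big1// => i _; by rewrite mxE mulr0.
have ex : 0 < enorm x by rewrite lt_neqAle eq_sym x0 enorm_ge0.
have ey : 0 < enorm y by rewrite lt_neqAle eq_sym y0 enorm_ge0.
have : 0 <= \sum_i (x 0 i * enorm y - y 0 i * enorm x) ^+ 2.
  by apply: sumr_ge0 => i _; rewrite sqr_ge0.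
have -> : \sum_i (x 0 i * enorm y - y 0 i * enorm x) ^+ 2 =
    2 * (enorm x * enorm y) * (enorm x * enorm y - \sum_i x 0 i * y 0 i).
  have ea := enorm_sqr x; have eb := enorm_sqr y.
  move: (enorm x) (enorm y) ea eb => a b ea eb.
  transitivity ((\sum_i x 0 i ^+ 2) * b ^+ 2 + (\sum_i y 0 i ^+ 2) * a ^+ 2 -
      2 * a * b * \sum_i x 0 i * y 0 i); last by rewrite -ea -eb; ring.
  rewrite !mulr_suml mulr_sumr -big_split/= -sumrB; apply: eq_bigr => i _; ring.
by rewrite pmulr_rge0 ?mulr_gt0// subr_ge0.
Qed.

Lemma enormD x y : enorm (x + y) <= enorm x + enorm y.
Proof.
rewrite -(@ler_pXn2r _ 2)// ?nnegrE ?addr_ge0 ?enorm_ge0// enorm_sqr.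
under eq_bigr do rewrite mxE sqrrD mulr2n.
rewrite !big_split/= sqrrD mulr2n !enorm_sqr lerD2r lerD2l.
by apply: lerD; exact: cauchy_schwarz.
Qed.

Lemma enormZ (c : R) x : enorm (c *: x) = `|c| * enorm x.
Proof.
rewrite /enorm; under eq_bigr do rewrite mxE exprMn.
by rewrite -mulr_sumr sqrtrM ?sqr_ge0// sqrtr_sqr.
Qed.

Lemma enorm_delta i : enorm (delta_mx 0 i : 'rV[R]_n) = 1.
Proof.
rewrite /enorm (bigD1 i)//= big1 => [|j /negPf ji].
  by rewrite mxE !eqxx/= expr1n addr0 sqrtr1.
by rewrite mxE eqxx ji/= expr0n.
Qed.

Lemma continuous_enorm : continuous (@enorm R n).
Proof.
move=> x; apply: (continuous_comp (g := @Num.sqrt R)); last exact: sqrt_continuous.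
have h : C1 (fun x : 'rV[R]_n => \sum_i x 0 i * x 0 i).
  by apply: C1_sum => i; exact: (C1M (C1_coord i) (C1_coord i)).
have -> : (fun x : 'rV[R]_n => \sum_i x 0 i ^+ 2) = (fun x => \sum_i x 0 i * x 0 i).
  by apply/funext => y; apply: eq_bigr => i _; rewrite expr2.
exact: C1_continuous h x.
Qed.

End euclidean_norm.

(** * Sobolev norms and boundary values *)

Section sobolev.
Context {R : realType} {n : nat}.
Local Notation T := (lebesgue_rV R n).
Implicit Types (f u v phi : 'rV[R]_n -> R) (g h : 'rV[R]_n -> 'rV[R]_n).
Implicit Types (x : 'rV[R]_n) (K : set 'rV[R]_n) (i : 'I_n).
Variables (Omega : set 'rV[R]_n) (p : R).
Hypothesis oO : open Omega.
Hypothesis fO : (leb (Omega : set T) < +oo)%E.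
Hypothesis p1 : 1 < p.

Let mO : measurable (Omega : set T). Proof. exact: leb_open_measurable. Qed.
Let p0 : 0 < p. Proof. by rewrite (lt_trans ltr01). Qed.
Let pn0 : p != 0. Proof. by rewrite gt_eqF// p0. Qed.

Definition lpint f : R := rint (fun x => `|zext Omega f x| `^ p).

Lemma lpint_ge0 f : 0 <= lpint f.
Proof. by apply: rint_ge0 => x; exact: powR_ge0. Qed.

Lemma in_Lp_rint f : in_Lp Omega p f -> rintegrable (fun x => `|zext Omega f x| `^ p).
Proof. by move=> /(in_LpP _ mO pn0)[]. Qed.

Lemma in_LpD f f' : in_Lp Omega p f -> in_Lp Omega p f' ->
  in_Lp Omega p (fun x => f x + f' x) /\
  lpint (fun x => f x + f' x) <= 2 `^ p * (lpint f + lpint f').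
Proof.
move=> /(in_LpP _ mO pn0)[mf fi] /(in_LpP _ mO pn0)[mf' fi'].
have e : zext Omega (fun x => f x + f' x) = (fun x => zext Omega f x + zext Omega f' x).
  by apply/funext => x; rewrite /zext mulrDr.
have [i h] := Lp_addle (ltW p0) mf mf' fi fi'.
rewrite /lpint e; split; last exact: h.
apply/(in_LpP _ mO pn0); rewrite e; split; last exact: i.
exact: measurable_funD mf mf'.
Qed.

Lemma in_LpN f : in_Lp Omega p f ->
  in_Lp Omega p (fun x => - f x) /\ lpint (fun x => - f x) = lpint f.
Proof.
move=> /(in_LpP _ mO pn0)[mf fi].
have e : zext Omega (fun x => - f x) = (fun x => - zext Omega f x).
  by apply/funext => x; rewrite /zext mulrN.
have e' : (fun x => `|- zext Omega f x| `^ p) = (fun x => `|zext Omega f x| `^ p).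
  by apply/funext => x; rewrite normrN.
rewrite /lpint e e'; split; last by [].
apply/(in_LpP _ mO pn0); rewrite e e'; split; last exact: fi.
by apply: measurableT_comp mf; exact: oppr_measurable.
Qed.

Lemma in_LpB f f' : in_Lp Omega p f -> in_Lp Omega p f' ->
  in_Lp Omega p (fun x => f x - f' x) /\
  lpint (fun x => f x - f' x) <= 2 `^ p * (lpint f + lpint f').
Proof.
by move=> fi /in_LpN[fi' <-]; have [a b] := in_LpD fi fi'.
Qed.

Lemma in_Lp_C1c phi : C1c setT phi ->
  in_Lp Omega p phi /\ forall i, in_Lp Omega p (partial i phi).
Proof.
move=> cphi; have [M M0 hM] := C1c_bounded cphi; have [c1 _ _] := cphi.
have h f : continuous f -> (forall x, `|f x| <= M) -> in_Lp Omega p f.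
  move=> cf fM; have mf : measurable_fun [set: T] (zext Omega f).
    by apply: (measurable_zext f mO).1; exact: leb_measurable_continuous.
  apply/(in_LpP _ mO pn0); split; first exact: mf.
  apply: (@rintegrable_bounded _ _ _ Omega (M `^ p)).
  - exact: measurable_abs_powR.
  - exact: mO.
  - exact: fO.
  - move=> x; rewrite ger0_norm ?powR_ge0//; apply: ler_powR_ge0 => //; first exact: ltW.
    have [Ox|Ox] := pselect (Omega x); first by rewrite zextE.
    by rewrite zext_out// normr0.
  - by move=> x Ox; rewrite zext_out// normr0 powR0.
split; first by apply: h => [|x]; [exact: C1_continuous|exact: (hM x).1].
by move=> i; apply: h => [|x]; [exact: c1.2|exact: (hM x).2].
Qed.

Lemma in_Lp_enorm g : (forall i, in_Lp Omega p (fun x => g x 0 i)) ->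
  [/\ measurable_fun (Omega : set T) (fun x => enorm (g x)),
      rintegrable (zext Omega (fun x => enorm (g x) `^ p)),
      rint (zext Omega (fun x => enorm (g x) `^ p)) <=
        n%:R `^ p * \sum_i lpint (fun x => g x 0 i) &
      forall i, lpint (fun x => g x 0 i) <=
        rint (zext Omega (fun x => enorm (g x) `^ p))].
Proof.
move=> hg; have ig i := in_Lp_rint (hg i).
have mg : measurable_fun (Omega : set T) (fun x => enorm (g x)).
  apply: (measurable_continuous_comp (G := g : T -> 'rV[R]_n) mO) => [i|].
    exact: (hg i).1.
  exact: continuous_enorm.
have mgp : measurable_fun [set: T] (zext Omega (fun x => enorm (g x) `^ p)).
  apply: (measurable_zext _ mO).1.
  exact: (measurableT_comp (measurable_powR p) mg).
have z0 x : 0 <= zext Omega (fun x => enorm (g x) `^ p) x.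
  by rewrite /zext mulr_ge0 ?powR_ge0// indicE.
have i2 := rintegrableZ (n%:R `^ p) (rintegrable_sum (index_enum _) ig).
have le x : zext Omega (fun x => enorm (g x) `^ p) x <=
    n%:R `^ p * \sum_i `|zext Omega (fun x => g x 0 i) x| `^ p.
  have [Ox|Ox] := pselect (Omega x).
    rewrite zextE//; under eq_bigr do rewrite zextE//.
    exact: enorm_powR_le.
  by rewrite zext_out// mulr_ge0 ?powR_ge0//; apply: sumr_ge0 => i _; exact: powR_ge0.
have i1 : rintegrable (zext Omega (fun x => enorm (g x) `^ p)).
  by apply: (le_rintegrable mgp _ i2) => x; rewrite ger0_norm; [exact: le|exact: z0].
split; [exact: mg|exact: i1| |].
  rewrite -(rint_sum _ ig) -rintZ; last exact: (rintegrable_sum _ ig).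
  exact: (le_rint i1 i2).
move=> i; apply: (le_rint (ig i) i1) => x.
rewrite (_ : _ `^ p = zext Omega (fun x => `|g x 0 i| `^ p) x); last first.
  by rewrite -zext_powR.
rewrite /zext ler_wpM2l ?indicE//.
by apply: ler_powR_ge0; [exact: ltW|by []|exact: coord_le_enorm].
Qed.

(** Comparable, up to constants depending on n and p, to the p-th power of [W1p_norm] when [g] is
    the weak gradient; split into components so that each can be approximated separately. *)
Definition sobnorm u g : R := lpint u + \sum_i lpint (fun x => g x 0 i).

Lemma W1p_norm_le u g : is_wgrad Omega u g -> in_Lp Omega p u ->
  (forall i, in_Lp Omega p (fun x => g x 0 i)) ->
  exists2 N : R, W1p_norm Omega p u = (N `^ p^-1)%:E &
    [/\ 0 <= N, N <= (1 + n%:R `^ p) * sobnorm u g & sobnorm u g <= (1 + n%:R) * N].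
Proof.
move=> wg hu hg; have [me ie le1 le2] := in_Lp_enorm hg.
set N := lpint u + rint (zext Omega (fun x => enorm (g x) `^ p)).
have S0 : 0 <= \sum_i lpint (fun x => g x 0 i).
  by apply: sumr_ge0 => i _; exact: lpint_ge0.
have B0 : 0 <= rint (zext Omega (fun x => enorm (g x) `^ p)).
  by apply: rint_ge0 => x; rewrite /zext mulr_ge0 ?powR_ge0// indicE.
exists N; last first.
  split; first by rewrite addr_ge0// lpint_ge0.
  - rewrite /sobnorm mulrDl mul1r mulrDr addrACA -addrA; apply: lerD => //.
    rewrite addrA (le_trans le1)// lerDr addr_ge0 ?mulr_ge0 ?powR_ge0 ?lpint_ge0//.
  - rewrite /sobnorm /N mulrDl mul1r mulrDr -addrA; apply: lerD => //.
    apply: le_trans (sum_le_const le2) _.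
    by rewrite addrA lerDr addr_ge0// mulr_ge0// lpint_ge0.
rewrite /W1p_norm.
have -> : (\int[leb]_(x in (Omega : set T)) (`|u x| `^ p)%:E = (lpint u)%:E)%E.
  have i0 := in_Lp_rint hu; rewrite (zext_powR _ _ pn0) in i0.
  by rewrite (integral_zext mO i0) /lpint (zext_powR _ _ pn0).
have -> : (\int[leb]_(x in (Omega : set T)) (enorm (wgrad Omega u x) `^ p)%:E =
    (rint (zext Omega (fun x => enorm (g x) `^ p)))%:E)%E.
  have hN : leb ([set x | zext Omega (fun x => enorm (g x) `^ p) x !=
      zext Omega (fun x => enorm (wgrad Omega u x) `^ p) x] : set T) = 0%E.
    apply: leb_subset_null (wgradE oO wg) => x /= h.
    have [Ox|Ox] := pselect (Omega x); last by move: h; rewrite !(zext_out _ Ox) eqxx.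
    by split; [exact: Ox|apply: contraNneq h => e; rewrite /zext e].
  have [iw ew] := rint_null ie hN.
  by rewrite (integral_zext mO iw) ew.
by [].
Qed.

End sobolev.

Section cutoff_compact.
Context {R : realType} {n : nat}.
Local Notation T := (lebesgue_rV R n).
Implicit Types (K U : set 'rV[R]_n) (x : 'rV[R]_n).

(** The indicator of the 2r-neighbourhood of [K], mollified at scale r = e/4, equals 1 within r of
    [K] and 0 beyond 3r. The plateau around [K] is demanded so that the gradient vanishes on [K]. *)
Lemma compact_cutoff K U : compact K -> open U -> K `<=` U ->
  exists2 chi, C1c U chi & exists2 e : R, 0 < e &
    forall x y, K y -> `|x - y| < e -> chi x = 1.
Proof.
move=> cK oU KU; have [e e0 he] := compact_thickening cK oU KU.
pose r := e / 4; have r0 : 0 < r by rewrite divr_gt0.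
pose K2 : set 'rV[R]_n := [set x | exists2 y, K y & `|x - y| <= 2 * r].
have cK2 : compact K2 by exact: thickening_compact.
have mK2 := leb_compact_measurable cK2.
have iK2 : rintegrable (\1_(K2 : set T)).
  by apply: rintegrable_indic; [exact: mK2|exact: leb_compact_fin].
have cm := @C1c_mollifier R n r r0.
have [c1 _] := C1_convol iK2 cm (C1_partial_mollifier r).
exists (convol (\1_(K2 : set T)) (mollifier r)).
  have cK3 : compact [set x | exists2 y, K y & `|x - y| <= e] by exact: thickening_compact.
  apply: (C1cP c1 cK3) => [x [y Ky xy]|x hx]; first exact: he Ky xy.
  rewrite /convol (_ : (fun y => _) = cst 0) ?rint0//; apply/funext => y /=.
  have [xyr|xyr] := ltP `|x - y| r; last by rewrite (mollifier_out r0 xyr) mulr0.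
  rewrite indicE memNset ?mul0r// => -[z Kz yz]; apply: hx; exists z => //.
  rewrite -(subrKA y x (- z)) (le_trans (ler_normD _ _))//.
  by move: xyr yz; rewrite /r; lra.
exists r => // x z Kz xz; have [i3 e3 _ _] := mollifier_shift x r0.
rewrite /convol -[RHS]e3; congr rint; apply/funext => y.
have [xyr|xyr] := ltP `|x - y| r; last by rewrite (mollifier_out r0 xyr) mulr0.
rewrite indicE mem_set ?mul1r//; exists z => //.
rewrite -(subrKA x y (- z)) (le_trans (ler_normD _ _))// distrC.
by move: xyr xz; lra.
Qed.

End cutoff_compact.

Section sobolev_closure.
Context {R : realType} {n : nat}.
Local Notation T := (lebesgue_rV R n).
Implicit Types (f u v phi : 'rV[R]_n -> R) (g h : 'rV[R]_n -> 'rV[R]_n).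
Implicit Types (x : 'rV[R]_n) (K : set 'rV[R]_n) (i : 'I_n).
Variables (Omega : set 'rV[R]_n) (p : R).
Hypothesis oO : open Omega.
Hypothesis fO : (leb (Omega : set T) < +oo)%E.
Hypothesis p1 : 1 < p.

Let mO : measurable (Omega : set T). Proof. exact: leb_open_measurable. Qed.
Let p0 : 0 < p. Proof. by rewrite (lt_trans ltr01). Qed.
Let pn0 : p != 0. Proof. by rewrite gt_eqF// p0. Qed.

(** An explicit gradient travels with the function: [wgrad] chooses a representative arbitrarily, so
    sums of functions would match sums of gradients only almost everywhere. *)
Definition W1p_pair u g : Prop := [/\ is_wgrad Omega u g, in_Lp Omega p u &
  forall i, in_Lp Omega p (fun x => g x 0 i)].

Lemma W1pP u : W1p Omega p u <-> exists g, W1p_pair u g.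
Proof.
split=> [[hu [g wg hg]]|[g [wg hu hg]]]; first by exists g; split.
by split; [exact: hu|exists g].
Qed.

Lemma W1p_pairD u v g h : W1p_pair u g -> W1p_pair v h ->
  W1p_pair (fun x => u x + v x) (fun x => g x + h x) /\
  sobnorm Omega p (fun x => u x + v x) (fun x => g x + h x) <=
    2 `^ p * (sobnorm Omega p u g + sobnorm Omega p v h).
Proof.
move=> [ug hu hg] [vh hv hh]; have [uv le1] := in_LpD oO p1 hu hv.
have gh i := in_LpD oO p1 (hg i) (hh i).
have e i : (fun x => (g x + h x) 0 i) = (fun x => g x 0 i + h x 0 i).
  by apply/funext => x; rewrite mxE.
split; first split.
- exact: is_wgradD ug vh.
- exact: uv.
- by move=> i; rewrite e; exact: (gh i).1.
rewrite /sobnorm addrACA mulrDr; apply: lerD; first exact: le1.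
rewrite -big_split mulr_sumr/=; apply: ler_sum => i _; rewrite e; exact: (gh i).2.
Qed.

Lemma W1p_pairN u g : W1p_pair u g ->
  W1p_pair (fun x => - u x) (fun x => - g x).
Proof.
move=> [ug hu hg]; split; first exact: is_wgradN ug.
  exact: (in_LpN oO p1 hu).1.
move=> i; rewrite (_ : (fun x => _) = (fun x => - g x 0 i)).
  exact: (in_LpN oO p1 (hg i)).1.
by apply/funext => x; rewrite mxE.
Qed.

Lemma W1p_pairB u v g h : W1p_pair u g -> W1p_pair v h ->
  W1p_pair (fun x => u x - v x) (fun x => g x - h x).
Proof. by move=> ug /W1p_pairN vh; exact: (W1p_pairD ug vh).1. Qed.

Lemma W1p_pair_C1c phi : C1c setT phi -> W1p_pair phi (grad phi).
Proof.
move=> cphi; split; first exact: is_wgrad_C1c.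
  exact: (in_Lp_C1c oO fO p1 cphi).1.
move=> i; rewrite (_ : (fun x => _) = partial i phi).
  exact: (in_Lp_C1c oO fO p1 cphi).2 i.
by apply/funext => x; rewrite mxE.
Qed.

Lemma powR_root_lt (N e : R) : 0 <= N -> 0 < e -> (N `^ p^-1 < e) = (N < e `^ p).
Proof.
move=> N0 e0; apply/idP/idP => h.
  rewrite -[N](powRr1 N0) -(mulVf pn0) powRrM.
  by apply: gt0_ltr_powR; rewrite ?nnegrE ?powR_ge0// ltW.
rewrite -[e](powRr1 (ltW e0)) -(mulfV pn0) powRrM.
by apply: gt0_ltr_powR; rewrite ?nnegrE ?powR_ge0 ?invr_gt0.
Qed.

Lemma W1p0P u g : W1p_pair u g -> W1p0 Omega p u <->
  forall e : R, 0 < e -> exists2 phi, C1c Omega phi &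
    sobnorm Omega p (fun x => u x - phi x) (fun x => g x - grad phi x) < e.
Proof.
move=> ug; have up phi : C1c Omega phi ->
    W1p_pair (fun x => u x - phi x) (fun x => g x - grad phi x).
  by move=> cphi; apply: W1p_pairB ug _; apply: W1p_pair_C1c; exact: C1cW cphi.
split=> [[_ h] e e0|h].
  have c0 : 0 < 1 + n%:R :> R by rewrite ltr_wpDr.
  have d0 : 0 < (e / (1 + n%:R)) `^ p^-1 by apply: powR_gt0; exact: divr_gt0.
  have [phi cphi hphi] := h _ d0; exists phi => //.
  have [wg wu hg] := up phi cphi.
  have [N eN [N0 _ le2]] := W1p_norm_le oO p1 wg wu hg.
  apply: le_lt_trans le2 _; rewrite mulrC -ltr_pdivlMr//.
  move: hphi; rewrite eN lte_fin powR_root_lt// -powRrM mulVf// powRr1//.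
  by rewrite divr_ge0// ltW.
split; first by apply/W1pP; exists g.
move=> e e0; have c0 : 0 < 1 + n%:R `^ p :> R by rewrite ltr_wpDr ?powR_ge0.
have ep0 : 0 < e `^ p by apply: powR_gt0.
have [phi cphi hphi] := h _ (divr_gt0 ep0 c0); exists phi => //.
have [wg wu hg] := up phi cphi.
have [N eN [N0 le1 _]] := W1p_norm_le oO p1 wg wu hg.
rewrite eN lte_fin powR_root_lt//.
by apply: le_lt_trans le1 _; rewrite mulrC -ltr_pdivlMr.
Qed.

Lemma W1p0D u v g h : W1p_pair u g -> W1p_pair v h ->
  W1p0 Omega p u -> W1p0 Omega p v -> W1p0 Omega p (fun x => u x + v x).
Proof.
move=> ug vh /(W1p0P ug) hu /(W1p0P vh) hv.
have [uvp _] := W1p_pairD ug vh; apply/(W1p0P uvp) => e e0.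
have c0 : 0 < 2 `^ p :> R by apply: powR_gt0.
have e2 : 0 < e / 2 `^ p / 2 by rewrite !divr_gt0.
have [a ca ha] := hu _ e2; have [b cb hb] := hv _ e2.
exists (a \+ b); first exact: C1cD.
have ap := W1p_pair_C1c (C1cW (@subsetT _ Omega) ca).
have bp := W1p_pair_C1c (C1cW (@subsetT _ Omega) cb).
have [_ le] := W1p_pairD (W1p_pairB ug ap) (W1p_pairB vh bp).
have -> : (fun x => u x + v x - (a \+ b) x) =
    (fun x => u x - a x + (v x - b x)).
  by apply/funext => x /=; rewrite opprD addrACA.
have -> : (fun x => g x + h x - grad (a \+ b) x) =
    (fun x => g x - grad a x + (h x - grad b x)).
  apply/funext => x; rewrite (_ : grad (a \+ b) x = grad a x + grad b x).
    by rewrite opprD addrACA.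
  apply/rowP => i; rewrite !mxE (@partialD _ _ i a b)//.
    exact: (C1c_C1 ca).1.
  exact: (C1c_C1 cb).1.
apply: le_lt_trans le _; rewrite mulrC -ltr_pdivlMr//.
by rewrite (splitr (e / _)); exact: (ltrD ha hb).
Qed.

Lemma in_Lp_zext_supp K f : K `<=` Omega -> (forall x, ~ K x -> f x = 0) ->
  in_Lp Omega p f -> [/\ rintegrable f, rintegrable (fun x => `|f x| `^ p) &
    forall f', (forall x, ~ Omega x -> f' x = 0) ->
      lpint Omega p (fun x => f x - f' x) = rint (fun x => `|f' x - f x| `^ p)].
Proof.
move=> KO f0 hf; have z : zext Omega f = f.
  apply/funext => x; have [Ox|Ox] := pselect (Omega x); first by rewrite zextE.
  by rewrite zext_out// f0// => /KO.
have h := in_Lp_rint oO p1 hf; have h1 := in_Lp_rintegrable mO fO (ltW p1) hf.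
rewrite z in h h1; split; [exact: h1|exact: h|move=> f' f'0].
rewrite /lpint; congr rint; apply/funext => x; rewrite distrC; congr (`|_| `^ p).
have [Ox|Ox] := pselect (Omega x); first by rewrite zextE.
by rewrite zext_out// f'0// f0// ?subrr// => /KO.
Qed.

(** At small scales the mollifications of [w] are supported in Omega, and their partial derivatives
    are the mollifications of the components of [g]; both converge in L^p. *)
Lemma W1p0_compact K w g : compact K -> K `<=` Omega ->
  (forall x, ~ K x -> w x = 0) -> (forall x, ~ K x -> g x = 0) ->
  W1p_pair w g -> W1p0 Omega p w.
Proof.
move=> cK KO w0 g0 wgp; apply/(W1p0P wgp) => e e0.
have [/is_wgradP[_ _ wg] hw hg] := wgp.
have g0i i x : ~ K x -> g x 0 i = 0 by move=> Kx; rewrite g0// mxE.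
have [iw iwp ew] := in_Lp_zext_supp KO w0 hw.
have hgi i := in_Lp_zext_supp KO (g0i i) (hg i).
have [chi cchi [e1 e10 hchi]] := compact_cutoff cK oO KO.
have [e2 e20 he2] := compact_thickening cK oO KO.
(* One share of the error for [w] and one for each of the [n] components of [g]. *)
pose N : R := n%:R + 1; have N0 : 0 < N by rewrite ltr_wpDl.
have eN0 : 0 < e / N by rewrite divr_gt0.
have [d d0 hd] := mollify_Lp (ltW p1) iw iwp eN0.
have hdi i : {di : R | 0 < di & forall r, 0 < r -> r < di ->
    rint (fun x => `|convol (fun x => g x 0 i) (mollifier r) x - g x 0 i| `^ p) < e / N}.
  have [ig igp _] := hgi i; apply: cid2.
  have [di di0 h] := mollify_Lp (ltW p1) ig igp eN0.
  by exists di => // r r0 rd; exact: (h r r0 rd).2.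
pose m := \big[Num.min/Num.min d (Num.min e1 e2)]_i s2val (hdi i).
have m0 : 0 < m.
  rewrite /m; elim/big_ind: _ => [|a b a0 b0|i _].
  - by rewrite !lt_min d0 e10 e20.
  - by rewrite lt_min a0 b0.
  - by case: (hdi i).
pose r := m / 2; have r0 : 0 < r by rewrite divr_gt0.
have rm : r < m by rewrite /r ltr_pdivrMr// ltr_pMr// ltr1n.
have mle : m <= Num.min d (Num.min e1 e2).
  by rewrite /m; exact: bigmin_le_id.
have [rd re1 re2] : [/\ r < d, r < e1 & r < e2].
  by move: (lt_le_trans rm mle); rewrite !lt_min => /and3P[].
have rdi i : r < s2val (hdi i).
  by apply: lt_le_trans rm _; rewrite /m; exact: bigmin_le_cond.
have cm := @C1c_mollifier R n r r0.
have [c1 dc] := C1_convol iw cm (C1_partial_mollifier r).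
pose phi := convol w (mollifier r).
have cK2 : compact [set x | exists2 y, K y & `|x - y| <= e2] by exact: thickening_compact.
have cphi : C1c Omega phi.
  apply: (C1cP c1 cK2) => [x [y Ky xy]|x hx]; first exact: he2 Ky xy.
  rewrite /phi /convol (_ : (fun y => _) = cst 0) ?rint0//; apply/funext => y /=.
  have [xyr|xyr] := ltP `|x - y| r; last by rewrite (mollifier_out r0 xyr) mulr0.
  rewrite w0 ?mul0r// => Ky; apply: hx; exists y => //.
  by apply: ltW; exact: lt_trans xyr re2.
have dphi i x : partial i phi x = convol (fun x => g x 0 i) (mollifier r) x.
  (* The kernel centred at an arbitrary [x] need not be supported in Omega. Multiplied by [chi] it
     is admissible, and nothing changes on [K], where [chi] is 1 with zero gradient and outside of
     which [w] and [g] vanish. *)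
  rewrite dc; have c2 : C1c Omega (fun y => mollifier r (x - y) * chi y).
    exact: (C1cMr (C1_mollifier_reflect r x) cchi).
  have chi1 y : K y -> chi y = 1 by move=> Ky; apply: (hchi y y) => //; rewrite subrr normr0.
  have dchi y : K y -> partial i chi y = 0.
    (* The function chi - 1 has the same derivative and vanishes in a ball around [y], so [y] is off
       its support. *)
    move=> Ky; have := @partialD _ _ i chi (cst (-1)) y ((C1c_C1 cchi).1 y) ((C1_cst _).1 y).
    rewrite partial_cst addr0 => <-; apply: partial_out => sy.
    have [z [/= /eqP cz]] := sy _ (nbhsx_ballx y e1 e10).
    by rewrite -ball_normE/= distrC => /(hchi _ _ Ky) hz; apply: cz; rewrite hz subrr.
  have := wg i _ c2; rewrite /convol.
  have -> : (fun y => w y * partial i (fun y => mollifier r (x - y) * chi y) y) =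
      (fun y => - (w y * partial i (mollifier r) (x - y))).
    apply/funext => y; have [Ky|Ky] := pselect (K y); last by rewrite w0// !mul0r oppr0.
    rewrite (@partialM _ _ i (fun y => mollifier r (x - y)) chi).
    - by rewrite (dchi y Ky) chi1// mulr0 add0r mul1r partial_mollifier_reflect mulrN.
    - exact: (C1_mollifier_reflect r x).1.
    - exact: (C1c_C1 cchi).1.
  have -> : (fun y => g y 0 i * (mollifier r (x - y) * chi y)) =
      (fun y => g y 0 i * mollifier r (x - y)).
    apply/funext => y; have [Ky|Ky] := pselect (K y); last by rewrite g0i// !mul0r.
    by rewrite chi1// mulr1.
  rewrite rintN; last first.
    have [M _ hM] := C1c_bounded cm.
    exact: (convol_rintegrable x iw ((C1c_C1 cm).2 i) (fun z => (hM z).2 i)).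
  by move/oppr_inj.
exists phi; first exact: cphi.
have phi0 x : ~ Omega x -> phi x = 0 by exact: C1c_out.
rewrite /sobnorm (ew phi phi0).
apply: (@lt_le_trans _ _ (e / N + \sum_(i < n) e / N)); last first.
  by rewrite sumr_const card_ord -mulr_natl -[X in X + _]mul1r -mulrDl [1 + _]addrC mulrC divfK// gt_eqF.
apply: ltr_leD; first exact: (hd r r0 rd).2.
apply: ler_sum => i _; have [_ _ eg] := hgi i.
rewrite (_ : (fun x => _) = (fun x => g x 0 i - partial i phi x)); last first.
  by apply/funext => x; rewrite !mxE.
rewrite eg; last first.
  by move=> x Ox; apply: partial_out; have [_ _ sO] := cphi; apply: contra_not Ox => /sO.
apply: ltW; apply: le_lt_trans (_ : _ <= _) _; last first.
  by case: (hdi i) (rdi i) => di di0 h /= rdi'; exact: (h r r0 rdi').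
rewrite le_eqVlt; apply/orP; left; apply/eqP; congr rint; apply/funext => x.
by rewrite dphi.
Qed.

End sobolev_closure.

(** * Deformation of configurations by shears *)

Section shear_inverse.
Context {R : realType} {n : nat}.
Local Notation T := (lebesgue_rV R n).
Implicit Types (f h : 'rV[R]_n -> R) (x y : 'rV[R]_n) (i j : 'I_n) (A U : set 'rV[R]_n).
Variables (k : 'I_n) (psi : 'rV[R]_n -> R).
Hypothesis cpsi : C1c setT psi.
Hypothesis psi2 : forall i, C1 (partial i psi).
Hypothesis psi_small : forall i x, n%:R * `|partial i psi x| <= 2^-1.

Let c1 : C1 psi. Proof. exact: C1c_C1 cpsi. Qed.
Let cont : continuous psi. Proof. exact: C1_continuous. Qed.

Lemma shear_jacobian_bounds x : 2^-1 <= jacobian_shear k psi x <= 2.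
Proof.
(* The existence of an index [k] excludes dimension 0. *)
have n1 : 1 <= n%:R :> R by rewrite ler1n; case: (n) k => // -[].
have := psi_small k x; rewrite /jacobian_shear => h.
have : `|partial k psi x| <= 2^-1 by rewrite (le_trans _ h)// ler_peMl.
by rewrite ler_norml => /andP[]; lra.
Qed.

Lemma shear_jacobian_gt0 x : 0 < jacobian_shear k psi x.
Proof. by have /andP[h _] := shear_jacobian_bounds x; rewrite (lt_le_trans _ h). Qed.

(** So the shear is the identity plus a map of Lipschitz constant 1/2, which makes it injective with
    a Lipschitz inverse. *)
Lemma psi_contraction x y : `|psi x - psi y| <= 2^-1 * `|x - y|.
Proof.
have n1 : 0 < n%:R :> R by rewrite ltr0n; case: (n) k => // -[].
have h i z : `|partial i psi z| <= 2^-1 / n%:R.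
  by rewrite ler_pdivlMr// mulrC.
by have := C1_lipschitz c1 h x y; rewrite [n%:R * _]mulrC divfK// gt_eqF.
Qed.

Lemma norm_delta (s : R) : `|s *: (delta_mx 0 k : 'rV[R]_n)| <= `|s|.
Proof.
apply: norm_le_coord => // i; rewrite !mxE eqxx/=.
by case: eqP => _; rewrite ?mulr1 ?mulr0 ?normr0.
Qed.

Lemma shear_expanding x y : `|x - y| <= 2 * `|shear k psi x - shear k psi y|.
Proof.
have e : x - y = (shear k psi x - shear k psi y) -
    (psi x - psi y) *: (delta_mx 0 k : 'rV[R]_n).
  by rewrite /shear scalerBl; apply/rowP => i; rewrite !mxE; ring.
have := psi_contraction x y; have := norm_delta (psi x - psi y).
have : `|x - y| <= `|shear k psi x - shear k psi y| +
    `|(psi x - psi y) *: (delta_mx 0 k : 'rV[R]_n)|.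
  by rewrite {1}e; exact: ler_normB.
by lra.
Qed.

Lemma shear_inj : injective (shear k psi).
Proof.
move=> x y e; have := shear_expanding x y; rewrite e subrr normr0 mulr0.
by rewrite normr_le0 subr_eq0 => /eqP.
Qed.

(** A one-dimensional problem on the line through [y] in direction k: s + psi (y + s e_k) is
    nonpositive at -M and nonnegative at M. *)
Lemma shear_surj y : exists x, shear k psi x = y.
Proof.
have [M M0 hM] := C1c_bounded cpsi.
pose f (s : R) := s + psi (y + s *: delta_mx 0 k).
have cf : continuous f.
  move=> s; apply: cvgD; first exact: cvg_id.
  apply: (continuous_comp (f := fun s : R => y + s *: (delta_mx 0 k : 'rV[R]_n))).
    by apply: cvgD; [exact: cvg_cst|apply: cvgZl; exact: cvg_id].
  exact: cont.
have hb s : -M <= psi (y + s *: delta_mx 0 k) <= M by rewrite -ler_norml (hM _).1.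
have [|||s _ fs] := @IVT R f (- M) M 0.
- by rewrite ge0_cp.
- exact: continuous_subspaceT.
- have /andP[_ h1] := hb (- M); have /andP[h2 _] := hb M.
  rewrite ge_min le_max; apply/andP; split; apply/orP.
    by left; rewrite /f; lra.
  by right; rewrite /f; lra.
exists (y + s *: delta_mx 0 k); rewrite /shear -addrA -scalerDl -/(f s) fs.
by rewrite scale0r addr0.
Qed.

Definition shear_inv y : 'rV[R]_n := xget 0 [set x | shear k psi x = y].

Lemma shear_invK y : shear k psi (shear_inv y) = y.
Proof. exact: (@xgetPex _ 0 [set x | shear k psi x = y] (shear_surj y)). Qed.

Lemma shearK x : shear_inv (shear k psi x) = x.
Proof. by apply: shear_inj; rewrite shear_invK. Qed.

Lemma shear_id x : psi x = 0 -> shear k psi x = x.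
Proof. by move=> h; rewrite /shear h scale0r addr0. Qed.

Lemma shear_inv_id x : psi x = 0 -> shear_inv x = x.
Proof. by move=> h; rewrite -[in LHS](shear_id h) shearK. Qed.

Lemma continuous_shear_inv : continuous shear_inv.
Proof.
apply: (@lipschitz_continuous R 'rV[R]_n 'rV[R]_n _ 2) => y z.
by have := shear_expanding (shear_inv y) (shear_inv z); rewrite !shear_invK.
Qed.

Let vol := fun U => @shear_volume R n k psi U cpsi (psi2 k) shear_jacobian_gt0.
Let csh : continuous (shear k psi). Proof. exact: continuous_shear. Qed.
Let cJ : continuous (jacobian_shear k psi). Proof. exact: continuous_jacobian_shear. Qed.

(** A Borel null set [N] is the preimage under the shear of its image, so the Jacobian formula gives
    the image measure zero; the Borel sandwich does the rest. *)
Lemma measurable_shear_inv : measurable_fun [set: T] (shear_inv : T -> T).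
Proof.
move=> _ A mA; rewrite setTI; have [B [N [bB bN N0 BN AB]]] := leb_borel_approx mA.
have bB' := borel_preimage continuous_shear_inv bB.
have bN' := borel_preimage continuous_shear_inv bN.
have eN : shear k psi @^-1` (shear_inv @^-1` N) = N.
  by apply/seteqP; split => x /=; rewrite shearK.
have N'0 : leb (shear_inv @^-1` N : set T) = 0%E.
  rewrite -(jacobian_borel csh cJ shear_jacobian_gt0 vol bN') eN.
  apply: null_set_integral (leb_borel_measurable bN) _ N0.
  apply/measurable_EFinP.
  exact: leb_measurable_continuous (leb_borel_measurable bN) cJ.
have mB' := leb_borel_measurable bB'.
have mD : measurable (shear_inv @^-1` A `\` shear_inv @^-1` B : set T).
  apply: leb0_measurable; apply: leb_subset_null N'0 => y [Ay By].
  by have [] := AB _ Ay.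
have mD' : measurable (shear_inv @^-1` B `\` shear_inv @^-1` A : set T).
  apply: leb0_measurable; apply: leb_subset_null N'0 => y [By Ay] /=.
  by apply: contrapT => Ny; apply: Ay; apply: BN.
have -> : shear_inv @^-1` A = (shear_inv @^-1` B `\` (shear_inv @^-1` B `\` shear_inv @^-1` A))
    `|` (shear_inv @^-1` A `\` shear_inv @^-1` B).
  apply/seteqP; split => y /=.
    by have [|] := pselect (B (shear_inv y)); tauto.
  by move=> [[? /not_andP[]//]|[]//]; apply: contrapT.
exact: (measurableU _ _ (measurableD mB' mD') mD).
Qed.

Lemma measurable_shear_image A : measurable (A : set T) ->
  measurable (shear_inv @^-1` A : set T).
Proof. by move=> mA; rewrite -[X in measurable X]setTI; exact: measurable_shear_inv. Qed.

Lemma rint_shear f : rintegrable f ->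
  rint (fun x => f (shear k psi x) * jacobian_shear k psi x) = rint f.
Proof. by move=> fi; have [_ e] := rint_jacobian csh cJ shear_jacobian_gt0 vol fi. Qed.

Lemma rint_shear_inv f : rintegrable f ->
  rintegrable (fun y => f (shear_inv y)) /\
  rint (fun y => f (shear_inv y)) = rint (fun x => f x * jacobian_shear k psi x).
Proof.
move=> fi; have mf : measurable_fun [set: T] (fun y => f (shear_inv y)).
  exact: measurableT_comp (rintegrable_measurable fi) measurable_shear_inv.
have Jb x : `|jacobian_shear k psi x| <= 2.
  by rewrite gtr0_norm ?shear_jacobian_gt0//; have /andP[] := shear_jacobian_bounds x.
have fJ : rintegrable (fun x => f x * jacobian_shear k psi x).
  exact: rintegrableM fi (leb_measurable_continuous measurableT cJ) Jb.
have fi' : rintegrable (fun y => f (shear_inv y)).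
  apply/integrableP; split; first exact/measurable_EFinP.
  have mF : measurable_fun [set: T] (fun y => (`|f (shear_inv y)|)%:E).
    by apply/measurable_EFinP; exact: measurableT_comp mf.
  have := @ge0_jacobian R n _ _ csh cJ shear_jacobian_gt0 vol _ mF (fun y => normr_ge0 _).
  rewrite [X in _ = X](_ : _ = (\int[leb]_x `|(EFin \o (fun y => f (shear_inv y))) x|)%E)// => <-.
  rewrite (eq_integral (fun x : T => (`|f x * jacobian_shear k psi x|)%:E)); last first.
    move=> x _; rewrite /= shearK -EFinM normrM [`|jacobian_shear k psi x|]gtr0_norm//.
    exact: shear_jacobian_gt0.
  by rewrite (rint_fin (rintegrable_abs fJ)) ltry.
split; first exact: fi'.
rewrite -(rint_shear fi').
by congr rint; apply/funext => x; rewrite shearK.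
Qed.

(** The Jacobian is exactly 1 + D_k psi, so there is no higher order term in the change of volume,
    and a prescribed volume will be reached by solving a linear equation. The image of [A] is
    written as its preimage under the inverse. *)
Lemma leb_shear_image A : measurable (A : set T) -> (leb (A : set T) < +oo)%E ->
  measurable (shear_inv @^-1` A : set T) /\
  leb (shear_inv @^-1` A : set T) =
    (fine (leb (A : set T)) + rint (fun x => \1_A x * partial k psi x))%:E.
Proof.
move=> mA fA; have mA' := measurable_shear_image mA.
split; first exact: mA'.
have iA := rintegrable_indic mA fA.
have [iA' eA'] := rint_shear_inv iA.
have e : (fun y => \1_A (shear_inv y)) = \1_(shear_inv @^-1` A : set T) :> ('rV[R]_n -> R).
  by apply/funext => y; rewrite !indicE; congr (_%:R); apply/idP/idP => /set_mem h; apply/mem_set.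
rewrite e in iA' eA'.
have fA' : (leb (shear_inv @^-1` A : set T) < +oo)%E.
  have := rint_fin iA'; rewrite (@integral_indic _ _ _ _ _ measurableT _ mA') setIT => ->.
  by rewrite ltry.
rewrite -[LHS]fineK; last by rewrite ge0_fin_numE.
rewrite -(rint_indic mA') eA'; congr (_%:E); rewrite -(rint_indic mA).
have ip : rintegrable (fun x => \1_A x * partial k psi x).
  apply: (rintegrableM iA (M := 2^-1)).
    by apply: leb_measurable_continuous => //; exact: c1.2.
  move=> x; rewrite (le_trans _ (psi_small k x))// ler_peMl//.
  by rewrite ler1n; case: (n) k => // -[].
rewrite -(rintD iA ip); congr rint; apply/funext => x.
by rewrite /jacobian_shear mulrDr mulr1.
Qed.

Variable Omega : set 'rV[R]_n.
Hypothesis psi_out : forall x, ~ Omega x -> psi x = 0.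

(** Points outside Omega are fixed, so by injectivity no point of Omega can be sent there. *)
Lemma shear_preserves x : Omega (shear k psi x) <-> Omega x.
Proof.
split=> [h|h]; apply: contrapT => Ox.
  by move: h; rewrite shear_id//; exact: psi_out.
have := shear_id (psi_out Ox) => /shear_inj e; move: Ox.
by rewrite e.
Qed.

Lemma shear_inv_preserves y : Omega (shear_inv y) <-> Omega y.
Proof. by rewrite -shear_preserves shear_invK. Qed.

Lemma zext_shear_inv f : zext Omega (f \o shear_inv) = zext Omega f \o shear_inv.
Proof.
apply/funext => y /=; have [Oy|Oy] := pselect (Omega y).
  by rewrite !zextE//; exact/shear_inv_preserves.
by rewrite !zext_out// => /shear_inv_preserves.
Qed.

End shear_inverse.

(** * Perimeter and test fields *)

Section perimeter_lemmas.
Context {R : realType} {n : nat}.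
Local Notation T := (lebesgue_rV R n).
Implicit Types (x y : 'rV[R]_n) (i j : 'I_n) (A Omega : set 'rV[R]_n) (X : 'rV[R]_n -> 'rV[R]_n).

Definition test_field Omega X : Prop :=
  (forall i, C1c Omega (fun x => X x 0 i)) /\ (forall x, enorm (X x) <= 1).

Lemma div_rintegrable Omega X A : measurable (A : set T) ->
  (forall i, C1c Omega (fun x => X x 0 i)) ->
  rintegrable (fun x => \1_A x * div X x).
Proof.
move=> mA cX; have id_ : rintegrable (div X).
  by apply: rintegrable_sum => i; exact: partial_rintegrable (cX i).
under eq_fun do rewrite mulrC; apply: (rintegrableM id_ (M := 1)).
  exact: measurable_indic.
by move=> x; rewrite indicE; case: (_ \in _); rewrite ?normr1 ?normr0.
Qed.

Lemma integral_div Omega X A : measurable (A : set T) ->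
  (forall i, C1c Omega (fun x => X x 0 i)) ->
  (\int[leb]_(x in (A : set T)) (div X x)%:E = (rint (fun x => \1_A x * div X x))%:E)%E.
Proof. by move=> mA cX; exact: integral_zext mA (div_rintegrable mA cX). Qed.

Lemma perimeter_ge Omega A X : measurable (A : set T) -> test_field Omega X ->
  ((rint (fun x => \1_A x * div X x))%:E <= perimeter A Omega)%E.
Proof.
move=> mA hX; rewrite -(integral_div mA hX.1).
by apply: ereal_sup_ubound; exists X.
Qed.

Lemma perimeter_le Omega A (c : \bar R) : measurable (A : set T) ->
  (forall X, test_field Omega X -> ((rint (fun x => \1_A x * div X x))%:E <= c)%E) ->
  (perimeter A Omega <= c)%E.
Proof.
move=> mA h; apply: ge_ereal_sup => _ [X hX <-].
by rewrite (integral_div mA hX.1); exact: h.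
Qed.

Lemma test_field0 Omega : test_field Omega (cst 0).
Proof.
split=> [i|x]; last by rewrite enorm0.
rewrite (_ : (fun _ => _) = cst 0); first exact: C1c0.
by apply/funext => x; rewrite mxE.
Qed.

Lemma divZ X (c : R) x : (forall i, C1 (fun x => X x 0 i)) ->
  div (fun x => c *: X x) x = c * div X x.
Proof.
move=> cX; rewrite /div mulr_sumr; apply: eq_bigr => i _.
rewrite (_ : (fun y => _) = cst c \* (fun y => X y 0 i)); last first.
  by apply/funext => y; rewrite mxE.
rewrite (@partialM _ _ i (cst c) (fun y => X y 0 i)).
- by rewrite partial_cst mulr0 addr0.
- exact: (C1_cst _).1.
- exact: (cX i).1.
Qed.

Lemma perimeter_ge0 Omega A : measurable (A : set T) -> (0 <= perimeter A Omega)%E.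
Proof.
move=> mA; have := perimeter_ge mA (test_field0 Omega).
rewrite (_ : (fun x => _) = cst 0) ?rint0//; apply/funext => x.
rewrite /div big1 ?mulr0// => i _; rewrite (_ : (fun _ => _) = cst 0) ?partial_cst//.
by apply/funext => y; rewrite mxE.
Qed.

(** By homogeneity: a field bounded by [c] is [c] times an admissible one. *)
Lemma perimeter_scaled Omega A X (c M : R) : measurable (A : set T) -> 0 < c ->
  (forall i, C1c Omega (fun x => X x 0 i)) -> (forall x, enorm (X x) <= c) ->
  (perimeter A Omega <= M%:E)%E -> rint (fun x => \1_A x * div X x) <= c * M.
Proof.
move=> mA c0 cX Xc PM; rewrite -ler_pdivrMl// -lee_fin; apply: le_trans PM.
have cX1 i : C1 (fun x => X x 0 i) by exact: C1c_C1 (cX i).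
have := @perimeter_ge Omega A (fun x => c^-1 *: X x) mA.
have -> : (fun x => \1_A x * div (fun x => c^-1 *: X x) x) =
    (fun x => c^-1 * (\1_A x * div X x)).
  by apply/funext => x; rewrite divZ// mulrCA.
rewrite (rintZ _ (div_rintegrable mA cX)); apply; split => [i|x].
  rewrite (_ : (fun x => _) = (fun x => c^-1 * X x 0 i)); first exact: C1cZ.
  by apply/funext => x; rewrite mxE.
rewrite enormZ ger0_norm ?invr_ge0 ?(ltW c0)//.
by rewrite ler_pdivrMl// mulr1.
Qed.

End perimeter_lemmas.

(** * Transport of sets and Sobolev functions by a shear *)

Section deformation.
Context {R : realType} {n : nat}.
Local Notation T := (lebesgue_rV R n).
Implicit Types (v phi : 'rV[R]_n -> R) (g : 'rV[R]_n -> 'rV[R]_n).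
Implicit Types (x y : 'rV[R]_n) (i j m : 'I_n) (A : set 'rV[R]_n).
Variables (k : 'I_n) (psi : 'rV[R]_n -> R) (Omega : set 'rV[R]_n) (p : R).
Hypothesis oO : open Omega.
Hypothesis fO : (leb (Omega : set T) < +oo)%E.
Hypothesis p1 : 1 < p.
Hypothesis cpsi : C1c Omega psi.
Hypothesis psi2 : forall i, C1 (partial i psi).
Hypothesis psiC : forall i j, partial j (partial i psi) = partial i (partial j psi).
Hypothesis psi_small : forall i x, n%:R * `|partial i psi x| <= 2^-1.

Let mO : measurable (Omega : set T). Proof. exact: leb_open_measurable. Qed.
Let p0 : 0 < p. Proof. by rewrite (lt_trans ltr01). Qed.
Let pn0 : p != 0. Proof. by rewrite gt_eqF// p0. Qed.
Let cpsiT : C1c setT psi. Proof. exact: C1cW cpsi. Qed.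
Let c1 : C1 psi. Proof. exact: C1c_C1 cpsi. Qed.
Local Notation Phi := (shear k psi).
Local Notation Psi := (shear_inv k psi).
Local Notation J := (jacobian_shear k psi).
Let PsiK x : Psi (Phi x) = x. Proof. exact: shearK. Qed.
Let PhiK y : Phi (Psi y) = y. Proof. exact: shear_invK. Qed.

Lemma C1_jacobian : C1 J.
Proof. exact: (C1D (C1_cst 1) (psi2 k)). Qed.

Lemma partial_jacobian j x : partial j J x = partial j (partial k psi) x.
Proof.
rewrite (@partialD _ _ j (cst 1) (partial k psi)).
- by rewrite partial_cst add0r.
- exact: (C1_cst _).1.
- exact: (psi2 k).1.
Qed.

(* the cofactor identity behind the Piola transform of the test function [phi] *)
Lemma piola_shear phi j x : C1 phi ->
  partial j phi (Phi x) * J x =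
  partial j (J \* (phi \o Phi)) x - partial k (partial j psi \* (phi \o Phi)) x.
Proof.
move=> cphi; have cp := C1_shear k c1 cphi.
rewrite (@partialM _ _ j J (phi \o Phi)); [|exact: C1_jacobian.1|exact: cp.1].
rewrite (@partialM _ _ k (partial j psi) (phi \o Phi)); [|exact: (psi2 j).1|exact: cp.1].
rewrite partial_jacobian (psiC k j) !partial_shear; try exact: c1.1; try exact: cphi.1.
rewrite /jacobian_shear /=.
move: (partial j phi _) (partial k phi _) (phi _) (partial k psi x) (partial j psi x).
by move: (partial k (partial j psi) x) => a b c d e f; ring.
Qed.

Lemma C1c_jacobian_shear phi : C1c Omega phi -> C1c Omega (J \* (phi \o Phi)).
Proof. by move=> cphi; apply: C1cMr C1_jacobian _; exact: C1c_shear. Qed.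

Lemma C1c_partial_shear phi j : C1c Omega phi ->
  C1c Omega (partial j psi \* (phi \o Phi)).
Proof. by move=> cphi; apply: C1cMr (psi2 j) _; exact: C1c_shear. Qed.

(** A test field for the image of [A] is pulled back to [A] by the Piola transform, which turns its
    divergence into the composed divergence times the Jacobian. The pulled back field has length at
    most J + c, hence at most 1 + 2 c. *)
Lemma perimeter_shear A (c M : R) : measurable (A : set T) ->
  (forall x, \sum_i `|partial i psi x| <= c) ->
  (perimeter A Omega <= M%:E)%E ->
  (perimeter (Psi @^-1` A) Omega <= ((1 + 2 * c) * M)%:E)%E.
Proof.
move=> mA hc PM.
have mA' : measurable (Psi @^-1` A : set T).
  exact: (measurable_shear_image k cpsiT psi2 psi_small mA).
have c0 : 0 <= c.
  by apply: le_trans (hc 0); apply: sumr_ge0.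
apply: (perimeter_le mA') => X [cX X1].
(* The Jacobian times the inverse of the differential I + e_k (grad psi)^T, applied to [X] at
   [Phi x]. *)
pose Xs x : 'rV[R]_n := \row_j (J x * X (Phi x) 0 j) -
   (\sum_m partial m psi x * X (Phi x) 0 m) *: delta_mx 0 k.
have XsE j : (fun x => Xs x 0 j) = (fun x => (J \* ((fun y => X y 0 j) \o Phi)) x +
    - ((j == k)%:R * \sum_m (partial m psi \* ((fun y => X y 0 m) \o Phi)) x)).
  by apply/funext => x; rewrite !mxE eqxx/=; congr (_ - _); rewrite mulrC.
have cXs j : C1c Omega (fun x => Xs x 0 j).
  rewrite XsE; apply: C1cB; first exact: C1c_jacobian_shear (cX j).
  apply: C1cZ; apply: C1c_sum => m; exact: C1c_partial_shear (cX m).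
have divXs x : div Xs x = div X (Phi x) * J x.
  rewrite /div mulr_suml; under [RHS]eq_bigr => i _ do rewrite (piola_shear i x (C1c_C1 (cX i))).
  rewrite sumrB.
  have -> : \sum_i partial i (fun y => Xs y 0 i) x = \sum_i
      (partial i (J \* ((fun y => X y 0 i) \o Phi)) x -
       (i == k)%:R * \sum_m partial k (partial m psi \* ((fun y => X y 0 m) \o Phi)) x).
    apply: eq_bigr => i _; rewrite XsE.
    have cs : C1 (fun x => \sum_m (partial m psi \* ((fun y => X y 0 m) \o Phi)) x).
      by apply: C1_sum => m; exact: C1c_C1 (C1c_partial_shear m (cX m)).
    have csi := C1M (C1_cst ((i == k)%:R : R)) cs.
    have cJ := C1c_C1 (C1c_jacobian_shear (cX i)).
    rewrite (@partialD _ _ i (J \* ((fun y => X y 0 i) \o Phi))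
      (\- (cst (i == k)%:R \* (fun x => \sum_m (partial m psi \* ((fun y => X y 0 m) \o Phi)) x)))).
    - rewrite (partialN _ (csi.1 x)); congr (_ - _).
      rewrite (@partialM _ _ i (cst _)); [|exact: (C1_cst _).1|exact: cs.1].
      rewrite partial_cst mulr0 addr0 /=; case: eqP => [->|_]; last by rewrite !mul0r.
      congr (_ * _); have cm m : C1 (partial m psi \* ((fun y => X y 0 m) \o Phi)).
        by exact: C1c_C1 (C1c_partial_shear m (cX m)).
      exact: (partial_sum (index_enum _) k x cm).
    - exact: cJ.1.
    - exact: (C1N csi).1.
  rewrite sumrB; congr (_ - _).
  rewrite (bigD1 k)//= eqxx mul1r [X in _ + X]big1 ?addr0// => i /negPf ->.
  by rewrite mul0r.
have -> : rint (fun x => \1_(Psi @^-1` A) x * div X x) = rint (fun x => \1_A x * div Xs x).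
  have iX := div_rintegrable mA' cX.
  have e := rint_shear k cpsiT psi2 psi_small iX.
  rewrite -e; congr rint; apply/funext => x; rewrite divXs mulrA; congr (_ * _ * _).
  by rewrite !indicE; have [Ax|Ax] := pselect (A x);
    [rewrite !mem_set//=|rewrite !memNset//=]; rewrite PsiK.
rewrite lee_fin; apply: (perimeter_scaled mA _ cXs _ PM).
  by rewrite ltr_wpDr// mulr_ge0.
move=> x; have XJ : \row_j (J x * X (Phi x) 0 j) = J x *: X (Phi x).
  by apply/rowP => j; rewrite !mxE.
rewrite /Xs XJ (le_trans (enormD _ _))// enormN !enormZ enorm_delta mulr1.
have J0 : 0 < J x by exact: (shear_jacobian_gt0 k psi_small x).
have J1 : J x <= 1 + c.
  rewrite /jacobian_shear lerD2l (le_trans (ler_norm _))// (le_trans _ (hc x))//.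
  by rewrite (bigD1 k)//= lerDl sumr_ge0.
have h1 : `|J x| * enorm (X (Phi x)) <= 1 + c.
  by rewrite gtr0_norm// (le_trans _ J1)// ler_piMr// ltW.
have h2 : `|\sum_m partial m psi x * X (Phi x) 0 m| <= c.
  apply: le_trans (ler_norm_sum _ _ _) _; apply: le_trans (hc x).
  apply: ler_sum => m _; rewrite normrM ler_piMr//.
  exact: le_trans (coord_le_enorm _ _) (X1 _).
by have := lerD h1 h2; rewrite -addrA mulr_natl mulr2n.
Qed.

Lemma in_Lp_L1loc v : in_Lp Omega p v -> in_L1loc Omega v.
Proof.
move=> hv; have iv := in_Lp_rintegrable mO fO (ltW p1) hv.
apply/in_L1locP => K cK KO; have mK := leb_compact_measurable cK.
have -> : zext K v = zext Omega v \* (\1_(K : set T)).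
  apply/funext => x /=; rewrite indicE; have [Kx|Kx] := pselect (K x).
    by rewrite mem_set// mulr1 !zextE//; exact: KO.
  by rewrite memNset// mulr0 zext_out.
apply: (rintegrableM iv (M := 1)); first exact: measurable_indic.
by move=> x; rewrite indicE; case: (_ \in _); rewrite ?normr1 ?normr0.
Qed.

Lemma in_LpMl v (h : 'rV[R]_n -> R) (M : R) : continuous h ->
  (forall x, `|h x| <= M) -> in_Lp Omega p v -> in_Lp Omega p (fun x => h x * v x).
Proof.
move=> ch hM /(in_LpP _ mO pn0)[mv iv]; have mh : measurable_fun [set: T] h.
  exact: leb_measurable_continuous.
have e : zext Omega (fun x => h x * v x) = (fun x => h x * zext Omega v x).
  by apply/funext => x; rewrite /zext mulrCA.
apply/(in_LpP _ mO pn0); rewrite e; have m1 := measurable_funM mh mv.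
split; first exact: m1.
apply: (le_rintegrable (measurable_abs_powR p m1) _ (rintegrableZ (M `^ p) iv)) => x.
rewrite ger0_norm ?powR_ge0// normrM powRM// ler_wpM2r ?powR_ge0//.
exact: ler_powR_ge0 (ltW p0) (normr_ge0 _) (hM x).
Qed.

Let psi_out x : ~ Omega x -> psi x = 0. Proof. exact: C1c_out. Qed.

Lemma in_Lp_shear v : in_Lp Omega p v -> in_Lp Omega p (v \o Psi).
Proof.
move=> /(in_LpP _ mO pn0)[mv iv]; apply/(in_LpP _ mO pn0).
have e := zext_shear_inv k cpsiT psi_small psi_out v.
split.
  rewrite e; exact: measurableT_comp mv (measurable_shear_inv k cpsiT psi2 psi_small).
rewrite e; exact: (rint_shear_inv k cpsiT psi2 psi_small iv).1.
Qed.

(* the gradient of [v \o Psi] at [Phi x], when [g] is the gradient of [v] *)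
Definition pull_gradient g x : 'rV[R]_n :=
  g x - (g x 0 k / J x) *: grad psi x.

Lemma pull_gradientE g x j : pull_gradient g x 0 j =
  g x 0 j - partial j psi x / J x * g x 0 k.
Proof. by rewrite !mxE; congr (_ - _); rewrite mulrC mulrA mulrAC. Qed.

Lemma in_Lp_pull_gradient g : (forall i, in_Lp Omega p (fun x => g x 0 i)) ->
  forall i, in_Lp Omega p (fun x => pull_gradient g x 0 i).
Proof.
move=> hg j; have J0 x : 0 < J x by exact: (shear_jacobian_gt0 k psi_small x).
have cJ := C1_continuous C1_jacobian.
have cJi : continuous (fun x => (J x)^-1).
  by move=> x; exact: (cvgV (lt0r_neq0 (J0 x)) (cJ x)).
have [M _ hM] := C1c_bounded cpsi.
have -> : (fun x => pull_gradient g x 0 j) =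
    (fun x => g x 0 j - partial j psi x / J x * g x 0 k).
  by apply/funext => x; exact: pull_gradientE.
apply: (in_LpB oO p1 (hg j) _).1; apply: (@in_LpMl _ _ (M * 2) _ _ (hg k)).
  exact: (continuous_mul (c1.2 j) cJi).
move=> x; rewrite normrM ler_pM//; first exact: (hM x).2.
rewrite gtr0_norm ?invr_gt0// -[2]invrK lef_pV2 ?posrE ?invr_gt0//.
by have /andP[] := shear_jacobian_bounds k psi_small x.
Qed.

(** In the weak formulation after the change of variables, the Piola identity writes the derivative
    of the test function as D_j a - D_k b with [a] and [b] admissible, so that the weak gradient of
    [v] can be used on both terms. *)
Lemma shear_pair v g : W1p_pair Omega p v g ->
  W1p_pair Omega p (v \o Psi) (pull_gradient g \o Psi).
Proof.
move=> [vg hv hg]; have J0 x : 0 < J x by exact: (shear_jacobian_gt0 k psi_small x).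
have hpg := in_Lp_pull_gradient hg.
have hv' := in_Lp_shear hv; have hg' j := in_Lp_shear (hpg j).
split; [|exact: hv'|exact: hg'].
have /is_wgradP[lv lg wg] := vg.
apply/is_wgradP; split; [exact: in_Lp_L1loc hv'|by move=> i; exact: in_Lp_L1loc (hg' i)|].
move=> j phi cphi; have cphi1 := C1c_C1 cphi; have csh := C1c_shear k cpsi cphi.
have csh' : continuous Phi by apply: continuous_shear; exact: C1_continuous.
pose a := J \* (phi \o Phi); pose b := partial j psi \* (phi \o Phi).
have ca : C1c Omega a by exact: C1c_jacobian_shear.
have cb : C1c Omega b by exact: C1c_partial_shear.
pose h x := v x * partial j phi (Phi x).
pose h2 x := pull_gradient g x 0 j * phi (Phi x).
have ih : rintegrable h.
  have [c2 cs sO] := cphi.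
  have cK : compact (Psi @` supp phi).
    apply: continuous_compact cs; apply: continuous_subspaceT.
    exact: continuous_shear_inv.
  apply: (L1loc_mul lv cK) => [_ [y sy <-]||x Kx].
  - exact/(shear_inv_preserves k cpsiT psi_small psi_out)/sO.
  - move=> x; apply: continuous_comp; last exact: c2.2.
    exact: (csh' x).
  - by apply: partial_out => sx; apply: Kx; exists (Phi x).
have ih2 : rintegrable h2 by exact: L1loc_C1c (in_Lp_L1loc (hpg j)) csh.
have -> : (fun y => (v \o Psi) y * partial j phi y) = (fun y => h (Psi y)).
  by apply/funext => y; rewrite /h PhiK.
have -> : (fun y => (pull_gradient g \o Psi) y 0 j * phi y) = (fun y => h2 (Psi y)).
  by apply/funext => y; rewrite /h2 PhiK.
rewrite (rint_shear_inv k cpsiT psi2 psi_small ih).2.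
rewrite (rint_shear_inv k cpsiT psi2 psi_small ih2).2.
have -> : (fun x => h x * J x) = (fun x => v x * partial j a x - v x * partial k b x).
  by apply/funext => x; rewrite /h -mulrA (piola_shear j x cphi1) mulrBr.
have -> : (fun x => h2 x * J x) = (fun x => g x 0 j * a x - g x 0 k * b x).
  apply/funext => x; rewrite /h2 pull_gradientE /a /b /=; have := J0 x.
  move: (J x) (g x 0 j) (g x 0 k) (partial j psi x) (phi _) => s t u w z s0.
  by field; rewrite gt_eqF.
rewrite (rintB (L1loc_partial j lv ca) (L1loc_partial k lv cb)).
rewrite (rintB (L1loc_C1c (lg j) ca) (L1loc_C1c (lg k) cb)).
by rewrite (wg j a ca) (wg k b cb) opprB opprK addrC.
Qed.

(** The deformed function and its gradient differ from those of [v] only on the compact support of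
    [psi], so the difference lies in [W1p0] and the boundary values are kept. *)
Lemma shear_W1p0 v g u0 h : W1p_pair Omega p v g -> W1p_pair Omega p u0 h ->
  W1p0 Omega p (v \- u0) -> W1p0 Omega p ((v \o Psi) \- u0).
Proof.
move=> vg u0h h0; have vg' := shear_pair vg.
have [_ cs sO] := cpsi.
have out x : ~ supp psi x -> Psi x = x.
  by move=> sx; apply: (shear_inv_id k cpsiT psi_small); exact: supp_out.
have d0 : W1p0 Omega p (fun x => (v \o Psi) x - v x).
  apply: (W1p0_compact oO fO p1 cs sO _ _ (W1p_pairB oO p1 vg' vg)) => x sx /=.
    by rewrite out// subrr.
  rewrite out// /pull_gradient (_ : grad psi x = 0) ?scaler0 ?subr0 ?subrr//.
  by apply/rowP => i; rewrite !mxE partial_out.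
have e : (v \o Psi) \- u0 = (fun x => ((v \o Psi) x - v x) + (v x - u0 x)).
  by apply/funext => x /=; rewrite subrKA.
rewrite e; apply: (W1p0D oO fO p1 (W1p_pairB oO p1 vg' vg) (W1p_pairB oO p1 vg u0h) d0).
exact: h0.
Qed.

End deformation.

(** * Quasiconvexity *)

Section oscillation.
Context {R : realType} {n : nat}.
Local Notation T := (lebesgue_rV R n).
Implicit Types (x y z w zeta : 'rV[R]_n) (H eta : 'rV[R]_n -> R) (K : set 'rV[R]_n) (i : 'I_n).

(** One of the two points may leave [K], as a perturbed gradient does later. *)
Lemma compact_unif_continuous H K (e : R) : continuous H -> compact K -> 0 < e ->
  exists2 d : R, 0 < d & forall x y, K y -> `|x - y| <= d -> `|H x - H y| <= e.
Proof.
move=> cH cK e0; have /compact_near_coveringP := cK.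
move=> /(_ R (0 : R)^'+ (fun d y => forall x, `|x - y| <= d -> `|H x - H y| <= e) _).
have hK : forall y, K y -> \forall y' \near y & d \near (0 : R)^'+,
    forall x, `|x - y'| <= d -> `|H x - H y'| <= e.
  move=> y Ky; have e2 : 0 < e / 2 by rewrite divr_gt0.
  have /cvgrPdist_le/(_ _ e2)/nbhs_ballP[d /= d0 yd] := cH y.
  have d2 : 0 < d / 2 by rewrite divr_gt0.
  exists (ball y (d / 2), [set e | e < d / 2]) => /=.
    by split; [exact: nbhsx_ballx|exact: nbhs_right_lt].
  move=> [y' d'] [/= By' dd] x xy'.
  move: By'; rewrite mx_norm_ball /ball_ /= => By'.
  have h1 : `|H y - H y'| <= e / 2.
    apply: yd; rewrite mx_norm_ball /ball_ /=.
    by rewrite (lt_trans By')// ltr_pdivrMr// ltr_pMr// ltr1n.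
  have h2 : `|H y - H x| <= e / 2.
    apply: yd; rewrite mx_norm_ball /ball_ /=.
    rewrite -(subrKA y' y (- x)) (le_lt_trans (ler_normD _ _))//.
    by rewrite [ltRHS]splitr ltrD// distrC (le_lt_trans xy').
  rewrite -(subrKA (H y) (H x) (- H y')) (le_trans (ler_normD _ _))//.
  by rewrite [leRHS]splitr lerD// distrC.
move=> /(_ hK) h.
have {}h : \forall d \near (0 : R)^'+, forall y x, K y -> `|x - y| <= d -> `|H x - H y| <= e.
  by apply: filterS h => d hd y x Ky; exact: hd.
near (0 : R)^'+ => d; exists d; first by near: d; exact: nbhs_right_gt.
by move=> x y; move: y x; near: d.
Unshelve. all: by end_near. Qed.

(* disjoint translates of a bounded piece of [N] all fit in one fixed ball *)
Lemma leb0_transversal (N : set 'rV[R]_n) w : measurable (N : set T) ->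
  (forall x (t : R), `|t| <= 1 -> N x -> N (x + t *: w) -> t = 0) -> leb (N : set T) = 0%E.
Proof.
move=> mN hN.
have bd (r : R) : leb (N `&` nball r : set T) = 0%E.
  set f := \1_(N `&` nball r : set T) : 'rV[R]_n -> R.
  have mb : measurable (nball r : set T) by exact/leb_closed_measurable/closed_nball.
  have mNr : measurable (N `&` nball r : set T) by exact: measurableI.
  have fin B : B `<=` nball r -> (leb (B : set T) < +oo)%E.
    by move=> /le_leb h; exact: le_lt_trans h (leb_ball_fin _).
  have fi : rintegrable f by apply: rintegrable_indic mNr (fin _ _); exact: subIsetr.
  have f0 x : 0 <= f x by rewrite /f indicE.
  have V := rintegrable_indic (leb_closed_measurable (@closed_nball R n (r + `|w|)))
    (leb_ball_fin _).
  have key (k : nat) : k%:R * rint f <= rint (\1_(nball (r + `|w|) : set T)).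
    have ti (i : 'I_k) := rint_translate (- (i%:R / k%:R *: w)) fi.
    have -> : k%:R * rint f = rint (fun x => \sum_(i < k) f (x - i%:R / k%:R *: w)).
      rewrite (rint_sum _ (fun i : 'I_k => (ti i).1)).
      under eq_bigr do rewrite (ti _).2.
      by rewrite sumr_const card_ord mulr_natl.
    apply: (le_rint (rintegrable_sum _ (fun i : 'I_k => (ti i).1)) V) => x.
    (* Two translates containing [x] would give two points of [N] on a line along [w] with
       parameters at most 1 apart, so at most one term of the sum is nonzero. *)
    have [[i0 hi0]|hno] := pselect (exists i0 : 'I_k, (N `&` nball r) (x - i0%:R / k%:R *: w)).
      rewrite (bigD1 i0)//= big1 ?addr0.
        rewrite /f indicE mem_set// indicE mem_set// /nball/=.
        rewrite -(subrK (i0%:R / k%:R *: w) x) (le_trans (ler_normD _ _))// lerD//.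
          exact: hi0.2.
        rewrite normrZ ger0_norm ?divr_ge0// ler_piMl//.
        by rewrite ler_pdivrMr ?mul1r ?ler_nat ?ltr0n ?(leq_ltn_trans _ (ltn_ord i0))// ltnW.
      move=> i ii0; rewrite /f indicE memNset// => -[Ni _].
      have kn0 : (k%:R : R) != 0 by rewrite pnatr_eq0 -lt0n (leq_ltn_trans _ (ltn_ord i0)).
      have k0 : 0 < k%:R :> R by rewrite lt_neqAle eq_sym kn0/=.
      have t1 : `|i%:R / k%:R - i0%:R / k%:R| <= 1 :> R.
        rewrite -mulrBl normrM [`|_^-1|]gtr0_norm ?invr_gt0// ler_pdivrMr// mul1r ler_norml.
        have : (i%:R : R) <= k%:R by rewrite ler_nat ltnW.
        have : (i0%:R : R) <= k%:R by rewrite ler_nat ltnW.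
        have : 0 <= i%:R :> R by []. have : 0 <= i0%:R :> R by [].
        by lra.
      have := hN _ (i%:R / k%:R - i0%:R / k%:R) t1 Ni.
      rewrite scalerBl addrA subrK => /(_ hi0.1)/eqP.
      rewrite -mulrBl mulf_eq0 invr_eq0 (negPf kn0) orbF subr_eq0 eqr_nat => /eqP/val_inj e.
      by rewrite e eqxx in ii0.
    rewrite big1 ?indicE// => i _; rewrite /f indicE memNset// => h.
    by apply: hno; exists i.
  have r0 : rint f = 0.
    apply/eqP; rewrite eq_le rint_ge0// andbT; apply/ler_addgt0Pr => e e0; rewrite add0r.
    set C := rint (\1_(nball (r + `|w|) : set T)) in key.
    have C0 : 0 <= C by apply: rint_ge0 => x; rewrite indicE.
    near \oo => k; have k0 : 0 < k%:R :> R by near: k; exact: nbhs_infty_gtr.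
    rewrite -(ler_pM2l k0) (le_trans (key k))// -ler_pdivrMr//.
    by apply: ltW; near: k; exact: nbhs_infty_gtr.
  rewrite -[LHS]fineK; last by rewrite ge0_fin_numE// fin//; exact: subIsetr.
  by rewrite -(rint_indic mNr) r0.
apply: leb_subset_null (leb0_bigcup (fun k : nat => bd k%:R)) => x Nx.
have : (\bigcup_k nball k%:R) x by rewrite bigcup_closed_balls.
by move=> [k _ kx]; exists k.
Unshelve. all: by end_near. Qed.

Definition dot zeta x : R := \sum_i zeta 0 i * x 0 i.

Lemma C1_dot zeta : C1 (dot zeta).
Proof. by apply: C1_sum => i; exact: (C1M (C1_cst _) (C1_coord i)). Qed.

Lemma partial_dot zeta i x : partial i (dot zeta) x = zeta 0 i.
Proof.
rewrite (@partial_sum _ _ _ _ (fun j x => zeta 0 j * x 0 j)); last first.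
  by move=> j; exact: (C1M (C1_cst _) (C1_coord j)).
rewrite (bigD1 i)//= big1 ?addr0 => [|j ji].
  rewrite (@partialM _ _ i (cst _) (fun x => x 0 i)); [|exact: (C1_cst _).1|exact: (C1_coord i).1].
  by rewrite partial_cst partial_coord eqxx mulr1 mulr0 addr0.
rewrite (@partialM _ _ i (cst _) (fun x => x 0 j)); [|exact: (C1_cst _).1|exact: (C1_coord j).1].
by rewrite partial_cst partial_coord eq_sym (negPf ji) !mulr0 addr0.
Qed.

(** Moving by t along the suitably normalized [zeta] shifts the phase by t. If the cosine vanishes
    at both phases then sin t = 0, which for |t| <= 1 leaves only t = 0; so the zero set is
    transversal to [zeta]. *)
Lemma dot_zeros_null zeta (m : R) : zeta != 0 -> m != 0 ->
  leb ([set x | cos (m * dot zeta x) = 0] : set T) = 0%E.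
Proof.
move=> z0 m0; have e0 : 0 < enorm zeta.
  by rewrite lt_neqAle enorm_ge0 andbT eq_sym; apply: contraNneq z0 => /enorm_eq0 ->.
have ez : dot zeta zeta = enorm zeta ^+ 2.
  by rewrite enorm_sqr; apply: eq_bigr => i _; rewrite expr2.
have cc : continuous (fun x : 'rV[R]_n => cos (m * dot zeta x)).
  have cd := C1_continuous (C1M (C1_cst m) (C1_dot zeta)).
  by move=> x; apply: (continuous_comp (cd x)); exact: continuous_cos.
apply: (@leb0_transversal _ ((m * enorm zeta ^+ 2)^-1 *: zeta)).
  apply: leb_closed_measurable.
  rewrite (_ : [set x | _] = (fun x => cos (m * dot zeta x)) @^-1` [set 0]); last by [].
  by apply: closed_comp => [x _|]; [exact: cc|exact: closed_eq].
move=> x t t1 /= cx; have -> : m * dot zeta (x + t *: ((m * enorm zeta ^+ 2)^-1 *: zeta)) =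
    m * dot zeta x + t.
  rewrite /dot; under eq_bigr do rewrite !mxE mulrDr.
  rewrite big_split/= mulrDr; congr (_ + _).
  rewrite (eq_bigr (fun i => t / (m * enorm zeta ^+ 2) * (zeta 0 i * zeta 0 i))).
    rewrite -mulr_sumr -/(dot zeta zeta) ez; field.
    by rewrite m0 gt_eqF.
  by move=> i _; ring.
rewrite cosD cx mul0r sub0r => /eqP; rewrite oppr_eq0 mulf_eq0 => /orP[/eqP sx|/eqP st].
  by have := cos2Dsin2 (m * dot zeta x); rewrite cx sx expr0n/= addr0 => /eqP; rewrite eq_sym oner_eq0.
have [t0|t0|//] := ltgtP t 0.
  have : 0 < sin (- t).
    by apply: sin2_gt0; move: t1; rewrite ler_norml => /andP[? ?]; lra.
  by rewrite sinN st oppr0 ltxx.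
have : 0 < sin t by apply: sin2_gt0; move: t1; rewrite ler_norml => /andP[? ?]; lra.
by rewrite st ltxx.
Qed.

End oscillation.

(** * Smoothed triangle waves and laminates *)

Section wave.
Context {R : realType}.
Implicit Types (c s : R).

(* As [c] tends to 1, [wave c] tends to the triangle wave [asin (sin s)], of slopes 1
   and -1; unlike the limit it is C^1. *)
Definition wave c s : R := asin (c * sin s).
Definition dwave c s : R := c * cos s / Num.sqrt (1 - (c * sin s) ^+ 2).

Lemma wave_arg c s : 0 <= c < 1 -> -1 < c * sin s < 1.
Proof.
move=> /andP[c0 c1]; rewrite -ltr_norml normrM (ger0_norm c0).
by rewrite (le_lt_trans _ c1)// ler_piMr// ler_norml sin_le1 sin_geN1.
Qed.

Lemma wave_root c s : 0 <= c < 1 -> 0 < 1 - (c * sin s) ^+ 2.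
Proof.
move=> /(wave_arg s) h; rewrite subr_gt0 -real_normK ?num_real//.
by rewrite expr_lt1// ltr_norml.
Qed.

Lemma is_derive_wave c s : 0 <= c < 1 -> is_derive s 1 (wave c) (dwave c s).
Proof.
move=> h; have h1 := is_derive1_asin (wave_arg s h).
have h2 : is_derive s 1 (fun s => c * sin s) (c * cos s).
  exact: is_deriveZ.
have := (@is_derive1_comp R asin (fun s => c * sin s) s _ _ h1 h2).
by rewrite /dwave mulrC.
Qed.

Lemma continuous_dwave c : 0 <= c < 1 -> continuous (dwave c).
Proof.
move=> h s; have cs : (c * sin t) ^+ 2 @[t --> s] --> (c * sin s) ^+ 2.
  have h1 : c * sin t @[t --> s] --> c * sin s.
    by apply: cvgM; [exact: cvg_cst|exact: continuous_sin].
  rewrite expr2 (_ : (fun t => _) = (fun t => (c * sin t) * (c * sin t))).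
    exact: (cvgM h1 h1).
  by apply/funext => t; rewrite expr2.
apply: cvgM.
  by apply: cvgM; [exact: cvg_cst|exact: continuous_cos].
apply: cvgV; first by rewrite gt_eqF// sqrtr_gt0 wave_root.
apply: (continuous_cvg _ (@sqrt_continuous R _)).
by apply: cvgB; [exact: cvg_cst|exact: cs].
Qed.

(** (c cos s)^2 = c^2 - (c sin s)^2 <= 1 - (c sin s)^2. *)
Lemma dwave_le1 c s : 0 <= c < 1 -> `|dwave c s| <= 1.
Proof.
move=> h; have r0 := wave_root s h; rewrite normrM.
rewrite [`|_^-1|]gtr0_norm ?invr_gt0 ?sqrtr_gt0// ler_pdivrMr ?sqrtr_gt0// mul1r.
rewrite -sqrtr_sqr ler_sqrt ?(ltW r0)//.
have /andP[c0 c1] := h; have := cos2Dsin2 s => e.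
have -> : (c * cos s) ^+ 2 = c ^+ 2 - (c * sin s) ^+ 2.
  by rewrite !exprMn -{2}[c ^+ 2]mulr1 -e; ring.
by rewrite lerD2r expr_le1// ltW.
Qed.

Lemma wave_bounded c s : 0 <= c < 1 -> `|wave c s| <= pi / 2.
Proof.
move=> h; have /andP[h1 h2] := wave_arg s h; rewrite ler_norml.
by rewrite asin_geNpi2 ?asin_lepi2// !ltW.
Qed.

(** At c = 1 the root is |cos s|, so the slope becomes the sign of cos s. *)
Lemma cvg_dwave (s : R) : cos s != 0 ->
  dwave (1 - j.+2%:R^-1) s @[j --> \oo] --> Num.sg (cos s).
Proof.
move=> cs0; have cj : (1 - j.+2%:R^-1 : R) @[j --> \oo] --> (1 : R).
  rewrite -[X in _ --> X]subr0; apply: cvgB; first exact: cvg_cst.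
  have := @cvg_harmonic R; rewrite -cvg_shiftS; exact.
have csin : ((1 - j.+2%:R^-1) * sin s) ^+ 2 @[j --> \oo] --> sin s ^+ 2.
  have h1 : (1 - j.+2%:R^-1) * sin s @[j --> \oo] --> sin s.
    by rewrite -[X in _ --> X]mul1r; apply: cvgM; [exact: cj|exact: cvg_cst].
  rewrite expr2 (_ : (fun j => _) = (fun j : nat => ((1 - j.+2%:R^-1) * sin s) * ((1 - j.+2%:R^-1) * sin s))).
    exact: (cvgM h1 h1).
  by apply/funext => j; rewrite expr2.
have -> : Num.sg (cos s) = 1 * cos s / Num.sqrt (1 - sin s ^+ 2).
  have -> : 1 - sin s ^+ 2 = cos s ^+ 2 by rewrite -(cos2Dsin2 s) addrK.
  have n0 : `|cos s| != 0 by rewrite normr_eq0.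
  by apply: (mulIf n0); rewrite sqrtr_sqr mul1r -numEsg divfK.
apply: cvgM; first by apply: cvgM; [exact: cj|exact: cvg_cst].
apply: cvgV.
  have -> : 1 - sin s ^+ 2 = cos s ^+ 2 by rewrite -(cos2Dsin2 s) addrK.
  by rewrite sqrtr_sqr normr_eq0.
apply: (continuous_cvg _ (@sqrt_continuous R _)).
by apply: cvgB; [exact: cvg_cst|exact: csin].
Qed.

End wave.

Section laminate.
Context {R : realType} {n : nat}.
Local Notation T := (lebesgue_rV R n).
Implicit Types (x y z zeta : 'rV[R]_n) (eta : 'rV[R]_n -> R) (K : set 'rV[R]_n) (i : 'I_n).
Variables (Omega : set 'rV[R]_n) (H : 'rV[R]_n -> R).
Hypothesis oO : open Omega.
Hypothesis fO : (leb (Omega : set T) < +oo)%E.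
Hypothesis posO : (0 < leb (Omega : set T))%E.
Hypothesis cH : continuous H.
Hypothesis evenH : forall z, H (- z) = H z.
Hypothesis qcH : forall phi, C1c Omega phi -> 0 <= rint (zext Omega (H \o grad phi)).

Let mO : measurable (Omega : set T). Proof. exact: leb_open_measurable. Qed.
Let iO : rintegrable (\1_(Omega : set T)). Proof. exact: rintegrable_indic. Qed.

Lemma zext_bounded_rintegrable (f : 'rV[R]_n -> R) (M : R) : measurable_fun (Omega : set T) f ->
  (forall x, `|f x| <= M) -> rintegrable (zext Omega f).
Proof.
move=> mf fM; apply: (@rintegrable_bounded _ _ _ Omega M).
- exact: (measurable_zext f mO).1.
- exact: mO.
- exact: fO.
- move=> x; have [Ox|Ox] := pselect (Omega x); first by rewrite zextE.
  by rewrite zext_out// normr0 (le_trans _ (fM x)).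
- by move=> x; exact: zext_out.
Qed.

(* Where [eta] is 1, the gradient takes values close to [zeta] and to [- zeta] in equal
   proportions, for [m] large and [c] near 1. *)
Definition wave_test zeta eta (m c : R) x : R := m^-1 * (eta x * wave c (m * dot zeta x)).

Let C1_wave c : 0 <= c < 1 -> (forall s, derivable (@wave R c) s 1) /\ (wave c)^`()%classic = dwave c.
Proof.
move=> h; split=> [s|]; first exact: (@ex_derive _ _ _ _ _ _ _ (is_derive_wave s h)).
apply/funext => s; rewrite derive1E; exact: (@derive_val _ _ _ _ _ _ _ (is_derive_wave s h)).
Qed.

Lemma C1c_wave_test zeta eta (m c : R) : 0 <= c < 1 -> C1c Omega eta ->
  C1c Omega (wave_test zeta eta m c).
Proof.
move=> h ceta; apply: C1cZ; apply: C1cMl ceta _.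
have [d1 d2] := C1_wave h.
have cd : continuous (wave c)^`()%classic by rewrite d2; exact: continuous_dwave.
exact: (C1_comp d1 cd (C1M (C1_cst m) (C1_dot zeta))).
Qed.

Lemma grad_wave_test zeta eta (m c : R) x : m != 0 -> 0 <= c < 1 -> C1 eta ->
  grad (wave_test zeta eta m c) x =
  (eta x * dwave c (m * dot zeta x)) *: zeta + (wave c (m * dot zeta x) / m) *: grad eta x.
Proof.
move=> m0 h ceta; have [d1 d2] := C1_wave h.
have cm := C1M (C1_cst m) (C1_dot zeta).
have cw : C1 (wave c \o (fun x => m * dot zeta x)).
  have cd : continuous (wave c)^`()%classic by rewrite d2; exact: continuous_dwave.
  exact: (C1_comp d1 cd cm).
apply/rowP => i; rewrite !mxE.
rewrite (@partialM _ _ i (cst m^-1) (eta \* (wave c \o (fun x => m * dot zeta x)))).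
- rewrite (@partialM _ _ i eta (wave c \o (fun x => m * dot zeta x))).
  + rewrite partial_cst mulr0 addr0 (partial_comp i (cm.1 x) (d1 _)) d2.
    rewrite (@partialM _ _ i (cst m) (dot zeta)).
    * by rewrite partial_cst mulr0 addr0 partial_dot /=; field.
    * exact: (C1_cst _).1.
    * exact: (C1_dot _).1.
  + exact: ceta.1.
  + exact: cw.1.
- exact: (C1_cst _).1.
- exact: (C1M ceta cw).1.
Qed.

Let mH zeta (f : 'rV[R]_n -> R) : measurable_fun (Omega : set T) f ->
  measurable_fun (Omega : set T) (fun x => H (f x *: zeta)).
Proof.
move=> mf; apply: (measurable_continuous_comp (G := fun x : T => f x *: zeta) mO _ cH) => i.
rewrite (_ : (fun x => _) = (fun x => f x * zeta 0 i)).
  by apply: measurable_funM mf _; exact: measurable_cst.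
by apply/funext => x; rewrite mxE.
Qed.

(** Evenness of [H] makes a pointwise limit sufficient: the gradient oscillates between values near
    eta zeta and - eta zeta, on which [H] agrees, so no averaging of oscillations is needed. The
    frequency [m] is fixed by the tolerance [e], and [c] tends to 1 with [m] fixed. *)
Lemma laminate_cutoff zeta eta : zeta != 0 -> C1c Omega eta ->
  (forall x, 0 <= eta x <= 1) -> 0 <= rint (zext Omega (fun x => H (eta x *: zeta))).
Proof.
move=> z0 ceta eta01; have ce := C1_continuous (C1c_C1 ceta).
pose K : set 'rV[R]_n := closed_ball_ Num.norm 0 `|zeta|.
have cK : compact K by exact: compact_closed_ball_rV.
have KP t : `|t| <= 1 -> K (t *: zeta).
  by move=> t1; rewrite /K /closed_ball_ /= sub0r normrN normrZ ler_piMl.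
have [C hC] : exists C : R, forall z, K z -> `|H z| <= C.
  have [C [_ hC]] := compact_bounded (continuous_compact (continuous_subspaceT cH) cK).
  by exists (C + 1) => z Kz; apply: (hC (C + 1)); [rewrite ltrDl|exists z].
set I := rint _.
set V := rint (\1_(Omega : set T)); have V0 : 0 <= V by apply: rint_ge0 => x; rewrite indicE.
suff key (e : R) : 0 < e -> 0 <= I + e * V.
  apply/ler_addgt0Pr => e e0; have := key (e / (V + 1)).
  rewrite divr_gt0// ?ltr_wpDl// => /(_ isT) h; apply: le_trans h _.
  by rewrite lerD2l mulrAC ler_pdivrMr ?ltr_wpDl// ler_wpM2l ?(ltW e0)// lerDl.
move=> e0; have [d d0 hd] := compact_unif_continuous cH cK e0.
have [M M0 hM] := C1c_bounded ceta.
(* The part of the gradient containing grad eta is at most (pi / 2) M / m; this choice brings it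
   below [d], the distance at which [H] varies by at most [e]. *)
pose m : R := pi / 2 * M / d + 1.
have pi0 : 0 <= pi / 2 :> R by rewrite divr_ge0// pi_ge0.
have m0 : 0 < m by apply: ltr_wpDl => //; apply: divr_ge0; [exact: mulr_ge0|exact: ltW].
pose c (j : nat) : R := 1 - j.+2%:R^-1.
have c01 j : 0 <= c j < 1.
  rewrite /c subr_ge0 invf_le1 ?ltr0n// ler1n/=.
  by rewrite gtrBl invr_gt0 ltr0n.
pose D j x := eta x * dwave (c j) (m * dot zeta x).
have D1 j x : `|D j x| <= 1.
  have /andP[a b] := eta01 x.
  by rewrite normrM mulr_ile1// ?dwave_le1// ger0_norm.
have mD j : measurable_fun (Omega : set T) (D j).
  apply: leb_measurable_continuous => //; apply: continuous_mul ce _.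
  have cd := C1_continuous (C1M (C1_cst m) (C1_dot zeta)).
  by move=> x; apply: (continuous_comp (cd x)); exact: continuous_dwave.
have iD j : rintegrable (zext Omega (fun x => H (D j x *: zeta))).
  apply: (@zext_bounded_rintegrable _ C); first exact: mH.
  by move=> x; apply: hC; exact: KP.
have ge0 j : 0 <= rint (zext Omega (fun x => H (D j x *: zeta))) + e * V.
  have ct := C1c_wave_test zeta m (c01 j) ceta.
  apply: le_trans (qcH ct) _; rewrite -(rintZ _ iO) -(rintD (iD j) (rintegrableZ _ iO)).
  have hx x : `|H (grad (wave_test zeta eta m (c j)) x) - H (D j x *: zeta)| <= e.
    apply: hd; first exact: KP.
    rewrite grad_wave_test ?gt_eqF//; last exact: C1c_C1 ceta.
    rewrite addrC addKr; apply: norm_le_coord => [|i]; first exact: ltW.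
    rewrite !mxE normrM normrM [`|m^-1|]gtr0_norm ?invr_gt0//.
    rewrite mulrAC ler_pdivrMr//; apply: (@le_trans _ _ (pi / 2 * M)).
      by rewrite ler_pM// ?wave_bounded//; exact: (hM x).2.
    by rewrite /m mulrDr mulr1 [d * _]mulrC divfK ?gt_eqF// lerDl ltW.
  apply: le_rint.
  - apply: (@zext_bounded_rintegrable _ (C + e)).
      apply: (measurable_continuous_comp (G := grad (wave_test zeta eta m (c j)) : T -> 'rV[R]_n) mO _ cH) => i.
      apply: leb_measurable_continuous => //.
      under [X in continuous X]eq_fun do rewrite mxE.
      exact: (C1c_C1 ct).2.
    move=> x /=; rewrite -(subrK (H (D j x *: zeta)) (H _)) (le_trans (ler_normD _ _))// addrC.
    by apply: lerD (hx x); apply: hC; exact: KP.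
  - exact: rintegrableD (iD j) (rintegrableZ _ iO).
  move=> x; have [Ox|Ox] := pselect (Omega x).
    rewrite /= !zextE// indicE mem_set// mulr1 -lerBlDl.
    by apply: le_trans (ler_norm _) (hx x).
  by rewrite !zext_out// indicE memNset// mulr0 addr0.
pose s x : R := eta x * Num.sg (cos (m * dot zeta x)).
have lim x : zext Omega (fun x => H (D j x *: zeta)) x @[j --> \oo] --> zext Omega (fun x => H (s x *: zeta)) x.
  have [Ox|Ox] := pselect (Omega x); last first.
    by rewrite zext_out//; under eq_fun do rewrite zext_out//; exact: cvg_cst.
  rewrite zextE//; under eq_fun do rewrite zextE//.
  have hs : D j x @[j --> \oo] --> s x.
    apply: cvgM; first exact: cvg_cst.
    have [cx|cx] := eqVneq (cos (m * dot zeta x)) 0; last exact: cvg_dwave.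
    by rewrite /dwave cx sgr0; under eq_fun do rewrite mulr0 mul0r; exact: cvg_cst.
  have ct : continuous (fun t : R => H (t *: zeta)).
    move=> t; apply: (continuous_comp (f := fun t : R => t *: zeta)); last exact: cH.
    by apply: cvgZl; exact: cvg_id.
  exact: (cvg_comp _ _ hs (ct _)).
have bd j x : `|zext Omega (fun x => H (D j x *: zeta)) x| <= C * \1_Omega x.
  have [Ox|Ox] := pselect (Omega x).
    by rewrite zextE// indicE mem_set// mulr1; apply: hC; exact: KP.
  by rewrite zext_out// indicE memNset// mulr0 normr0.
have [is_ cvs] := rint_dominated (fun j => rintegrable_measurable (iD j)) lim bd (rintegrableZ _ iO).
(* The limit contains the sign of the cosine, which evenness of [H] removes off the null set of its
   zeros. *)
have <- : rint (zext Omega (fun x => H (s x *: zeta))) = I.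
  apply: (rint_null is_ _).2; apply: leb_subset_null (dot_zeros_null z0 (lt0r_neq0 m0)) => x /=.
  apply: contra_neqP => /eqP cx; rewrite /zext; congr (_ * _).
  rewrite /s; have [|_|_] := sgrP (cos (m * dot zeta x)); first by move=> e1; rewrite e1 eqxx in cx.
    by rewrite mulr1.
  by rewrite mulrN mulr1 scaleNr evenH.
have lims : rint (zext Omega (fun x => H (D j x *: zeta))) + e * V @[j --> \oo] -->
    rint (zext Omega (fun x => H (s x *: zeta))) + e * V.
  by apply: cvgD; [exact: cvs|exact: cvg_cst].
by apply: (cvgr_to_ge lims); apply: nearW => j; exact: ge0.
Qed.

(** Cutoffs converging to the indicator of Omega turn the integral into [H zeta] times the positive
    measure of Omega. *)
Lemma laminate zeta : 0 <= H zeta.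
Proof.
have [th [cth th01 thO]] := open_cutoff oO.
have HV : H zeta * rint (\1_(Omega : set T)) = rint (zext Omega (fun _ => H zeta)).
  by rewrite -(rintZ _ iO); congr rint; apply/funext => x; rewrite mulrC.
have V0 : 0 < rint (\1_(Omega : set T)).
  by rewrite (rint_indic mO) fine_gt0// posO.
rewrite -(pmulr_lge0 _ V0) HV.
have [z0|z0] := eqVneq zeta 0.
  have := qcH (C1c0 Omega); congr (_ <= rint _); apply/funext => x.
  rewrite /zext z0; congr (_ * H _); apply/rowP => i.
  by rewrite !mxE partial_cst.
have [C hC] : exists C : R, forall k x, `|H (th k x *: zeta)| <= C.
  have cK := @compact_closed_ball_rV R n 0 `|zeta|.
  have [C [_ hC]] := compact_bounded (continuous_compact (continuous_subspaceT cH) cK).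
  exists (C + 1) => k x; apply: (hC (C + 1)); first by rewrite ltrDl.
  exists (th k x *: zeta) => //; rewrite /closed_ball_ /= sub0r normrN normrZ ler_piMl//.
  by have /andP[a b] := th01 k x; rewrite ger0_norm.
have [||||_ lims] := @rint_dominated _ _ (fun k => zext Omega (fun x => H (th k x *: zeta)))
   (zext Omega (fun _ => H zeta)) (fun x => C * \1_Omega x).
- move=> k; apply: (measurable_zext _ mO).1.
  apply: mH; apply: leb_measurable_continuous mO _.
  exact: C1_continuous (C1c_C1 (cth k)).
- move=> x; have [Ox|Ox] := pselect (Omega x); last first.
    by rewrite zext_out//; under eq_fun do rewrite zext_out//; exact: cvg_cst.
  have [N hN] := thO x Ox; apply: cvg_near_cst; exists N => //= k /hN e.
  by rewrite !zextE// e scale1r.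
- move=> k x; have [Ox|Ox] := pselect (Omega x).
    by rewrite zextE// indicE mem_set// mulr1.
  by rewrite zext_out// indicE memNset// mulr0 normr0.
- exact: rintegrableZ iO.
apply: (cvgr_to_ge lims); apply: nearW => k.
exact: laminate_cutoff z0 (cth k) (th01 k).
Qed.

End laminate.

(** * Midpoint convexity, coercivity and stability of the integrands *)

Section quasiconvexity.
Context {R : realType} {n : nat}.
Local Notation T := (lebesgue_rV R n).
Implicit Types (x z xi zeta : 'rV[R]_n) (phi W : 'rV[R]_n -> R) (i : 'I_n).
Variables (Omega : set 'rV[R]_n) (F : 'rV[R]_n -> R) (p l L mu : R).
Hypothesis oO : open Omega.
Hypothesis fO : (leb (Omega : set T) < +oo)%E.
Hypothesis posO : (0 < leb (Omega : set T))%E.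
Hypothesis p1 : 1 < p.
Hypothesis l0 : 0 < l.
Hypothesis L0 : 0 < L.
Hypothesis mu0 : 0 <= mu.
Hypothesis cF : continuous F.
Hypothesis gF : growth F p mu L.
Hypothesis qF : quasiconvex Omega F p mu l.

Let mO : measurable (Omega : set T). Proof. exact: leb_open_measurable. Qed.
Let p0 : 0 < p. Proof. by rewrite (lt_trans ltr01). Qed.
Let F0 xi : 0 <= F xi. Proof. by have /andP[] := gF xi. Qed.

Lemma zext_grad_rintegrable (H : 'rV[R]_n -> R) phi : continuous H -> C1c Omega phi ->
  measurable_fun (Omega : set T) (H \o grad phi) /\ rintegrable (zext Omega (H \o grad phi)).
Proof.
move=> cH cphi; have mH : measurable_fun (Omega : set T) (H \o grad phi).
  apply: (measurable_continuous_comp (G := grad phi : T -> 'rV[R]_n) mO _ cH) => i.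
  apply: leb_measurable_continuous mO _.
  under [X in continuous X]eq_fun do rewrite mxE.
  exact: (C1c_C1 cphi).2.
split; first exact: mH.
have [M M0 hM] := C1c_bounded cphi.
have cK := @compact_closed_ball_rV R n 0 M.
have [C [_ hC]] := compact_bounded (continuous_compact (continuous_subspaceT cH) cK).
apply: (zext_bounded_rintegrable oO fO mH (M := C + 1)) => x.
apply: (hC (C + 1)); first by rewrite ltrDl.
exists (grad phi x) => //; rewrite /closed_ball_ /= sub0r normrN.
by apply: norm_le_coord M0 _ => i; rewrite mxE; exact: (hM x).2.
Qed.

Definition qc_gap xi z : R :=
  (mu ^+ 2 + enorm xi ^+ 2 + enorm z ^+ 2) `^ ((p - 2) / 2) * enorm z ^+ 2.

(** Adding the quasiconvexity inequalities for phi and for - phi gives a nonnegative integral of an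
    even function [H] of the gradient, to which laminates apply. The minorant [W] stands for the
    gap, whose power may have a negative exponent, because continuity is needed. *)
Lemma qc_midpoint W xi zeta : continuous W -> (forall z, W (- z) = W z) ->
  (forall z, 0 <= W z <= qc_gap xi z) ->
  2 * F xi + 2 * l * W zeta <= F (xi + zeta) + F (xi - zeta).
Proof.
move=> cW eW hW; pose H z := F (xi + z) + F (xi - z) - (2 * F xi + 2 * l * W z).
rewrite -subr_ge0 -/(H zeta).
have cFp : continuous (fun z => F (xi + z)).
  rewrite (_ : (fun z => _) = F \o translate xi).
    by move=> z; apply: continuous_comp; [exact: continuous_translate|exact: cF].
  by apply/funext => z; rewrite /translate /= addrC.
have cFm : continuous (fun z => F (xi - z)).
  move=> z; apply: (continuous_comp (f := fun z => xi - z)); last exact: cF.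
  exact: continuous_reflect.
have ccst (a : R) : continuous (fun _ : 'rV[R]_n => a) := C1_continuous (C1_cst a).
have cR : continuous (fun z => F xi + l * W z).
  exact: (continuous_add (ccst _) (continuous_mul (ccst l) cW)).
have cH : continuous H.
  have h1 := continuous_add cFp cFm.
  have h2 := continuous_mul (ccst (-1)) (continuous_add (ccst (2 * F xi)) (continuous_mul (ccst (2 * l)) cW)).
  rewrite (_ : H = (fun z => F (xi + z) + F (xi - z) + -1 * (2 * F xi + 2 * l * W z))).
    exact: (continuous_add h1 h2).
  by apply/funext => z; rewrite mulN1r.
apply: (@laminate _ _ Omega H oO fO posO cH) => [z|phi cphi].
- by rewrite /H opprK eW [F (xi - z) + _]addrC.
have qc (psi : 'rV[R]_n -> R) : C1c Omega psi ->
    rint (zext Omega ((fun z => F xi + l * W z) \o grad psi)) <=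
    rint (zext Omega ((fun z => F (xi + z)) \o grad psi)).
  move=> cpsi; have [m1 i1] := zext_grad_rintegrable cR cpsi.
  have [m2 i2] := zext_grad_rintegrable cFp cpsi.
  rewrite -lee_fin -(integral_zext mO i1) -(integral_zext mO i2).
  apply: le_trans (qF xi cpsi).
  apply: ge0_le_integral.
  - exact: mO.
  - move=> x _; rewrite lee_fin addr_ge0// mulr_ge0 ?(ltW l0)//.
    by have /andP[] := hW (grad psi x).
  - exact/measurable_EFinP.
  - apply/measurable_EFinP.
    have [me _] := zext_grad_rintegrable continuous_enorm cpsi.
    have me2 : measurable_fun (Omega : set T) (fun x => enorm (grad psi x) ^+ 2).
      exact: measurable_funX.
    apply: measurable_funD; first exact: measurable_cst.
    apply: (measurable_funM _ me2); apply: measurable_funM; first exact: measurable_cst.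
    apply: (measurableT_comp (measurable_powR _)).
    by apply: (measurable_funD _ me2); exact: measurable_cst.
  - move=> x _; rewrite lee_fin lerD2l -mulrA ler_wpM2l ?(ltW l0)//.
    by have /andP[] := hW (grad psi x).
have e1 : zext Omega (H \o grad phi) = (fun x =>
    (zext Omega ((fun z => F (xi + z)) \o grad phi) x - zext Omega ((fun z => F xi + l * W z) \o grad phi) x) +
    (zext Omega ((fun z => F (xi + z)) \o grad (\- phi)) x - zext Omega ((fun z => F xi + l * W z) \o grad (\- phi)) x)).
  apply/funext => x; rewrite /zext /H /= (_ : grad (\- phi) x = - grad phi x).
    by rewrite eW; ring.
  by apply/rowP => i; rewrite !mxE (partialN _ ((C1c_C1 cphi).1 x)).
have cn := C1cN cphi.
have i1 := (zext_grad_rintegrable cR cphi).2.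
have i2 := (zext_grad_rintegrable cFp cphi).2.
have i3 := (zext_grad_rintegrable cR cn).2.
have i4 := (zext_grad_rintegrable cFp cn).2.
rewrite e1 (rintD (rintegrableB i2 i1) (rintegrableB i4 i3)).
rewrite (rintB i2 i1) (rintB i4 i3) addr_ge0// subr_ge0; exact: qc.
Qed.

Lemma qc_midpoint_convex xi zeta : 2 * F xi <= F (xi + zeta) + F (xi - zeta).
Proof.
have := @qc_midpoint (cst 0) xi zeta; rewrite mulr0 addr0; apply => //.
  exact: C1_continuous (C1_cst 0).
by move=> z; rewrite lexx mulr_ge0 ?powR_ge0// sqr_ge0.
Qed.

(** For nonzero [xi] the base of the power stays positive, so the gap itself is continuous, also
    when p < 2. *)
Lemma qc_midpoint_strong xi zeta : xi != 0 ->
  2 * F xi + 2 * l * qc_gap xi zeta <= F (xi + zeta) + F (xi - zeta).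
Proof.
move=> xi0; apply: qc_midpoint.
- have a0 : 0 < mu ^+ 2 + enorm xi ^+ 2.
    rewrite ltr_wpDl ?sqr_ge0// exprn_gt0// lt_neqAle enorm_ge0 andbT eq_sym.
    by apply: contraNneq xi0 => /enorm_eq0 ->.
  have ce : continuous (fun z : 'rV[R]_n => enorm z ^+ 2).
    rewrite (_ : (fun z => _) = (fun z : 'rV[R]_n => enorm z * enorm z)).
      exact: (continuous_mul continuous_enorm continuous_enorm).
    by apply/funext => y; rewrite expr2.
  have cb : continuous (fun z : 'rV[R]_n => mu ^+ 2 + enorm xi ^+ 2 + enorm z ^+ 2).
    exact: (continuous_add (C1_continuous (C1_cst (mu ^+ 2 + enorm xi ^+ 2))) ce).
  suff cp : continuous (fun z : 'rV[R]_n =>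
      (mu ^+ 2 + enorm xi ^+ 2 + enorm z ^+ 2) `^ ((p - 2) / 2)).
    exact: (continuous_mul cp ce).
  move=> z; apply: (continuous_comp (g := fun t : R => t `^ ((p - 2) / 2)) (cb z)).
  have b0 : 0 < mu ^+ 2 + enorm xi ^+ 2 + enorm z ^+ 2 by rewrite ltr_wpDr// sqr_ge0.
  have d := is_derive1_powR ((p - 2) / 2) b0.
  exact: (differentiable_continuous ((@derivable1_diffP _ _ _ _).1 (@ex_derive _ _ _ _ _ _ _ d))).
- by move=> z; rewrite /qc_gap enormN.
- by move=> z; rewrite lexx mulr_ge0 ?powR_ge0// sqr_ge0.
Qed.

Lemma sqr_powR_half (e q : R) : 0 <= e -> (e ^+ 2) `^ (q / 2) = e `^ q.
Proof.
move=> e0; rewrite -powR_mulrn// -powRrM; congr (_ `^ _); by field.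
Qed.

Lemma powR_antimono (a b q : R) : 0 < a -> a <= b -> q <= 0 -> b `^ q <= a `^ q.
Proof.
move=> a0 ab q0; rewrite -[q]opprK !(powRN _ (- q)).
rewrite lef_pV2 ?posrE ?powR_gt0 ?(lt_le_trans a0)//.
by apply: ler_powR_ge0; rewrite ?oppr_ge0 ?(ltW a0).
Qed.

Lemma growth_powR xi : F xi <= L * (2 `^ p * (mu `^ p + enorm xi `^ p)).
Proof.
have /andP[_ h] := gF xi; apply: le_trans h _; rewrite ler_wpM2l ?(ltW L0)//.
apply: (@le_trans _ _ ((mu + enorm xi) `^ p)).
  rewrite -(sqr_powR_half p (addr_ge0 mu0 (enorm_ge0 xi))).
  apply: ler_powR_ge0; first by rewrite divr_ge0// ltW.
    by rewrite addr_ge0 ?sqr_ge0.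
  by rewrite sqrrD addrAC lerDl mulrn_wge0// mulr_ge0// enorm_ge0.
by apply: powR_addle mu0 (enorm_ge0 xi); exact: ltW.
Qed.

(** The midpoint inequality at xi/2 with increment xi/2 bounds the gap by a multiple of F xi + F 0,
    and the gap controls |xi|^p up to mu^p. *)
Lemma qc_coercive : exists2 C : R, 0 < C & forall xi, enorm xi `^ p <= C * (1 + F xi).
Proof.
(* For p < 2 and mu <= |zeta| the base is at most 3 |zeta|^2 and the exponent is negative. When p >=
   2, or when mu > |zeta|, the factor 1 suffices. *)
pose c : R := Num.min 1 (3 `^ ((p - 2) / 2)).
have c0 : 0 < c by rewrite /c lt_min ltr01 powR_gt0.
have gap zeta : zeta != 0 -> c * enorm zeta `^ p <= mu `^ p + qc_gap zeta zeta.
  move=> z0; rewrite /qc_gap; set e := enorm zeta.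
  have e0 : 0 < e.
    rewrite lt_neqAle enorm_ge0 andbT eq_sym.
    by apply: contraNneq z0 => /enorm_eq0 ->.
  have ep : e `^ p = (e ^+ 2) `^ ((p - 2) / 2) * e ^+ 2.
    rewrite sqr_powR_half ?(ltW e0)// -[e ^+ 2]powR_mulrn ?(ltW e0)// -powRD ?subrK//.
    by rewrite gt_eqF// implybT.
  have mp : 0 <= mu `^ p by exact: powR_ge0.
  have e20 : 0 < e ^+ 2 by exact: exprn_gt0.
  have [p2|p2] := leP 2 p.
    have h : (e ^+ 2) `^ ((p - 2) / 2) <= (mu ^+ 2 + e ^+ 2 + e ^+ 2) `^ ((p - 2) / 2).
      apply: ler_powR_ge0; [by rewrite divr_ge0// subr_ge0|exact: ltW|].
      by rewrite lerDr addr_ge0 ?sqr_ge0.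
    apply: (@le_trans _ _ (e `^ p)).
      by rewrite ler_piMl ?powR_ge0// /c ge_min lexx.
    rewrite ep; apply: (le_trans (ler_wpM2r (ltW e20) h)).
    by rewrite lerDr.
  have q0 : (p - 2) / 2 <= 0 by rewrite pmulr_lle0 ?invr_gt0// subr_le0 ltW.
  have [mue|emu] := leP mu e; last first.
    apply: (@le_trans _ _ (mu `^ p)); last first.
      by rewrite lerDl mulr_ge0 ?powR_ge0// ltW.
    apply: (@le_trans _ _ (e `^ p)).
      by rewrite ler_piMl ?powR_ge0// /c ge_min lexx.
    by apply: ler_powR_ge0; exact: ltW.
  apply: (@le_trans _ _ ((3 * e ^+ 2) `^ ((p - 2) / 2) * e ^+ 2)).
    rewrite powRM ?(ltW e20)// -mulrA -ep ler_wpM2r ?powR_ge0//.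
    by rewrite /c ge_min lexx orbT.
  apply: (@le_trans _ _ ((mu ^+ 2 + e ^+ 2 + e ^+ 2) `^ ((p - 2) / 2) * e ^+ 2)); last first.
    by rewrite lerDr.
  apply: ler_wpM2r; first exact: ltW.
  apply: powR_antimono => //; first by rewrite ltr_wpDl// addr_ge0 ?sqr_ge0.
  have : mu ^+ 2 <= e ^+ 2 by rewrite lerXn2r ?nnegrE// ltW.
  by lra.
pose K : R := 2 `^ p / c.
have K0 : 0 < K by rewrite divr_gt0// powR_gt0.
have mp : 0 <= mu `^ p by exact: powR_ge0.
exists (K * (mu `^ p + (1 + F 0) / (2 * l)) + 1) => [|xi].
  rewrite ltr_wpDl// mulr_ge0 ?(ltW K0)// addr_ge0// divr_ge0 ?addr_ge0//.
  by rewrite mulr_ge0// ltW.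
have A0 : 0 <= K * (mu `^ p + (1 + F 0) / (2 * l)).
  rewrite mulr_ge0 ?(ltW K0)// addr_ge0// divr_ge0 ?addr_ge0//.
  by rewrite mulr_ge0// ltW.
have [->|xi0] := eqVneq xi 0.
  by rewrite enorm0 powR0 ?gt_eqF// mulr_ge0 ?addr_ge0// addr_ge0.
pose zeta := 2^-1 *: xi.
have z0 : zeta != 0 by rewrite scaler_eq0 negb_or xi0 andbT invr_eq0 pnatr_eq0.
have ez : enorm xi `^ p = 2 `^ p * enorm zeta `^ p.
  rewrite -powRM ?enorm_ge0//; congr (_ `^ _).
  by rewrite enormZ ger0_norm ?invr_ge0// mulrA mulfV ?mul1r// pnatr_eq0.
have h1 := gap _ z0; have h2 := qc_midpoint_strong zeta z0.
rewrite subrr -scalerDl (_ : 2^-1 + 2^-1 = 1 :> R) in h2; last by field.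
rewrite scale1r in h2.
have h3 : qc_gap zeta zeta <= (F xi + F 0) / (2 * l).
  rewrite ler_pdivlMr ?mulr_gt0// mulrC; apply: le_trans h2.
  by rewrite lerDr mulr_ge0.
have h4 : enorm xi `^ p <= K * (mu `^ p + (F xi + F 0) / (2 * l)).
  rewrite ez /K -!mulrA ler_wpM2l ?powR_ge0// ler_pdivlMl// (le_trans h1)//.
  by rewrite lerD2l.
apply: le_trans h4 _; have Fx := F0 xi; have F00 := F0 0.
have il0 : 0 < (2 * l)^-1 by rewrite invr_gt0 mulr_gt0.
apply: (@le_trans _ _ (K * (mu `^ p + (1 + F 0) / (2 * l)) * (1 + F xi))).
  rewrite -[leRHS]mulrA; apply: ler_wpM2l; first exact: ltW.
  rewrite [leRHS]mulrDl; apply: lerD.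
    by rewrite ler_peMr// lerDl.
  rewrite mulrAC ler_wpM2r ?(ltW il0)//.
  rewrite mulrDr mulr1 mulrDl mul1r.
  have : 0 <= F 0 * F xi by rewrite mulr_ge0.
  by lra.
by apply: ler_wpM2r; [rewrite addr_ge0|rewrite lerDl].
Qed.

(** Each halving applies midpoint convexity between [xi] and the previous point; the base case is F
    >= 0. *)
Lemma qc_dyadic xi zeta (m : nat) :
  F (xi + 2^-1 ^+ m *: zeta) <= F xi + 2^-1 ^+ m * F (xi + zeta).
Proof.
elim: m => [|m ih].
  by rewrite expr0 scale1r mul1r lerDr.
have := qc_midpoint_convex (xi + 2^-1 ^+ m.+1 *: zeta) (2^-1 ^+ m.+1 *: zeta).
rewrite addrK -addrA -scalerDl exprS -mulrDl (_ : 2^-1 + 2^-1 = 1 :> R); last by field.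
rewrite mul1r; set a := 2^-1 ^+ m in ih *; have := F0 xi.
rewrite -mulrA; move: ih; set b := a * F _.
by set y := F (xi + a *: zeta); set w := F (xi + (2^-1 * a) *: zeta); set v := F xi; lra.
Qed.

Lemma dyadic_scale (s : R) : 0 < s <= 1 ->
  exists m : nat, 2^-1 ^+ m.+1 < s /\ s <= 2^-1 ^+ m.
Proof.
move=> /andP[s0 s1]; have hs : exists m, 2^-1 ^+ m.+1 < s.
  have h : `|2^-1 : R| < 1 by rewrite ger0_norm ?invr_ge0// invf_lt1// ltr1n.
  have /cvgrPdist_lt/(_ _ s0)[N _ /(_ N.+1 (leqnSn N))] := cvg_expr h.
  by rewrite /= sub0r normrN ger0_norm ?exprn_ge0 ?invr_ge0// => ?; exists N.
case: (ex_minnP hs) => m hm min_m; exists m; split => //.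
case: m hm min_m => [//|m] _ min_m; rewrite leNgt; apply/negP => h.
by have := min_m m h; rewrite ltnn.
Qed.

(** With 2^-(m+1) < s <= 2^-m, the increment s zeta is 2^-m times a vector no longer than [xi];
    growth bounds [F] at the end of that vector, and 2^-m < 2 s. *)
Lemma qc_stable : exists2 C : R, 0 <= C & forall xi zeta (s : R), enorm zeta <= enorm xi ->
  0 <= s <= 1 -> F (xi + s *: zeta) <= F xi + s * (C * (1 + enorm xi `^ p)).
Proof.
pose C : R := L * (2 `^ p * (mu `^ p + 2 `^ p)).
have mp : 0 <= mu `^ p by exact: powR_ge0.
have tp : 0 <= 2 `^ p :> R by exact: powR_ge0.
have C0 : 0 <= C by rewrite mulr_ge0 ?(ltW L0)// mulr_ge0// addr_ge0.
exists (2 * C) => [|xi zeta s zx]; first by rewrite mulr_ge0.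
have ep : 0 <= enorm xi `^ p by exact: powR_ge0.
have CE : 0 <= C * (1 + enorm xi `^ p) by rewrite mulr_ge0// addr_ge0.
have [->|s0] := eqVneq s 0; first by rewrite scale0r addr0 mul0r addr0.
move=> /andP[s0' s1]; have sgt0 : 0 < s by rewrite lt_neqAle eq_sym s0.
have [|m [m1 m2]] := @dyadic_scale s; first by rewrite sgt0.
have a0 : 0 < 2^-1 ^+ m :> R by rewrite exprn_gt0 ?invr_gt0.
have := qc_dyadic xi ((s / 2^-1 ^+ m) *: zeta) m.
rewrite scalerA mulrC divfK ?gt_eqF// => /le_trans; apply; rewrite lerD2l.
have Fz : F (xi + (s / 2^-1 ^+ m) *: zeta) <= C * (1 + enorm xi `^ p).
  apply: le_trans (growth_powR _) _; rewrite /C -!mulrA ler_wpM2l ?(ltW L0)// ler_wpM2l//.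
  have h : enorm (xi + (s / 2^-1 ^+ m) *: zeta) `^ p <= 2 `^ p * enorm xi `^ p.
    rewrite -powRM ?enorm_ge0//; apply: ler_powR_ge0; [exact: ltW|exact: enorm_ge0|].
    rewrite (le_trans (enormD _ _))// mulr_natl mulr2n lerD2l enormZ.
    rewrite (le_trans _ zx)// ler_piMl ?enorm_ge0// ger0_norm ?divr_ge0 ?(ltW a0)//.
    by rewrite ler_pdivrMr// mul1r.
  apply: (le_trans (lerD (lexx (mu `^ p)) h)); rewrite mulrDl; apply: lerD.
    by rewrite ler_peMr// lerDl.
  by rewrite mulrDr mulr1 lerDr.
apply: (@le_trans _ _ (2^-1 ^+ m * (C * (1 + enorm xi `^ p)))).
  by rewrite ler_wpM2l// ltW.
have -> : s * (2 * C * (1 + enorm xi `^ p)) = (2 * s) * (C * (1 + enorm xi `^ p)) by ring.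
apply: (ler_wpM2r CE).
by move: m1; rewrite exprS; set a := 2^-1 ^+ m; lra.
Qed.

End quasiconvexity.

(** * Nondegeneracy of sets of bounded perimeter *)

Section smoothing_sets.
Context {R : realType} {n : nat}.
Local Notation T := (lebesgue_rV R n).
Implicit Types (theta : 'rV[R]_n -> R) (x y w : 'rV[R]_n) (i : 'I_n) (A Omega : set 'rV[R]_n).

Lemma measurable_fst_add (k : 'rV[R]_n -> R) : continuous k ->
  measurable_fun [set: T * T] (fun z : T * T => k ((z.1 : 'rV[R]_n) + (z.2 : 'rV[R]_n))).
Proof.
move=> ck.
apply: (measurable_continuous_comp (G := fun z : T * T => (z.1 : 'rV[R]_n) + z.2)) => //.
move=> i; rewrite (_ : (fun _ => _) = (fun z : T * T => (z.1 : 'rV[R]_n) 0 i + (z.2 : 'rV[R]_n) 0 i)).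
  have mi : measurable_fun [set: T] (fun x : T => (x : 'rV[R]_n) 0 i).
    exact: leb_measurable_coord.
  by apply: measurable_funD; apply: measurableT_comp mi _;
    [exact: measurable_fst|exact: measurable_snd].
by apply/funext => z; rewrite !mxE.
Qed.

Lemma partial_translate (f : 'rV[R]_n -> R) a i x :
  partial i (fun y => f (y + a)) x = partial i f (x + a).
Proof.
rewrite /partial /derive (_ : (fun y => f (y + a)) \o shift x = f \o shift (x + a))//.
by apply/funext => h /=; rewrite addrA.
Qed.

Lemma C1_translate a (f : 'rV[R]_n -> R) : C1 f -> C1 (fun y => f (y + a)).
Proof.
move=> [df cf]; split=> [x|i].
  have dt : differentiable (fun y : 'rV[R]_n => y + a) x by exact: differentiableD.
  by apply: (differentiable_comp dt); exact: df.
rewrite (_ : partial i _ = partial i f \o translate a).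
  by move=> x; apply: continuous_comp; [exact: continuous_translate|exact: cf].
by apply/funext => x; exact: partial_translate.
Qed.

Lemma measurable_add theta y : continuous theta ->
  measurable_fun [set: T] (fun x : 'rV[R]_n => theta (y + x)).
Proof.
move=> ct; apply: leb_measurable_continuous => //.
rewrite (_ : (fun x => _) = theta \o translate y).
  by move=> x; apply: continuous_comp; [exact: continuous_translate|exact: ct].
by apply/funext => x; rewrite /translate /= addrC.
Qed.

(** By Fubini, applied twice: mollifying the indicator amounts to averaging over translates of
    [theta], for which the perimeter gives an estimate. *)
Lemma rint_mollified_set A theta r : measurable (A : set T) -> (leb (A : set T) < +oo)%E ->
  C1c setT theta -> 0 < r ->
  rintegrable (fun w => mollifier r w * rint (fun y => \1_A y * theta (y + w))) /\
  rint (fun x => theta x * convol \1_A (mollifier r) x) =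
  rint (fun w => mollifier r w * rint (fun y => \1_A y * theta (y + w))).
Proof.
move=> mA fA ct r0; have iA := rintegrable_indic mA fA.
have ckt := C1_continuous (C1c_C1 ct); have it := C1c_rintegrable ct.
have [B B0 hB] := C1c_bounded ct; have cm := @C1c_mollifier R n r r0.
have im := C1c_rintegrable cm.
have A1 x : `|\1_A x : R| <= 1 by rewrite indicE; case: (_ \in _); rewrite ?normr1 ?normr0.
have [_ ->] := convol_fubini iA cm (rintegrable_measurable it) (fun x => (hB x).1).
have e y : rint (fun x => theta x * mollifier r (x - y)) =
    rint (fun w => mollifier r w * theta (y + w)).
  have i1 : rintegrable (fun x => theta x * mollifier r (x - y)).
    have [j _] := rint_translate (- y) im.
    under eq_fun do rewrite mulrC.
    exact: rintegrableM j (rintegrable_measurable it) (fun x => (hB x).1).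
  have [_ <-] := rint_translate y i1; congr rint; apply/funext => x.
  by rewrite addrK mulrC addrC.
have -> : (fun y => \1_A y * rint (fun x => theta x * mollifier r (x - y))) =
   (fun y => \1_A y * rint (fun w => mollifier r w * theta (y + w))).
  by apply/funext => y; rewrite e.
have mth : measurable_fun [set: T * T]
    (fun z : T * T => theta ((z.1 : 'rV[R]_n) + (z.2 : 'rV[R]_n))).
  exact: measurable_fst_add.
have bt (x y : 'rV[R]_n) : `|theta (x + y)| <= B by exact: (hB _).1.
have st y : rintegrable (fun x => theta (x + y)) by exact: (rint_translate y it).1.
have nt y : rint (fun x => `|theta (x + y)|) <= rint (fun x => `|theta x|).
  by have [_ ->] := rint_translate y (rintegrable_abs it).
have [_ e1] := @kernel_fubini _ _ (fun x y => theta (x + y)) _ _ 1 B _ im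
  (measurable_indic mA) A1 mth (fun x => measurable_add x ckt) bt st nt.
have st' x : rintegrable (fun y => theta (x + y)).
  by under eq_fun do rewrite addrC; exact: st.
have nt' x : rint (fun y => `|theta (x + y)|) <= rint (fun x => `|theta x|).
  by have [_ <-] := rint_translate x (rintegrable_abs it); apply: le_rint => [| |y];
    [exact: rintegrable_abs|exact: rintegrable_abs|rewrite addrC].
have mth' : measurable_fun [set: T * T]
    (fun z : T * T => theta ((z.2 : 'rV[R]_n) + (z.1 : 'rV[R]_n))).
  by under eq_fun do rewrite addrC.
have [Bm Bm0 hm] := C1c_bounded cm.
have [i2 _] := @kernel_fubini _ _ (fun x y => theta (y + x)) _ _ Bm B _ iA
  (rintegrable_measurable im) (fun x => (hm x).1) mth'
  (fun x => rintegrable_measurable (st x)) (fun x y => bt y x) st' nt'.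
by split.
Qed.

(** Along the path t w, the t-derivative is the integral over [A] of the divergence of the field
    theta(. + t w) w, which the perimeter bounds by |w| M; the mean value theorem concludes. *)
Lemma rint_translate_set_le A Omega theta w (M : R) : open Omega ->
  measurable (A : set T) -> (leb (A : set T) < +oo)%E -> 0 <= M ->
  (perimeter A Omega <= M%:E)%E -> C1c setT theta -> (forall x, `|theta x| <= 1) ->
  (forall x y, supp theta y -> `|x - y| <= `|w| -> Omega x) ->
  `|rint (fun y => \1_A y * theta (y + w)) - rint (fun y => \1_A y * theta y)| <= enorm w * M.
Proof.
move=> oO mA fA M0 PM ct t1 hO; have iA := rintegrable_indic mA fA.
have [B B0 hB] := C1c_bounded ct; have [c1 cs _] := ct.
have [w0|w0] := eqVneq w 0.
  have -> : (fun y => \1_A y * theta (y + w)) = (fun y => \1_A y * theta y).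
    by apply/funext => y; rewrite w0 addr0.
  by rewrite subrr normr0 mulr_ge0 ?enorm_ge0.
have ew : 0 < enorm w.
  rewrite lt_neqAle enorm_ge0 andbT eq_sym.
  by apply: contraNneq w0 => /enorm_eq0 ->.
pose f (t : R) y := \1_A y * theta (y + t *: w).
pose df (t : R) y := \1_A y * \sum_i w 0 i * partial i theta (y + t *: w).
have if_ t : rintegrable (f t).
  apply: (rintegrableM iA (M := B)) => [|y]; last exact: (hB _).1.
  rewrite (_ : (fun y => _) = (fun y => theta (t *: w + y))); last by apply/funext => y; rewrite addrC.
  exact: measurable_add (C1_continuous c1).
have dft (t : R) y : is_derive t 1 (f ^~ y) (df t y).
  apply: is_deriveZ; exact: is_derive_line (c1.1 _).
have bd (a t : R) y : `|t - a| < 1 -> `|df t y| <= (\sum_i `|w 0 i| * B) * \1_A y.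
  move=> _; rewrite normrM mulrC [`|\1_A y|]ger0_norm ?indicE// ler_wpM2r//.
  apply: le_trans (ler_norm_sum _ _ _) _; apply: ler_sum => i _.
  by rewrite normrM ler_wpM2l//; exact: (hB _).2.
have dh (a : R) := rint_derive if_ dft (rintegrableZ _ iA) (bd a).
have idf t : rintegrable (df t).
  have tt : `|t - t| < 1 by rewrite subrr normr0.
  apply: (le_rintegrable _ (fun y => bd t t y tt) (rintegrableZ _ iA)).
    apply: measurable_funM; first exact: measurable_indic.
    apply: measurable_sum => i; apply: measurable_funM; first exact: measurable_cst.
    rewrite (_ : (fun y => _) = (fun y => partial i theta (t *: w + y))).
      exact: measurable_add (c1.2 i).
    by apply/funext => y; rewrite addrC.
have dle (t : R) : 0 <= t <= 1 -> `|rint (df t)| <= enorm w * M.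
  move=> /andP[t0 t1']; set a := t *: w.
  have cta := C1_translate a c1.
  have ca : C1c Omega (fun y => theta (y + a)).
    apply: (C1cP cta (K := translate (- a) @` supp theta)).
    - apply: continuous_compact cs; apply: continuous_subspaceT.
      exact: continuous_translate.
    - move=> _ [y sy <-]; apply: (hO _ _ sy).
      rewrite /translate addrC addKr normrN normrZ ger0_norm// ler_piMl//.
    - move=> y Ky; apply: supp_out => sy; apply: Ky; exists (y + a) => //.
      by rewrite /translate addrK.
  (* Taken at s = 1 and s = -1 to bound the absolute value. *)
  have key (s : R) : `|s| <= 1 -> s * rint (df t) <= enorm w * M.
    move=> s1; pose X y := (s * theta (y + a)) *: w.
    have XE i : (fun y => X y 0 i) = (fun y => (w 0 i * s) * theta (y + a)).
      by apply/funext => y; rewrite mxE; ring.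
    have cX i : C1c Omega (fun y => X y 0 i) by rewrite XE; exact: C1cZ.
    have Xw x : enorm (X x) <= enorm w.
      by rewrite enormZ ler_piMl ?enorm_ge0// normrM mulr_ile1.
    have := perimeter_scaled mA ew cX Xw PM; congr (_ <= _).
    rewrite -(rintZ _ (idf t)); congr rint; apply/funext => y.
    rewrite /df mulrCA; congr (_ * _); rewrite /div mulr_sumr; apply: eq_bigr => i _.
    rewrite XE (@partialM _ _ i (cst (w 0 i * s)) (fun y => theta (y + a))).
    - by rewrite partial_cst mulr0 addr0 partial_translate /=; ring.
    - exact: (C1_cst _).1.
    - exact: cta.1.
  rewrite ler_norml; apply/andP; split.
    by have := key (-1); rewrite normrN1 lexx mulN1r lerNl => ->.
  by have := key 1; rewrite normr1 lexx mul1r => ->.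
pose h (t : R) := rint (f t).
have ch : {within `[0, 1], continuous h}.
  by apply: derivable_within_continuous => s _; exact: (@ex_derive _ _ _ _ _ _ _ (dh s)).
have [s] := MVT_segment ler01 (fun s _ => dh s) ch.
rewrite in_itv/= => s01; rewrite subr0 mulr1 /h /f.
under [X in rint X - _]eq_fun do rewrite scale1r.
under [X in _ - rint X]eq_fun do rewrite scale0r addr0.
by move=> ->; exact: dle.
Qed.

End smoothing_sets.

(** * Chains of balls in a connected domain *)

Section chains.
Context {R : realType} {n : nat}.
Implicit Types (g : 'rV[R]_n -> R) (x y z : 'rV[R]_n) (K Omega : set 'rV[R]_n) (t e : R).

Definition inner Omega t : set 'rV[R]_n := [set x | forall y, `|y - x| <= t -> Omega y].

Lemma inner_lipschitz Omega t e x y z g : C1 g -> inner Omega (2 * t) x ->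
  `|y - x| <= t -> `|z - x| <= t ->
  (forall x i, inner Omega t x -> `|partial i g x| <= e) ->
  `|g y - g z| <= n%:R * e * (2 * t).
Proof.
move=> cg inx yx zx ge.
have e0 : n%:R * `|y - z| * e <= n%:R * (2 * t) * e.
  case: (pickP (fun _ : 'I_n => true)) => [i _|n0]; last first.
    by rewrite -[X in X%:R]card_ord (eq_card0 n0) !mul0r.
  have tx : 0 <= t by rewrite (le_trans _ yx).
  have e0 : 0 <= e.
    apply: le_trans (ge x i _) => // w wx; apply: inx.
    by rewrite (le_trans wx)// ler_peMl// ler1n.
  rewrite ler_wpM2r// ler_wpM2l// -(subrKA x y (- z)) (le_trans (ler_normD _ _))//.
  by rewrite mulr_natl mulr2n lerD// distrC.
rewrite mulrAC (le_trans _ e0)// mulrAC.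
apply: C1_lipschitz_segment cg _ => i s /andP[s0 s1]; apply: ge => w wx.
apply: inx; rewrite -(subrKA (z + s *: (y - z)) w (- x)) (le_trans (ler_normD _ _))//.
rewrite mulr_natl mulr2n lerD//.
have -> : z + s *: (y - z) - x = (1 - s) *: (z - x) + s *: (y - x).
  by apply/rowP => j; rewrite !mxE; ring.
rewrite (le_trans (ler_normD _ _))// !normrZ ger0_norm ?subr_ge0// ger0_norm//.
have -> : t = (1 - s) * t + s * t by ring.
by rewrite lerD// ler_wpM2l// subr_ge0.
Qed.

(* [y] can be reached from [x0] by a chain of boundedly many balls whose
   [t]-neighbourhoods stay in [Omega], expressed through the effect of such a chain on a function. *)
Definition chained Omega x0 t y : Prop := forall g e, C1 g -> 0 <= e ->
  (forall x i, inner Omega t x -> `|partial i g x| <= e) -> `|g y - g x0| <= e / t.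

Lemma chainedW Omega x0 t t' y : 0 < t' -> t' <= t ->
  chained Omega x0 t y -> chained Omega x0 t' y.
Proof.
move=> t'0 tt h g e cg e0 ge; apply: le_trans (h g e cg e0 _) _.
  by move=> x i ix; apply: ge => w wx; apply: ix; exact: le_trans wx tt.
by rewrite ler_wpM2l// lef_pV2// posrE// (lt_le_trans t'0).
Qed.

Lemma open_inner Omega x : open Omega -> Omega x -> exists2 t : R, 0 < t & inner Omega (2 * t) x.
Proof.
move=> oO Ox; have [e e0 he] := compact_thickening (@compact_set1 _ x) oO
  (fun y (yx : [set x] y) => eq_ind_r Omega Ox yx).
exists (e / 2); first by rewrite divr_gt0.
by move=> y yx; apply: (he y x) => //; rewrite (le_trans yx)// mulrC divfK.
Qed.

(** The points having a neighbourhood chained to [x0] at a common scale form a set containing [x0]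
    that is open and relatively closed in Omega, hence contains Omega; compactness then gives one
    scale for [K]. *)
Lemma connected_chain Omega K x0 : open Omega -> connected Omega -> compact K ->
  K `<=` Omega -> Omega x0 ->
  \forall t \near (0 : R)^'+, forall y, K y -> chained Omega x0 t y.
Proof.
move=> oO conO cK KO Ox0.
pose S : set 'rV[R]_n := [set x | exists2 t, 0 < t &
  forall y, `|y - x| < t -> chained Omega x0 t y].
have oS : open S.
  rewrite openE => x [t t0 ht]; have t2 : 0 < t / 2 by rewrite divr_gt0.
  apply/nbhs_ballP; exists (t / 2) => //= z.
  rewrite mx_norm_ball /ball_ /= => xz; exists (t / 2) => // y yz.
  apply: (chainedW t2 (t := t)); first by rewrite ler_pdivrMr// ler_peMr ?ler1n// ltW.
  apply: ht; rewrite -(subrKA z y (- x)) (le_lt_trans (ler_normD _ _))//.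
  by rewrite [ltRHS]splitr ltrD// distrC.
have step x z tz : Omega x -> 0 < tz -> (exists2 r, 0 < r & inner Omega (2 * r) x /\ `|z - x| <= r) ->
    chained Omega x0 tz z -> S x.
  move=> Ox tz0 [r r0 [ir zr]] cz.
  (* The cost 2 n r of the last ball plus the cost of the chain up to [z]; a scale below 1/q pays
     for both. *)
  pose q := 2 * n%:R * r + tz^-1.
  have q0 : 0 < q by rewrite ltr_wpDl ?invr_gt0// !mulr_ge0// ltW.
  pose t := Num.min (Num.min r tz) q^-1.
  have t0 : 0 < t by rewrite !lt_min r0 tz0 invr_gt0.
  exists t => // y yt g e cg e0 ge.
  have tr : t <= r by rewrite /t !ge_min lexx.
  have ttz : t <= tz by rewrite /t !ge_min lexx orbT.
  have tq : t <= q^-1 by rewrite /t !ge_min lexx !orbT.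
  have ger w i : inner Omega r w -> `|partial i g w| <= e.
    by move=> iw; apply: ge => v vw; apply: iw; exact: le_trans vw tr.
  have h1 := inner_lipschitz cg ir (le_trans (ltW yt) tr) zr ger.
  have h2 := chainedW t0 ttz cz; have h3 : `|g z - g x0| <= e / tz.
    apply: cz => // w i iw; apply: ge => v vw; apply: iw.
    exact: le_trans vw ttz.
  rewrite -(subrKA (g z) (g y) (- g x0)) (le_trans (ler_normD _ _))//.
  apply: le_trans (lerD h1 h3) _.
  have -> : n%:R * e * (2 * r) + e / tz = e * q by rewrite /q; ring.
  by rewrite ler_wpM2l// -[q]invrK lef_pV2 ?posrE ?invr_gt0.
have Sx0 : S x0.
  have [r r0 ir] := open_inner oO Ox0.
  apply: (step x0 x0 1 Ox0 ltr01); first by exists r => //; rewrite subrr normr0 ltW.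
  by move=> g e _ e0 _; rewrite subrr normr0 divr1.
have SO : Omega `&` S = Omega.
  apply: conO.
  - by exists x0.
  - by exists S.
  - exists (closure S); first exact: closed_closure.
    apply/seteqP; split => x [Ox Sx]; split => //; first exact: subset_closure.
    have [r r0 ir] := open_inner oO Ox.
    have [z [[tz tz0 hz] /=]] := Sx _ (nbhsx_ballx x r r0).
    rewrite mx_norm_ball /ball_ /= => xz.
    apply: (step x z tz Ox tz0); first by exists r => //; split; [|rewrite distrC ltW].
    by apply: hz; rewrite subrr normr0.
have /compact_near_coveringP := cK.
move=> /(_ R (0 : R)^'+ (fun t y => chained Omega x0 t y) _); apply.
move=> y Ky; have [_ [t t0 ht]] : (Omega `&` S) y by rewrite SO; exact: KO.
exists (ball y t, [set e | 0 < e < t]) => /=.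
  split; first exact: nbhsx_ballx.
  near=> e; apply/andP; split; near: e; [exact: nbhs_right_gt|exact: nbhs_right_lt].
move=> [y' t'] [/= By' /andP[t'0 t't]].
move: By'; rewrite mx_norm_ball /ball_ /= => By'.
apply: (chainedW t'0 (ltW t't)); apply: ht.
by rewrite distrC.
Unshelve. all: by end_near. Qed.

End chains.

(** * A uniform lower bound for some first variation of volume *)

Section nondegeneracy.
Context {R : realType} {n : nat}.
Local Notation T := (lebesgue_rV R n).
Implicit Types (theta : 'rV[R]_n -> R) (x y w : 'rV[R]_n) (i : 'I_n) (A : set 'rV[R]_n) (r M : R).

Lemma convol_set_bounds A r x : measurable (A : set T) -> (leb (A : set T) < +oo)%E ->
  0 < r -> 0 <= convol \1_A (mollifier r) x <= 1.
Proof.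
move=> mA fA r0; have iA := rintegrable_indic mA fA.
have [i3 e3 _ _] := mollifier_shift x r0.
apply/andP; split.
  by apply: rint_ge0 => y; rewrite mulr_ge0 ?indicE// mollifier_ge0.
rewrite -e3; apply: (le_rint (convol_rintegrable_mollifier x r0 iA) i3) => y.
by rewrite ler_piMl ?mollifier_ge0// indicE; case: (_ \in _).
Qed.

(** Up to normalization, the gradient of the mollified density consists of the first variations of
    volume under shears along translated bumps. If all of them are small, the density is almost
    constant. *)
Lemma partial_convol_set A r x i : measurable (A : set T) -> (leb (A : set T) < +oo)%E ->
  0 < r -> partial i (convol \1_A (mollifier r)) x =
  - ((rint (cbump (0 : 'rV[R]_n) r))^-1 * rint (fun y => \1_A y * partial i (cbump x r) y)).
Proof.
move=> mA fA r0; have iA := rintegrable_indic mA fA.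
have [_ ->] := C1_convol iA (C1c_mollifier r0) (C1_partial_mollifier r).
have ib : rintegrable (fun y => \1_A y * partial i (cbump x r) y).
  have [B _ hB] := C1c_bounded (C1c_bumpT x r0).
  apply: (rintegrableM iA _ (fun y => (hB y).2 i)).
  exact: leb_measurable_continuous measurableT ((C1_bump x r).2 i).
rewrite /convol -(rintZ _ ib) -(rintN (rintegrableZ _ ib)); congr rint; apply/funext => y.
rewrite mulrCA -mulrN; congr (_ * _).
have := partial_mollifier_reflect r x i y; rewrite mollifier_reflectE.
rewrite (@partialM _ _ i (cst _) (cbump x r)); [|exact: (C1_cst _).1|exact: (C1_bump _ _).1].
by rewrite partial_cst mulr0 addr0 => ->; rewrite opprK.
Qed.

(** Averages the translation estimate over shifts in the support of the mollifier, of sup norm below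
    [r]. *)
Lemma mollified_set_le A Omega theta r M : open Omega ->
  measurable (A : set T) -> (leb (A : set T) < +oo)%E -> 0 <= M -> 0 < r ->
  (perimeter A Omega <= M%:E)%E -> C1c setT theta -> (forall x, `|theta x| <= 1) ->
  (forall x y, supp theta y -> `|x - y| <= r -> Omega x) ->
  `|rint (fun x => theta x * convol \1_A (mollifier r) x) -
    rint (fun y => \1_A y * theta y)| <= n%:R * r * M.
Proof.
move=> oO mA fA M0 r0 PM ct t1 hO.
have [i1 ->] := rint_mollified_set mA fA ct r0.
have im := C1c_rintegrable (@C1c_mollifier R n r r0).
set T0 := rint (fun y => _ * theta y).
have -> : T0 = rint (fun w => mollifier r w * T0 : R).
  under eq_fun do rewrite mulrC.
  by rewrite (rintZ _ im) (rint_mollifier r0) mulr1.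
have i2 : rintegrable (fun w => mollifier r w * T0).
  by under eq_fun do rewrite mulrC; exact: rintegrableZ.
have -> : n%:R * r * M = rint (fun w => n%:R * r * M * mollifier r w : R).
  by rewrite (rintZ _ im) (rint_mollifier r0) mulr1.
rewrite -(rintB i1 i2).
apply: le_trans (rint_norm_le (rintegrableB i1 i2)) _.
apply: (le_rint (rintegrable_abs (rintegrableB i1 i2)) (rintegrableZ _ im)) => w.
rewrite /= -mulrBr normrM (ger0_norm (mollifier_ge0 _ r0)) mulrC.
have [wr|wr] := ltP `|w| r; last by rewrite (mollifier_out r0 wr) !mulr0.
rewrite ler_wpM2r ?mollifier_ge0//.
have hw x y : supp theta y -> `|x - y| <= `|w| -> Omega x.
  by move=> sy xy; apply: (hO x y sy); rewrite (le_trans xy)// ltW.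
apply: le_trans (rint_translate_set_le oO mA fA M0 PM ct t1 hw) _.
rewrite ler_wpM2r// (le_trans (enorm_le_norm _))// ler_wpM2l// ltW//.
Qed.

Variable Omega : set 'rV[R]_n.
Hypothesis oO : open Omega.
Hypothesis conO : connected Omega.
Hypothesis fO : (leb (Omega : set T) < +oo)%E.

Let mO : measurable (Omega : set T). Proof. exact: leb_open_measurable. Qed.
Let iO : rintegrable (\1_(Omega : set T)). Proof. exact: rintegrable_indic. Qed.

Lemma cutoff_mass (e : R) : 0 < e -> exists2 omega, C1c Omega omega &
  (forall x, 0 <= omega x <= 1) /\ rint (\1_(Omega : set T)) - e < rint omega.
Proof.
move=> e0; have [th [cth th01 thO]] := open_cutoff oO.
have lim x : th k x @[k --> \oo] --> (\1_(Omega : set T) : 'rV[R]_n -> R) x.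
  rewrite indicE; have [Ox|Ox] := pselect (Omega x).
    rewrite mem_set//; have [N hN] := thO x Ox.
    by apply: cvg_near_cst; exists N => //= k; exact: hN.
  rewrite memNset//; under eq_fun do rewrite (C1c_out (cth _) Ox).
  exact: cvg_cst.
have bd k x : `|th k x| <= \1_(Omega : set T) x.
  rewrite indicE; have [Ox|Ox] := pselect (Omega x).
    by rewrite mem_set//; have /andP[a b] := th01 k x; rewrite ger0_norm.
  by rewrite memNset// (C1c_out (cth k) Ox) normr0.
have [_] := rint_dominated (fun k => rintegrable_measurable (C1c_rintegrable (cth k))) lim bd iO.
move=> /cvgrPdist_lt/(_ _ e0)[k _ /(_ k (leqnn k))] /=.
rewrite ltr_norml => /andP[_ h]; exists (th k); first exact: cth.
by split; [exact: th01|rewrite ltrBlDr -ltrBlDl].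
Qed.

(* If all these integrals were small, the mollification of [\1_A] would be close to a
   constant [kap] away from the boundary. The perimeter bound makes [\1_A] close to its
   mollification when tested against [theta], itself close to [omega * (1 - 2 * \1_A)];
   this forces [A] or its complement to be almost null. *)
Lemma nondegenerate (d M : R) : 0 < d -> d < rint (\1_(Omega : set T)) -> 0 <= M ->
  exists c r delta : R, [/\ 0 < c, 0 < r, 0 < delta &
    forall A, A `<=` Omega -> measurable (A : set T) ->
      (perimeter A Omega <= M%:E)%E -> `|rint \1_(A : set T) - d| <= delta ->
      exists x i, closed_ball_ Num.norm x r `<=` Omega /\
        c <= `|rint (fun y => \1_A y * partial i (cbump x r) y)| ].
Proof.
set V := rint _ => d0 dV M0.
(* If |A| is within m/2 of [d], then [A] and its complement in Omega both have measure above [m]. *)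
pose m : R := Num.min d (V - d) / 2.
have m0 : 0 < m by rewrite divr_gt0// lt_min d0 subr_gt0.
have md : 2 * m <= d by rewrite mulrC divfK// ge_min lexx.
have mV : 2 * m <= V - d by rewrite mulrC divfK// ge_min lexx orbT.
have m2 : 0 < m / 2 by rewrite divr_gt0.
have [omega com [om01 omV]] := cutoff_mass m2.
have [c1 cK KO] := com; set K := supp omega in cK KO.
have iom := C1c_rintegrable com.
have [x0 Ox0] : Omega !=set0.
  apply: contrapT => /nonemptyPn O0; move: dV.
  rewrite /V (rint_indic mO) O0 measure0/= => /(lt_trans d0).
  by rewrite ltxx.
have [e1 e10 he1] := compact_thickening cK oO KO.
have V0 : 0 < V by rewrite (lt_trans d0).
have nM : 0 < n%:R * M + 1 by rewrite ltr_wpDl// mulr_ge0.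
have mM : 0 < m / 4 / (n%:R * M + 1) by exact: divr_gt0 (divr_gt0 m0 (ltr0Sn _ 3)) nM.
(* The scale serves three purposes: translates of the cutoff stay in Omega, the perimeter error n r
   M is small, and chains reach all of [K]. It is fixed before the set [A]. *)
have [r r0 [re1 rM chain]] : exists2 r : R, 0 < r &
    [/\ r <= e1, n%:R * r * M <= m / 4 & forall y, K y -> chained Omega x0 r y].
  near (0 : R)^'+ => r; exists r; first by near: r; exact: nbhs_right_gt.
  split.
  - by near: r; exact: nbhs_right_le.
  - have : r <= m / 4 / (n%:R * M + 1) by near: r; exact: nbhs_right_le.
    rewrite ler_pdivlMr// mulrDr mulr1 => h.
    by rewrite mulrAC mulrC (le_trans _ h)// lerDl; near: r; exact: nbhs_right_ge.
  - by near: r; exact: connected_chain.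
pose mass := rint (cbump (0 : 'rV[R]_n) r).
have mass0 : 0 < mass by exact: bump_mass_gt0.
pose q : R := m / (4 * (V + 1)).
have q0 : 0 < q by rewrite divr_gt0// mulr_gt0// addr_gt0.
exists (mass * (r * q)), r, (m / 2); split; [exact: mulr_gt0 mass0 (mulr_gt0 r0 q0)|exact: r0|exact: m2|].
move=> A AO mA PM Ad; apply: contrapT => hno.
have fA : (leb (A : set T) < +oo)%E by exact: le_lt_trans (le_leb AO) fO.
have iA := rintegrable_indic mA fA.
pose f := convol \1_A (mollifier r).
have [cf _] := C1_convol iA (@C1c_mollifier R n r r0) (C1_partial_mollifier r).
have df x i : inner Omega r x -> `|partial i f x| <= r * q.
  move=> ix; rewrite partial_convol_set// normrN normrM gtr0_norm ?invr_gt0//.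
  rewrite ler_pdivrMl//; apply: ltW; rewrite ltNge; apply/negP => h; apply: hno.
  exists x, i; split; last exact: h.
  by move=> y; rewrite /closed_ball_ /= distrC; exact: ix.
(* The chain costs a factor 1/r, which the factor [r] in the bound on the gradient compensates. *)
have osc y : K y -> `|f y - f x0| <= q.
  move=> Ky; have := chain y Ky f (r * q) cf; rewrite mulrAC mulfV ?gt_eqF// mul1r.
  by apply => //; rewrite mulr_ge0// ltW.
have fb x := convol_set_bounds x mA fA r0.
set kap := f x0 in osc; have /andP[k0 k1] : 0 <= kap <= 1 by exact: fb.
have m16 : 0 < m / 16 by rewrite divr_gt0.
(* A second, finer mollification stands for the indicator in [theta] and makes [theta] C^1. Its
   scale may depend on [A], since it does not enter the constants. *)
have [d' d'0 hd'] := mollify_L1 iA m16.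
have s0 : 0 < d' / 2 by rewrite divr_gt0.
have := hd' (d' / 2) s0; rewrite ltr_pdivrMr// ltr_pMr// ltr1n => /(_ isT) hs.
set s := d' / 2 in s0 hs; pose h := convol \1_A (mollifier s).
have [ch _] := C1_convol iA (@C1c_mollifier R n s s0) (C1_partial_mollifier s).
have hb x := convol_set_bounds x mA fA s0.
have [ih _] := rint_convol_mollifier s0 iA.
pose theta x := (1 - 2 * h x) * omega x.
have cth : C1c Omega theta.
  exact: (C1cMr (C1B (C1_cst 1) (C1M (C1_cst 2) ch)) com).
have th0 x : ~ K x -> theta x = 0 by move=> Kx; rewrite /theta (supp_out (f := omega) Kx) mulr0.
have th1 x : `|theta x| <= 1.
  have /andP[a b] := om01 x; have /andP[a' b'] := hb x.
  rewrite /theta normrM mulr_ile1//; last by rewrite ger0_norm.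
  by rewrite ler_norml; move: a' b'; rewrite -/(h x); clear; lra.
have ith := C1c_rintegrable cth; have cthT : C1c setT theta := C1cW (@subsetT _ _) cth.
have b1 := mollified_set_le oO mA fA M0 r0 PM cthT th1.
have A1 x : `|\1_A x : R| <= 1 by rewrite indicE; case: (_ \in _); rewrite ?normr1 ?normr0.
have mAi : measurable_fun [set: T] (\1_A : T -> R) by exact: measurable_indic.
have iM g : rintegrable g -> rintegrable (fun x => \1_A x * g x).
  by move=> ig; under eq_fun do rewrite mulrC; exact: rintegrableM ig mAi A1.
have {}b1 : `|rint (fun x => theta x * f x) - rint (fun y => \1_A y * theta y)| <= m / 4.
  apply: le_trans rM; apply: b1 => x y sy xy; apply: (he1 x y); last exact: le_trans xy re1.
  exact: (supp_sub cK th0).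
have if_ : rintegrable (fun x => theta x * f x).
  apply: (rintegrableM ith (M := 1)).
    exact: leb_measurable_continuous measurableT (C1_continuous cf).
  by move=> x; have /andP[a b] := fb x; rewrite ger0_norm.
have b2 : `|rint (fun x => theta x * f x) - kap * rint theta| <= m / 4.
  rewrite -(rintZ _ ith) -(rintB if_ (rintegrableZ _ ith)).
  apply: le_trans (rint_norm_le (rintegrableB if_ (rintegrableZ _ ith))) _.
  apply: (@le_trans _ _ (q * V)); last first.
    have -> : m / 4 = q * (V + 1) by rewrite /q invfM mulrA mulfVK// gt_eqF// addr_gt0.
    by rewrite ler_wpM2l ?lerDl// ltW.
  rewrite -(rintZ _ iO); apply: le_rint.
  - exact: rintegrable_abs (rintegrableB if_ (rintegrableZ _ ith)).
  - exact: rintegrableZ.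
  move=> x /=; rewrite [kap * _]mulrC -mulrBr normrM.
  have [Kx|Kx] := pselect (K x); last first.
    by rewrite th0// normr0 mul0r mulr_ge0 ?indicE// ltW.
  by rewrite indicE mem_set ?mulr1; [rewrite -[leRHS]mul1r ler_pM// osc|exact: KO].
have ioA := iM _ iom; have i1A := rintegrableB iA ioA.
have ohA x : `|omega x| <= 1 by have /andP[a b] := om01 x; rewrite ger0_norm.
have ihA : rintegrable (fun x => `|h x - \1_A x|) by exact: rintegrable_abs (rintegrableB ih iA).
have key g : rintegrable g -> (forall x, `|g x| <= 2 * `|h x - \1_A x|) -> `|rint g| <= m / 8.
  move=> ig gle; apply: le_trans (rint_norm_le ig) _.
  apply: (le_trans (le_rint (rintegrable_abs ig) (rintegrableZ 2 ihA) gle)).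
  by rewrite (rintZ _ ihA); move: hs; clear; lra.
have b3 : `|rint theta - (rint omega - 2 * rint (fun x => \1_A x * omega x))| <= m / 8.
  have i2 := rintegrableZ 2 ioA; have i3 := rintegrableB iom i2.
  rewrite -(rintZ _ ioA) -(rintB iom i2) -(rintB ith i3); apply: key; first exact: rintegrableB.
  move=> x /=; have -> : theta x - (omega x - 2 * (\1_A x * omega x)) = 2 * (omega x * (\1_A x - h x)).
    by rewrite /theta; ring.
  by rewrite normrM ger0_norm// ler_wpM2l// normrM distrC ler_piMl.
have b4 : `|rint (fun x => \1_A x * theta x) + rint (fun x => \1_A x * omega x)| <= m / 8.
  rewrite -(rintD (iM _ ith) ioA); apply: key; first exact: rintegrableD (iM _ ith) ioA.
  move=> x /=; rewrite /theta indicE; case: (_ \in _); last by rewrite !mul0r addr0 normr0 mulr_ge0.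
  rewrite !mul1r; have -> : (1 - 2 * h x) * omega x + omega x = 2 * (omega x * (1 - h x)) by ring.
  by rewrite normrM ger0_norm// ler_wpM2l// normrM distrC ler_piMl.
have aA : rint (\1_(A : set T)) - rint (fun x => \1_A x * omega x) <= V - rint omega.
  rewrite -(rintB iA ioA) -(rintB iO iom); apply: (le_rint i1A (rintegrableB iO iom)) => x /=.
  have /andP[ox0 ox1] := om01 x; rewrite !indicE; have [Ax|Ax] := pselect (A x).
    by rewrite !mem_set ?mul1r//; exact: AO.
  rewrite (memNset Ax) mul0r subrr subr_ge0; have [Ox|Ox] := pselect (Omega x).
    by rewrite mem_set.
  by rewrite (C1c_out com Ox).
have aA' : rint (fun x => \1_A x * omega x) <= rint (\1_(A : set T)).
  apply: (le_rint ioA iA) => x; have /andP[ox0 ox1] := om01 x.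
  by rewrite ler_piMr ?indicE.
move: b1 b2 b3 b4 aA aA' Ad md mV omV k0 k1 m0; clear.
set a := rint (fun x => \1_A x * omega x); set b := rint (fun x => \1_A x * theta x).
set w := rint omega; set t := rint theta; set v := rint \1_A; set z := rint (fun x => theta x * f x).
rewrite !ler_norml => /andP[_ p2] /andP[p3 _] /andP[p5 p6] /andP[_ p8] q1 q2 /andP[q3 q4] q5 q6 q7 k0 k1 m0.
clearbody m a b w t v z kap; rewrite -/V in q7; clearbody V.
(* Up to small errors, [t] is w - 2 a and [b] is - a, so kap t - b is close to kap (w - a) + (1 -
   kap) a. This is a convex combination of numbers at least [m], while the estimates above bound kap
   t - b by m/2. *)
have a1 : m <= a by lra.
have a2 : m <= w - a by lra.
have h1 : kap * t - b <= m / 2 by lra.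
have h2 : kap * (w - 2 * a - m / 8) <= kap * t by rewrite ler_wpM2l//; lra.
have h3 : kap * m <= kap * (w - a) by rewrite ler_wpM2l.
have h4 : (1 - kap) * m <= (1 - kap) * a by rewrite ler_wpM2l// subr_ge0.
have h5 : kap * m <= m by rewrite ler_piMl// ltW.
lra.
Unshelve. all: by end_near.
Qed.

End nondegeneracy.

(** * A set of prescribed volume *)

Section halfspaces.
Context {R : realType} {n : nat}.
Local Notation T := (lebesgue_rV R n).
Implicit Types (f g : 'rV[R]_n -> R) (x : 'rV[R]_n) (tau : R).

Lemma rintegrable_partialM i f g : C1 f -> C1c setT g ->
  rintegrable (fun x => partial i f x * g x).
Proof.
move=> cf [c1 cs _]; apply: (rintegrable_continuous _ cs).
  by apply: continuous_mul; [exact: cf.2|exact: C1_continuous].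
by move=> x sx; rewrite (supp_out (f := g))// mulr0.
Qed.

Lemma rint_by_parts i f g : C1 f -> C1c setT g ->
  rint (fun x => f x * partial i g x) = - rint (fun x => partial i f x * g x).
Proof.
move=> cf cg; have cfg := C1cMr cf cg.
have := rint_partial0 i cfg.
have e x : partial i (f \* g) x = f x * partial i g x + partial i f x * g x.
  rewrite partialM; [by rewrite /= [g x * _]mulrC|exact: cf.1|exact: (C1c_C1 cg).1].
rewrite (_ : partial i _ = fun x => f x * partial i g x + partial i f x * g x); last exact/funext.
have i1 : rintegrable (fun x => f x * partial i g x).
  have [c1 cs _] := cg; apply: (rintegrable_continuous _ cs).
    by apply: continuous_mul; [exact: C1_continuous|exact: c1.2].
  by move=> x sx; rewrite partial_out// mulr0.
have i2 := rintegrable_partialM i cf cg.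
by rewrite (rintD i1 i2) => /eqP; rewrite addr_eq0 => /eqP.
Qed.

Variable i0 : 'I_n.

Definition halfspace tau : set 'rV[R]_n := [set x | x 0 i0 <= tau].

(** A C^1 approximation of the indicator of the half-space, nonincreasing in the coordinate and
    decreasing to the indicator as [k] grows. The squares of positive parts provide the C^1
    regularity. *)
Definition hstep tau (k : nat) x : R :=
  Num.max 0 (1 - k%:R * Num.max 0 (x 0 i0 - tau) ^+ 2) ^+ 2.

Lemma measurable_halfspace tau : measurable (halfspace tau : set T).
Proof.
apply: leb_closed_measurable.
rewrite (_ : halfspace tau = (fun x : 'rV[R]_n => x 0 i0) @^-1` [set t | t <= tau]); last by [].
by apply: closed_comp => [x _|]; [exact: coord_continuous|exact: closed_le].
Qed.

Lemma C1_hstep tau k : C1 (hstep tau k) /\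
  forall i x, partial i (hstep tau k) x =
  - (4 * k%:R * Num.max 0 (1 - k%:R * Num.max 0 (x 0 i0 - tau) ^+ 2) *
     Num.max 0 (x 0 i0 - tau) * (i == i0)%:R).
Proof.
have c1 : C1 (fun x : 'rV[R]_n => x 0 i0 - tau) by apply: (C1B (C1_coord i0)); exact: C1_cst.
have c2 := @C1_pospow _ _ 0 _ c1.
have c3 := C1M (C1_cst (k%:R : R)) c2; have c4 := C1B (C1_cst 1) c3.
split=> [|i x]; first exact: (@C1_pospow _ _ 0 _ c4).
rewrite (@partial_pospow _ _ 0 _ _ _ c4).
rewrite (@partialD _ _ i (cst 1) (\- _)); [|exact: (C1_cst _).1|exact: (C1N c3).1].
rewrite partialN; last exact: c3.1.
rewrite (@partialM _ _ i (cst _)); [|exact: (C1_cst _).1|exact: c2.1].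
rewrite (@partial_pospow _ _ 0 _ _ _ c1) !partial_cst.
rewrite (@partialD _ _ i (fun x => x 0 i0) (cst (- tau))); [|exact: (C1_coord _).1|exact: (C1_cst _).1].
by rewrite partial_cst partial_coord /=; ring.
Qed.

Lemma hstep_bounds tau k x : 0 <= hstep tau k x <= 1.
Proof.
rewrite /hstep exprn_ge0 ?le_max ?lexx//= expr_le1// ?le_max ?lexx//.
by rewrite ge_max ler01/= gerBl mulr_ge0// exprn_ge0// le_max lexx.
Qed.

Lemma cvg_hstep tau x :
  hstep tau k x @[k --> \oo] --> (\1_(halfspace tau) x : R).
Proof.
rewrite indicE; have [h|h] := lerP (x 0 i0) tau.
  rewrite mem_set//; apply: cvg_near_cst; near=> k.
  have m0 : Num.max 0 (x 0 i0 - tau) = 0 by apply/max_idPl; rewrite subr_le0.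
  by rewrite /hstep m0 expr0n mulr0 subr0 (max_idPr _) ?ler01// expr1n.
rewrite memNset; last by apply/negP; rewrite -ltNge.
have a0 : 0 < x 0 i0 - tau by rewrite subr_gt0.
apply: cvg_near_cst; near=> k.
have m0 : Num.max 0 (x 0 i0 - tau) = x 0 i0 - tau by apply/max_idPr; exact: ltW.
rewrite /hstep m0 (max_idPl _) ?expr0n// subr_le0 -ler_pdivrMr ?exprn_gt0//.
by near: k; exact: nbhs_infty_ger.
Unshelve. all: by end_near. Qed.

Lemma leb_hyperplane tau : leb ([set x | x 0 i0 = tau] : set T) = 0%E.
Proof.
apply: (@leb0_transversal _ _ _ (delta_mx 0 i0)).
  have h : closed ((fun x : 'rV[R]_n => x 0 i0) @^-1` [set tau]).
    by apply: closed_comp => [x _|]; [exact: coord_continuous|exact: closed_eq].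
  exact: leb_closed_measurable h.
move=> x t _ /= <-; rewrite !mxE eqxx/= eqxx mulr1 => /eqP.
by rewrite -subr_eq0 addrAC subrr add0r => /eqP.
Qed.

Variable Omega : set 'rV[R]_n.
Hypothesis oO : open Omega.
Hypothesis bO : bounded_set Omega.

Let fO : (leb (Omega : set T) < +oo)%E. Proof. exact: leb_bounded_fin. Qed.
Let mO : measurable (Omega : set T). Proof. exact: leb_open_measurable. Qed.
Let iO : rintegrable (\1_(Omega : set T)). Proof. exact: rintegrable_indic. Qed.

Lemma measurable_slice tau : measurable (Omega `&` halfspace tau : set T).
Proof. by apply: measurableI => //; exact: measurable_halfspace. Qed.

Lemma rintegrable_slice tau : rintegrable (\1_(Omega `&` halfspace tau)).
Proof.
apply: (rintegrable_indic (measurable_slice tau)).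
exact: le_lt_trans (le_leb (@subIsetl _ _ _)) fO.
Qed.

(** Off the null hyperplane at level tau, the indicators of the slices are eventually constant along
    any sequence tending to tau, so dominated convergence applies. *)
Lemma continuous_slice : continuous (fun tau => rint (\1_(Omega `&` halfspace tau))).
Proof.
pose g tau := rint (\1_(Omega `&` halfspace tau)).
suff key tau (u : nat -> R) : u k @[k --> \oo] --> tau -> g (u k) @[k --> \oo] --> g tau.
  move=> tau; apply/left_right_continuousP; split.
    by apply/cvg_at_leftP => u [_]; exact: key.
  by apply/cvg_at_rightP => u [_]; exact: key.
move=> utau; rewrite /g.
pose P : set 'rV[R]_n := [set x | x 0 i0 != tau].
have mP : measurable (P : set T).
  rewrite (_ : P = ~` [set x | x 0 i0 = tau]); first exact: (measurableC (leb0_measurable (leb_hyperplane tau))).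
  by apply/seteqP; split => x /= /eqP.
have e s : rint (\1_(Omega `&` halfspace s)) =
    rint (fun x => \1_(Omega `&` halfspace s) x * \1_P x).
  have [] := rint_null (g := fun x => \1_(Omega `&` halfspace s) x * \1_P x) (rintegrable_slice s) _ => //.
  apply/eqP; rewrite -measure_le0 -(leb_hyperplane tau); apply: le_leb => x /=.
  apply: contra_neqP => xt; rewrite [X in _ * X]indicE mem_set ?mulr1//.
  exact/eqP.
rewrite e (_ : (fun k => _) = fun k => rint (fun x => \1_(Omega `&` halfspace (u k)) x * \1_P x)); last first.
  by apply/funext => k; rewrite e.
have ms s : measurable_fun [set: T] (fun x => \1_(Omega `&` halfspace s) x * \1_P x : R).
  by apply: measurable_funM; apply: measurable_indic => //; exact: measurable_slice.
have bd k x : `|\1_(Omega `&` halfspace (u k)) x * \1_P x| <= \1_Omega x :> R.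
  rewrite indicI /= ger0_norm ?mulr_ge0 ?indicE//.
  by do 3 case: (_ \in _); rewrite ?mulr1 ?mulr0.
apply: (rint_dominated (fun k => ms (u k)) _ bd iO).2 => x.
have [xt|xt] := eqVneq (x 0 i0) tau.
  have P0 : \1_P x = 0 :> R by rewrite indicE memNset// /P /= xt eqxx.
  by rewrite P0 mulr0; under eq_fun do rewrite mulr0; exact: cvg_cst.
have [xt1|xt1] : x 0 i0 < tau \/ tau < x 0 i0 by apply/orP; rewrite -neq_lt.
  apply: cvg_near_cst; near=> k; congr (_ * _); rewrite !indicI /=; congr (_ * _).
  have h1 : halfspace (u k) x by rewrite /halfspace /=; near: k; exact: (cvgr_ge _ utau).
  have h2 : halfspace tau x by exact: ltW.
  by rewrite !indicE !mem_set.
apply: cvg_near_cst; near=> k; congr (_ * _); rewrite !indicI /=; congr (_ * _).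
have h1 : ~ halfspace (u k) x.
  by apply/negP; rewrite -ltNge; near: k; exact: (cvgr_lt _ utau).
have h2 : ~ halfspace tau x by apply/negP; rewrite -ltNge.
by rewrite !indicE !memNset.
Unshelve. all: by end_near. Qed.

(* The integral of the divergence against the smoothed step is at most that of its
   slope against a cutoff, as the step is monotone; integrating by parts once more moves
   the derivative to the cutoff. *)
Lemma perimeter_slice tau : (perimeter (Omega `&` halfspace tau) Omega < +oo)%E.
Proof.
have [N [_ hN]] := bO.
pose K : set 'rV[R]_n := [set x | `|x| <= N + 1].
have OK : Omega `<=` K by move=> x Ox; apply: (hN (N + 1)) => //; rewrite ltrDl.
have cK : compact K by apply: bounded_closed_compact; [exact: nball_bounded|exact: closed_nball].
have [chi0 cchi0 [e e0 he]] := compact_cutoff cK openT (@subsetT _ K).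
(* The square makes the cutoff nonnegative, which [compact_cutoff] does not state. *)
pose chi := chi0 \* chi0.
have cchi : C1c setT chi := C1cMl cchi0 (C1c_C1 cchi0).
have chi1 x : Omega x -> chi x = 1.
  by move=> /OK Kx; rewrite /chi /= (he x x)// ?mulr1// subrr normr0.
have chip x : 0 <= chi x by rewrite /chi /= -expr2 sqr_ge0.
have iac := rintegrable_abs (partial_rintegrable i0 cchi).
apply: (le_lt_trans _ (ltry (rint (fun x => `|partial i0 chi x|)))).
apply: perimeter_le; first exact: measurable_slice.
move=> X [cX X1]; rewrite lee_fin.
have cXT i : C1c setT (fun x => X x 0 i) by exact: C1cW (@subsetT _ _) (cX i).
have ix i : rintegrable (fun x => partial i (fun y => X y 0 i) x).
  exact: partial_rintegrable (cX i).
have idX : rintegrable (div X) by apply: rintegrable_sum.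
have cs k := C1_hstep tau k.
have hs1 k x : `|hstep tau k x| <= 1.
  by have /andP[a b] := hstep_bounds tau k x; rewrite ger0_norm.
have mhs k : measurable_fun [set: T] (hstep tau k : T -> R).
  exact: leb_measurable_continuous measurableT (C1_continuous (cs k).1).
have ih k f : rintegrable f -> rintegrable (fun x => hstep tau k x * f x).
  by move=> jf; under eq_fun do rewrite mulrC; exact: (rintegrableM jf (mhs k) (hs1 k)).
have [_] : rintegrable (fun x => \1_(halfspace tau) x * div X x) /\
    rint (fun x => hstep tau k x * div X x) @[k --> \oo] -->
    rint (fun x => \1_(halfspace tau) x * div X x).
  apply: (rint_dominated _ _ _ (rintegrable_abs idX)).
  - by move=> k; exact: rintegrable_measurable (ih k _ idX).
  - by move=> x; apply: cvgM; [exact: cvg_hstep|exact: cvg_cst].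
  - by move=> k x; rewrite normrM ler_piMl.
have -> : (fun x => \1_(halfspace tau) x * div X x) =
    (fun x => \1_(Omega `&` halfspace tau) x * div X x).
  apply/funext => x; rewrite indicI /=; have [Ox|Ox] := pselect (Omega x).
    by rewrite [X in X * _ * _]indicE mem_set// mul1r.
  rewrite /div big1 ?mulr0// => i _; apply: partial_out => sx.
  by apply: Ox; have [_ _] := cX i; apply.
move=> cv; rewrite -(cvg_lim _ cv)//; apply: limr_le; first by apply/cvg_ex; eexists; exact: cv.
apply: nearW => k /=; have [ck dk] := cs k.
have -> : rint (fun x => hstep tau k x * div X x) =
    - rint (fun x => partial i0 (hstep tau k) x * X x 0 i0).
  under eq_fun do rewrite /div mulr_sumr.
  rewrite rint_sum; last by move=> i; exact: ih.
  rewrite (bigD1 i0)//= big1 ?addr0; first exact: rint_by_parts.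
  move=> i ii; rewrite rint_by_parts// (_ : (fun x => _) = cst 0) ?rint0 ?oppr0//.
  by apply/funext => x; rewrite dk (negbTE ii) mulr0 oppr0 mul0r.
have d0 x : 0 <= - partial i0 (hstep tau k) x.
  by rewrite dk eqxx mulr1 opprK !mulr_ge0// le_max lexx.
have j1 := rintegrable_partialM i0 ck (cXT i0); have j2 := rintegrable_partialM i0 ck cchi.
rewrite -(rintN j1); apply: (@le_trans _ _ (- rint (fun x => partial i0 (hstep tau k) x * chi x))).
  rewrite -(rintN j2); apply: (le_rint (rintegrableN j1) (rintegrableN j2)) => x.
  rewrite /= -!mulNr ler_wpM2l//; have [Ox|Ox] := pselect (Omega x).
    rewrite chi1// (le_trans (ler_norm _))// (le_trans (coord_le_enorm _ _))//.
  by rewrite (C1c_out (cX i0) Ox).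
rewrite -rint_by_parts//; have j3 := ih k _ (partial_rintegrable i0 cchi).
by apply: (le_rint j3 iac) => x; rewrite (le_trans (ler_norm _))// normrM ler_piMl.
Qed.

(** Half-spaces sweep the bounded set from nothing to everything, continuously in tau. *)
Lemma volume_slice (d : R) : 0 < d -> d < rint (\1_(Omega : set T)) ->
  exists tau, rint (\1_(Omega `&` halfspace tau)) = d.
Proof.
move=> d0 dV; have [N [_ hN]] := bO.
pose g tau := rint (\1_(Omega `&` halfspace tau)).
have hc x : Omega x -> `|x 0 i0| <= N + 1.
  by move=> Ox; apply: le_trans (coord_le_norm _ _) _; apply: (hN (N + 1)) => //; rewrite ltrDl.
have g0 : g (- (N + 2)) = 0.
  rewrite /g (_ : _ `&` _ = set0) ?indic0 ?rint0//.
  apply/seteqP; split=> // x [/hc]; rewrite /halfspace /= ler_norml => /andP[a _] b.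
  by move: (le_trans a b); lra.
have g1 : g (N + 2) = rint (\1_(Omega : set T)).
  rewrite /g (_ : _ `&` _ = Omega)//.
  apply/seteqP; split=> [x []//|x Ox]; split => //.
  by have := hc x Ox; rewrite /halfspace /= ler_norml => /andP[_ b]; lra.
have N0 : Omega !=set0.
  apply: contrapT => /nonemptyPn O0; move: dV.
  by rewrite (rint_indic mO) O0 measure0/= => /(lt_trans d0); rewrite ltxx.
have NN : - (N + 2) <= N + 2.
  by have [x /hc] := N0; move=> /(le_trans (normr_ge0 _)); lra.
have [tau _ <-] : exists2 c, c \in `[(- (N + 2)), (N + 2)] & g c = d.
  apply: IVT NN _ _; first by apply: continuous_subspaceT => t; exact: continuous_slice.
  by rewrite g0 g1 ge_min le_max (ltW d0) (ltW dV) orbT.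
by exists tau.
Qed.

End halfspaces.

(** * Exact penalization *)

Section competitor.
Context {R : realType} {n : nat}.
Local Notation T := (lebesgue_rV R n).
Implicit Types (x xi zeta : 'rV[R]_n) (v u psi : 'rV[R]_n -> R) (g : 'rV[R]_n -> 'rV[R]_n) (A : set 'rV[R]_n).
Variables (Omega : set 'rV[R]_n) (F G : 'rV[R]_n -> R) (p K C D : R).
Hypothesis oO : open Omega.
Hypothesis fO : (leb (Omega : set T) < +oo)%E.
Hypothesis p1 : 1 < p.
Hypothesis cF : continuous F.
Hypothesis cG : continuous G.
Hypothesis FK : forall xi, 0 <= F xi <= K * (1 + enorm xi `^ p).
Hypothesis GK : forall xi, 0 <= G xi <= K * (1 + enorm xi `^ p).
Hypothesis C0 : 0 <= C.
Hypothesis FC : forall xi zeta (s : R), enorm zeta <= enorm xi -> 0 <= s <= 1 ->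
  F (xi + s *: zeta) <= F xi + s * (C * (1 + enorm xi `^ p)).
Hypothesis GC : forall xi zeta (s : R), enorm zeta <= enorm xi -> 0 <= s <= 1 ->
  G (xi + s *: zeta) <= G xi + s * (C * (1 + enorm xi `^ p)).
Hypothesis D0 : 0 <= D.
Hypothesis FD : forall xi, enorm xi `^ p <= D * (1 + F xi).

Let mO : measurable (Omega : set T). Proof. exact: leb_open_measurable. Qed.
Let iO : rintegrable (\1_(Omega : set T)). Proof. exact: rintegrable_indic. Qed.

Definition density A g : 'rV[R]_n -> R :=
  zext Omega (fun x => F (g x) + \1_A x * G (g x)).

Definition bulk A g : R := rint (density A g).

Lemma density_ge0 A g x : 0 <= density A g x.
Proof.
have /andP[a _] := FK (g x); have /andP[b _] := GK (g x).
by rewrite /density /zext mulr_ge0 ?indicE// addr_ge0// mulr_ge0.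
Qed.

Lemma bulk_ge0 A g : 0 <= bulk A g.
Proof. by apply: rint_ge0 => x; exact: density_ge0. Qed.

Lemma density_rintegrable A g : measurable (A : set T) ->
  (forall i, in_Lp Omega p (fun x => g x 0 i)) -> rintegrable (density A g).
Proof.
move=> mA hg; have [_ ie _ _] := in_Lp_enorm oO p1 hg.
have mg i : measurable_fun (Omega : set T) (fun x : T => g x 0 i) by exact: (hg i).1.
have mF := measurable_continuous_comp mO mg cF.
have mG := measurable_continuous_comp mO mg cG.
have mAO : measurable_fun (Omega : set T) (\1_A : T -> R) by exact: measurable_indic.
have md : measurable_fun [set: T] (density A g).
  by apply/(measurable_zext _ mO); apply: measurable_funD mF (measurable_funM mAO mG).
have ib := rintegrableZ (2 * K) (rintegrableD iO ie).
apply: (le_rintegrable md _ ib) => x.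
rewrite ger0_norm ?density_ge0//; have /andP[a1 a2] := FK (g x); have /andP[b1 b2] := GK (g x).
rewrite /= /density /zext indicE; case: (_ \in _); last by rewrite !mul0r addr0 mulr0.
rewrite !mul1r -mulrA mulr_natl mulr2n lerD// indicE; case: (_ \in _); rewrite ?mul1r//.
by rewrite mul0r (le_trans b1).
Qed.

Lemma energyE A v g : measurable (A : set T) -> W1p_pair Omega p v g ->
  energy Omega F G (v, A) = ((bulk A g)%:E + perimeter A Omega)%E.
Proof.
move=> mA [wg _ hg]; rewrite /energy /=.
have id_ := density_rintegrable mA hg.
have [i e] : rintegrable (density A (wgrad Omega v)) /\ bulk A g = bulk A (wgrad Omega v).
  apply: rint_null id_ _; apply: leb_subset_null (wgradE oO wg) => x /= h.
  have [Ox|Ox] := pselect (Omega x).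
    by split => //; move: h; apply: contra_neq => e; rewrite /density !zextE// e.
  by move: h; rewrite /density !zext_out// eqxx.
by rewrite e; congr (_ + _)%E; exact: integral_zext mO i.
Qed.

Variables (k : 'I_n) (psi : 'rV[R]_n -> R) (e : R).
Hypothesis cpsi : C1c Omega psi.
Hypothesis psi2 : forall i, C1 (partial i psi).
Hypothesis psiC : forall i j, partial j (partial i psi) = partial i (partial j psi).
Hypothesis e0 : 0 < e.
Hypothesis e1 : e <= 1.
Hypothesis psie : forall i x, n%:R * `|partial i psi x| <= e / 2.

Local Notation Psi := (shear_inv k psi).
Local Notation J := (jacobian_shear k psi).

Lemma psi_small i x : n%:R * `|partial i psi x| <= 2^-1.
Proof. by rewrite (le_trans (psie i x))// -[leRHS]mul1r ler_wpM2r. Qed.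

Let n1 : 1 <= n%:R :> R. Proof. by rewrite ler1n; case: (n) k => // -[]. Qed.

(** The shape required by the stability estimates: a step [e] in a direction no longer than the
    gradient. It results from |grad psi| <= e/2 and J >= 1/2. *)
Lemma pull_gradient_decomp g x : exists2 zeta, enorm zeta <= enorm (g x) &
  pull_gradient k psi g x = g x + e *: zeta.
Proof.
exists (- (g x 0 k / (J x * e)) *: grad psi x); last first.
  rewrite /pull_gradient -scaleNr scalerA; congr (_ + _ *: _).
  have J0 := shear_jacobian_gt0 k psi_small x; field.
  by rewrite !gt_eqF.
have /andP[J1 _] := shear_jacobian_bounds k psi_small x.
have J0 := shear_jacobian_gt0 k psi_small x.
rewrite enormZ normrN normrM mulrAC -mulrA.
apply: (@le_trans _ _ (enorm (g x) * 1)); last by rewrite mulr1.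
apply: ler_pM => //; first by rewrite mulr_ge0 ?enorm_ge0.
  exact: coord_le_enorm.
have Je : 0 < J x * e by rewrite mulr_gt0.
rewrite normfV gtr0_norm// mulrC ler_pdivrMl// mulr1.
apply: le_trans (enorm_le_norm _) _.
have h : n%:R * `|grad psi x| <= e / 2.
  rewrite mulrC -ler_pdivlMr ?(lt_le_trans ltr01)//; apply: norm_le_coord.
    by rewrite !divr_ge0// ltW.
  by move=> i; rewrite mxE ler_pdivlMr ?(lt_le_trans ltr01)// mulrC psie.
by apply: le_trans h _; rewrite mulrC ler_wpM2r// ltW.
Qed.

(** The 1 comes from J <= 1 + e. The rest comes from the stability errors of F and G, each at most e
    C (1 + |g|^p), doubled by J <= 2; coercivity bounds 1 + |g|^p by 1 + 2 D times one plus the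
    density. *)
Definition distortion : R := 1 + 4 * C * (1 + 2 * D).

Lemma distortion_ge0 : 0 <= distortion.
Proof. by rewrite addr_ge0// !mulr_ge0// addr_ge0// mulr_ge0. Qed.

Lemma density_pull A g x :
  density A (pull_gradient k psi g) x * J x <=
  density A g x + e * distortion * (\1_Omega x + density A g x).
Proof.
have [Ox|Ox] := pselect (Omega x); last first.
  by rewrite /density !zext_out// mul0r add0r addr0 indicE memNset// mulr0.
have O1 : \1_Omega x = 1 :> R by rewrite indicE mem_set.
rewrite O1 /density !zextE//.
have [zeta zle ->] := pull_gradient_decomp g x.
have es : 0 <= e <= 1 by rewrite ltW.
have := FC zle es; have := GC zle es; have := FD (g x).
have /andP[f0 _] := FK (g x); have /andP[g0 _] := GK (g x).
have /andP[f0' _] := FK (g x + e *: zeta); have /andP[g0' _] := GK (g x + e *: zeta).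
have /andP[J1 J2] := shear_jacobian_bounds k psi_small x.
have J3 : J x <= 1 + e.
  have := psie k x; rewrite /jacobian_shear lerD2l => h.
  rewrite (le_trans (ler_norm _))//; apply: le_trans (_ : e / 2 <= _).
    by apply: le_trans h; rewrite ler_peMl.
  by rewrite ler_pdivrMr// ler_peMr ?ler1n// ltW.
have a0 : 0 <= (\1_A x : R) <= 1 by rewrite indicE; case: (_ \in _); rewrite ?lexx ?ler01.
have q0 : 0 <= enorm (g x) `^ p by exact: powR_ge0.
move: (J x) (F _) (G _) (F (g x + _)) (G (g x + _)) (\1_A x) (enorm _ `^ p) f0 g0 f0' g0' J1 J2 J3 a0 q0.
rewrite /distortion; move: C0 D0 e0 e1; clear.
move=> C0 D0 e0 e1 j f g' f' g'' a q f0 g0 f0' g0' J1 J2 J3 /andP[a0 a1] q0 hD.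
set w := 1 + q; set h := f + a * g' => hG hF.
have w0 : 0 <= w by rewrite addr_ge0.
have Cw : 0 <= e * (C * w) by rewrite !mulr_ge0// ltW.
have h0 : 0 <= h by rewrite addr_ge0// mulr_ge0.
have fh : f <= h by rewrite lerDl mulr_ge0.
have s1 : f' + a * g'' <= h + 2 * (e * (C * w)).
  have : a * g'' <= a * g' + e * (C * w).
    apply: le_trans (ler_wpM2l a0 hG) _; rewrite mulrDr lerD2l.
    by rewrite ler_piMl.
  by rewrite /h; lra.
have s2 : (f' + a * g'') * j <= (h + 2 * (e * (C * w))) * j.
  by rewrite ler_wpM2r// (le_trans _ J1)// invr_ge0.
have s3 : h * j <= h * (1 + e) by rewrite ler_wpM2l.
have s4 : 2 * (e * (C * w)) * j <= 2 * (e * (C * w)) * 2.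
  by rewrite ler_wpM2l// mulr_ge0.
have s5 : w <= (1 + 2 * D) * (1 + h).
  have : D * (1 + f) <= D * (1 + h) by rewrite ler_wpM2l// lerD2l.
  have : 0 <= D * (1 + h) by rewrite mulr_ge0// addr_ge0.
  by rewrite /w; lra.
have s6 : e * (C * w) <= e * (C * ((1 + 2 * D) * (1 + h))).
  by rewrite ler_wpM2l ?(ltW e0)// ler_wpM2l.
apply: le_trans s2 _; rewrite mulrDl; apply: le_trans (lerD s3 s4) _.
have -> : h + e * (1 + 4 * C * (1 + 2 * D)) * (1 + h) =
    h * (1 + e) + (e + 4 * (e * (C * ((1 + 2 * D) * (1 + h))))) by ring.
have -> : 2 * (e * (C * w)) * 2 = 4 * (e * (C * w)) by ring.
have n4 : (0 : R) <= 4 by [].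
by rewrite lerD2l (le_trans (ler_wpM2l n4 s6))// lerDr ltW.
Qed.

Lemma bulk_shear A g : measurable (A : set T) ->
  (forall i, in_Lp Omega p (fun x => g x 0 i)) ->
  (forall i, in_Lp Omega p (fun x => (pull_gradient k psi g \o Psi) x 0 i)) ->
  (forall i, in_Lp Omega p (fun x => pull_gradient k psi g x 0 i)) ->
  bulk (Psi @^-1` A) (pull_gradient k psi g \o Psi) <=
  bulk A g + e * distortion * (rint (\1_Omega) + bulk A g).
Proof.
move=> mA hg hp' hp; have cT : C1c setT psi := C1cW (@subsetT _ _) cpsi.
have po x : ~ Omega x -> psi x = 0 by exact: C1c_out.
have ip := density_rintegrable mA hp; have ig := density_rintegrable mA hg.
have E : density (Psi @^-1` A) (pull_gradient k psi g \o Psi) =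
    fun y => density A (pull_gradient k psi g) (Psi y).
  have := zext_shear_inv k cT psi_small po (fun x => F (pull_gradient k psi g x) + \1_A x * G (pull_gradient k psi g x)).
  exact.
have [_] := rint_shear_inv k cT psi2 psi_small ip.
rewrite /bulk E => ->.
have iJ : rintegrable (fun x => density A (pull_gradient k psi g) x * J x).
  apply: (rintegrableM ip (M := 2)).
    exact: leb_measurable_continuous measurableT (C1_continuous (C1_jacobian k psi2)).
  move=> x; rewrite gtr0_norm ?shear_jacobian_gt0//; last exact: psi_small.
  by have /andP[] := shear_jacobian_bounds k psi_small x.
have i2 := rintegrableZ (e * distortion) (rintegrableD iO ig).
rewrite -(rintD iO ig) -(rintZ _ (rintegrableD iO ig)) -(rintD ig i2).
apply: (le_rint iJ (rintegrableD ig i2)) => x; exact: density_pull.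
Qed.

(** The function is moved together with the set, so that at the point Phi x the new indicator and
    the new gradient come from [x], and the F and G terms transform alike. *)
Lemma competitor A v g u0 h (P : R) : configuration Omega p u0 (v, A) ->
  W1p_pair Omega p v g -> W1p_pair Omega p u0 h -> (perimeter A Omega = P%:E)%E ->
  exists2 c', configuration Omega p u0 c' &
    leb (c'.2 : set T) = (fine (leb (A : set T)) + rint (fun x => \1_A x * partial k psi x))%:E /\
    (energy Omega F G c' <= (bulk A g + P + e * distortion * (rint (\1_Omega) + (bulk A g + P)))%:E)%E.
Proof.
move=> [_ /= [AO mA _] v0] vg u0h PA; have cT : C1c setT psi := C1cW (@subsetT _ _) cpsi.
have fA : (leb (A : set T) < +oo)%E by exact: le_lt_trans (le_leb AO) fO.
have [mA' lA'] := leb_shear_image k cT psi2 psi_small mA fA.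
have vg' := shear_pair k oO fO p1 cpsi psi2 psiC psi_small vg.
have w0' := shear_W1p0 k oO fO p1 cpsi psi2 psiC psi_small vg u0h v0.
have P0 : 0 <= P by rewrite -lee_fin -PA; exact: perimeter_ge0.
have Pe : (perimeter (Psi @^-1` A) Omega <= ((1 + 2 * (e / 2)) * P)%:E)%E.
  apply: (perimeter_shear k cpsi psi2 psiC psi_small mA); last by rewrite PA.
  move=> x; have h1 i : `|partial i psi x| <= e / 2 / n%:R.
    by rewrite ler_pdivlMr ?(lt_le_trans ltr01)// mulrC.
  apply: le_trans (sum_le_const h1) _.
  by rewrite mulrC divfK// gt_eqF// (lt_le_trans ltr01).
exists (v \o Psi, Psi @^-1` A).
  split=> /=.
  - by apply/W1pP; exists (pull_gradient k psi g \o Psi).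
  - split; [|exact: mA'|exact: le_lt_trans Pe (ltry _)].
    move=> y /AO; apply: (shear_inv_preserves k cT psi_small _ y).1.
    by move=> x; exact: C1c_out.
  - exact: w0'.
split; first exact: lA'.
rewrite (energyE mA' vg').
have [_ _ hg] := vg; have [_ _ hp'] := vg'.
have hp i : in_Lp Omega p (fun x => pull_gradient k psi g x 0 i).
  exact: (in_Lp_pull_gradient k oO p1 cpsi psi2 psi_small hg i).
have b := bulk_shear mA hg hp' hp.
apply: le_trans (leeD (_ : _ <= (bulk A g + e * distortion * (rint (\1_Omega) + bulk A g))%:E)%E Pe) _.
  by rewrite lee_fin.
rewrite -EFinD lee_fin.
(* Gives the perimeter the same factor as the bulk, [distortion] being at least 1. *)
have : e * P <= e * distortion * P.
  by rewrite -mulrA ler_wpM2l ?(ltW e0)// ler_peMl// lerDl !mulr_ge0// addr_ge0// mulr_ge0.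
by lra.
Qed.

End competitor.

Section scaled_bump.
Context {R : realType} {n : nat}.
Implicit Types (x y : 'rV[R]_n) (r t : R).

Lemma partialZ (c : R) (f : 'rV[R]_n -> R) i : C1 f ->
  partial i (fun x => c * f x) = (fun x => c * partial i f x).
Proof.
move=> cf; apply/funext => x.
rewrite (@partialM _ _ i (cst c) f); [|exact: (C1_cst _).1|exact: cf.1].
by rewrite partial_cst mulr0 addr0.
Qed.

Lemma bump_translate x r : cbump x r = fun y => cbump 0 r (y - x).
Proof.
by apply/funext => y; rewrite -[in LHS](add0r x) -{1}(subrK x y) bump_shift.
Qed.

(** Translation makes one bound valid for all centres; the constants of the repair must not depend
    on where the ball lies. *)
Lemma bump_partial_bound r : 0 < r -> exists2 B : R, 0 <= B &
  forall x i y, `|partial i (cbump x r) y| <= B.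
Proof.
move=> r0; have [B B0 hB] := C1c_bounded (C1c_bumpT (0 : 'rV[R]_n) r0).
by exists B => // x i y; rewrite bump_translate partial_translate; exact: (hB _).2.
Qed.

End scaled_bump.

(** * Restoring the prescribed volume *)

Section volume_repair.
Context {R : realType} {n : nat}.
Local Notation T := (lebesgue_rV R n).
Implicit Types (x xi zeta : 'rV[R]_n) (v u psi : 'rV[R]_n -> R) (g : 'rV[R]_n -> 'rV[R]_n) (A : set 'rV[R]_n).
Variables (Omega : set 'rV[R]_n) (F G : 'rV[R]_n -> R) (p K C D : R).
Hypothesis oO : open Omega.
Hypothesis fO : (leb (Omega : set T) < +oo)%E.
Hypothesis p1 : 1 < p.
Hypothesis cF : continuous F.
Hypothesis cG : continuous G.
Hypothesis FK : forall xi, 0 <= F xi <= K * (1 + enorm xi `^ p).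
Hypothesis GK : forall xi, 0 <= G xi <= K * (1 + enorm xi `^ p).
Hypothesis C0 : 0 <= C.
Hypothesis FC : forall xi zeta (s : R), enorm zeta <= enorm xi -> 0 <= s <= 1 ->
  F (xi + s *: zeta) <= F xi + s * (C * (1 + enorm xi `^ p)).
Hypothesis GC : forall xi zeta (s : R), enorm zeta <= enorm xi -> 0 <= s <= 1 ->
  G (xi + s *: zeta) <= G xi + s * (C * (1 + enorm xi `^ p)).
Hypothesis D0 : 0 <= D.
Hypothesis FD : forall xi, enorm xi `^ p <= D * (1 + F xi).
Variables (u0 : 'rV[R]_n -> R) (h : 'rV[R]_n -> 'rV[R]_n) (d : R).
Hypothesis u0h : W1p_pair Omega p u0 h.

Lemma configuration_measure v A : configuration Omega p u0 (v, A) ->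
  measurable (A : set T) /\ leb (A : set T) = (rint (\1_(A : set T)))%:E.
Proof.
move=> [_ /= [AO mA _] _]; split; first exact: mA.
rewrite (rint_indic mA) fineK// ge0_fin_numE ?measure_ge0//.
exact: le_lt_trans (le_leb AO) fO.
Qed.

Lemma volume_repair (c r M : R) : 0 < c -> 0 < r -> 0 <= M ->
  exists S delta : R, [/\ 0 <= S, 0 < delta &
    forall v A g P x i, configuration Omega p u0 (v, A) -> W1p_pair Omega p v g ->
      (perimeter A Omega = P%:E)%E -> bulk Omega F G A g + P <= M ->
      closed_ball_ Num.norm x r `<=` Omega ->
      c <= `|rint (fun y => \1_A y * partial i (cbump x r) y)| ->
      `|rint \1_(A : set T) - d| <= delta ->
      exists2 c', configuration Omega p u0 c' & leb (c'.2 : set T) = d%:E /\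
        (energy Omega F G c' <=
          (bulk Omega F G A g + P + S * `|rint \1_(A : set T) - d|)%:E)%E].
Proof.
move=> c0 r0 M0; have [B B0 hB] := @bump_partial_bound R n r r0.
case: (pickP (fun _ : 'I_n => true)) => [i0 _|noi]; last first.
  by exists 0, 1; split => // v A g P x i; have := noi i.
have n1 : 0 < n%:R :> R by rewrite ltr0n; case: (n) i0 => // -[].
(* Calibrated so that a coefficient [t] of size at most |a - d| / c gives n |D_j (t b)| <= e/2 for
   the bump b, with e = N |a - d|. *)
pose N : R := 2 * n%:R * (B + 1) / c.
have N0 : 0 < N by rewrite divr_gt0// !mulr_gt0// ltr_wpDl.
pose S := N * distortion C D * (rint (\1_Omega) + M).
have V0 : 0 <= rint (\1_(Omega : set T)) by apply: rint_ge0 => y; rewrite indicE.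
have S0 : 0 <= N * distortion C D by rewrite mulr_ge0 ?(ltW N0)// distortion_ge0.
(* The tolerance 1/N on the volume keeps [e] at most 1. *)
exists S, N^-1; split; [by rewrite mulr_ge0// addr_ge0|by rewrite invr_gt0|].
move=> v A g P x i cv vg PA EM xO cq ad.
have [mA lA] := configuration_measure cv; set a := rint \1_A in lA ad *.
(* Handled apart, since the shear estimates need a positive [e]. *)
have [ae|ae] := eqVneq a d.
  exists (v, A); first exact: cv.
  rewrite /= lA ae subrr normr0 mulr0 addr0; split; first by [].
  by rewrite (energyE oO fO p1 cF cG FK GK mA vg) PA.
set q := rint (fun y => \1_A y * partial i (cbump x r) y) in cq.
have q0 : q != 0 by rewrite -normr_gt0 (lt_le_trans c0).
pose t := (d - a) / q; pose e := N * `|a - d|.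
have ad0 : 0 < `|a - d| by rewrite normr_gt0 subr_eq0.
have e0 : 0 < e by rewrite mulr_gt0.
have e1 : e <= 1 by rewrite /e mulrC -ler_pdivlMr// mul1r.
have cb := @C1_bump R n x r.
have pe j : partial j (fun y => t * cbump x r y) = fun y => t * partial j (cbump x r) y.
  exact: partialZ.
have cpsi : C1c Omega (fun y => t * cbump x r y) := C1cZ t (C1c_bump r0 xO).
have psi2 j : C1 (partial j (fun y => t * cbump x r y)).
  by rewrite pe; apply: (C1M (C1_cst t)); exact: C1_partial_bump.
have psiC j m : partial m (partial j (fun y => t * cbump x r y)) =
    partial j (partial m (fun y => t * cbump x r y)).
  rewrite (pe j) (pe m) (partialZ t m (C1_partial_bump x r j)) (partialZ t j (C1_partial_bump x r m)).
  by rewrite partial_bumpC.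
have tq : `|t| <= `|a - d| / c.
  by rewrite normrM normfV distrC ler_pM// lef_pV2 ?posrE// (lt_le_trans c0).
have psie j y : n%:R * `|partial j (fun y => t * cbump x r y) y| <= e / 2.
  rewrite pe normrM; apply: (@le_trans _ _ (n%:R * (`|a - d| / c * (B + 1)))).
    rewrite ler_wpM2l ?(ltW n1)// ler_pM//.
    by rewrite (le_trans (hB _ _ _))// lerDl.
  by rewrite /e /N le_eqVlt; apply/orP; left; apply/eqP; field; rewrite gt_eqF.
have [c' cc' [lc' Ec']] := competitor oO fO p1 cF cG FK GK C0 FC GC D0 FD i cpsi psi2 psiC
  e0 e1 psie cv vg u0h PA.
exists c'; first exact: cc'.
split.
  rewrite lc' lA /=; congr EFin.
  have -> : rint (fun y => \1_A y * partial i (fun y => t * cbump x r y) y) = t * q.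
    have ib : rintegrable (fun y => \1_A y * partial i (cbump x r) y).
      under eq_fun do rewrite mulrC.
      apply: (rintegrableM (partial_rintegrable i (C1c_bumpT x r0)) (M := 1)).
        exact: measurable_indic.
      by move=> y; rewrite indicE; case: (_ \in _); rewrite ?normr1 ?normr0.
    rewrite -(rintZ _ ib).
    by congr rint; apply/funext => y; rewrite pe mulrCA.
  by rewrite /t divfK// addrC subrK.
apply: le_trans Ec' _; rewrite lee_fin lerD2l.
have -> : S * `|a - d| = N * `|a - d| * distortion C D * (rint (\1_Omega) + M).
  by rewrite /S; ring.
apply: ler_wpM2l; first by rewrite mulr_ge0 ?(ltW e0)// distortion_ge0.
by rewrite lerD2l.
Qed.

End volume_repair.

(** * The repair inequality for all configurations *)

Section exact_penalty.
Context {R : realType} {n : nat}.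
Local Notation T := (lebesgue_rV R n).
Implicit Types (x xi zeta : 'rV[R]_n) (v u psi : 'rV[R]_n -> R) (g : 'rV[R]_n -> 'rV[R]_n) (A : set 'rV[R]_n).
Variables (Omega : set 'rV[R]_n) (F G : 'rV[R]_n -> R) (p K C D : R).
Hypothesis oO : open Omega.
Hypothesis bO : bounded_set Omega.
Hypothesis conO : connected Omega.
Hypothesis p1 : 1 < p.
Hypothesis cF : continuous F.
Hypothesis cG : continuous G.
Hypothesis FK : forall xi, 0 <= F xi <= K * (1 + enorm xi `^ p).
Hypothesis GK : forall xi, 0 <= G xi <= K * (1 + enorm xi `^ p).
Hypothesis C0 : 0 <= C.
Hypothesis FC : forall xi zeta (s : R), enorm zeta <= enorm xi -> 0 <= s <= 1 ->
  F (xi + s *: zeta) <= F xi + s * (C * (1 + enorm xi `^ p)).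
Hypothesis GC : forall xi zeta (s : R), enorm zeta <= enorm xi -> 0 <= s <= 1 ->
  G (xi + s *: zeta) <= G xi + s * (C * (1 + enorm xi `^ p)).
Hypothesis D0 : 0 <= D.
Hypothesis FD : forall xi, enorm xi `^ p <= D * (1 + F xi).
Variables (u0 : 'rV[R]_n -> R) (h : 'rV[R]_n -> 'rV[R]_n) (d : R) (i0 : 'I_n).
Hypothesis u0h : W1p_pair Omega p u0 h.
Hypothesis d0 : 0 < d.
Hypothesis dV : d < rint (\1_(Omega : set T)).

Let fO : (leb (Omega : set T) < +oo)%E. Proof. exact: leb_bounded_fin. Qed.

(** Take [u0] itself together with the part of Omega in a half-space, whose level is chosen by the
    volume. *)
Lemma reference_configuration : exists (M : R) c, [/\ 0 <= M, configuration Omega p u0 c,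
  leb (c.2 : set T) = d%:E & (energy Omega F G c <= M%:E)%E].
Proof.
have [tau hd] := volume_slice i0 oO bO d0 dV.
set A := Omega `&` halfspace i0 tau in hd.
have mA : measurable (A : set T) by exact: measurable_slice.
have PA : (perimeter A Omega < +oo)%E by exact: perimeter_slice.
have P0 := perimeter_ge0 Omega mA.
have PE : perimeter A Omega = (fine (perimeter A Omega))%:E by rewrite fineK// ge0_fin_numE.
have cA : configuration Omega p u0 (u0, A).
  split => /=; [by apply/W1pP; exists h|by split; [exact: subIsetl|exact: mA|exact: PA]|].
  have hh : W1p_pair Omega p (u0 \- u0) (fun x => h x - h x).
    by apply: (W1p_pairB _ _ u0h u0h).
  by apply: (W1p0_compact oO fO p1 (@compact0 _) (@sub0set _ _) _ _ hh) => x _ /=; rewrite subrr.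
exists (bulk Omega F G A h + fine (perimeter A Omega)), (u0, A); split; [|exact: cA| |].
- exact: addr_ge0 (bulk_ge0 _ FK GK _ _) (fine_ge0 P0).
- by have [_ ->] := configuration_measure fO cA; rewrite hd.
- by rewrite (energyE oO fO p1 cF cG FK GK mA u0h) EFinD PE.
Qed.

Lemma exact_penalty : exists2 S : R, 0 <= S & forall c, configuration Omega p u0 c ->
  exists2 c', configuration Omega p u0 c' & leb (c'.2 : set T) = d%:E /\
    (energy Omega F G c' <= energy Omega F G c + (S * `|rint \1_(c.2 : set T) - d|)%:E)%E.
Proof.
have [M [c0 [M0 cc0 lc0 Ec0]]] := reference_configuration.
have [a [r [delta [a0 r0 delta0 nd]]]] := nondegenerate oO conO fO d0 dV M0.
have [S1 [delta1 [S10 delta10 rep]]] := volume_repair oO fO p1 cF cG FK GK C0 FC GC D0 FD d u0h a0 r0 M0.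
pose e : R := Num.min delta delta1.
have e0 : 0 < e by rewrite lt_min delta0.
(* The term [M / e] pays for the reference configuration as soon as the volume error exceeds [e];
   [S1] pays for the shear otherwise. *)
have S0 : 0 <= S1 + M / e by rewrite addr_ge0// divr_ge0// ltW.
exists (S1 + M / e) => // -[v A] cv; set q : R := `|_ - d|.
have [mA lA] := configuration_measure fO cv.
have [/W1pP[g vg] [/= AO _ PA] _] := cv.
have P0 := perimeter_ge0 Omega mA.
have PE : perimeter A Omega = (fine (perimeter A Omega))%:E by rewrite fineK// ge0_fin_numE.
set P := fine _ in PE; have {}P0 : 0 <= P by exact: fine_ge0.
have b0 : 0 <= bulk Omega F G A g by exact: (bulk_ge0 _ FK GK).
rewrite (energyE oO fO p1 cF cG FK GK mA vg) PE -!EFinD.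
have q0 : 0 <= q by exact: normr_ge0.
have useref : M <= bulk Omega F G A g + P + (S1 + M / e) * q ->
    exists2 c', configuration Omega p u0 c' & leb (c'.2 : set T) = d%:E /\
    (energy Omega F G c' <= (bulk Omega F G A g + P + (S1 + M / e) * q)%:E)%E.
  by move=> Mle; exists c0 => //; split => //; apply: le_trans Ec0 _; rewrite lee_fin.
have [EM|/ltW EM] := leP (bulk Omega F G A g + P) M; last first.
  by apply: useref; rewrite (le_trans EM)// lerDl mulr_ge0.
have [qe|/ltW eq] := leP q e; last first.
  apply: useref; apply: (@le_trans _ _ ((S1 + M / e) * q)); last by rewrite lerDr addr_ge0.
  apply: (@le_trans _ _ (M / e * q)); last by rewrite ler_wpM2r// lerDr.
  by rewrite -mulrA ler_peMr// mulrC ler_pdivlMr// mul1r.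
have qd : q <= delta by rewrite (le_trans qe)// ge_min lexx.
have qd1 : q <= delta1 by rewrite (le_trans qe)// ge_min lexx orbT.
have PM : (perimeter A Omega <= M%:E)%E by rewrite PE lee_fin (le_trans _ EM)// lerDr.
have [x [i [xO hi]]] := nd A AO mA PM qd.
have [c' cc' [lc' Ec']] := rep v A g P x i cv vg PE EM xO hi qd1.
exists c' => //; split => //; apply: le_trans Ec' _; rewrite lee_fin lerD2l.
by rewrite ler_wpM2r// lerDl divr_ge0// ltW.
Qed.

End exact_penalty.

(** A constant [K] above [L] lets F and G, whose growth constants are L and beta L, share one
    bound. *)
Lemma growth_affine {R : realType} {n : nat} (F : 'rV[R]_n -> R) (p mu L K : R) :
  1 < p -> 0 < L -> 0 <= mu -> L <= K -> growth F p mu L ->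
  forall xi, 0 <= F xi <= K * (2 `^ p * (mu `^ p + 1)) * (1 + enorm xi `^ p).
Proof.
move=> p1 L0 mu0 LK gF xi; have /andP[-> _] := gF xi.
apply: (le_trans (growth_powR p1 L0 mu0 gF xi)).
have q0 : 0 <= enorm xi `^ p by exact: powR_ge0.
have m0 : 0 <= mu `^ p by exact: powR_ge0.
have t0 : 0 <= 2 `^ p :> R by exact: powR_ge0.
rewrite -!mulrA; apply: ler_pM => //; [exact: ltW|by rewrite mulr_ge0// addr_ge0|].
rewrite ler_wpM2l// mulrDl mul1r mulrDr mulr1 -addrA lerD2l [1 + _]addrC addrCA.
by rewrite lerDl addr_ge0// mulr_ge0.
Qed.

Unset Implicit Arguments.

Theorem theorem1p4 (R : realType) (n : nat) (n_gt0 : (0 < n)%N)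
    (Omega : set 'rV[R]_n)
    (Omega_bounded : bounded_set Omega) (Omega_connected : connected Omega)
    (Omega_open : open Omega)
    (p l L alpha beta mu : R) (p_gt1 : 1 < p) (l_gt0 : 0 < l) (L_gt0 : 0 < L)
    (alpha_gt0 : 0 < alpha) (beta_gt0 : 0 < beta) (mu_ge0 : 0 <= mu)
    (F G : 'rV[R]_n -> R) (F_C1 : C1 F) (G_C1 : C1 G)
    (F_growth : growth F p mu L)
    (F_quasiconvex : quasiconvex Omega F p mu l)
    (G_growth : growth G p mu (beta * L))
    (G_quasiconvex : quasiconvex Omega G p mu (alpha * l))
    (u0 : 'rV[R]_n -> R) (u0_W1p : W1p Omega p u0)
    (d : R) (d_gt0 : 0 < d) (d_lt : (d%:E < leb Omega)%E) :
  exists2 lambda0 : R, 0 < lambda0 &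
    (forall (u : 'rV[R]_n -> R) (E : set 'rV[R]_n) (lambda : R),
       lambda0 <= lambda ->
       minimizer (configuration Omega p u0)
         (penalized_energy Omega F G d lambda) (u, E) ->
       leb E = d%:E /\
       minimizer [set c | configuration Omega p u0 c /\ leb c.2 = d%:E]
         (energy Omega F G) (u, E)) /\
    (forall (u : 'rV[R]_n -> R) (E : set 'rV[R]_n),
       minimizer [set c | configuration Omega p u0 c /\ leb c.2 = d%:E]
         (energy Omega F G) (u, E) ->
       forall lambda : R, lambda0 <= lambda ->
         minimizer (configuration Omega p u0)
           (penalized_energy Omega F G d lambda) (u, E)).
Proof.
have mO : measurable (Omega : set (lebesgue_rV R n)) by exact: leb_open_measurable.
have fO : (leb (Omega : set (lebesgue_rV R n)) < +oo)%E by exact: leb_bounded_fin.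
have posO : (0 < leb (Omega : set (lebesgue_rV R n)))%E.
  by apply: lt_trans d_lt; rewrite lte_fin.
have dV : d < rint (\1_(Omega : set (lebesgue_rV R n))).
  by rewrite (rint_indic mO) -lte_fin fineK// ge0_fin_numE// measure_ge0.
have [h u0h] := (W1pP _ _ _).1 u0_W1p.
have bL : 0 < beta * L by exact: mulr_gt0.
have al : 0 < alpha * l by exact: mulr_gt0.
have cF := C1_continuous F_C1; have cG := C1_continuous G_C1.
have LK : L <= L + beta * L by rewrite lerDl ltW.
have bLK : beta * L <= L + beta * L by rewrite lerDr ltW.
have FK := growth_affine p_gt1 L_gt0 mu_ge0 LK F_growth.
have GK := growth_affine p_gt1 bL mu_ge0 bLK G_growth.
have [D D0 FD] := qc_coercive Omega_open fO posO p_gt1 l_gt0 mu_ge0 cF F_growth F_quasiconvex.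
have [CF CF0 FC1] := qc_stable Omega_open fO posO p_gt1 l_gt0 L_gt0 mu_ge0 cF F_growth F_quasiconvex.
have [CG CG0 GC2] := qc_stable Omega_open fO posO p_gt1 al bL mu_ge0 cG G_growth G_quasiconvex.
have C0 : 0 <= CF + CG by exact: addr_ge0.
have weaken (H : 'rV[R]_n -> R) (c : R) : c <= CF + CG ->
    (forall (xi zeta : 'rV[R]_n) (s : R), enorm zeta <= enorm xi -> 0 <= s <= 1 ->
      H (xi + s *: zeta) <= H xi + s * (c * (1 + enorm xi `^ p))) ->
    forall (xi zeta : 'rV[R]_n) (s : R), enorm zeta <= enorm xi -> 0 <= s <= 1 ->
      H (xi + s *: zeta) <= H xi + s * ((CF + CG) * (1 + enorm xi `^ p)).
  move=> cC hH xi zeta s zx s01; apply: le_trans (hH _ _ _ zx s01) _.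
  by have /andP[s0 _] := s01; rewrite lerD2l ler_wpM2l// ler_wpM2r// addr_ge0// powR_ge0.
have FC := weaken F CF (ltac:(by rewrite lerDl)) FC1.
have GC := weaken G CG (ltac:(by rewrite lerDr)) GC2.
have [S S0 pen] := exact_penalty Omega_open Omega_bounded Omega_connected p_gt1 cF cG FK GK
  C0 FC GC (ltW D0) FD (Ordinal n_gt0) u0h d_gt0 dV.
have [M [c0 [M0 cc0 lc0 Ec0]]] := reference_configuration Omega_open Omega_bounded p_gt1 cF cG FK GK
  (Ordinal n_gt0) u0h d_gt0 dV.
have pE lambda c : configuration Omega p u0 c -> penalized_energy Omega F G d lambda c =
    (energy Omega F G c + (lambda * `|rint \1_(c.2 : set (lebesgue_rV R n)) - d|)%:E)%E.
  case: c => v A cv; have [_ lA] := configuration_measure fO cv.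
  by rewrite /penalized_energy /= lA.
have pEd lambda c : leb (c.2 : set (lebesgue_rV R n)) = d%:E ->
    penalized_energy Omega F G d lambda c = energy Omega F G c.
  by rewrite /penalized_energy => ->; rewrite -EFinB subrr abse0 mule0 adde0.
have ge0 c : configuration Omega p u0 c -> (0 <= energy Omega F G c)%E.
  move=> [_ [_ mA _] _]; apply: adde_ge0; last exact: perimeter_ge0.
  apply: integral_ge0 => x _; rewrite lee_fin.
  have /andP[f0 _] := FK (wgrad Omega c.1 x); have /andP[g0 _] := GK (wgrad Omega c.1 x).
  by rewrite addr_ge0// mulr_ge0 ?indicE.
(* The added 1 forces a volume error q >= 0 of a penalized minimizer to vanish, by (S + 1) q <= S
   q. *)
exists (S + 1); first by rewrite ltr_wpDl.
split=> [u E lambda Sl [cu umin]|u E [[cu lE] umin] lambda Sl].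
  (* Comparison with the reference configuration makes the energy of the minimizer finite, so that
     it can be cancelled in the extended reals. *)
  have uM : (energy Omega F G (u, E) + (lambda * `|rint \1_(E : set (lebesgue_rV R n)) - d|)%:E <= M%:E)%E.
    by rewrite -(pE lambda _ cu) (le_trans (umin _ cc0))// pEd.
  have [c' cc' [lc' Ec']] := pen _ cu.
  have := umin _ cc'; rewrite (pEd lambda c' lc') (pE lambda _ cu) => h1.
  have := le_trans h1 Ec'.
  have lq : 0 <= lambda * `|rint \1_(E : set (lebesgue_rV R n)) - d|.
    by rewrite mulr_ge0// (le_trans _ Sl)// addr_ge0.
  have fE : energy Omega F G (u, E) \is a fin_num.
    rewrite ge0_fin_numE ?ge0// (le_lt_trans _ (ltry M))//; apply: le_trans uM.
    by rewrite leeDl// lee_fin.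
  rewrite -(fineK fE) -!EFinD lee_fin lerD2l => h2.
  have lE : leb (E : set (lebesgue_rV R n)) = d%:E.
    have [_ ->] := configuration_measure fO cu; congr EFin; apply/eqP.
    rewrite -subr_eq0 -normr_le0; move: h2; rewrite /= => h2.
    have := le_trans (ler_wpM2r (normr_ge0 (rint \1_E - d)) Sl) h2.
    by rewrite mulrDl mul1r gerDl.
  split; first exact: lE.
  split; first by split.
  by move=> c [cc lc]; rewrite -(pEd lambda (u, E) lE) -(pEd lambda c lc); exact: umin.
split; first exact: cu.
(* Any competitor is repaired at a cost of at most [S] times its volume error, which its penalty
   covers. *)
move=> c cc; have [c' cc' [lc' Ec']] := pen _ cc.
rewrite (pEd lambda (u, E) lE) (pE lambda _ cc).
apply: le_trans (umin c' (conj cc' lc')) _; apply: le_trans Ec' _.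
rewrite leeD2l// lee_fin ler_wpM2r//.
by rewrite (le_trans _ Sl)// lerDl.
Qed.
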